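(* Let $\sigma$ be a surface tension. If $p_0\in\mathscr G$ is a gas point, then the boundary of the subdifferential $\partial\sigma(p_0)$ is a bounded, convex, analytic Jordan curve. If $p_0\in\mathscr P\cup\mathscr Q$, then the boundary of $\partial\sigma(p_0)$ is an unbounded convex Jordan arc $\gamma_{p_0}$, analytic except at $\infty$, and its tangents at its two ends at $\infty$ are parallel to $i(p_{-1}-p_0)$ and $i(p_0-p_1)$ respectively (i.e. orthogonal to the sides $[p_{-1},p_0]$ and $[p_0,p_1]$), where $p_{-1},p_1\in\mathscr P\cup\mathscr Q$ are the neighbours of $p_0$ in the order along $\partial N$.
   Context: Surface tension: $N\subset\mathbb R^2\cong\mathbb C$ compact convex polygon with corners $\mathscr P$; $\mathscr G=\{q_1,\dots,q_l\}\subset N^\circ$ finite (possibly empty) set of gas points; $c_j>0$; $L:\partial N\to\mathbb R$ continuous, piecewise affine, admitting a convex extension; $\sigma$ the unique bounded convex solution of $\det D^2\sigma=1+\sum_jc_j\delta_{q_j}$ in $N^\circ$, $\sigma=L$ on $\partial N$. $\mathscr Q$ = points of $\partial N\setminus\mathscr P$ where $L$ is not differentiable along $\partial N$; $\mathscr P\cup\mathscr Q$ is ordered counter-clockwise along $\partial N$. Subdifferential: $\partial\sigma(p_0)=\{\xi:\sigma(p)\ge\sigma(p_0)+\langle\xi,p-p_0\rangle\ \forall p\in N\}$. *)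

(* Defs.v *)
From HB Require Import structures.
From mathcomp Require Import all_boot all_order all_algebra.
From mathcomp Require Import all_classical all_reals all_analysis.
Set Implicit Arguments. Unset Strict Implicit. Unset Printing Implicit Defensive.
Import Order.TTheory GRing.Theory Num.Theory.
Import numFieldNormedType.Exports.
Local Open Scope classical_set_scope.
Local Open Scope ring_scope.

Notation pt R := (R * R)%type.

Section Defs.
Variable R : realType.
Local Notation pt := (pt R).

Definition addp (x y : pt) : pt := (x.1 + y.1, x.2 + y.2).
Definition subp (x y : pt) : pt := (x.1 - y.1, x.2 - y.2).
Definition scalep (t : R) (x : pt) : pt := (t * x.1, t * x.2).
Definition dotp (x y : pt) : R := x.1 * y.1 + x.2 * y.2.
Definition crossp (x y : pt) : R := x.1 * y.2 - x.2 * y.1.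
Definition multi (x : pt) : pt := (- x.2, x.1).
Definition enorm (x : pt) : R := Num.sqrt (dotp x x).
Definition segpt (a b : pt) (t : R) : pt := addp (scalep (1 - t) a) (scalep t b).

Definition convex_set (S : set pt) : Prop :=
  forall x y t, S x -> S y -> 0 <= t <= 1 -> S (segpt x y t).

Definition convex_on (S : set pt) (f : pt -> R) : Prop :=
  forall x y t, S x -> S y -> 0 <= t <= 1 ->
    f (segpt x y t) <= (1 - t) * f x + t * f y.

Definition frontier (S : set pt) : set pt := closure S `\` interior S.

Definition conv_hull (P : set pt) : set pt :=
  [set x | exists (n : nat) (w : 'I_n -> R) (v : 'I_n -> pt),
     (forall i, 0 <= w i) /\ \sum_(i < n) w i = 1 /\ (forall i, P (v i)) /\
     x = (\sum_(i < n) w i * (v i).1, \sum_(i < n) w i * (v i).2)].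

Definition extreme_point (N : set pt) (p : pt) : Prop :=
  N p /\ ~ (exists a b t, N a /\ N b /\ a <> b /\ 0 < t < 1 /\ p = segpt a b t).

Definition is_polygon (N P : set pt) : Prop :=
  finite_set P /\ N = conv_hull P /\ P = extreme_point N /\ interior N !=set0.

Definition piecewise_affine_on_boundary (N : set pt) (L : pt -> R) : Prop :=
  exists (n : nat) (a b : 'I_n -> pt),
    frontier N = \bigcup_(k in [set: 'I_n]) [set segpt (a k) (b k) t | t in `[0, 1]] /\
    forall k t, 0 <= t <= 1 ->
      L (segpt (a k) (b k) t) = (1 - t) * L (a k) + t * L (b k).

Definition boundary_datum (N : set pt) (L : pt -> R) : Prop :=
  {within frontier N, continuous L} /\
  piecewise_affine_on_boundary N L /\
  exists F : pt -> R, convex_on N F /\ (forall p, frontier N p -> F p = L p).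

Definition subdiff (N : set pt) (s : pt -> R) (p0 : pt) : set pt :=
  [set xi | forall p, N p -> s p0 + dotp xi (subp p p0) <= s p].

Definition subdiff_img (N : set pt) (s : pt -> R) (E : set pt) : set pt :=
  \bigcup_(p in E) subdiff N s p.

Definition leb2 : set pt -> \bar R :=
  ((@lebesgue_measure R) \x (@lebesgue_measure R))%E.

Definition MA_solution (N : set pt) (l : nat) (q : 'I_l -> pt) (c : 'I_l -> R)
  (s : pt -> R) : Prop :=
  forall E : set pt, measurable E -> E `<=` interior N ->
    mu_ext leb2 (subdiff_img N s E) =
    (leb2 E + \sum_(j < l) (c j)%:E * \d_(q j) E)%E.

Definition surface_tension (N P : set pt) (L : pt -> R)
   (l : nat) (q : 'I_l -> pt) (c : 'I_l -> R) (s : pt -> R) : Prop :=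
  convex_on N s /\ {within N, continuous s} /\
  (forall p, frontier N p -> s p = L p) /\ MA_solution N q c s.

Definition Qset (N P : set pt) (L : pt -> R) : set pt :=
  [set p | frontier N p /\ ~ P p /\
     ~ (exists (e : pt) (r : R), e <> (0, 0) /\ 0 < r /\
         (forall t, `|t| < r -> frontier N (addp p (scalep t e))) /\
         derivable (fun t : R => L (addp p (scalep t e))) 0 1)].

Definition ccw_next (N : set pt) (V : set pt) (p0 p1 : pt) : Prop :=
  V p1 /\ p1 <> p0 /\
  (forall t, 0 <= t <= 1 -> frontier N (segpt p0 p1 t)) /\
  (forall t, 0 < t < 1 -> ~ V (segpt p0 p1 t)) /\
  (forall p, N p -> 0 <= crossp (subp p1 p0) (subp p p0)).

Definition analytic (f : R -> R) : Prop :=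
  forall t0, exists (a : nat -> R) (r : R), 0 < r /\
    forall t, `|t - t0| < r ->
      ([series a k * (t - t0) ^+ k]_k @ \oo --> f t).

Definition analytic_regular (g : R -> pt) : Prop :=
  analytic (fun t => (g t).1) /\ analytic (fun t => (g t).2) /\
  forall t, (derive1 (fun u => (g u).1) t, derive1 (fun u => (g u).2) t) <> (0, 0).

Definition unit_tangent (g : R -> pt) (t : R) : pt :=
  let v := (derive1 (fun u => (g u).1) t, derive1 (fun u => (g u).2) t) in
  scalep (enorm v)^-1 v.

Definition box_bounded (C : set pt) : Prop :=
  exists M : R, forall x, C x -> `|x.1| <= M /\ `|x.2| <= M.

Definition convex_curve (C : set pt) : Prop :=
  exists K, convex_set K /\ C = frontier K.

Definition analytic_jordan_curve (C : set pt) : Prop :=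
  exists g : R -> pt,
    (forall t, g (t + 1) = g t) /\
    (forall s t, 0 <= s < 1 -> 0 <= t < 1 -> g s = g t -> s = t) /\
    analytic_regular g /\ C = range g.

Definition parallel (d u : pt) : Prop := d <> (0, 0) /\ crossp d u = 0.

Definition unbounded_arc_with_end_tangents (C : set pt) (u_minus u_plus : pt) : Prop :=
  exists g : R -> pt,
    injective g /\ analytic_regular g /\ C = range g /\
    (forall M : R, exists T : R, forall t, T < `|t| -> M < enorm (g t)) /\
    exists d_minus d_plus : pt,
      ((fun t => (unit_tangent g t).1) @ -oo --> d_minus.1) /\
      ((fun t => (unit_tangent g t).2) @ -oo --> d_minus.2) /\
      ((fun t => (unit_tangent g t).1) @ +oo --> d_plus.1) /\
      ((fun t => (unit_tangent g t).2) @ +oo --> d_plus.2) /\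
      parallel d_minus u_minus /\ parallel d_plus u_plus.
End Defs.

(* Main.v *)
(* After a rotation put the point [p0] at the origin, and let
   [psi (p, y) = min_x (sigma (x, y) - p x)] be the partial Legendre transform.  The
   subgradients [(p, q)] at the origin are those for which the line [sigma 0 + q y]
   supports [psi (p, .)] at [y = 0].  Away from the gas points the Monge-Ampere equation
   says that the subgradient map preserves the area of open sets; this forbids quadratics
   of the wrong sign of Laplacian to touch [psi], which is therefore harmonic in the
   viscosity sense.  When the origin is the only minimiser for the slopes near [p],
   [psi - sigma 0] vanishes on [y = 0], so comparison with the harmonic functions
   [Im P (p + i y)], for [P] approximating the boundary values on a half-disc, shows that
   the slope [H p] of [psi (p, .)] at [y = 0+] is a real-analytic function of [p].  Hence
   the boundary of the subdifferential is locally the analytic graph [q = H p].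
   At a gas point this holds in every direction and gives a closed curve.  At a corner
   [p] ranges over the whole line, and at a flat point of the boundary over the open
   interval between the two slopes of [L]; the concavity of [H] then gives the tangents
   at infinity.  The same area argument shows that no subgradient exists at interior points
   of the edges, where [sigma = L] is affine, so that minimisers stay inside [N]. *)

Require Import Defs.
From HB Require Import structures.
From mathcomp Require Import all_boot all_order all_algebra.
From mathcomp Require Import all_classical all_reals all_analysis.
From mathcomp Require Import measurable_realfun ring lra.
Set Implicit Arguments. Unset Strict Implicit. Unset Printing Implicit Defensive.
Import Order.TTheory GRing.Theory Num.Theory.
Import numFieldNormedType.Exports.
Local Open Scope classical_set_scope.
Local Open Scope ring_scope.

(** * Real-analytic functions *)

(** The obstacle is that [sigma] is a solution in the sense of Alexandrov only: it has no known
    derivatives, and the equation only speaks of areas of gradient images. The partial Legendre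
    transform makes it linear because a quadratic with second derivatives [A] in [p] and [C] in [y]
    has two one-variable gradient maps, which multiply area by [|A|] and [|C|]; inclusions between
    gradient images and these models turn equality of areas into a sign of [A + C]. Concavity of
    [psi] in [p] and convexity in [y] fix the signs of [A] and [C] and make critical points global.
    Analyticity up to the line [y = 0] is reached without integrals: discrete Fourier sums bound the
    coefficients of [P] by the values of [Im P] on a half-circle, so uniform approximation becomes
    convergence in a weighted [l^1] norm of coefficients. In that norm products, compositions and
    inverse functions are limits of polynomial operations. The positive mass at a gas point gives
    its subdifferential positive area, hence an interior point around which the boundary is
    described in polar coordinates. *)

Section PolyNorm.
Variable R : realType.
Implicit Types (p q a b : {poly R}) (r s t : R).

(** The weight [r ^+ i] makes this norm submultiplicative and larger than the supremum of [|p|] on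
    [[-r, r]]; the completion is a Banach algebra of power series on the disc of radius [r]. *)
Definition pnorm r p : R := \sum_(i < size p) `|p`_i| * r ^+ i.

Lemma pnormE r p n : (size p <= n)%N -> pnorm r p = \sum_(i < n) `|p`_i| * r ^+ i.
Proof.
move=> pn; rewrite /pnorm (big_ord_widen _ (fun i => `|p`_i| * r ^+ i) pn).
rewrite big_mkcond; apply: eq_bigr => i _; case: ltnP => // h.
by rewrite nth_default // normr0 mul0r.
Qed.

Lemma pnorm_ge0 r p : 0 <= r -> 0 <= pnorm r p.
Proof. by move=> r0; apply: sumr_ge0 => i _; rewrite mulr_ge0 ?exprn_ge0. Qed.

Lemma pnorm0 r : pnorm r 0 = 0.
Proof. by rewrite /pnorm size_poly0 big_ord0. Qed.

Lemma pnormD r p q : 0 <= r -> pnorm r (p + q) <= pnorm r p + pnorm r q.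
Proof.
move=> r0; set n := maxn (size p) (size q).
rewrite (@pnormE r (p + q) n) ?size_polyD //.
rewrite (@pnormE r p n) ?leq_maxl // (@pnormE r q n) ?leq_maxr // -big_split /=.
apply: ler_sum => i _; rewrite -mulrDl ler_wpM2r ?exprn_ge0 // coefD.
exact: ler_normD.
Qed.

Lemma pnormZ r c p : pnorm r (c *: p) = `|c| * pnorm r p.
Proof.
rewrite (@pnormE r _ (size p)) ?size_scale_leq // /pnorm mulr_sumr.
by apply: eq_bigr => i _; rewrite coefZ normrM mulrA.
Qed.

Lemma pnormN r p : pnorm r (- p) = pnorm r p.
Proof. by rewrite -scaleN1r pnormZ normrN normr1 mul1r. Qed.

Lemma pnormC r p q : pnorm r (p - q) = pnorm r (q - p).
Proof. by rewrite -pnormN opprB. Qed.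

Lemma pnorm_sum r (I : Type) (s : seq I) (P : pred I) (F : I -> {poly R}) : 0 <= r ->
  pnorm r (\sum_(i <- s | P i) F i) <= \sum_(i <- s | P i) pnorm r (F i).
Proof.
move=> r0; elim/big_rec2: _ => [|i x y _ h]; first by rewrite pnorm0.
by apply: (le_trans (pnormD _ _ r0)); rewrite lerD2l.
Qed.

Lemma pnorm_polyC r c : pnorm r c%:P = `|c|.
Proof.
by rewrite (@pnormE r _ 1) ?size_polyC_leq1 // big_ord1 coefC eqxx expr0 mulr1.
Qed.

Lemma pnormMX r p : 0 <= r -> pnorm r (p * 'X) = r * pnorm r p.
Proof.
move=> r0; rewrite (@pnormE r _ (size p).+1); last first.
  by rewrite (leq_trans (size_polyMleq _ _)) // size_polyX addn2.
rewrite big_ord_recl /= coefMX eqxx normr0 mul0r add0r /pnorm mulr_sumr.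
by apply: eq_bigr => i _; rewrite coefMX /= exprS; ring.
Qed.

Lemma pnormX r : 0 <= r -> pnorm r 'X = r.
Proof. by move=> r0; rewrite -[X in pnorm r X]mul1r pnormMX // pnorm_polyC normr1 mulr1. Qed.

Lemma pnormM r p q : 0 <= r -> pnorm r (p * q) <= pnorm r p * pnorm r q.
Proof.
move=> r0; elim/poly_ind: p => [|p c IH]; first by rewrite mul0r pnorm0 mul0r.
have E : pnorm r (p * 'X + c%:P) = r * pnorm r p + `|c|.
  have [->|p0] := eqVneq p 0.
    by rewrite mul0r add0r pnorm_polyC pnorm0 mulr0 add0r.
  rewrite (@pnormE r _ (size p).+1); last first.
    rewrite (leq_trans (size_polyD _ _)) // geq_max (leq_trans (size_polyC_leq1 _)) //.
    by rewrite size_mulX // ltnSn.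
  rewrite big_ord_recl /= coefD coefMX eqxx add0r coefC eqxx expr0 mulr1 addrC.
  congr (_ + _); rewrite /pnorm mulr_sumr; apply: eq_bigr => i _.
  by rewrite coefD coefMX coefC /= addr0 exprS; ring.
rewrite E !mulrDl (le_trans (pnormD _ _ r0)) // lerD //.
  have -> : p * 'X * q = (p * q) * 'X by rewrite -!mulrA ['X * q]mulrC.
  by rewrite pnormMX // -mulrA ler_wpM2l.
by rewrite mul_polyC pnormZ.
Qed.

Lemma pnorm1 r : pnorm r 1 = 1.
Proof. by rewrite -[1]/(1%:P) pnorm_polyC normr1. Qed.

Lemma pnorm_exp r p n : 0 <= r -> pnorm r (p ^+ n) <= pnorm r p ^+ n.
Proof.
move=> r0; elim: n => [|n IH]; first by rewrite !expr0 pnorm1.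
rewrite !exprS (le_trans (pnormM _ _ r0)) //.
by rewrite ler_wpM2l // pnorm_ge0.
Qed.

Lemma horner_le_pnorm r p t : `|t| <= r -> `|p.[t]| <= pnorm r p.
Proof.
move=> tr; rewrite horner_coef (le_trans (ler_norm_sum _ _ _)) //.
apply: ler_sum => i _; rewrite normrM ler_wpM2l // normrX.
by rewrite lerXn2r // nnegrE ?(le_trans _ tr).
Qed.

Lemma pnorm_mono r s p : 0 <= r -> r <= s -> pnorm r p <= pnorm s p.
Proof.
move=> r0 rs; apply: ler_sum => i _; rewrite ler_wpM2l // lerXn2r // nnegrE //.
exact: le_trans rs.
Qed.

Lemma coef_le_pnorm r p i : 0 <= r -> `|p`_i| * r ^+ i <= pnorm r p.
Proof.
move=> r0; have [h|h] := ltnP i (size p); last first.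
  by rewrite nth_default // normr0 mul0r pnorm_ge0.
rewrite /pnorm (bigD1 (Ordinal h)) //= lerDl.
by apply: sumr_ge0 => j _; rewrite mulr_ge0 ?exprn_ge0.
Qed.

Lemma sum_coef_le_pnorm r p n : 0 <= r -> \sum_(i < n) `|p`_i| * r ^+ i <= pnorm r p.
Proof.
move=> r0; rewrite (@pnormE r p (maxn n (size p))) ?leq_maxr //.
rewrite (big_ord_widen _ (fun i => `|p`_i| * r ^+ i) (leq_maxl n (size p))).
rewrite big_mkcond; apply: ler_sum => i _; case: ifP => // _.
by rewrite mulr_ge0 ?exprn_ge0.
Qed.

Lemma pnorm_comp r p q : 0 <= r -> pnorm r (p \Po q) <= pnorm (pnorm r q) p.
Proof.
move=> r0; rewrite comp_polyE (le_trans (pnorm_sum _ _ _ r0)) //.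
apply: ler_sum => i _; rewrite pnormZ ler_wpM2l //; exact: pnorm_exp.
Qed.

(** Cauchy's estimate for one monomial: a derivative on radius [r] costs the gap [s - r]. It is the
    source of the gap factors in the bounds for derivatives, compositions and imaginary parts. *)
Lemma expr_diff_le r s n : 0 <= r -> r < s -> n%:R * r ^+ n.-1 * (s - r) <= s ^+ n.
Proof.
move=> r0 rs; have s0 : 0 <= s by rewrite ltW // (le_lt_trans r0).
elim: n => [|n IH]; first by rewrite !mul0r expr0.
have h : n%:R * r ^+ n * (s - r) <= r * s ^+ n.
  case: n IH => [|n] IH; first by rewrite !mul0r expr0 mulr1.
  have -> : n.+1%:R * r ^+ n.+1 * (s - r) = r * (n.+1%:R * r ^+ n * (s - r)).
    by rewrite exprS; ring.
  by rewrite ler_wpM2l.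
have h2 : r ^+ n * (s - r) <= (s - r) * s ^+ n.
  by rewrite mulrC ler_wpM2l ?subr_ge0 ?(ltW rs) // lerXn2r ?nnegrE ?(ltW rs).
have -> : s ^+ n.+1 = r * s ^+ n + (s - r) * s ^+ n by rewrite exprS; ring.
have -> : n.+1%:R * r ^+ n.+1.-1 * (s - r) = n%:R * r ^+ n * (s - r) + r ^+ n * (s - r).
  by rewrite /= -natr1; ring.
exact: lerD.
Qed.

Lemma pnorm_deriv r s p : 0 <= r -> r < s -> pnorm r p^`() * (s - r) <= pnorm s p.
Proof.
move=> r0 rs; rewrite (@pnormE r _ (size p).-1); last first.
  have [->|p0] := eqVneq p 0; first by rewrite deriv0 size_poly0.
  by rewrite -ltnS prednK ?lt_size_deriv // size_poly_gt0.
have [->|p0] := eqVneq p 0; first by rewrite size_poly0 big_ord0 mul0r pnorm0.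
rewrite /pnorm -[in leRHS](prednK (n := size p)) ?size_poly_gt0 // big_ord_recl /=.
rewrite -[leLHS]add0r lerD ?mulr_ge0 ?expr0 // mulr_suml.
apply: ler_sum => i _; rewrite coef_deriv -mulr_natr normrM normr_nat.
rewrite /bump /= add1n.
have -> : `|p`_i.+1| * i.+1%:R * r ^+ i * (s - r)
        = `|p`_i.+1| * (i.+1%:R * r ^+ i * (s - r)) by ring.
by rewrite ler_wpM2l // (expr_diff_le i.+1 r0 rs).
Qed.

Lemma pnorm_exp_diff r a b n m : 0 <= r -> pnorm r a <= m -> pnorm r b <= m ->
  pnorm r (a ^+ n - b ^+ n) <= n%:R * m ^+ n.-1 * pnorm r (a - b).
Proof.
move=> r0 am bm; rewrite subrXX (le_trans (pnormM _ _ r0)) // mulrC.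
rewrite ler_wpM2r ?pnorm_ge0 // (le_trans (pnorm_sum _ _ _ r0)) //.
have m0 : 0 <= m by rewrite (le_trans _ am) ?pnorm_ge0.
rewrite (@le_trans _ _ (\sum_(i < n) m ^+ n.-1)) //; last first.
  by rewrite sumr_const card_ord mulr_natl.
apply: ler_sum => i _; rewrite (le_trans (pnormM _ _ r0)) //.
have ile : (i <= n.-1)%N by rewrite -ltnS prednK // (leq_ltn_trans _ (ltn_ord i)).
have -> : m ^+ n.-1 = m ^+ (n.-1 - i) * m ^+ i by rewrite -exprD subnK.
have -> : (n.-1 - i)%N = (n - i.+1)%N by rewrite -subn1 -subnDA add1n.
by rewrite ler_pM ?pnorm_ge0 // (le_trans (pnorm_exp _ _ r0)) // lerXn2r // nnegrE // pnorm_ge0.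
Qed.

(** Factoring each [a ^+ i - b ^+ i] shows that composition is Lipschitz in its inner argument, as
    long as a gap [s - m] of radius remains. Both [wan_comp] and the contraction in [wan_inverse]
    rest on this. *)
Lemma pnorm_comp_diff r m s p a b : 0 <= r -> pnorm r a <= m -> pnorm r b <= m ->
  m < s -> pnorm r ((p \Po a) - (p \Po b)) * (s - m) <= pnorm s p * pnorm r (a - b).
Proof.
move=> r0 am bm ms.
have m0 : 0 <= m by rewrite (le_trans _ am) ?pnorm_ge0.
have -> : (p \Po a) - (p \Po b) = \sum_(i < size p) p`_i *: (a ^+ i - b ^+ i).
  under eq_bigr do rewrite scalerBr.
  by rewrite sumrB !comp_polyE.
apply: (@le_trans _ _ ((\sum_(i < size p) `|p`_i| * (i%:R * m ^+ i.-1 * pnorm r (a - b))) * (s - m))).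
  rewrite ler_wpM2r ?subr_ge0 ?(ltW ms) // (le_trans (pnorm_sum _ _ _ r0)) //.
  by apply: ler_sum => i _; rewrite pnormZ ler_wpM2l // pnorm_exp_diff.
rewrite mulr_suml /pnorm [leRHS]mulr_suml; apply: ler_sum => i _.
rewrite -/(pnorm r (a - b)).
have -> : `|p`_i| * (i%:R * m ^+ i.-1 * pnorm r (a - b)) * (s - m)
    = `|p`_i| * (i%:R * m ^+ i.-1 * (s - m)) * pnorm r (a - b) by ring.
by rewrite ler_wpM2r ?pnorm_ge0 // ler_wpM2l // expr_diff_le.
Qed.

End PolyNorm.

Section Seq.
Variable R : realType.
Implicit Types (u v : nat -> R) (l e : R).

Lemma cvg_eps u l : u @ \oo --> l <->
  forall e, 0 < e -> exists n0, forall n, (n0 <= n)%N -> `|u n - l| <= e.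
Proof.
split=> [/cvgrPdist_le h e e0|h].
  have [n0 _ hn] := h e e0; exists n0 => n nn; rewrite distrC; exact: hn.
apply/cvgrPdist_le => e e0; have [n0 hn] := h e e0.
by exists n0 => // n /= nn; rewrite distrC; exact: hn.
Qed.

Lemma cvg_eq_seq u v l : (forall n, u n = v n) -> u @ \oo --> l -> v @ \oo --> l.
Proof. by move=> /funext ->. Qed.

Lemma cvg_ordsum (F : nat -> nat -> R) (a : nat -> R) n : (forall i, F i @ \oo --> a i) ->
  (fun m => \sum_(i < n) F i m) @ \oo --> \sum_(i < n) a i.
Proof.
move=> h; elim: n => [|n IH].
  rewrite big_ord0; under eq_fun do rewrite big_ord0; exact: cvg_cst.
rewrite big_ord_recr; under eq_fun do rewrite big_ord_recr; apply: cvgD => //; exact: h.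
Qed.

Lemma cvg_dist_le u l c e : u @ \oo --> l ->
  (exists n0, forall n, (n0 <= n)%N -> `|u n - c| <= e) -> `|l - c| <= e.
Proof.
move=> /cvg_eps h [n0 hn]; apply/ler_addgt0Pr => d d0.
have [n1 h1] := h d d0.
have a := hn (maxn n0 n1) (leq_maxl _ _); have b := h1 (maxn n0 n1) (leq_maxr _ _).
rewrite -(subrKA (u (maxn n0 n1))) (le_trans (ler_normD _ _)) // addrC lerD //.
by rewrite distrC.
Qed.

Lemma cauchy_eps u :
  (forall e, 0 < e -> exists n0, forall m n, (n0 <= m)%N -> (n0 <= n)%N -> `|u m - u n| <= e) ->
  exists l, u @ \oo --> l.
Proof.
move=> h; exists (lim (u @ \oo)).
apply/cauchy_cvgP; apply: cauchy_exP => e e0.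
have [n0 hn] := h (e / 2) (divr_gt0 e0 (ltr0Sn _ 1)).
exists (u n0); exists n0 => // n /= nn.
rewrite /ball /= (le_lt_trans (hn _ _ (leqnn _) nn)) //; lra.
Qed.
End Seq.

(** * Germs of analytic functions: sums, products, compositions *)

Section Wan.
Variable R : realType.
Implicit Types (P Q : nat -> {poly R}) (r s t : R) (f g : R -> R).

Definition ncauchy r P := forall e, 0 < e -> exists n0, forall m n,
  (n0 <= m)%N -> (n0 <= n)%N -> pnorm r (P m - P n) <= e.

(* A function is analytic at [t0] iff near [t0] it is a limit of polynomials
   that are Cauchy for the weighted l^1 norm of their coefficients. *)
Definition wan f t0 := exists r P, [/\ 0 < r, ncauchy r P &
  forall t, `|t| <= r -> (fun n => (P n).[t]) @ \oo --> f (t0 + t)].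

Lemma ncauchy_bounded r P : 0 <= r -> ncauchy r P ->
  exists M, 0 < M /\ forall n, pnorm r (P n) <= M.
Proof.
move=> r0 h; have [n0 hn] := h 1 ltr01.
exists (\sum_(i < n0.+1) pnorm r (P i) + 1); split.
  by rewrite ltr_wpDl // sumr_ge0 // => i _; exact: pnorm_ge0.
move=> n; have [nn|nn] := ltnP n n0.+1.
  rewrite (bigD1 (Ordinal nn)) //= -addrA lerDl addr_ge0 // sumr_ge0 // => i _.
  exact: pnorm_ge0.
apply: (@le_trans _ _ (1 + pnorm r (P n0))).
  by rewrite -[P n](subrK (P n0)) (le_trans (pnormD _ _ r0)) // lerD2r hn // ltnW.
rewrite addrC lerD2r big_ord_recr /= lerDr.
by rewrite sumr_ge0 // => i _; exact: pnorm_ge0.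
Qed.

Lemma ncauchy_mono r s P : 0 <= r -> r <= s -> ncauchy s P -> ncauchy r P.
Proof.
move=> r0 rs h e e0; have [n0 hn] := h e e0; exists n0 => m n hm hnn.
by rewrite (le_trans (pnorm_mono _ r0 rs)) // hn.
Qed.

Lemma ncauchyD r P Q : 0 <= r -> ncauchy r P -> ncauchy r Q -> ncauchy r (fun n => P n + Q n).
Proof.
move=> r0 hP hQ e e0; have e2 : 0 < e / 2 by lra.
have [n1 h1] := hP _ e2; have [n2 h2] := hQ _ e2.
exists (maxn n1 n2) => m n; rewrite !geq_max => /andP[? ?] /andP[? ?].
rewrite opprD addrACA (le_trans (pnormD _ _ r0)) //.
have -> : e = e / 2 + e / 2 by lra.
by rewrite lerD ?h1 ?h2.
Qed.

Lemma ncauchyM r P Q : 0 <= r -> ncauchy r P -> ncauchy r Q -> ncauchy r (fun n => P n * Q n).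
Proof.
move=> r0 hP hQ e e0.
have [A [A0 hA]] := ncauchy_bounded r0 hP; have [B [B0 hB]] := ncauchy_bounded r0 hQ.
have eA : 0 < e / (2 * A) by rewrite divr_gt0 // mulr_gt0.
have eB : 0 < e / (2 * B) by rewrite divr_gt0 // mulr_gt0.
have [n1 h1] := hP _ eB; have [n2 h2] := hQ _ eA.
exists (maxn n1 n2) => m n; rewrite !geq_max => /andP[? ?] /andP[? ?].
have -> : P m * Q m - P n * Q n = (P m - P n) * Q m + P n * (Q m - Q n) by ring.
rewrite (le_trans (pnormD _ _ r0)) //.
have -> : e = e / (2 * B) * B + A * (e / (2 * A)) by field; lra.
by rewrite lerD // (le_trans (pnormM _ _ r0)) // ler_pM ?pnorm_ge0 ?h1 ?h2.
Qed.

Lemma ncauchy_const r p : ncauchy r (fun=> p).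
Proof. by move=> e e0; exists 0%N => m n _ _; rewrite subrr pnorm0 ltW. Qed.

Lemma ncauchy_deriv r s P : 0 <= r -> r < s -> ncauchy s P -> ncauchy r (fun n => (P n)^`()).
Proof.
move=> r0 rs hP e e0; have sr : 0 < s - r by rewrite subr_gt0.
have [n0 h] := hP (e * (s - r)) (mulr_gt0 e0 sr); exists n0 => m n hm hn.
by rewrite -derivB -(ler_pM2r sr) (le_trans (pnorm_deriv _ r0 rs)) // h.
Qed.

Lemma wan_near f g t0 d : 0 < d -> (forall t, `|t - t0| < d -> f t = g t) ->
  wan g t0 -> wan f t0.
Proof.
move=> d0 fg [r [P [r0 hP hg]]].
pose s := Num.min r (d / 2).
have s0 : 0 < s by rewrite lt_min r0 divr_gt0.
have sr : s <= r by rewrite ge_min lexx.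
exists s, P; split => //; first exact: ncauchy_mono (ltW s0) sr hP.
move=> t ts; rewrite fg; first by apply: hg; exact: le_trans ts sr.
rewrite addrAC subrr add0r (le_lt_trans ts) // (@le_lt_trans _ _ (d / 2)) //.
  by rewrite ge_min lexx orbT.
lra.
Qed.

Lemma wan_cst c t0 : wan (fun=> c) t0.
Proof.
exists 1, (fun=> c%:P); split => //; first exact: ncauchy_const.
by move=> t _; rewrite hornerC; exact: cvg_cst.
Qed.

Lemma wan_id t0 : wan id t0.
Proof.
exists 1, (fun=> t0%:P + 'X); split => //; first exact: ncauchy_const.
by move=> t _; rewrite hornerD hornerC hornerX; exact: cvg_cst.
Qed.

Lemma wan_common f g t0 : wan f t0 -> wan g t0 -> exists r P Q,
  [/\ 0 < r, ncauchy r P, ncauchy r Q,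
   forall t, `|t| <= r -> (fun n => (P n).[t]) @ \oo --> f (t0 + t) &
   forall t, `|t| <= r -> (fun n => (Q n).[t]) @ \oo --> g (t0 + t)].
Proof.
move=> [r1 [P [r10 hP hf]]] [r2 [Q [r20 hQ hg]]].
pose r := Num.min r1 r2; have r0 : 0 < r by rewrite lt_min r10.
have rr1 : r <= r1 by rewrite ge_min lexx.
have rr2 : r <= r2 by rewrite ge_min lexx orbT.
exists r, P, Q; split => //.
- exact: ncauchy_mono (ltW r0) rr1 hP.
- exact: ncauchy_mono (ltW r0) rr2 hQ.
- by move=> t tr; apply: hf; exact: le_trans rr1.
- by move=> t tr; apply: hg; exact: le_trans rr2.
Qed.

Lemma wanD f g t0 : wan f t0 -> wan g t0 -> wan (fun t => f t + g t) t0.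
Proof.
move=> hf hg; have [r [P [Q [r0 hP hQ cf cg]]]] := wan_common hf hg.
exists r, (fun n => P n + Q n); split => //; first exact: ncauchyD (ltW r0) hP hQ.
move=> t tr; under eq_fun do rewrite hornerD.
by apply: cvgD; [exact: cf|exact: cg].
Qed.

Lemma wanM f g t0 : wan f t0 -> wan g t0 -> wan (fun t => f t * g t) t0.
Proof.
move=> hf hg; have [r [P [Q [r0 hP hQ cf cg]]]] := wan_common hf hg.
exists r, (fun n => P n * Q n); split => //; first exact: ncauchyM (ltW r0) hP hQ.
move=> t tr; under eq_fun do rewrite hornerM.
by apply: cvgM; [exact: cf|exact: cg].
Qed.

Lemma wanZ c f t0 : wan f t0 -> wan (fun t => c * f t) t0.
Proof. by move=> h; apply: wanM => //; exact: wan_cst. Qed.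

Lemma wanN f t0 : wan f t0 -> wan (fun t => - f t) t0.
Proof.
by move=> h; apply: (wan_near (g := fun t => -1 * f t) ltr01) => [t _|];
  [rewrite mulN1r|exact: wanZ].
Qed.

Lemma wanB f g t0 : wan f t0 -> wan g t0 -> wan (fun t => f t - g t) t0.
Proof. by move=> hf hg; apply: wanD => //; exact: wanN. Qed.

Lemma horner_comp_diff_le p s m a b : `|a| <= m -> `|b| <= m -> m < s ->
  `|p.[a] - p.[b]| * (s - m) <= pnorm s p * `|a - b|.
Proof.
move=> am bm ms.
have := @pnorm_comp_diff R 0 m s p a%:P b%:P (lexx _).
rewrite !comp_polyCr -!polyCB !pnorm_polyC; exact.
Qed.

(** Without constant term every monomial carries a factor of the radius, so shrinking the radius
    from [s] to [r] gains [r / s]. *)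
Lemma pnorm_noconst r s p : 0 <= r -> r <= s -> 0 < s -> p.[0] = 0 ->
  pnorm r p <= r / s * pnorm s p.
Proof.
move=> r0 rs s0 p0; rewrite /pnorm mulr_sumr; apply: ler_sum => -[[|i] /= _] _.
  by rewrite -horner_coef0 p0 normr0 !mul0r mulr0.
rewrite mulrCA ler_wpM2l // !exprS mulrA mulfVK ?gt_eqF // ler_wpM2l //.
by rewrite lerXn2r // nnegrE ltW.
Qed.

(** The polynomials of [g] may only be composed with inner polynomials of small norm. Subtracting
    constant terms centres [f] at [f t0], and a smaller radius then makes the norms small enough. *)
Lemma wan_comp f g t0 : wan f t0 -> wan g (f t0) -> wan (fun t => g (f t)) t0.
Proof.
move=> [r [P [r0 hP hf]]] [s [Q [s0 hQ hg]]].
have [M [M0 hM]] := ncauchy_bounded (ltW r0) hP.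
pose A n := P n - (P n).[0]%:P.
have A00 n : (A n).[0] = 0 by rewrite hornerD hornerN hornerC subrr.
have hA : ncauchy r A.
  move=> e e0; have e2 : 0 < e / 2 by lra.
  have [n0 hn] := hP _ e2; exists n0 => m n hm hnn.
  have -> : A m - A n = (P m - P n) - ((P m - P n).[0])%:P.
    by rewrite /A hornerD hornerN polyCB; ring.
  rewrite (le_trans (pnormD _ _ (ltW r0))) // pnormN pnorm_polyC.
  have -> : e = e / 2 + e / 2 by lra.
  rewrite lerD ?hn // (le_trans _ (hn m n hm hnn)) // horner_le_pnorm //.
  by rewrite normr0 ltW.
have [N [N0 hN]] := ncauchy_bounded (ltW r0) hA.
have [K [K0 hK]] := ncauchy_bounded (ltW s0) hQ.
(* [N] bounds the norms of [A n] on radius [r]; the new radius brings them below [s / 2], which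
   leaves a gap of [s / 2] for [pnorm_comp_diff]. *)
pose r' := Num.min r (r * (s / 2) / N).
have r'0 : 0 < r' by rewrite lt_min r0 divr_gt0 // mulr_gt0 // divr_gt0.
have r'r : r' <= r by rewrite ge_min lexx.
have An n : pnorm r' (A n) <= s / 2.
  apply: (le_trans (pnorm_noconst (ltW r'0) r'r r0 (A00 n))).
  apply: (@le_trans _ _ (r' / r * N)).
    by rewrite ler_wpM2l ?hN // divr_ge0 ?ltW.
  have h : r' <= r * (s / 2) / N by rewrite ge_min lexx orbT.
  rewrite -(ler_pM2r (_ : 0 < N)) // in h; rewrite mulfVK ?gt_eqF // in h.
  rewrite mulrAC ler_pdivrMr // [leRHS]mulrC; exact: h.
have s2s : s / 2 < s by lra.
have ss2 : s - s / 2 = s / 2 by lra.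
have s20 : 0 < s / 2 by lra.
have hA' : ncauchy r' A by exact: ncauchy_mono (ltW r'0) r'r hA.
exists r', (fun n => Q n \Po A n); split => //.
  move=> e e0; have e2 : 0 < e / 2 by lra.
  have [n1 h1] := hQ _ e2.
  have [n2 h2] := hA' _ (divr_gt0 (mulr_gt0 e2 s20) K0).
  exists (maxn n1 n2) => m n; rewrite !geq_max => /andP[a1 a2] /andP[b1 b2].
  have -> : (Q m \Po A m) - (Q n \Po A n) =
      ((Q m - Q n) \Po A m) + ((Q n \Po A m) - (Q n \Po A n)).
    by rewrite comp_polyB; ring.
  rewrite (le_trans (pnormD _ _ (ltW r'0))) //.
  have -> : e = e / 2 + e / 2 by lra.
  rewrite lerD //.
    rewrite (le_trans (pnorm_comp _ _ (ltW r'0))) //.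
    apply: (le_trans (pnorm_mono (Q m - Q n) (pnorm_ge0 _ (ltW r'0)) (le_trans (An m) (ltW s2s)))).
    exact: h1.
  rewrite -(ler_pM2r s20) -[in X in X <= _]ss2.
  apply: (le_trans (pnorm_comp_diff _ (ltW r'0) (An m) (An n) s2s)).
  apply: (@le_trans _ _ (K * (e / 2 * (s / 2) / K))).
    by rewrite ler_pM ?pnorm_ge0 ?(ltW s0) ?(ltW r'0) // h2.
  by rewrite mulrC mulfVK ?gt_eqF.
move=> t tr'.
have tr : `|t| <= r by exact: le_trans r'r.
have cA : (fun n => (A n).[t]) @ \oo --> f (t0 + t) - f t0.
  under eq_fun do rewrite /A hornerD hornerN hornerC.
  apply: cvgB; first exact: hf.
  by have := hf 0; rewrite addr0; apply; rewrite normr0 ltW.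
pose y := f (t0 + t) - f t0.
have yle : `|y| <= s / 2.
  rewrite -[y]subr0; apply: (cvg_dist_le cA); exists 0%N => n _.
  rewrite subr0 (le_trans (horner_le_pnorm _ tr')) //.
have cQ : (fun n => (Q n).[y]) @ \oo --> g (f (t0 + t)).
  have -> : f (t0 + t) = f t0 + y by rewrite /y; ring.
  by apply: hg; rewrite (le_trans yle) // ltW.
apply/cvg_eps => e e0; have e2 : 0 < e / 2 by lra.
have [n1 h1] := (cvg_eps _ _).1 cQ _ e2.
have [n2 h2] := (cvg_eps _ _).1 cA _ (divr_gt0 (mulr_gt0 e2 s20) K0).
exists (maxn n1 n2) => n; rewrite geq_max => /andP[b1 b2].
rewrite horner_comp -(subrKA (Q n).[y]) (le_trans (ler_normD _ _)) //.
have -> : e = e / 2 + e / 2 by lra.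
rewrite lerD ?h1 // -(ler_pM2r s20) -[in X in X <= _]ss2.
have An' : `|(A n).[t]| <= s / 2 by rewrite (le_trans (horner_le_pnorm _ tr')).
apply: (le_trans (horner_comp_diff_le _ An' yle s2s)).
apply: (@le_trans _ _ (K * (e / 2 * (s / 2) / K))).
  by rewrite ler_pM ?pnorm_ge0 ?(ltW s0) // h2.
by rewrite mulrC mulfVK ?gt_eqF.
Qed.

End Wan.

(** * Power series, elementary functions and the inverse function theorem *)

Section Wan2.
Variable R : realType.
Implicit Types (P Q : nat -> {poly R}) (r s t : R) (f g : R -> R).

Lemma pnormZXn r c n : 0 <= r -> pnorm r (c *: 'X^n) <= `|c| * r ^+ n.
Proof.
move=> r0; rewrite pnormZ ler_wpM2l // -[r in leRHS]pnormX //; exact: pnorm_exp.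
Qed.

Lemma half_pow_small (M e : R) : 0 < e -> exists n0, forall n, (n0 <= n)%N -> M * 2^-1 ^+ n <= e.
Proof.
move=> e0; exists (Num.bound (`|M| / e)) => n hn.
have h : `|M| / e < n%:R.
  rewrite (lt_le_trans (archi_boundP _)) ?ler_nat // divr_ge0 // ltW //.
rewrite ltr_pdivrMr // in h.
have h2 : n%:R <= 2 ^+ n :> R by rewrite -natrX ler_nat ltnW // ltn_expl.
rewrite exprVn ler_pdivrMr ?exprn_gt0 //.
rewrite (le_trans (ler_norm M)) // (le_trans (ltW h)) // mulrC ler_wpM2l //; exact: ltW.
Qed.

(** Halving the radius turns bounded terms [|a i| x^i] into a geometric series. *)
Lemma ncauchy_series (a : nat -> R) x M : 0 < x -> (forall i, `|a i| * x ^+ i <= M) ->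
  ncauchy (x / 2) (fun n => \poly_(i < n) a i).
Proof.
move=> x0 hM; have x2 : 0 <= x / 2 by rewrite divr_ge0 // ltW.
have M0 : 0 <= M by rewrite (le_trans _ (hM 0%N)) // mulr_ge0 // exprn_ge0 // ltW.
(* The right-hand side is the exact sum of [M 2^-i] for [n <= i < n + k], so the induction on [k]
   closes. *)
have step n k : pnorm (x / 2) (\poly_(i < n + k) a i - \poly_(i < n) a i)
     <= M * 2^-1 ^+ n * (2 - 2 * 2^-1 ^+ k).
  elim: k => [|k IH].
    by rewrite addn0 subrr pnorm0 expr0 mulr1 subrr mulr0.
  have -> : \poly_(i < n + k.+1) a i - \poly_(i < n) a i =
      (\poly_(i < n + k) a i - \poly_(i < n) a i) + a (n + k)%N *: 'X^(n + k).
    apply/polyP => i; rewrite !coefB coefD coefB coefZ coefXn !coef_poly addnS ltnS.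
    rewrite leq_eqVlt; case: eqP => [->|]; rewrite ?ltnn /= ?mulr1 ?mulr0 ?addr0 //.
    by ring.
  rewrite (le_trans (pnormD _ _ x2)) //.
  rewrite (le_trans (lerD IH (pnormZXn _ _ x2))) //.
  rewrite expr_div_n -exprVn.
  have h := hM (n + k)%N.
  have -> : `|a (n + k)%N| * (x ^+ (n + k) * 2^-1 ^+ (n + k)) =
            (`|a (n + k)%N| * x ^+ (n + k)) * 2^-1 ^+ (n + k) by ring.
  apply: (@le_trans _ _ (M * 2^-1 ^+ n * (2 - 2 * 2^-1 ^+ k) + M * 2^-1 ^+ (n + k))).
    by rewrite lerD2l ler_wpM2r // exprn_ge0.
  rewrite exprD exprS; set u := 2^-1 ^+ n; set v := 2^-1 ^+ k.
  by rewrite le_eqVlt; apply/orP; left; apply/eqP; field.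
have step2 n k : pnorm (x / 2) (\poly_(i < n + k) a i - \poly_(i < n) a i) <= 2 * M * 2^-1 ^+ n.
  apply: (le_trans (step n k)).
  have -> : 2 * M * 2^-1 ^+ n = M * 2^-1 ^+ n * 2 by ring.
  by rewrite ler_wpM2l ?mulr_ge0 ?exprn_ge0 // gerBl mulr_ge0 // exprn_ge0.
move=> e e0; have [n0 n0P] := half_pow_small (2 * M) e0; exists n0; move=> {step} m k hm hk.
wlog mn : m k hm hk / (k <= m)%N.
  move=> H; have [h|h] := leqP k m; first exact: H.
  by rewrite pnormC; apply: H => //; exact: ltnW.
by rewrite -(subnKC mn) (le_trans (step2 _ _)) // n0P.
Qed.

Lemma wan_series f t0 (a : nat -> R) x M : 0 < x -> (forall i, `|a i| * x ^+ i <= M) ->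
  (forall t, `|t| <= x / 2 -> series (fun i => a i * t ^+ i) @ \oo --> f (t0 + t)) ->
  wan f t0.
Proof.
move=> x0 hM hf; exists (x / 2), (fun n => \poly_(i < n) a i); split.
- by rewrite divr_gt0.
- exact: ncauchy_series hM.
- move=> t tx; apply: (cvg_eq_seq _ (hf t tx)) => n.
  by rewrite horner_poly /series /= big_mkord.
Qed.

Lemma wan_shift f t0 : wan (fun t => f (t0 + t)) 0 -> wan f t0.
Proof.
move=> [r [P [r0 hP hf]]]; exists r, P; split => // t tr.
by have := hf t tr; rewrite add0r.
Qed.

Lemma wan_inv (x0 : R) : x0 != 0 -> wan (fun x => x^-1) x0.
Proof.
move=> x00; have nx0 : 0 < `|x0| by rewrite normr_gt0.
apply: (@wan_series _ _ (fun i => (- 1) ^+ i * x0^-1 ^+ i.+1) `|x0| `|x0|^-1) => // [i|t tx].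
  rewrite normrM !normrX normrN1 expr1n mul1r normfV exprS -mulrA -exprMn mulVf ?gt_eqF //.
  by rewrite expr1n mulr1.
have z1 : `|- (t / x0)| < 1.
  by rewrite normrN normrM normfV ltr_pdivrMr // mul1r (le_lt_trans tx) //; lra.
have cv := @cvg_geometric_series R x0^-1 _ z1.
have E : x0^-1 * (1 - - (t / x0))^-1 = (x0 + t)^-1.
  by rewrite -invfM; congr (_^-1); field.
rewrite -E; apply: (cvg_eq_seq _ cv) => n; rewrite /series /=; apply: eq_bigr => i _.
rewrite /geometric /= -[- (t / x0)]mulN1r !exprMn exprS.
set a := (-1) ^+ i; set b := x0^-1 ^+ i; set c := t ^+ i; set d := x0^-1.
by ring.
Qed.

(** The defining series gives the expansion at [0], and [expR t0 * expR (t - t0)] moves it to [t0];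
    [wan_sincos] does the same with the addition formulas. *)
Lemma wan_exp t0 : wan expR t0.
Proof.
have h0 : wan (@expR R) 0.
  apply: (@wan_series _ _ (fun i => (i`!%:R)^-1) 1 1) => // [i|t _].
    rewrite expr1n mulr1 ger0_norm ?invr_ge0 // invf_le1 ?ltr0n ?fact_gt0 //.
    by rewrite ler1n fact_gt0.
  rewrite add0r /expR.
  apply: (cvg_eq_seq _ (is_cvg_series_exp_coeff t)) => n.
  by rewrite /series /=; apply: eq_bigr => i _; rewrite /exp_coeff /= mulrC.
apply: (wan_near (g := fun t => expR t0 * expR (t - t0)) ltr01) => [t _|].
  by rewrite -expRD addrC subrK.
apply: wanZ; apply: (wan_comp (f := fun t => t - t0) (g := expR)).
  by apply: wanB; [exact: wan_id|exact: wan_cst].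
by rewrite subrr.
Qed.

Lemma wan_sincos t0 : wan (@sin R) t0 /\ wan (@cos R) t0.
Proof.
have bnd (b : bool) (k i : nat) : `|b%:R * (-1) ^+ k / i`!%:R : R| <= 1.
  rewrite !normrM normrX normrN1 expr1n mulr1 normfV normr_nat [`|i`!%:R|]normr_nat.
  rewrite ler_pdivrMr ?ltr0n ?fact_gt0 // mul1r ler_nat.
  by rewrite (@leq_trans 1) ?fact_gt0 // leq_b1.
have s0 : wan (@sin R) 0.
  apply: (@wan_series _ _ (fun i => (odd i)%:R * (-1) ^+ i.-1./2 / i`!%:R) 1 1) => // [i|t _].
    by rewrite expr1n mulr1 bnd.
  rewrite add0r sin.unlock.
  have cv : series (sin_coeff t) @ \oo --> limn (series (sin_coeff t)) by exact: is_cvg_series_sin_coeff.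
  apply: (cvg_eq_seq _ cv) => n.
  by rewrite /series /=; apply: eq_bigr => i _; rewrite /sin_coeff /=; ring.
have c0 : wan (@cos R) 0.
  apply: (@wan_series _ _ (fun i => (~~ odd i)%:R * (-1) ^+ i./2 / i`!%:R) 1 1) => // [i|t _].
    by rewrite expr1n mulr1 bnd.
  rewrite add0r cos.unlock.
  have cv : series (cos_coeff t) @ \oo --> limn (series (cos_coeff t)) by exact: is_cvg_series_cos_coeff.
  apply: (cvg_eq_seq _ cv) => n.
  rewrite /series /=; apply: eq_bigr => i _; rewrite /cos_coeff /=.
  by rewrite -exprnP; ring.
have sh g : wan g 0 -> wan (fun t => g (t - t0)) t0.
  move=> h; apply: (wan_comp (f := fun t => t - t0) (g := g)).
    by apply: wanB; [exact: wan_id|exact: wan_cst].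
  by rewrite subrr.
split.
  apply: (wan_near (g := fun t => sin t0 * cos (t - t0) + cos t0 * sin (t - t0)) ltr01).
    by move=> t _; rewrite -sinD addrC subrK.
  by apply: wanD; apply: wanZ; exact: sh.
apply: (wan_near (g := fun t => cos t0 * cos (t - t0) - sin t0 * sin (t - t0)) ltr01).
  by move=> t _; rewrite -cosD addrC subrK.
by apply: wanB; apply: wanZ; exact: sh.
Qed.

(** In a Cauchy sequence of polynomials each coefficient converges; the limits are the coefficients
    of the power series. *)
Lemma wan_analytic f : (forall t, wan f t) -> analytic f.
Proof.
move=> h t0; have [r [P [r0 hP hf]]] := h t0.
have hc k : exists l : R, (fun n => (P n)`_k) @ \oo --> l.
  apply: (cauchy_eps (u := fun n => (P n)`_k)) => e e0.
  have rk : 0 < r ^+ k by rewrite exprn_gt0.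
  have [n0 hn] := hP _ (mulr_gt0 e0 rk); exists n0 => m n hm hnn.
  rewrite -coefB -(ler_pM2r rk) (le_trans (coef_le_pnorm _ _ (ltW r0))) //; exact: hn.
have [a ha] := choice hc.
exists a, r; split => // t /ltW tr.
apply/cvg_eps => e e0; have e2 : 0 < e / 2 by lra.
have [N hN] := hP _ e2.
(* From [size (P N)] on, the truncated sum of [P N] is its value, so only differences of
   coefficients remain, and the norm bounds them for all [n] at once. *)
exists (size (P N)) => n hn.
have E : [series a k * (t - t0) ^+ k]_k n = \sum_(i < n) a i * (t - t0) ^+ i.
  by rewrite /series /= big_mkord.
rewrite E -(subrKA (P N).[t - t0]).
have -> : e = e / 2 + e / 2 by lra.
rewrite (le_trans (ler_normD _ _)) // lerD //; last first.
  have := hf _ tr; rewrite (addrC t0) subrK => hft.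
  rewrite distrC.
  apply: (cvg_dist_le hft); exists N => m hm.
  rewrite -hornerN -hornerD (le_trans (horner_le_pnorm _ tr)) //; exact: hN.
rewrite (horner_coef_wide _ hn) -sumrB.
have cv : (fun m => \sum_(i < n) (P m)`_i * (t - t0) ^+ i) @ \oo -->
    \sum_(i < n) a i * (t - t0) ^+ i.
  by apply: (cvg_ordsum (F := fun i m => (P m)`_i * (t - t0) ^+ i) (a := fun i => a i * (t - t0) ^+ i)) => i; apply: cvgM => //; exact: cvg_cst.
rewrite sumrB; apply: (cvg_dist_le cv); exists N => m hm.
rewrite -sumrB (le_trans _ (hN m N hm (leqnn _))) //.
rewrite (le_trans _ (sum_coef_le_pnorm _ n (ltW r0))) //.
rewrite (le_trans (ler_norm_sum _ _ _)) //; apply: ler_sum => i _.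
rewrite -mulrBl normrM coefB ler_wpM2l // normrX.
by rewrite lerXn2r // nnegrE // ltW.
Qed.

Lemma quad_is_derive f (t0 a M d : R) : 0 < d ->
  (forall h, `|h| <= d -> `|f (t0 + h) - f t0 - a * h| <= M * h ^+ 2) ->
  is_derive t0 1 f a.
Proof.
move=> d0 H.
have cv : h^-1 *: (f (h *: 1 + t0) - f t0) @[h --> 0^'] --> a.
  apply/cvgrPdist_le => e e0.
  pose s := Num.min d (e / (`|M| + 1)).
  have M1 : 0 < `|M| + 1 by rewrite ltr_wpDl.
  have s0 : 0 < s by rewrite lt_min d0 divr_gt0.
  exists s => //= h; rewrite /ball /= sub0r normrN => hs h0.
  have hd : `|h| <= d by rewrite (le_trans (ltW hs)) // ge_min lexx.
  have he : `|h| * (`|M| + 1) <= e.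
    by rewrite -ler_pdivlMr // (le_trans (ltW hs)) // ge_min lexx orbT.
  rewrite distrC -(ler_pM2r (_ : 0 < `|h|)) ?normr_gt0 // -normrM.
  have -> : (h^-1 *: (f (h *: 1 + t0) - f t0) - a) * h = f (t0 + h) - f t0 - a * h.
    rewrite /GRing.scale /= mulr1 [h + t0]addrC; field; exact: h0.
  rewrite (le_trans (H _ hd)) //.
  apply: (@le_trans _ _ ((`|M| + 1) * `|h| ^+ 2)).
    by rewrite real_normK ?num_real // ler_wpM2r ?sqr_ge0 // (le_trans (ler_norm _)) // lerDl.
  by rewrite expr2 mulrA ler_wpM2r // mulrC.
split; last by apply/cvg_lim.
by apply/cvg_ex; exists a.
Qed.

(** The remainder after the tangent line at [0]; a smaller radius gains a square on it
    ([pnorm_plow]), which is what differentiation and inversion use. *)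
Definition plow (p : {poly R}) := p - (p`_0)%:P - p`_1 *: 'X.

Lemma plow_coef p i : (plow p)`_i = if (i < 2)%N then 0 else p`_i.
Proof.
rewrite /plow !coefB coefC coefZ coefX; case: i => [|[|i]] //=.
- by rewrite mulr0 subr0 subrr.
- by rewrite mulr1 subr0 subrr.
- by rewrite mulr0 !subr0.
Qed.

Lemma plowB p q : plow p - plow q = plow (p - q).
Proof.
by apply/polyP => i; rewrite coefB !plow_coef; case: ifP => _; rewrite ?subrr // coefB.
Qed.

Lemma pnorm_plow r s p : 0 <= r -> r <= s -> 0 < s ->
  pnorm r (plow p) <= (r / s) ^+ 2 * pnorm s p.
Proof.
move=> r0 rs s0.
have sz : (size (plow p) <= maxn 2 (size p))%N.
  apply/leq_sizeP => j hj; rewrite plow_coef; case: ltnP => // h.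
  by rewrite nth_default // (leq_trans _ hj) // leq_maxr.
rewrite (pnormE r sz) (@pnormE R s p (maxn 2 (size p))) ?leq_maxr // mulr_sumr.
apply: ler_sum => i _; rewrite plow_coef; case: ltnP => h.
  rewrite normr0 mul0r; apply: mulr_ge0; first by rewrite exprn_ge0 // divr_ge0 // ltW.
  by rewrite mulr_ge0 // exprn_ge0 // ltW.
rewrite mulrCA ler_wpM2l // -(subnKC h) !exprD mulrA.
have -> : (r / s) ^+ 2 * s ^+ 2 = r ^+ 2 by field; rewrite gt_eqF.
by rewrite ler_wpM2l ?exprn_ge0 // lerXn2r // nnegrE // ltW.
Qed.

Lemma coef1_cvg r P : 0 < r -> ncauchy r P -> exists a : R, (fun n => (P n)`_1) @ \oo --> a.
Proof.
move=> r0 hP; apply: (cauchy_eps (u := fun n => (P n)`_1)) => e e0.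
have [n0 hn] := hP _ (mulr_gt0 e0 r0); exists n0 => m n hm hnn.
rewrite -coefB -(ler_pM2r r0) -[r in X in X <= _]expr1.
by rewrite (le_trans (coef_le_pnorm _ _ (ltW r0))) // hn.
Qed.

Lemma wan_taylor f t0 r P a : 0 < r -> ncauchy r P ->
  (forall t, `|t| <= r -> (fun n => (P n).[t]) @ \oo --> f (t0 + t)) ->
  (fun n => (P n)`_1) @ \oo --> a -> is_derive t0 1 f a.
Proof.
move=> r0 hP hf ha; have [M [M0 hM]] := ncauchy_bounded (ltW r0) hP.
apply: (@quad_is_derive f t0 a (M / r ^+ 2) r r0) => h hr.
have cv : (fun n => (plow (P n)).[h]) @ \oo --> f (t0 + h) - f t0 - a * h.
  have -> : (fun n => (plow (P n)).[h]) =
     (fun n => (P n).[h] - (P n).[0] - (P n)`_1 * h).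
    apply/funext => n; rewrite /plow !hornerD !hornerN hornerZ hornerC hornerX.
    by rewrite horner_coef0.
  apply: cvgB; [apply: cvgB; [exact: hf|]|apply: cvgM => //; exact: cvg_cst].
  by have := hf 0; rewrite addr0; apply; rewrite normr0 ltW.
rewrite -[X in `|X|]subr0; apply: (cvg_dist_le cv); exists 0%N => n _; rewrite subr0.
rewrite (le_trans (horner_le_pnorm _ (lexx `|h|))) //.
rewrite (le_trans (pnorm_plow _ _ hr r0)) //.
have -> : M / r ^+ 2 * h ^+ 2 = (`|h| / r) ^+ 2 * M.
  by rewrite expr_div_n real_normK ?num_real //; ring.
by rewrite ler_wpM2l ?sqr_ge0.
Qed.

Lemma wan_derivable f t0 : wan f t0 -> derivable f t0 1.
Proof.
move=> [r [P [r0 hP hf]]]; have [a ha] := coef1_cvg r0 hP.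
by have [] := wan_taylor r0 hP hf ha.
Qed.

(** Fixed point iteration: with [f x = a x + G x], the inverse solves [k = a^-1 (y - G k)]. The
    iterates are polynomials because the step number also indexes the approximant [F m] of [G]. The
    left inverse near [0] is the form that the polar equation at a gas point calls for. *)
Lemma wan_inverse f (a : R) : wan f 0 -> f 0 = 0 -> is_derive (0 : R) 1 f a -> a != 0 ->
  exists k d, [/\ 0 < d, wan k 0 & forall x, `|x| < d -> k (f x) = x].
Proof.
move=> wf f0 fa a0; have [r [P [r0 hP hf0]]] := wf.
have hf t : `|t| <= r -> (fun n => (P n).[t]) @ \oo --> f t.
  by move=> tr; have := hf0 t tr; rewrite add0r.
have ha : (fun n => (P n)`_1) @ \oo --> a.
  have [b hb] := coef1_cvg r0 hP; have hd := wan_taylor r0 hP hf0 hb.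
  by rewrite -(@derive_val _ _ _ _ _ _ _ fa) (@derive_val _ _ _ _ _ _ _ hd).
have na : 0 < `|a| by rewrite normr_gt0.
have [M [M0 hM]] := ncauchy_bounded (ltW r0) hP.
pose F n : {poly R} := plow (P n); pose G x := f x - a * x.
have FG t : `|t| <= r -> (fun n => (F n).[t]) @ \oo --> G t.
  move=> tr.
  apply: (cvg_eq_seq (u := fun n => (P n).[t] - (P n).[0] - (P n)`_1 * t)).
    move=> n; rewrite /F /plow !hornerD !hornerN hornerZ hornerC hornerX.
    by rewrite horner_coef0.
  have -> : G t = f t - f 0 - a * t by rewrite f0 subr0.
  apply: cvgB; [apply: cvgB; [exact: hf|]|apply: cvgM => //; exact: cvg_cst].
  by apply: hf; rewrite normr0 ltW.
(* On radius [p] the remainders have norm at most [|a| p / 8], so composition with [F n] is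
   [|a| / 4]-Lipschitz on polynomials of norm at most [p / 2], and the iteration contracts by
   [1 / 4]. *)
pose p := Num.min r (`|a| * r ^+ 2 / (8 * M)).
have p0 : 0 < p.
  by rewrite lt_min r0 divr_gt0 // mulr_gt0 // exprn_gt0.
have pr : p <= r by rewrite ge_min lexx.
have Fp n : pnorm p (F n) <= `|a| * p / 8.
  apply: (le_trans (pnorm_plow _ (ltW p0) pr r0)).
  apply: (@le_trans _ _ ((p / r) ^+ 2 * M)); first by rewrite ler_wpM2l ?sqr_ge0.
  have h : p <= `|a| * r ^+ 2 / (8 * M) by rewrite ge_min lexx orbT.
  have r20 : 0 < r ^+ 2 by rewrite exprn_gt0.
  rewrite ler_pdivlMr ?mulr_gt0 // in h.
  rewrite expr_div_n mulrAC ler_pdivrMr // expr2.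
  have -> : `|a| * p / 8 * r ^+ 2 = p * (`|a| * r ^+ 2) / 8 by ring.
  rewrite ler_pdivlMr //.
  by have -> : p * p * M * 8 = p * (p * (8 * M)); [ring|rewrite ler_wpM2l // ltW].
have cF : ncauchy p F.
  move=> e e0; have [n0 hn] := ncauchy_mono (ltW p0) pr hP e0; exists n0 => m n hm hnn.
  rewrite plowB (le_trans (pnorm_plow _ (ltW p0) (lexx p) p0)) //.
  by rewrite divff ?gt_eqF // expr1n mul1r hn.
have p2p : p / 2 < p by lra.
have p20 : 0 < p / 2 by lra.
have Lip n d u v : 0 <= d -> pnorm d u <= p / 2 -> pnorm d v <= p / 2 ->
    pnorm d ((F n \Po u) - (F n \Po v)) <= `|a| / 4 * pnorm d (u - v).
  move=> d0 hu hv.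
  have h := pnorm_comp_diff (F n) d0 hu hv p2p.
  have e2 : p - p / 2 = p / 2 by lra.
  rewrite e2 in h; rewrite -(ler_pM2r p20) (le_trans h) //.
  have -> : `|a| / 4 * pnorm d (u - v) * (p / 2) = `|a| * p / 8 * pnorm d (u - v) by field.
  by rewrite ler_wpM2r // pnorm_ge0.
(* On this radius [a^-1 X] has norm [p / 8], which keeps the iterates within norm [p / 2]. *)
pose d := `|a| * p / 8.
have d0 : 0 < d by rewrite divr_gt0 // mulr_gt0.
pose K := fix K (n : nat) : {poly R} := if n is m.+1 then a^-1 *: ('X - (F m \Po K m)) else 0.
have F0 n : F n \Po 0 = 0.
  by rewrite -[X in _ \Po X]polyC0 comp_polyCr horner_coef0 plow_coef.
have Kp n : pnorm d (K n) <= p / 2.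
  elim: n => [|n IH]; first by rewrite /= pnorm0 ltW.
  rewrite /= pnormZ normfV mulrC ler_pdivrMr //.
  rewrite (le_trans (pnormD _ _ (ltW d0))) // pnormN pnormX ?(ltW d0) //.
  have := Lip n d (K n) 0 (ltW d0) IH; rewrite pnorm0 F0 !subr0 => /(_ (ltW p20)) h.
  apply: (@le_trans _ _ (d + `|a| / 4 * (p / 2))).
    by rewrite lerD2l (le_trans h) // ler_wpM2l // divr_ge0.
  have -> : d + `|a| / 4 * (p / 2) = p / 4 * `|a| by rewrite /d; field.
  by rewrite ler_wpM2r //; lra.
have cK : ncauchy d K.
  move=> e e0.
  have [N hN] := cF (e / 4 * `|a|) (mulr_gt0 (divr_gt0 e0 (ltr0Sn _ 3)) na).
  (* [e / 2] absorbs the change of [F] between indices and [p 2^-j] the initial distance of the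
     iterates; one contraction leaves [3 e / 8 + p 2^-j / 4], within the claim for [j + 1]. *)
  have key j : forall m n, (N + j <= m)%N -> (N + j <= n)%N ->
      pnorm d (K m - K n) <= e / 2 + p * 2^-1 ^+ j.
    elim: j => [|j IH] m n hm hn.
      rewrite expr0 mulr1 (le_trans (pnormD _ _ (ltW d0))) // pnormN.
      have := Kp m; have := Kp n; lra.
    case: m n hm hn => [|m] [|n]; rewrite ?addnS ?ltn0 // !ltnS => hm hn /=.
    rewrite -scalerBr pnormZ normfV mulrC ler_pdivrMr //.
    have -> : 'X - (F m \Po K m) - ('X - (F n \Po K n)) =
       ((F n - F m) \Po K m) + ((F n \Po K n) - (F n \Po K m)).
      have id4 (X U V W : {poly R}) : X - U - (X - V) = W - U + (V - W) by ring.
      by rewrite (comp_polyB (F n) (F m)); exact: id4.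
    rewrite (le_trans (pnormD _ _ (ltW d0))) //.
    have h1 : pnorm d ((F n - F m) \Po K m) <= e / 4 * `|a|.
      rewrite (le_trans (pnorm_comp _ _ (ltW d0))) //.
      apply: (le_trans (pnorm_mono _ (pnorm_ge0 _ (ltW d0)) (le_trans (Kp m) (ltW p2p)))).
      by apply: hN; [exact: leq_trans (leq_addr _ _) hn|exact: leq_trans (leq_addr _ _) hm].
    have h2 := Lip n d (K n) (K m) (ltW d0) (Kp n) (Kp m).
    have h3 := IH n m hn hm.
    have h4 : 0 <= 2^-1 ^+ j :> R by rewrite exprn_ge0.
    rewrite exprS.
    apply: (@le_trans _ _ (e / 4 * `|a| + `|a| / 4 * (e / 2 + p * 2^-1 ^+ j))).
      by rewrite lerD // (le_trans h2) // ler_wpM2l // divr_ge0.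
    have -> : e / 4 * `|a| + `|a| / 4 * (e / 2 + p * 2^-1 ^+ j) =
       (3 * e / 8 + p * 2^-1 ^+ j / 4) * `|a| by field.
    rewrite ler_wpM2r //.
    have h5 : 0 <= p * 2^-1 ^+ j by rewrite mulr_ge0 // ltW.
    lra.
  have e2 : 0 < e / 2 by lra.
  have [j0 hj] := half_pow_small p e2.
  exists (N + j0)%N => m n hm hn; apply: (le_trans (key j0 m n hm hn)).
  have := hj j0 (leqnn _); lra.
pose k y := lim ((fun n => (K n).[y]) @ \oo).
have ck y : `|y| <= d -> (fun n => (K n).[y]) @ \oo --> k y.
  move=> yd; have [l hl] : exists l : R, (fun n => (K n).[y]) @ \oo --> l.
    apply: (cauchy_eps (u := fun n => (K n).[y])) => e e0.
    have [n0 hn] := cK e e0; exists n0 => m n hm hnn.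
    by rewrite -hornerN -hornerD (le_trans (horner_le_pnorm _ yd)) // hn.
  by apply/cvg_ex; exists l.
have [_ [d1 /= d10 hd1]] : continuous_at 0 f /\ nbhs (0:R) (fun x => `|f x| <= d).
  have fc : continuous_at 0 f.
    by apply: differentiable_continuous; apply/derivable1_diffP; case: fa.
  split => //; have /cvgrPdist_le /(_ d d0) := fc.
  by rewrite f0; apply: filterS => x; rewrite sub0r normrN.
exists k, (Num.min d1 (p / 2)); split.
- by rewrite lt_min d10 p20.
- by exists d, K; split => // t td; rewrite add0r; exact: ck.
move=> x; rewrite lt_min => /andP[xd1 xp].
have yd : `|f x| <= d by apply: hd1; rewrite /= sub0r normrN.
set y := f x in yd *.
have kp : `|k y| <= p / 2.
  rewrite -[k y]subr0; apply: (cvg_dist_le (ck y yd)); exists 0%N => n _.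
  by rewrite subr0 (le_trans (horner_le_pnorm _ yd)).
have xr : `|x| <= r by rewrite (le_trans (ltW xp)) // (le_trans (ltW p2p)).
(* Both [k y] and [x] solve the fixed point equation for [y = f x]; the contraction forces them to
   coincide. *)
have key : `|a| * `|k y - x| <= `|a| / 4 * `|k y - x|.
  apply/ler_addgt0Pr => e e0.
  have [n1 h1] := (cvg_eps _ _).1 (ck y yd) _ (divr_gt0 e0 (mulr_gt0 (ltr0Sn _ 3) na)).
  have [n2 h2] := (cvg_eps _ _).1 (FG x xr) _ (divr_gt0 e0 (ltr0Sn _ 2)).
  pose n := maxn n1 n2.
  have b1 := h1 n (leq_maxl _ _); have b2 := h1 n.+1 (leqW (leq_maxl _ _)).
  have b3 := h2 n (leq_maxr _ _).
  have b4 : `|(F n).[(K n).[y]] - (F n).[x]| <= `|a| / 4 * `|(K n).[y] - x|.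
    have := Lip n 0 ((K n).[y])%:P x%:P (lexx _).
    rewrite !comp_polyCr -!polyCB !pnorm_polyC; apply; last exact: ltW.
    by rewrite (le_trans (horner_le_pnorm _ yd)).
  have E : a * ((K n.+1).[y] - x) = (G x - (F n).[x]) + ((F n).[x] - (F n).[(K n).[y]]).
    rewrite /= hornerZ hornerD hornerN hornerX horner_comp /G -/y.
    by field.
  have b5 : `|a| * `|(K n.+1).[y] - x| <= e / 3 + `|a| / 4 * `|(K n).[y] - x|.
    rewrite -normrM E (le_trans (ler_normD _ _)) // lerD //.
      by rewrite distrC.
    by rewrite distrC.
  have b6 : `|k y - x| <= `|(K n.+1).[y] - k y| + `|(K n.+1).[y] - x|.
    by rewrite (distrC _ (k y)) -(subrKA (K n.+1).[y] (k y)) ler_normD.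
  have b7 : `|(K n).[y] - x| <= `|(K n).[y] - k y| + `|k y - x|.
    by rewrite -(subrKA (k y)) ler_normD.
  have c1 : `|a| * `|(K n.+1).[y] - k y| <= e / 4.
    by rewrite mulrC -ler_pdivlMr // -mulrA -invfM.
  have c2 : `|a| * `|(K n).[y] - k y| <= e / 4.
    by rewrite mulrC -ler_pdivlMr // -mulrA -invfM.
  have c6 := ler_wpM2l (ltW na) b6; have c7 := ler_wpM2l (ltW na) b7.
  rewrite !mulrDr in c6 c7; clear -b5 c1 c2 c6 c7 e0; lra.
have : `|a| * `|k y - x| <= 0 by lra.
rewrite pmulr_rle0 // normr_le0 subr_eq0 => /eqP; exact.
Qed.

End Wan2.

(** * Lebesgue measure and topology of the plane *)

Section Lebesgue2.
Variable R : realType.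
Local Notation pt := (pt R).
Local Notation leb := (@lebesgue_measure R).

Lemma measurable_affine (a b c : R) :
  measurable_fun [set: pt] (fun z : pt => a * z.1 + b * z.2 + c).
Proof.
apply: measurable_funD; last exact: measurable_cst.
by apply: measurable_funD; apply: measurable_funM; try exact: measurable_cst;
  [exact: measurable_fst|exact: measurable_snd].
Qed.

Lemma measurable_affine1 (a c : R) : measurable_fun [set: R] (fun x : R => a * x + c).
Proof.
apply: measurable_funD; last exact: measurable_cst.
by apply: measurable_funM; [exact: measurable_cst|exact: measurable_id].
Qed.

(** The scaled pushforward by the affine map agrees with Lebesgue measure on half-open intervals,
    hence everywhere by uniqueness. *)
Lemma lebesgue_affine (a c : R) (B : set R) : 0 < a -> measurable B ->
  (a%:E * leb ((fun x : R => (a * x + c)%R) @^-1` B) = leb B)%E.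
Proof.
move=> a0 mB.
pose f : R -> measurableTypeR R := fun x => a * x + c.
have mf : measurable_fun setT f by exact: measurable_affine1.
pose pf := measure_function_pushforward__canonical__measure_function_Measure leb mf.
have E : leb B = mscale (NngNum (ltW a0)) pf B; last by rewrite E.
apply: lebesgue_measure_unique => // X [[u v]] _ <-.
have P : f @^-1` `]u, v] = `](u - c) / a, (v - c) / a]%classic.
  apply/seteqP; split => x /=; rewrite !in_itv /= ltr_pdivrMr // ler_pdivlMr //.
    by rewrite ltrBlDr lerBrDr mulrC.
  by rewrite ltrBlDr lerBrDr mulrC.
rewrite -[RHS]/(a%:E * leb (f @^-1` `]u, v]))%E P !lebesgue_measure_itv /= !lte_fin.
have -> : ((u - c) / a < (v - c) / a) = (u < v) by rewrite ltr_pM2r ?invr_gt0 // ltrD2r.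
case: ifP => _; last by rewrite mule0.
rewrite -!EFinB -EFinM; congr (_%:E); field; lra.
Qed.

Definition leb2m := [the measure _ _ of (leb \x leb)%E].

Lemma leb2_ysection (S : set pt) : measurable S ->
  leb2 S = (\int[leb]_y leb (ysection S y))%E.
Proof.
move=> mS; rewrite /leb2.
rewrite (product_measure_unique (m' := [the measure _ _ of (leb \x^ leb)%E])) //.
by move=> A B mA mB /=; rewrite product_measure2E.
Qed.

Lemma leb2_xsection (S : set pt) :
  leb2 S = (\int[leb]_x leb (xsection S x))%E.
Proof. by []. Qed.

Lemma measurable_preim (T : pt -> pt) (S : set pt) :
  measurable_fun setT T -> measurable S -> measurable (T @^-1` S).
Proof. by move=> mT mS; rewrite -[X in measurable X]setTI; exact: mT. Qed.

(** [xmap] and [ymap] change one coordinate affinely, so sections and Fubini give their effect on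
    area. Rotations are products of such shears, and the gradient maps of a quadratic have this
    form. *)
Definition xmap (a b c : R) (z : pt) : pt := (a * z.1 + b * z.2 + c, z.2).
Definition ymap (a b c : R) (z : pt) : pt := (z.1, b * z.1 + a * z.2 + c).

Lemma measurable_xmap a b c : measurable_fun [set: pt] (xmap a b c).
Proof.
apply: measurable_fun_pair; first exact: measurable_affine.
exact: measurable_snd.
Qed.

Lemma measurable_ymap a b c : measurable_fun [set: pt] (ymap a b c).
Proof.
apply: measurable_fun_pair; last exact: measurable_affine.
exact: measurable_fst.
Qed.

Lemma leb2_xmap a b c (S : set pt) : 0 < a -> measurable S ->
  (a%:E * leb2 (xmap a b c @^-1` S) = leb2 S)%E.
Proof.
move=> a0 mS.
have mT : measurable (xmap a b c @^-1` S) by apply: measurable_preim => //; exact: measurable_xmap.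
rewrite !leb2_ysection // -ge0_integralZl //; last 2 first.
- exact: measurable_fun_ysection.
- by rewrite lee_fin ltW.
apply: eq_integral => y _.
rewrite -(lebesgue_affine (b * y + c) a0 (measurable_ysection y mS)).
congr (_ * leb _)%E; apply/seteqP; split => x /=; rewrite /ysection /= !inE /xmap /= addrA //.
Qed.

Lemma leb2_ymap a b c (S : set pt) : 0 < a -> measurable S ->
  (a%:E * leb2 (ymap a b c @^-1` S) = leb2 S)%E.
Proof.
move=> a0 mS.
have mT : measurable (ymap a b c @^-1` S) by apply: measurable_preim => //; exact: measurable_ymap.
rewrite !leb2_xsection // -ge0_integralZl //; last 2 first.
- exact: measurable_fun_xsection.
- by rewrite lee_fin ltW.
apply: eq_integral => y _.
rewrite -(lebesgue_affine (b * y + c) a0 (measurable_xsection y mS)).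
congr (_ * leb _)%E; apply/seteqP; split => x /=; rewrite /xsection /= !inE /ymap /=;
  by have -> : b * y + a * x + c = a * x + (b * y + c) by ring.
Qed.

Definition leb_pres (T : pt -> pt) := forall S : set pt, measurable S ->
  measurable (T @^-1` S) /\ leb2 (T @^-1` S) = leb2 S.

Lemma leb_pres_comp T U : leb_pres T -> leb_pres U -> leb_pres (T \o U).
Proof.
move=> hT hU S mS; have [m1 e1] := hT S mS; have [m2 e2] := hU _ m1.
by split; [exact: m2|exact: etrans e2 e1].
Qed.

Lemma leb_pres_xmap b c : leb_pres (xmap 1 b c).
Proof.
move=> S mS; split; first by apply: measurable_preim => //; exact: measurable_xmap.
by rewrite -(leb2_xmap b c ltr01 mS) mul1e.
Qed.

Lemma leb_pres_ymap b c : leb_pres (ymap 1 b c).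
Proof.
move=> S mS; split; first by apply: measurable_preim => //; exact: measurable_ymap.
by rewrite -(leb2_ymap b c ltr01 mS) mul1e.
Qed.

Definition rot (c s : R) (z : pt) : pt := (c * z.1 - s * z.2, s * z.1 + c * z.2).

(** For [s <> 0] a rotation is a product of three shears, the outer two with coefficient
    [(c - 1) / s], minus the tangent of half the angle; the half turn is the square of a quarter
    turn. *)
Lemma leb_pres_rot c s : c ^+ 2 + s ^+ 2 = 1 -> leb_pres (rot c s).
Proof.
have key c' s' : c' ^+ 2 + s' ^+ 2 = 1 -> s' != 0 -> leb_pres (rot c' s').
  move=> h s0.
  have -> : rot c' s' = xmap 1 ((c' - 1) / s') 0 \o (ymap 1 s' 0 \o xmap 1 ((c' - 1) / s') 0).
    have us : (c' - 1) / s' * s' = c' - 1 by rewrite mulfVK.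
    have uc : (c' - 1) / s' * (c' + 1) = - s'.
      apply: (mulIf s0); rewrite mulrAC us mulNr -expr2; lra.
    move: us uc; set u := (c' - 1) / s' => us uc.
    apply/funext => -[x y]; rewrite /rot /xmap /ymap /=; congr (_, _).
      transitivity ((1 + u * s') * x + u * (2 + u * s') * y); last by ring.
      have -> : 2 + u * s' = c' + 1 by rewrite us; ring.
      by rewrite us uc; ring.
    have -> : s' * (1 * x + u * y + 0) = s' * x + (u * s') * y by ring.
    by rewrite us; ring.
  by do !apply: leb_pres_comp; try exact: leb_pres_xmap; exact: leb_pres_ymap.
have [->|s0] := eqVneq s 0; last by move=> h; exact: key.
move=> h; have {h} : (c - 1) * (c + 1) = 0 by have := h; nra.
move=> /eqP; rewrite mulf_eq0 subr_eq0 addr_eq0 => /orP[|] /eqP ->.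
  have -> : rot 1 0 = xmap 1 0 0 by apply/funext => -[x y]; rewrite /rot /xmap /=; congr (_, _); ring.
  exact: leb_pres_xmap.
have -> : rot (- 1) 0 = rot 0 1 \o rot 0 1.
  by apply/funext => -[x y]; rewrite /rot /=; congr (_, _); ring.
by apply: leb_pres_comp; apply: key; rewrite ?oner_neq0 // expr0n expr1n add0r.
Qed.

Lemma leb_pres_translate (v : pt) : leb_pres (fun z => addp z v).
Proof.
have -> : (fun z => addp z v) = xmap 1 0 v.1 \o ymap 1 0 v.2.
  by apply/funext => -[x y]; rewrite /addp /xmap /ymap /=; congr (_, _); ring.
by apply: leb_pres_comp; [exact: leb_pres_xmap|exact: leb_pres_ymap].
Qed.

(** Outer measure appears because gradient images are not known to be measurable. Pulling back a
    measurable cover gives one inequality; the other comes from the inverse map. *)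
Lemma mu_ext_preim T (E : set pt) : leb_pres T ->
  (mu_ext (@leb2 R) (T @^-1` E) <= mu_ext (@leb2 R) E)%E.
Proof.
move=> hT; apply/le_ereal_inf_tmp => x [F [mF EF] <-].
apply: ereal_inf_lbound; exists (fun i => T @^-1` F i).
  split=> [i|z Ez]; first by have [] := hT _ (mF i).
  by have [i _ Fi] := EF _ Ez; exists i.
by apply: eq_eseriesr => i _; have [_ ->] := hT _ (mF i).
Qed.

Lemma mu_ext_leb2 (E : set pt) : measurable E -> mu_ext (@leb2 R) E = leb2 E.
Proof. exact: (@measurable_mu_extE _ _ _ leb2m). Qed.

Lemma le_mu_ext_leb2 (E F : set pt) : E `<=` F -> (mu_ext (@leb2 R) E <= mu_ext (@leb2 R) F)%E.
Proof. by move=> EF; exact: le_mu_ext. Qed.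

Lemma leb2_rect (I J : interval R) :
  leb2 ([set` I] `*` [set` J]) = (leb [set` I] * leb [set` J])%E.
Proof. by rewrite /leb2 product_measure1E. Qed.

(** The measurable sets of the plane are generated by rectangles, so an open set is exhibited as the
    countable union of its rational rectangles. *)
Lemma open_measurable2 (S : set pt) : open S -> measurable S.
Proof.
move=> oS.
pose B (q : rat * rat * (rat * rat)) : set pt :=
  `]ratr q.1.1, ratr q.1.2[ `*` `]ratr q.2.1, ratr q.2.2[.
have mB q : measurable (B q) by apply: measurableX; exact: measurable_itv.
have -> : S = \bigcup_(q in [set q | B q `<=` S]) B q.
  apply/seteqP; split => [z Sz|z [q qS Bz]]; last exact: qS.
  move: oS; rewrite openE => /(_ _ Sz) /= [[U V] /= [[e1 /= e10 h1] [e2 /= e20 h2]] hUV].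
  have [q1 /[!in_itv] /= /andP[q1a q1b]] := @rat_in_itvoo R (z.1 - e1) z.1 ltac:(lra).
  have [q2 /[!in_itv] /= /andP[q2a q2b]] := @rat_in_itvoo R z.1 (z.1 + e1) ltac:(lra).
  have [q3 /[!in_itv] /= /andP[q3a q3b]] := @rat_in_itvoo R (z.2 - e2) z.2 ltac:(lra).
  have [q4 /[!in_itv] /= /andP[q4a q4b]] := @rat_in_itvoo R z.2 (z.2 + e2) ltac:(lra).
  exists ((q1, q2), (q3, q4)); last first.
    by split; rewrite /= in_itv /=; apply/andP.
  move=> w [/= /[!in_itv] /= /andP[w1 w2] /andP[w3 w4]]; apply: hUV; split.
    by apply: h1; rewrite /ball /= ltr_norml; lra.
  by apply: h2; rewrite /ball /= ltr_norml; lra.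
rewrite bigcup_mkcond; apply: countable_bigcupT_measurable => [|q]; first exact: countableP.
by case: ifP => _.
Qed.

Lemma leb2_open_gt0 (S : set pt) z : open S -> S z -> (0 < leb2 S)%E.
Proof.
move=> oS Sz; have mS := open_measurable2 oS.
move: oS; rewrite openE => /(_ _ Sz) /= [[U V] /= [[e1 /= e10 h1] [e2 /= e20 h2]] hUV].
have sub : [set` `]z.1 - e1, z.1 + e1[] `*` [set` `]z.2 - e2, z.2 + e2[] `<=` S.
  move=> w [/= /[!in_itv] /= /andP[w1 w2] /andP[w3 w4]]; apply: hUV; split.
    by apply: h1; rewrite /ball /= ltr_norml; lra.
  by apply: h2; rewrite /ball /= ltr_norml; lra.
apply: (@lt_le_trans _ _ (leb2 ([set` `]z.1 - e1, z.1 + e1[] `*` [set` `]z.2 - e2, z.2 + e2[]))).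
  rewrite leb2_rect !lebesgue_measure_itv /= !lte_fin !ifT; [|lra|lra].
  by rewrite -!EFinB -EFinM lte_fin mulr_gt0 //; lra.
apply: (@le_measure _ _ _ leb2m) => //; rewrite inE //.
by apply: measurableX; exact: measurable_itv.
Qed.

End Lebesgue2.

(** * Neighbourhoods, continuity and extrema in the plane, in epsilon form *)

Section Plane.
Variable R : realType.
Local Notation pt := (pt R).
Implicit Types (S : set pt) (f : pt -> R).

Definition near2 (d : R) (z w : pt) := `|w.1 - z.1| < d /\ `|w.2 - z.2| < d.

Definition contS S f := forall z, S z -> forall e, 0 < e ->
  exists2 d, 0 < d & forall w, S w -> near2 d z w -> `|f w - f z| <= e.

Lemma nbhs_near2 (z : pt) (A : set pt) :
  nbhs z A <-> exists2 d, 0 < d & forall w, near2 d z w -> A w.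
Proof.
split=> [[[U V] /= [[e1 /= e10 h1] [e2 /= e20 h2]] hUV]|[d d0 h]].
  exists (Num.min e1 e2); first by rewrite lt_min e10.
  move=> w [w1 w2]; apply: hUV; split => /=.
    by apply: h1; rewrite /ball /= distrC (lt_le_trans w1) // ge_min lexx.
  by apply: h2; rewrite /ball /= distrC (lt_le_trans w2) // ge_min lexx orbT.
exists (ball z.1 d, ball z.2 d); first by split; exact: nbhsx_ballx.
by move=> w [w1 w2]; apply: h; split; rewrite distrC.
Qed.

Lemma contSP S f : {within S, continuous f} <-> contS S f.
Proof.
split=> [/subspace_continuousP h z Sz e e0|h].
  have /cvgrPdist_le /(_ e e0) := h z Sz.
  rewrite /prop_near1 nbhs_filterE /within /= => /nbhs_near2[d d0 hd].
  by exists d => // w Sw wz; rewrite distrC; exact: hd.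
apply/subspace_continuousP => z Sz; apply/cvgrPdist_le => e e0.
have [d d0 hd] := h z Sz e e0.
rewrite /prop_near1 nbhs_filterE /within /=; apply/nbhs_near2; exists d => // w wz Sw.
by rewrite distrC; exact: hd.
Qed.

Lemma interior_near2 S (z : pt) :
  interior S z <-> exists2 d, 0 < d & forall w, near2 d z w -> S w.
Proof. exact: nbhs_near2. Qed.

Lemma closure_near2 S (z : pt) :
  closure S z <-> forall d, 0 < d -> exists2 w, S w & near2 d z w.
Proof.
split=> [h d d0|h B /nbhs_near2[d d0 hd]].
  have /h [w [Sw wz]] : nbhs z [set w | near2 d z w] by apply/nbhs_near2; exists d.
  by exists w.
by have [w Sw wz] := h d d0; exists w; split => //; exact: hd.
Qed.

Lemma near2_le d e z w : d <= e -> near2 d z w -> near2 e z w.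
Proof. by move=> de [h1 h2]; split; exact: lt_le_trans de. Qed.

Lemma near2_trans d e z w v : near2 d z w -> near2 e w v -> near2 (d + e) z v.
Proof.
move=> [h1 h2] [h3 h4]; split.
  by rewrite [d + e]addrC -(subrKA w.1) (le_lt_trans (ler_normD _ _)) // ltrD.
by rewrite [d + e]addrC -(subrKA w.2) (le_lt_trans (ler_normD _ _)) // ltrD.
Qed.

Lemma open_near2 S : (forall z, S z -> exists2 d, 0 < d & forall w, near2 d z w -> S w) -> open S.
Proof. by move=> h; rewrite openE => z Sz; apply/interior_near2; exact: h. Qed.

Lemma closed_near2 S : closed S <->
  forall z, (forall d, 0 < d -> exists2 w, S w & near2 d z w) -> S z.
Proof.
split=> [h z hz|h z hz]; first by apply: h; exact/closure_near2.
by apply: h; exact/closure_near2.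
Qed.

Lemma compact_box S M : closed S -> (forall z, S z -> `|z.1| <= M /\ `|z.2| <= M) -> compact S.
Proof.
move=> cS hM.
apply: (@subclosed_compact _ S ([set` `[- M, M]] `*` [set` `[- M, M]])) => //.
  by apply: compact_setX; exact: segment_compact.
by move=> z /hM [h1 h2]; split; rewrite /= in_itv /= -ler_norml.
Qed.

Lemma contS_max S f M : closed S -> (forall z, S z -> `|z.1| <= M /\ `|z.2| <= M) ->
  S !=set0 -> contS S f -> exists2 z, S z & forall w, S w -> f w <= f z.
Proof.
move=> cS hM S0 /contSP hf.
have [z /set_mem Sz hz] := compact_EVT_max S0 (compact_box cS hM) hf.
by exists z => // w Sw; apply: hz; exact/mem_set.
Qed.

Lemma contSN S f : contS S f -> contS S (fun z => - f z).
Proof.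
move=> h z Sz e e0; have [d d0 hd] := h z Sz e e0; exists d => // w Sw wz.
by rewrite -opprD normrN; exact: hd.
Qed.

Lemma contSD S f g : contS S f -> contS S g -> contS S (fun z => f z + g z).
Proof.
move=> hf hg z Sz e e0; have e2 : 0 < e / 2 by lra.
have [d d0 hd] := hf z Sz _ e2; have [d' d0' hd'] := hg z Sz _ e2.
exists (Num.min d d'); first by rewrite lt_min d0.
move=> w Sw wz.
have h1 : near2 d z w by apply: near2_le wz; rewrite ge_min lexx.
have h2 : near2 d' z w by apply: near2_le wz; rewrite ge_min lexx orbT.
rewrite opprD addrACA (le_trans (ler_normD _ _)) //.
have := hd _ Sw h1; have := hd' _ Sw h2; lra.
Qed.

Lemma contSB S f g : contS S f -> contS S g -> contS S (fun z => f z - g z).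
Proof. by move=> hf hg; apply: contSD => //; exact: contSN. Qed.

Lemma contS_sub S S' f : S' `<=` S -> contS S f -> contS S' f.
Proof.
move=> ss h z Sz e e0; have [d d0 hd] := h z (ss _ Sz) e e0; exists d => // w Sw wz.
exact: hd (ss _ Sw) wz.
Qed.

Lemma contS_min S f M : closed S -> (forall z, S z -> `|z.1| <= M /\ `|z.2| <= M) ->
  S !=set0 -> contS S f -> exists2 z, S z & forall w, S w -> f z <= f w.
Proof.
move=> cS hM S0 hf; have [z Sz hz] := contS_max cS hM S0 (contSN hf).
by exists z => // w Sw; have := hz w Sw; rewrite lerN2.
Qed.

End Plane.

(** * Viscosity harmonic functions on a half-disc *)

Section Bernstein.
Variable R : realType.
Local Notation pt := (pt R).

(* Bernstein polynomials, through the Pascal recursion of the binomial law. *)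
Fixpoint bern (n : nat) (g : nat -> R) : {poly R} :=
  if n is m.+1 then (1 - 'X) * bern m g + 'X * bern m (fun k => g k.+1) else (g 0%N)%:P.

Lemma bernS n g x :
  (bern n.+1 g).[x] = (1 - x) * (bern n g).[x] + x * (bern n (fun k => g k.+1)).[x].
Proof. by rewrite /= !(hornerD, hornerM, hornerN, hornerX, hornerC). Qed.

Lemma bern_le n g h x : 0 <= x <= 1 -> (forall k, (k <= n)%N -> g k <= h k) ->
  (bern n g).[x] <= (bern n h).[x].
Proof.
move=> /andP[x0 x1]; elim: n g h => [|n IH] g h gh; first by rewrite /= !hornerC gh.
rewrite !bernS lerD // ler_wpM2l ?subr_ge0 //; apply: IH => k kn; apply: gh => //.
exact: leqW.
Qed.

(** Mean [n x] and variance [n x (1 - x)] of the binomial law, with the shift [c] left free for the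
    induction. *)
Lemma bern_quad n a K c x : (bern n (fun k => a + K * (k%:R + c) ^+ 2)).[x] =
  a + K * ((n%:R * x + c) ^+ 2 + n%:R * (x * (1 - x))).
Proof.
elim: n c => [|n IH] c; first by rewrite /= hornerC; ring.
rewrite bernS IH.
have -> : (fun k : nat => a + K * (k.+1%:R + c) ^+ 2) = (fun k => a + K * (k%:R + (1 + c)) ^+ 2).
  by apply/funext => k; rewrite -natr1 addrA.
rewrite IH -natr1; ring.
Qed.

Definition cont1 (a b : R) (g : R -> R) := forall x, a <= x <= b -> forall e, 0 < e ->
  exists2 d, 0 < d & forall y, a <= y <= b -> `|y - x| < d -> `|g y - g x| <= e.

Lemma square_closed (a b : R) : closed [set z : pt | a <= z.1 <= b /\ a <= z.2 <= b].
Proof.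
have key (u : R) : (forall d, 0 < d -> exists2 w, a <= w <= b & `|w - u| < d) -> a <= u <= b.
  move=> h; apply/andP; split; rewrite leNgt; apply/negP => hu.
    have [w /andP[w1 w2]] := h (a - u) ltac:(lra).
    by rewrite ltr_norml => /andP[]; lra.
  have [w /andP[w1 w2]] := h (u - b) ltac:(lra).
  by rewrite ltr_norml => /andP[]; lra.
apply/closed_near2 => z h; split; apply: key => d d0; have [w [w1 w2] [w3 w4]] := h d d0.
  by exists w.1.
by exists w.2.
Qed.

(** Uniform continuity in the form that Bernstein polynomials can use, since [bern_quad] evaluates
    them on parabolas. On the compact set of pairs with [|g x - g y| >= e] the distance has a
    positive minimum, so a steep parabola covers the oscillation there. *)
Lemma cont1_quad_modulus (a b : R) g e : a <= b -> cont1 a b g -> 0 < e ->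
  exists K, 0 <= K /\ forall x y, a <= x <= b -> a <= y <= b ->
    `|g x - g y| <= e + K * (x - y) ^+ 2.
Proof.
move=> ab hg e0; set Q := [set z : pt | a <= z.1 <= b /\ a <= z.2 <= b].
pose f (z : pt) := `|g z.1 - g z.2|.
have bQ (z : pt) : Q z -> `|z.1| <= `|a| + `|b| /\ `|z.2| <= `|a| + `|b|.
  have key (u : R) : a <= u <= b -> `|u| <= `|a| + `|b|.
    move=> /andP[au ub]; rewrite ler_norml; apply/andP; split.
      rewrite lerNl (le_trans (_ : - u <= - a)) ?lerN2 // (le_trans (ler_norm _)) // normrN lerDl //.
    by rewrite (le_trans ub) // (le_trans (ler_norm _)) // lerDr.
  by move=> [h1 h2]; split; exact: key.
have cf : contS Q f.
  move=> z [z1 z2] d d0; have d2 : 0 < d / 2 by lra.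
  have [d1 d10 h1] := hg _ z1 _ d2; have [d3 d30 h3] := hg _ z2 _ d2.
  exists (Num.min d1 d3); first by rewrite lt_min d10.
  move=> w [w1 w2] [n1 n2]; rewrite /f.
  have a1 : `|g w.1 - g z.1| <= d / 2 by apply: h1 => //; rewrite (lt_le_trans n1) // ge_min lexx.
  have a2 : `|g w.2 - g z.2| <= d / 2.
    by apply: h3 => //; rewrite (lt_le_trans n2) // ge_min lexx orbT.
  rewrite (le_trans (ler_dist_dist _ _)) //.
  have -> : g w.1 - g w.2 - (g z.1 - g z.2) = (g w.1 - g z.1) - (g w.2 - g z.2) by ring.
  rewrite (le_trans (ler_normB _ _)) //; lra.
have Q0 : Q !=set0 by exists (a, a); split; rewrite lexx ab.
have [zm Qm hm] := contS_max (@square_closed a b) bQ Q0 cf.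
pose S := [set z | Q z /\ e <= f z].
have cS : closed S.
  apply/closed_near2 => z h.
  have Qz : Q z.
    apply: ((closed_near2 Q).1 (@square_closed a b)) => d d0.
    by have [w [Qw _] wz] := h d d0; exists w.
  split => //; rewrite leNgt; apply/negP => fe.
  have [d d0 hd] := cf z Qz ((e - f z) / 2) ltac:(lra).
  have [w [Qw we] wz] := h d d0; have := hd w Qw wz.
  by rewrite ler_norml => /andP[]; lra.
have M0 : 0 <= f zm by exact: normr_ge0.
have [S0|S0] := pselect (S !=set0); last first.
  exists 0; split => // x y hx hy; rewrite mul0r addr0 leNgt.
  by apply/negP => h; apply: S0; exists (x, y); split => //; exact: ltW.
have cd : contS S (fun z : pt => `|z.1 - z.2|).
  move=> z _ d d0; exists (d / 2); first lra.
  move=> w _ [n1 n2]; rewrite (le_trans (ler_dist_dist _ _)) //.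
  have -> : w.1 - w.2 - (z.1 - z.2) = (w.1 - z.1) - (w.2 - z.2) by ring.
  rewrite (le_trans (ler_normB _ _)) //; lra.
have [z0 [Qz0 ez0] hz0] := contS_min cS (fun z Sz => bQ z Sz.1) S0 cd.
have t0 : 0 < `|z0.1 - z0.2|.
  rewrite normr_gt0 subr_eq0; apply/eqP => E; move: ez0.
  by rewrite /f E subrr normr0 leNgt e0.
exists (f zm / `|z0.1 - z0.2| ^+ 2); split; first by rewrite divr_ge0 // sqr_ge0.
move=> x y hx hy; have [h|h] := leP `|g x - g y| e.
  by rewrite (le_trans h) // lerDl mulr_ge0 ?sqr_ge0 // divr_ge0 // sqr_ge0.
have Sxy : S (x, y) by split => //; exact: ltW.
have := hz0 _ Sxy => /= h2.
rewrite (le_trans (hm (x, y) Sxy.1)) // -[leLHS]add0r lerD ?(ltW e0) //.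
rewrite mulrAC ler_pdivlMr ?exprn_gt0 // ler_wpM2l //.
by rewrite -(real_normK (num_real (x - y))) lerXn2r ?nnegrE.
Qed.

Lemma weierstrass (a b : R) g e : a < b -> cont1 a b g -> 0 < e ->
  exists P : {poly R}, forall x, a <= x <= b -> `|g x - P.[x]| <= e.
Proof.
move=> ab hg e0; have e2 : 0 < e / 2 by lra.
have [K [K0 hK]] := cont1_quad_modulus (ltW ab) hg e2.
pose L := K * (b - a) ^+ 2.
have L0 : 0 <= L by rewrite mulr_ge0 // sqr_ge0.
(* The variance contributes at most [L / n]; this degree makes it at most [e / 2]. *)
pose n := (Num.bound (L / (e / 2))).+1.
have n0 : 0 < n%:R :> R by rewrite ltr0n.
have hn : L / n%:R <= e / 2.
  rewrite ler_pdivrMr // mulrC -ler_pdivrMr //.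
  rewrite (le_trans (ltW (archi_boundP _))) ?ler_nat //; first by rewrite divr_ge0 // ltW.
pose B := bern n (fun k => g (a + (b - a) * (k%:R / n%:R))).
have ba : 0 < b - a by lra.
exists (B \Po ((b - a)^-1 *: ('X - a%:P))) => x xab.
rewrite horner_comp hornerZ hornerXsubC.
set t := (b - a)^-1 * (x - a).
have xt : x = a + (b - a) * t by rewrite /t mulVKf ?gt_eqF //; ring.
have t01 : 0 <= t <= 1.
  move: xab; rewrite xt => /andP[h1 h2]; apply/andP; split.
    by rewrite -(pmulr_rge0 t ba); lra.
  by rewrite -(ler_pM2l ba); lra.
have pt k : (k <= n)%N -> a <= a + (b - a) * (k%:R / n%:R) <= b.
  move=> kn; have k0 : 0 <= k%:R / n%:R :> R by rewrite divr_ge0.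
  have k1 : k%:R / n%:R <= 1 :> R by rewrite ler_pdivrMr // mul1r ler_nat.
  by apply/andP; split; nra.
have quad s : (bern n (fun k => (g x + s * (e / 2)) + (s * (K * (b - a) ^+ 2 / n%:R ^+ 2)) * (k%:R + - (n%:R * t)) ^+ 2)).[t]
    = g x + s * (e / 2) + s * (L / n%:R * (t * (1 - t))).
  by rewrite bern_quad addrC /L; field; rewrite gt_eqF.
have dev k : (k <= n)%N -> `|g x - g (a + (b - a) * (k%:R / n%:R))| <=
    e / 2 + K * (b - a) ^+ 2 / n%:R ^+ 2 * (k%:R + - (n%:R * t)) ^+ 2.
  move=> kn; apply: (le_trans (hK _ _ xab (pt k kn))).
  rewrite lerD2l [x in (x - _)]xt.
  have -> : a + (b - a) * t - (a + (b - a) * (k%:R / n%:R)) = (b - a) * (n%:R * t - k%:R) / n%:R.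
    by field; rewrite gt_eqF.
  rewrite le_eqVlt; apply/orP; left; apply/eqP; field; rewrite gt_eqF //.
have tt : t * (1 - t) <= 1 by move: t01 => /andP[]; nra.
have tt0 : 0 <= t * (1 - t) by move: t01 => /andP[]; nra.
have Ln0 : 0 <= L / n%:R by rewrite divr_ge0 // ltW.
have bnd : L / n%:R * (t * (1 - t)) <= e / 2.
  by rewrite (le_trans _ hn) // ler_piMr.
have up : B.[t] <= g x + e.
  apply: (@le_trans _ _ (g x + 1 * (e / 2) + 1 * (L / n%:R * (t * (1 - t))))); last lra.
  rewrite -quad; apply: bern_le => // k kn.
  by have := dev k kn; rewrite ler_norml mul1r => /andP[]; lra.
have lo : g x - e <= B.[t].
  apply: (@le_trans _ _ (g x + (-1) * (e / 2) + (-1) * (L / n%:R * (t * (1 - t))))); first lra.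
  rewrite -quad; apply: bern_le => // k kn.
  by have := dev k kn; rewrite ler_norml mulN1r => /andP[]; lra.
by rewrite ler_norml; lra.
Qed.

End Bernstein.

(** * Harmonic polynomials and their values on circles *)

Section Harmonic.
Variable R : realType.
Implicit Types (P Q : {poly R}) (p y r c s h k : R).

(* Real and imaginary parts of [(p + i y)^n]. *)
Fixpoint cpw p y (n : nat) : R * R :=
  if n is m.+1 then (p * (cpw p y m).1 - y * (cpw p y m).2, p * (cpw p y m).2 + y * (cpw p y m).1)
  else (1, 0).

(* Imaginary part of [P (p + i y)]. *)
Definition imP P p y : R := \sum_(i < size P) P`_i * (cpw p y i).2.

Lemma imPE P p y n : (size P <= n)%N -> imP P p y = \sum_(i < n) P`_i * (cpw p y i).2.
Proof.
move=> pn; rewrite /imP (big_ord_widen _ (fun i => P`_i * (cpw p y i).2) pn).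
rewrite big_mkcond; apply: eq_bigr => i _; case: ltnP => // h.
by rewrite nth_default // mul0r.
Qed.

Lemma imPD P Q p y : imP (P + Q) p y = imP P p y + imP Q p y.
Proof.
set n := maxn (size P) (size Q).
rewrite (@imPE (P + Q) p y n) ?size_polyD // (@imPE P p y n) ?leq_maxl //.
rewrite (@imPE Q p y n) ?leq_maxr // -big_split /=.
by apply: eq_bigr => i _; rewrite coefD mulrDl.
Qed.

Lemma imPZ a P p y : imP (a *: P) p y = a * imP P p y.
Proof.
rewrite (@imPE _ p y (size P)) ?size_scale_leq // /imP mulr_sumr.
by apply: eq_bigr => i _; rewrite coefZ mulrA.
Qed.

Lemma imP0 p y : imP 0 p y = 0.
Proof. by rewrite /imP size_poly0 big_ord0. Qed.

Lemma imPXn n p y : imP 'X^n p y = (cpw p y n).2.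
Proof.
rewrite /imP size_polyXn big_ord_recr /= coefXn eqxx mul1r big1 ?add0r // => i _.
by rewrite coefXn ltn_eqF ?mul0r.
Qed.

Lemma imPB P Q p y : imP (P - Q) p y = imP P p y - imP Q p y.
Proof. by rewrite -scaleN1r imPD imPZ mulN1r. Qed.

Lemma imP_ind (F : {poly R} -> Prop) :
  F 0 -> (forall P a n, F P -> F (P + a *: 'X^n)) -> forall P, F P.
Proof.
move=> F0 FS P; rewrite -[P]coefK poly_def.
by elim: (size P) => [|n IH]; [rewrite big_ord0|rewrite big_ord_recr; exact: FS].
Qed.

Lemma cpw_norm p y n : (cpw p y n).1 ^+ 2 + (cpw p y n).2 ^+ 2 = (p ^+ 2 + y ^+ 2) ^+ n.
Proof.
elim: n => [|n IH] /=; first by rewrite expr0; ring.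
by rewrite [RHS]exprS -IH; ring.
Qed.

Lemma cpw_le p y r n : 0 <= r -> p ^+ 2 + y ^+ 2 <= r ^+ 2 ->
  `|(cpw p y n).1| <= r ^+ n /\ `|(cpw p y n).2| <= r ^+ n.
Proof.
move=> r0 h.
have h2 : (p ^+ 2 + y ^+ 2) ^+ n <= (r ^+ n) ^+ 2.
  by rewrite -exprM mulnC exprM lerXn2r // nnegrE ?sqr_ge0 // addr_ge0 ?sqr_ge0.
have := cpw_norm p y n => E.
split; rewrite -ler_sqr ?nnegrE ?exprn_ge0 // real_normK ?num_real //.
  by rewrite (le_trans _ h2) // -E lerDl sqr_ge0.
by rewrite (le_trans _ h2) // -E lerDr sqr_ge0.
Qed.

Lemma cpw_y0 p n : (cpw p 0 n).2 = 0.
Proof. by elim: n => [|n IH] //=; rewrite IH mul0r mulr0 addr0. Qed.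

Lemma imP_y0 P p : imP P p 0 = 0.
Proof. by rewrite /imP big1 // => i _; rewrite cpw_y0 mulr0. Qed.

(** The factor [|y|] is kept explicit: after division by [y], bounds on [Im P] near the axis become
    bounds on the slope at [y = 0]. *)
Lemma cpw_im_le p y r n : 0 <= r -> p ^+ 2 + y ^+ 2 <= r ^+ 2 ->
  `|(cpw p y n).2| <= `|y| * (n%:R * r ^+ n.-1).
Proof.
move=> r0 h; have hp : `|p| <= r.
  rewrite -ler_sqr ?nnegrE // real_normK ?num_real //.
  by rewrite (le_trans _ h) // lerDl sqr_ge0.
elim: n => [|n IH]; first by rewrite /= normr0 mul0r mulr0.
rewrite /= (le_trans (ler_normD _ _)) // !normrM.
have [h1 _] := cpw_le n r0 h.
have -> : `|y| * (n.+1%:R * r ^+ n) = r * (`|y| * (n%:R * r ^+ n.-1)) + `|y| * r ^+ n.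
  by case: n {IH h1} => [|n]; rewrite /= ?expr0 ?mul0r; [ring|rewrite -!natr1 exprS; ring].
by rewrite lerD // ?ler_wpM2l // ler_pM.
Qed.

Lemma imP_le_pnorm P p y r s : 0 <= r -> r < s -> p ^+ 2 + y ^+ 2 <= r ^+ 2 ->
  `|imP P p y| * (s - r) <= `|y| * pnorm s P.
Proof.
move=> r0 rs h; have sr : 0 <= s - r by rewrite subr_ge0 ltW.
apply: (@le_trans _ _ ((\sum_(i < size P) `|P`_i| * (`|y| * (i%:R * r ^+ i.-1))) * (s - r))).
  rewrite ler_wpM2r // (le_trans (ler_norm_sum _ _ _)) //.
  by apply: ler_sum => i _; rewrite normrM ler_wpM2l // cpw_im_le.
rewrite mulr_suml /pnorm mulr_sumr; apply: ler_sum => i _.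
have -> : `|P`_i| * (`|y| * (i%:R * r ^+ i.-1)) * (s - r) =
  `|y| * (`|P`_i| * (i%:R * r ^+ i.-1 * (s - r))) by ring.
by rewrite ler_wpM2l // ler_wpM2l // expr_diff_le.
Qed.

Lemma cpw_deriv p r n : `|p| <= r -> exists M, forall y, `|y| <= r ->
  `|(cpw p y n).1 - p ^+ n| <= M * `|y| /\
  `|(cpw p y n).2 - y * (n%:R * p ^+ n.-1)| <= M * `|y| ^+ 2.
Proof.
move=> hp; have r0 : 0 <= r by exact: le_trans hp.
elim: n => [|n [M IH]].
  by exists 0 => y _; rewrite /= expr0 !mul0r mulr0 !subrr normr0.
have r2 : 0 <= r + r by lra.
exists (r * `|M| + (r + r) ^+ n + `|M|) => y hy.
have [h1 h2] := IH y hy.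
have hpy : p ^+ 2 + y ^+ 2 <= (r + r) ^+ 2.
  move: hp hy; rewrite !ler_norml => /andP[? ?] /andP[? ?]; nra.
have [_ hb] := cpw_le n r2 hpy.
have M1 : M * `|y| <= `|M| * `|y| by rewrite ler_wpM2r // ler_norm.
have M2 : M * `|y| ^+ 2 <= `|M| * `|y| ^+ 2 by rewrite ler_wpM2r ?sqr_ge0 // ler_norm.
have q0 : 0 <= (r + r) ^+ n by rewrite exprn_ge0.
have m0 : 0 <= `|M| * `|y| by rewrite mulr_ge0.
split => /=.
  have -> : p * (cpw p y n).1 - y * (cpw p y n).2 - p ^+ n.+1 =
    p * ((cpw p y n).1 - p ^+ n) - y * (cpw p y n).2 by rewrite exprS; ring.
  rewrite (le_trans (ler_normB _ _)) // !normrM.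
  apply: (@le_trans _ _ (r * (`|M| * `|y|) + `|y| * (r + r) ^+ n)).
    by rewrite lerD // ?ler_wpM2l // ler_pM // (le_trans h1).
  have -> : (r * `|M| + (r + r) ^+ n + `|M|) * `|y| =
     r * (`|M| * `|y|) + `|y| * (r + r) ^+ n + `|M| * `|y| by ring.
  by rewrite lerDl.
have -> : p * (cpw p y n).2 + y * (cpw p y n).1 - y * (n.+1%:R * p ^+ n) =
    p * ((cpw p y n).2 - y * (n%:R * p ^+ n.-1)) + y * ((cpw p y n).1 - p ^+ n).
  by case: n {IH h1 h2 hb q0} => [|n]; rewrite /= ?expr0 ?mul0r; [ring|rewrite -!natr1 exprS; ring].
rewrite (le_trans (ler_normD _ _)) // !normrM.
apply: (@le_trans _ _ (r * (`|M| * `|y| ^+ 2) + `|y| * (`|M| * `|y|))).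
  rewrite lerD // ?ler_wpM2l // ?(le_trans h1) //.
  by rewrite ler_pM // (le_trans h2).
have -> : (r * `|M| + (r + r) ^+ n + `|M|) * `|y| ^+ 2 =
   r * (`|M| * `|y| ^+ 2) + `|y| * (`|M| * `|y|) + (r + r) ^+ n * `|y| ^+ 2 by ring.
by rewrite lerDl mulr_ge0 // sqr_ge0.
Qed.

(** By the Cauchy-Riemann equations the normal slope of [Im P] on the real axis is [P']; this is how
    the slope function [H] becomes a limit of derivatives of polynomials. *)
Lemma imP_deriv P p r : `|p| <= r -> exists M, forall y, `|y| <= r ->
  `|imP P p y - y * P^`().[p]| <= M * `|y| ^+ 2.
Proof.
move=> hp; elim/imP_ind: P => [|P a n [M IH]].
  by exists 0 => y _; rewrite imP0 deriv0 horner0 mulr0 subrr normr0 mul0r.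
have [M' h'] := cpw_deriv n hp.
exists (M + `|a| * M') => y hy; rewrite imPD imPZ imPXn derivD derivZ derivXn.
rewrite hornerD hornerZ hornerMn hornerXn.
have -> : imP P p y + a * (cpw p y n).2 - y * (P^`().[p] + a * (p ^+ n.-1 *+ n)) =
  (imP P p y - y * P^`().[p]) + a * ((cpw p y n).2 - y * (n%:R * p ^+ n.-1)).
  by rewrite -mulr_natl; ring.
rewrite (le_trans (ler_normD _ _)) // [leRHS]mulrDl lerD ?IH // normrM -[leRHS]mulrA ler_wpM2l //.
by have [] := h' y hy.
Qed.

(* The quadratic part of the expansion is harmonic. *)
Lemma cpw_taylor p y n : exists a1 a2 b1 b2 g1 g2 M : R, forall h k, `|h| <= 1 -> `|k| <= 1 ->
  `|(cpw (p + h) (y + k) n).1 -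
     (a1 + (b1 * h - b2 * k) + (g1 * (h ^+ 2 - k ^+ 2) - g2 * (2 * h * k)))|
     <= M * (`|h| + `|k|) ^+ 3 /\
  `|(cpw (p + h) (y + k) n).2 -
     (a2 + (b2 * h + b1 * k) + (g2 * (h ^+ 2 - k ^+ 2) + g1 * (2 * h * k)))|
     <= M * (`|h| + `|k|) ^+ 3.
Proof.
elim: n => [|n [a1 [a2 [b1 [b2 [g1 [g2 [M IH]]]]]]]].
  exists 1, 0, 0, 0, 0, 0, 0 => h k _ _ /=; rewrite !mul0r; split;
  by rewrite [X in `|X|](_ : _ = 0) ?normr0 //; ring.
exists (p * a1 - y * a2), (p * a2 + y * a1), (p * b1 - y * b2 + a1), (p * b2 + y * b1 + a2).
exists (p * g1 - y * g2 + b1), (p * g2 + y * g1 + b2).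
exists ((`|p| + `|y| + 2) * `|M| + (`|g1| + `|g2|)) => h k h1 k1.
have [e1 e2] := IH h k h1 k1.
set u := (cpw _ _ n).1 in e1 *; set v := (cpw _ _ n).2 in e2 *.
set U := a1 + _ + _ in e1; set V := a2 + _ + _ in e2.
set s := (`|h| + `|k|) ^+ 3 in e1 e2 *.
have s0 : 0 <= s by rewrite exprn_ge0 // addr_ge0.
have Ms : M * s <= `|M| * s by rewrite ler_wpM2r // ler_norm.
have c1 : `|h ^+ 3 - 3 * h * k ^+ 2| <= s.
  rewrite (le_trans (ler_normB _ _)) // (normrX 3) 2!normrM (normrX 2) (ger0_norm (ler0n _ 3)) /s.
  have := normr_ge0 h; have := normr_ge0 k; set a := `|h|; set b := `|k| => b0 a0.
  have -> : (a + b) ^+ 3 = (a ^+ 3 + 3 * a * b ^+ 2) + (3 * (a ^+ 2 * b) + b ^+ 3) by ring.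
  by rewrite lerDl addr_ge0 ?exprn_ge0 // !mulr_ge0 ?exprn_ge0.
have c2 : `|3 * h ^+ 2 * k - k ^+ 3| <= s.
  rewrite (le_trans (ler_normB _ _)) // (normrX 3 k) 2!normrM (normrX 2) (ger0_norm (ler0n _ 3)) /s.
  have := normr_ge0 h; have := normr_ge0 k; set a := `|h|; set b := `|k| => b0 a0.
  have -> : (a + b) ^+ 3 = (3 * a ^+ 2 * b + b ^+ 3) + (3 * (a * b ^+ 2) + a ^+ 3) by ring.
  by rewrite lerDl addr_ge0 ?exprn_ge0 // !mulr_ge0 ?exprn_ge0.
have ph : `|p + h| <= `|p| + 1 by rewrite (le_trans (ler_normD _ _)) // lerD2l.
have yk : `|y + k| <= `|y| + 1 by rewrite (le_trans (ler_normD _ _)) // lerD2l.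
have big (a b c d : R) : `|a| <= `|M| * s -> `|b| <= `|M| * s -> `|c| <= s -> `|d| <= s ->
    `|(p + h) * a| + `|(y + k) * b| + (`|g1 * c| + `|g2 * d|) <=
    ((`|p| + `|y| + 2) * `|M| + (`|g1| + `|g2|)) * s.
  move=> ha hb hc hd; rewrite !normrM.
  have -> : ((`|p| + `|y| + 2) * `|M| + (`|g1| + `|g2|)) * s =
    (`|p| + 1) * (`|M| * s) + (`|y| + 1) * (`|M| * s) + (`|g1| * s + `|g2| * s) by ring.
  by rewrite !lerD // ler_pM.
have e1' : `|u - U| <= `|M| * s by exact: le_trans Ms.
have e2' : `|v - V| <= `|M| * s by exact: le_trans Ms.
split => /=.
  rewrite -/u -/v.
  rewrite [X in `|X|](_ : _ = ((p + h) * (u - U) - (y + k) * (v - V)) +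
     (g1 * (h ^+ 3 - 3 * h * k ^+ 2) - g2 * (3 * h ^+ 2 * k - k ^+ 3))); last first.
    by rewrite /U /V; ring.
  apply: le_trans (big _ _ _ _ e1' e2' c1 c2).
  by rewrite (le_trans (ler_normD _ _)) // lerD // ler_normB.
rewrite -/u -/v.
rewrite [X in `|X|](_ : _ = ((p + h) * (v - V) + (y + k) * (u - U)) +
   (g1 * (3 * h ^+ 2 * k - k ^+ 3) + g2 * (h ^+ 3 - 3 * h * k ^+ 2))); last first.
  by rewrite /U /V; ring.
apply: le_trans (big _ _ _ _ e2' e1' c2 c1).
by rewrite (le_trans (ler_normD _ _)) // lerD // ler_normD.
Qed.

Lemma imP_taylor P p y : exists a b g d M : R, forall h k, `|h| <= 1 -> `|k| <= 1 ->
  `|imP P (p + h) (y + k) - (imP P p y + a * h + b * k + g * (h ^+ 2 - k ^+ 2) + d * (h * k))|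
     <= M * (`|h| + `|k|) ^+ 3.
Proof.
suff [a0 [a [b [g [d [M H]]]]]] : exists a0 a b g d M : R, forall h k, `|h| <= 1 -> `|k| <= 1 ->
  `|imP P (p + h) (y + k) - (a0 + a * h + b * k + g * (h ^+ 2 - k ^+ 2) + d * (h * k))|
     <= M * (`|h| + `|k|) ^+ 3.
  have E : imP P p y = a0.
    have := H 0 0; rewrite normr0 ler01 !addr0 => /(_ isT isT).
    rewrite [X in _ - X](_ : _ = a0); last by ring.
    by rewrite expr0n mulr0 normr_le0 subr_eq0 => /eqP.
  by exists a, b, g, d, M; rewrite E.
elim/imP_ind: P => [|P c n [a0 [a [b [g [d [M IH]]]]]]].
  exists 0, 0, 0, 0, 0, 0 => h k _ _; rewrite imP0 !mul0r !addr0 subrr normr0 //.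
have [a1 [a2 [b1 [b2 [g1 [g2 [M' H]]]]]]] := cpw_taylor p y n.
exists (a0 + c * a2), (a + c * b2), (b + c * b1), (g + c * g2), (d + c * (2 * g1)), (M + `|c| * M').
move=> h k h1 k1; rewrite imPD imPZ imPXn.
have [_ e2] := H h k h1 k1; have e1 := IH h k h1 k1.
rewrite [X in `|X|](_ : _ = (imP P (p + h) (y + k) -
   (a0 + a * h + b * k + g * (h ^+ 2 - k ^+ 2) + d * (h * k))) +
   c * ((cpw (p + h) (y + k) n).2 -
     (a2 + (b2 * h + b1 * k) + (g2 * (h ^+ 2 - k ^+ 2) + g1 * (2 * h * k))))); last by ring.
rewrite (le_trans (ler_normD _ _)) // [leRHS]mulrDl lerD // normrM -[leRHS]mulrA ler_wpM2l //.
Qed.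

(** The Dirichlet problem on a circle, solved by algebra: for [|z| = r] the real part satisfies
    [2 c = z + r^2 / z], so [c] times [Im z^n] is half of the imaginary part of
    [z^(n+1) + r^2 z^(n-1)]. Induction on [B], starting from [s = Im z], produces [P]. *)
Lemma circle_poly r B : exists P, forall c s, c ^+ 2 + s ^+ 2 = r ^+ 2 ->
  s * B.[c] = imP P c s.
Proof.
pose Q (n : nat) : {poly R} := if n is m.+1 then 2^-1 *: ('X^(m.+2) + r ^+ 2 *: 'X^m) else 0.
have hQ n c s : c ^+ 2 + s ^+ 2 = r ^+ 2 -> c * (cpw c s n).2 = imP (Q n) c s.
  move=> E; case: n => [|n]; first by rewrite imP0 /= mulr0.
  by rewrite /Q imPZ imPD imPZ !imPXn -E /=; field.
elim/poly_ind: B => [|B a [P IH]].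
  by exists 0 => c s _; rewrite imP0 horner0 mulr0.
suff [P' h'] : exists P', forall c s, c ^+ 2 + s ^+ 2 = r ^+ 2 -> c * imP P c s = imP P' c s.
  exists (P' + a *: 'X^1) => c s E; rewrite imPD imPZ imPXn -h' // -IH //=.
  by rewrite hornerD hornerMX hornerC; ring.
elim/imP_ind: P {IH} => [|P b n [P' h']].
  by exists 0 => c s _; rewrite imP0 mulr0.
exists (P' + b *: Q n) => c s E; rewrite !imPD !imPZ imPXn -h' // -hQ //; ring.
Qed.

Lemma cpw_polar r t n : cpw (r * cos t) (r * sin t) n = (r ^+ n * cos (n%:R * t), r ^+ n * sin (n%:R * t)).
Proof.
elim: n => [|n IH]; first by rewrite /= mul0r cos0 sin0 expr0 mulr1 mulr0.
by rewrite /= IH /= exprS -natr1 mulrDl mul1r cosD sinD; congr (_, _); ring.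
Qed.

(** Multiplying by [2 sin (x / 2)] makes the sum telescope; the bounds on [k] make this factor
    positive. *)
Lemma sum_cos_roots (M k : nat) : (0 < k < M)%N ->
  \sum_(j < M) cos (k%:R * (j%:R * (2 * pi / M%:R))) = 0 :> R.
Proof.
move=> /andP[k0 kM]; have M0 : 0 < M%:R :> R by rewrite ltr0n (leq_trans _ kM).
pose x : R := k%:R * (2 * pi / M%:R).
have sx : 0 < sin (x / 2) :> R.
  have -> : x / 2 = pi * (k%:R / M%:R) by rewrite /x; field; rewrite gt_eqF.
  have kM1 : k%:R / M%:R < 1 :> R by rewrite ltr_pdivrMr // mul1r ltr_nat.
  have kM0 : 0 < k%:R / M%:R :> R by rewrite divr_gt0 // ltr0n.
  have := pi_gt0 R => p0; apply: sin_gt0_pi; rewrite mulr_gt0 //=.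
  by rewrite gtr_pMr.
have tel n : 2 * sin (x / 2) * (\sum_(j < n) cos (k%:R * (j%:R * (2 * pi / M%:R)))) =
   sin (n%:R * x - x / 2) + sin (x / 2).
  elim: n => [|n IH]; first by rewrite big_ord0 mulr0 mul0r sub0r sinN addNr.
  rewrite big_ord_recr /= mulrDr IH.
  have -> : k%:R * (n%:R * (2 * pi / M%:R)) = n%:R * x by rewrite /x; ring.
  have -> : n.+1%:R * x - x / 2 = n%:R * x + x / 2 by rewrite -natr1; field.
  by rewrite !sinD sinN cosN; ring.
apply: (mulfI (_ : 2 * sin (x / 2) != 0)); first by rewrite mulf_neq0 // gt_eqF.
rewrite tel mulr0.
have -> : M%:R * x - x / 2 = - (x / 2) + pi *+ 2 *+ k.
  rewrite /x -(mulr_natr (pi *+ 2)) -(mulr_natr pi 2); move: (@pi R) (k%:R : R) (M%:R : R) M0 => q u v v0.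
  by field; rewrite gt_eqF.
by rewrite (periodicn (@sinD2pi R)) sinN addNr.
Qed.

End Harmonic.

(** * Fourier coefficients and the comparison principle on a half-disc *)

Section HalfDisc.
Variable R : realType.
Local Notation pt := (pt R).
Implicit Types (P Q : {poly R}) (r : R) (f : R -> R -> R).

Lemma sqrD_le (x y : R) : (x + y) ^+ 2 <= 2 * (x ^+ 2 + y ^+ 2).
Proof. by have := sqr_ge0 (x - y); nra. Qed.

Lemma cpw_conj (p y : R) n : cpw p (- y) n = ((cpw p y n).1, - (cpw p y n).2).
Proof. by elim: n => [|n IH] /=; [rewrite oppr0|rewrite IH /=; congr (_, _); ring]. Qed.

Lemma imP_odd P p y : imP P p (- y) = - imP P p y.
Proof. by rewrite /imP -sumrN; apply: eq_bigr => i _; rewrite cpw_conj mulrN. Qed.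

Lemma sin_orthogonal (M m i : nat) : (0 < m)%N -> (m + i < M)%N ->
  \sum_(j < M) sin (m%:R * (j%:R * (2 * pi / M%:R))) * sin (i%:R * (j%:R * (2 * pi / M%:R)))
  = (if i == m then M%:R / 2 else 0) :> R.
Proof.
move=> m0 miM; pose x (j : nat) : R := j%:R * (2 * pi / M%:R).
have prod (a b : R) : sin a * sin b = 2^-1 * (cos (a - b) - cos (a + b)).
  by rewrite cosB cosD; field.
have key : \sum_(j < M) sin (m%:R * x j) * sin (i%:R * x j) =
   2^-1 * (\sum_(j < M) cos ((`|(m%:Z - i%:Z)%R|%N)%:R * x j) - \sum_(j < M) cos ((m + i)%:R * x j)).
  rewrite -sumrB mulr_sumr; apply: eq_bigr => j _; rewrite prod -mulrBl -mulrDl -natrD.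
  congr (_ * (_ - _)); have [h|h] := leqP i m.
    by rewrite distnEl // natrB.
  by rewrite distnEr ?(ltnW h) // natrB ?(ltnW h) // -cosN -mulNr opprB.
rewrite /x in key; rewrite key (@sum_cos_roots _ _ (m + i)); last by rewrite miM addn_gt0 m0.
rewrite subr0; case: eqP => [->|/eqP im].
  rewrite distnn; under eq_bigr do rewrite mul0r cos0.
  by rewrite sumr_const card_ord mulrC.
rewrite sum_cos_roots ?mulr0 //; apply/andP; split.
  by rewrite lt0n distn_eq0 eq_sym.
apply: leq_ltn_trans miM; have [h|h] := leqP i m.
  by rewrite distnEl // (leq_trans (leq_subr _ _)) // leq_addr.
by rewrite distnEr ?(ltnW h) // (leq_trans (leq_subr _ _)) // leq_addl.
Qed.

(** A finite Fourier sum replaces the integral over the circle. [Im P] is odd in [y], so the bound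
    on the upper half-circle holds on the whole circle. *)
Lemma fourier_coef P r E m : 0 <= r ->
  (forall c s, c ^+ 2 + s ^+ 2 = r ^+ 2 -> 0 <= s -> `|imP P c s| <= E) ->
  (0 < m)%N -> `|P`_m| * r ^+ m <= 2 * E.
Proof.
move=> r0 hE m0.
have E0 : 0 <= E by rewrite (le_trans _ (hE r 0 _ _)) // ?expr0n ?addr0.
have [mP|mP] := leqP (size P) m.
  by rewrite nth_default // normr0 mul0r mulr_ge0.
have hE' c s : c ^+ 2 + s ^+ 2 = r ^+ 2 -> `|imP P c s| <= E.
  move=> h; have [s0|s0] := leP 0 s; first exact: hE.
  rewrite -normrN -imP_odd; apply: hE; last by rewrite oppr_ge0 ltW.
  by rewrite sqrrN.
(* With this many sample points [m + i < M] for every degree [i] occurring in [P], so there is no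
   aliasing and [sin_orthogonal] applies. *)
pose M := (m + size P)%N; have M0 : (0 < M)%N by rewrite addn_gt0 m0.
pose x (j : nat) : R := j%:R * (2 * pi / M%:R).
have S : \sum_(j < M) sin (m%:R * x j) * imP P (r * cos (x j)) (r * sin (x j)) =
   P`_m * r ^+ m * (M%:R / 2).
  transitivity (\sum_(i < size P) P`_i * r ^+ i * (\sum_(j < M) sin (m%:R * x j) * sin (i%:R * x j))).
    rewrite /imP; under eq_bigr do rewrite mulr_sumr.
    rewrite exchange_big /=; apply: eq_bigr => i _; rewrite mulr_sumr.
    by apply: eq_bigr => j _; rewrite cpw_polar /=; ring.
  rewrite (bigD1 (Ordinal mP)) //= sin_orthogonal ?eqxx // ?ltn_add2l // big1 ?addr0 //.
  move=> i im; rewrite sin_orthogonal // ?ltn_add2l // ifN ?mulr0 //.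
have M0' : 0 < M%:R :> R by rewrite ltr0n.
have : `|P`_m * r ^+ m * (M%:R / 2)| <= M%:R * E.
  rewrite -S (le_trans (ler_norm_sum _ _ _)) //.
  apply: (@le_trans _ _ (\sum_(j < M) E)); last by rewrite sumr_const card_ord mulr_natl.
  apply: ler_sum => j _; rewrite normrM -[E]mul1r ler_pM //.
    by rewrite ler_norml sin_geN1 sin_le1.
  apply: hE'; rewrite !exprMn -mulrDr cos2Dsin2 mulr1 //.
rewrite (normrM (_ * _)) (normrM P`_m) normrX (ger0_norm r0) (@ger0_norm _ (M%:R / 2)) ?divr_ge0 //.
have -> : `|P`_m| * r ^+ m * (M%:R / 2) = M%:R * (`|P`_m| * r ^+ m / 2) by ring.
by rewrite ler_pM2l // ler_pdivrMr // [E * 2]mulrC.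
Qed.

(** The coefficient bounds [2 E r^-i] become a geometric series on radius [r / 2]. The constant
    coefficient leaves no trace in [Im P], hence the normalisation to zero. *)
Lemma pnorm_half P r E : 0 < r -> P`_0 = 0 ->
  (forall c s, c ^+ 2 + s ^+ 2 = r ^+ 2 -> 0 <= s -> `|imP P c s| <= E) ->
  pnorm (r / 2) P <= 4 * E.
Proof.
move=> r0 P0 hE.
have E0 : 0 <= E by rewrite (le_trans _ (hE r 0 _ _)) // ?expr0n ?addr0.
have geo n : \sum_(i < n) 2^-1 ^+ i = 2 - 2 * 2^-1 ^+ n :> R.
  elim: n => [|n IH]; first by rewrite big_ord0 expr0; ring.
  by rewrite big_ord_recr /= IH exprS; field.
apply: (@le_trans _ _ (\sum_(i < size P) 2 * E * 2^-1 ^+ i)).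
  apply: ler_sum => -[[|i] /= _] _.
    by rewrite P0 normr0 mul0r !mulr_ge0 // exprn_ge0.
  have -> : (r / 2) ^+ i.+1 = r ^+ i.+1 * 2^-1 ^+ i.+1 by rewrite exprMn.
  by rewrite mulrA ler_wpM2r ?exprn_ge0 // (fourier_coef (ltW r0) hE).
rewrite -mulr_sumr geo.
have h : 0 <= 2^-1 ^+ size P :> R by rewrite exprn_ge0.
nra.
Qed.

(* [A + C] is the Laplacian of the touching quadratic; the [d] term makes the touching strict. *)
Definition touch_above f (h0 y0 : R) := exists a b A B C d p : R,
  [/\ 0 < d, 0 < p, A + C < 0 & forall h k, `|h| <= p -> `|k| <= p ->
    f (h0 + h) (y0 + k) <= f h0 y0 + a * h + b * k
      + (A / 2 * h ^+ 2 + B * (h * k) + C / 2 * k ^+ 2) - d * (h ^+ 2 + k ^+ 2)].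

Definition halfdisc r : set pt := [set z | z.1 ^+ 2 + z.2 ^+ 2 <= r ^+ 2 /\ 0 <= z.2].

Lemma contS_fst (S : set pt) : contS S (fun z => z.1).
Proof. by move=> z _ e e0; exists e => // w _ [h _]; exact: ltW. Qed.

Lemma contS_snd (S : set pt) : contS S (fun z => z.2).
Proof. by move=> z _ e e0; exists e => // w _ [_ h]; exact: ltW. Qed.

Lemma contS_near (S : set pt) (g : pt -> R) z e : contS S g -> S z -> 0 < e ->
  exists2 d, 0 < d & forall w, S w -> near2 d z w -> `|g w - g z| < e.
Proof.
move=> h Sz e0; have [d d0 hd] := h z Sz (e / 2) ltac:(lra).
by exists d => // w Sw wz; rewrite (le_lt_trans (hd w Sw wz)) //; lra.
Qed.

Lemma contSM (S : set pt) (g h : pt -> R) : contS S g -> contS S h -> contS S (fun z => g z * h z).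
Proof. by move=> /contSP hg /contSP hh; apply/contSP => z; exact: (cvgM (hg z) (hh z)). Qed.

Lemma contS_cst (S : set pt) (c : R) : contS S (fun=> c).
Proof. by move=> z _ e e0; exists 1 => // w _ _; rewrite subrr normr0 ltW. Qed.

Lemma contS_sq (S : set pt) : contS S (fun z => z.1 ^+ 2 + z.2 ^+ 2).
Proof.
apply: (@contSD _ S (fun z => z.1 ^+ 2) (fun z => z.2 ^+ 2)).
  exact: (contSM (@contS_fst S) (@contS_fst S)).
exact: (contSM (@contS_snd S) (@contS_snd S)).
Qed.

Lemma closed_le (g : pt -> R) c : contS setT g -> closed [set z | g z <= c].
Proof.
move=> hg; apply/closed_near2 => z hz /=; rewrite leNgt; apply/negP => h.
have gc : 0 < g z - c by rewrite subr_gt0.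
have [d d0 hd] := contS_near hg (I : setT z) gc.
have [w /= wc zw] := hz d d0; have := hd w I zw.
by rewrite ltr_norml => /andP[]; lra.
Qed.

Lemma halfdisc_closed r : closed (halfdisc r).
Proof.
have -> : halfdisc r = [set z | z.1 ^+ 2 + z.2 ^+ 2 <= r ^+ 2] `&` [set z | - z.2 <= 0].
  by apply/seteqP; split => z /= [h1 h2]; split => //; move: h2; rewrite oppr_le0.
apply: closedI; apply: closed_le; first exact: contS_sq.
by apply: contSN; exact: contS_snd.
Qed.

Lemma halfdisc_bounded r z : 0 <= r -> halfdisc r z -> `|z.1| <= r /\ `|z.2| <= r.
Proof.
move=> r0 [h _]; split; rewrite -ler_sqr ?nnegrE // real_normK ?num_real //.
  by rewrite (le_trans _ h) // lerDl sqr_ge0.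
by rewrite (le_trans _ h) // lerDr sqr_ge0.
Qed.

Lemma contS_imP (S : set pt) P : contS S (fun z => imP P z.1 z.2).
Proof.
have cpwc n : contS S (fun z => (cpw z.1 z.2 n).1) /\ contS S (fun z => (cpw z.1 z.2 n).2).
  elim: n => [|n [IH1 IH2]] /=; first by split; exact: contS_cst.
  split; [apply: contSB|apply: contSD]; apply: contSM => //;
    by [exact: contS_fst|exact: contS_snd].
elim/imP_ind: P => [|P a n IH].
  under eq_fun do rewrite imP0; exact: contS_cst.
under eq_fun do rewrite imPD imPZ imPXn.
by apply: contSD => //; apply: contSM; [exact: contS_cst|have [] := cpwc n].
Qed.

(** Maximum principle: the bump [t (p^2 + y^2)] turns an interior maximum into a touching point from
    above by a quadratic of Laplacian [- t], because the quadratic part of [Im P] has trace zero. *)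
Lemma halfdisc_compare r f P e : 0 < r -> 0 <= e ->
  contS (halfdisc r) (fun z => f z.1 z.2) ->
  (forall h, `|h| <= r -> f h 0 = 0) ->
  (forall h y, h ^+ 2 + y ^+ 2 < r ^+ 2 -> 0 < y -> ~ touch_above f h y) ->
  (forall c s, c ^+ 2 + s ^+ 2 = r ^+ 2 -> 0 <= s -> f c s - imP P c s <= e) ->
  forall z, halfdisc r z -> f z.1 z.2 - imP P z.1 z.2 <= e.
Proof.
move=> r0 e0 cf f0 nt hb z0 Dz0; rewrite leNgt; apply/negP => hz0.
set eta := f z0.1 z0.2 - imP P z0.1 z0.2 - e.
have eta0 : 0 < eta by rewrite /eta; lra.
have r20 : 0 < r ^+ 2 by rewrite exprn_gt0.
(* The bump uses at most half of the excess [eta], so the maximum lies neither on the arc nor on the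
   axis. *)
pose t := eta / (2 * r ^+ 2).
have t0 : 0 < t by rewrite divr_gt0 // mulr_gt0.
have tr : t * r ^+ 2 = eta / 2 by rewrite /t; field; rewrite gt_eqF.
clearbody t.
pose phi (z : pt) := f z.1 z.2 - imP P z.1 z.2 + t * (z.1 ^+ 2 + z.2 ^+ 2).
have cphi : contS (halfdisc r) phi.
  apply: contSD; first by apply: contSB => //; exact: contS_imP.
  by apply: contSM; [exact: contS_cst|exact: contS_sq].
have [z1 Dz1 hz1] := contS_max (@halfdisc_closed r)
  (fun z => halfdisc_bounded (ltW r0)) (ex_intro _ z0 Dz0) cphi.
have phi1 : e + eta <= phi z1.
  rewrite (le_trans _ (hz1 z0 Dz0)) // /phi /eta.
  have : 0 <= t * (z0.1 ^+ 2 + z0.2 ^+ 2) by rewrite mulr_ge0 ?(ltW t0) // addr_ge0 ?sqr_ge0.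
  lra.
have tz1 : t * (z1.1 ^+ 2 + z1.2 ^+ 2) <= eta / 2.
  by rewrite -tr ler_pM2l //; case: Dz1.
have y1 : 0 < z1.2.
  rewrite lt_neqAle; case: (Dz1) => h1 ->; rewrite andbT; apply/eqP => E.
  move: phi1; rewrite /phi -E imP_y0 f0 ?subr0; last by have [] := halfdisc_bounded (ltW r0) Dz1.
  by move: tz1; rewrite -E; lra.
have d1 : z1.1 ^+ 2 + z1.2 ^+ 2 < r ^+ 2.
  rewrite lt_neqAle; case: (Dz1) => -> h2; rewrite andbT; apply/eqP => E.
  by have := hb _ _ E h2; move: phi1 tz1; rewrite /phi; lra.
apply: (nt _ _ d1 y1).
have [a [b [g [d [M H]]]]] := imP_taylor P z1.1 z1.2.
have [p1 p10 hp1] : exists2 p1, 0 < p1 & forall h k, `|h| <= p1 -> `|k| <= p1 -> halfdisc r (z1.1 + h, z1.2 + k).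
  have gc : 0 < r ^+ 2 - (z1.1 ^+ 2 + z1.2 ^+ 2) by rewrite subr_gt0.
  have [q q0 hq] := contS_near (@contS_sq setT) (I : setT z1) gc.
  exists (Num.min (q / 2) z1.2); first by rewrite lt_min y1 andbT; lra.
  move=> h k; rewrite !le_min => /andP[hq1 _] /andP[hq2 hq3]; split => /=; last first.
    by move: hq3; rewrite ler_norml => /andP[]; lra.
  have q2 : q / 2 < q by lra.
  have h1 := le_lt_trans hq1 q2; have h2 := le_lt_trans hq2 q2.
  have h3 : near2 q z1 (z1.1 + h, z1.2 + k) by split; rewrite /= addrAC subrr add0r.
  by have := hq _ I h3; rewrite /= ltr_norml => /andP[]; lra.
(* On this scale the cubic remainder is at most [t / 2 (h^2 + k^2)]; of the rest of the bump,
   [t / 4] goes into the Laplacian and [t / 4] into strictness. *)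
pose p := Num.min p1 (Num.min 1 (t / (8 * (`|M| + 1)))).
have M1 : 0 < `|M| + 1 by rewrite ltr_wpDl.
have p0 : 0 < p by rewrite !lt_min p10 ltr01 /= divr_gt0 // mulr_gt0.
have pp1 : p <= p1 by rewrite ge_min lexx.
have p1' : p <= 1 by rewrite !ge_min lexx orbT.
have pM : p * (8 * (`|M| + 1)) <= t by rewrite -ler_pdivlMr ?mulr_gt0 // !ge_min lexx !orbT.
clearbody p; clear phi1 tz1 y1 d1 cphi.
exists (a - 2 * t * z1.1), (b - 2 * t * z1.2), (2 * g - t / 2), d, (- 2 * g - t / 2), (t / 4), p.
split => //; [lra|lra|move=> h k hp kp].
have := hz1 (z1.1 + h, z1.2 + k) (hp1 _ _ (le_trans hp pp1) (le_trans kp pp1)); rewrite /phi /= => h1.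
have h2 := H h k (le_trans hp p1') (le_trans kp p1').
have h3 : M * (`|h| + `|k|) ^+ 3 <= t / 2 * (h ^+ 2 + k ^+ 2).
  have q0 := normr_ge0 h; have q1 := normr_ge0 k.
  have s2 : (`|h| + `|k|) ^+ 2 <= 2 * (h ^+ 2 + k ^+ 2).
    by rewrite -(real_normK (num_real h)) -(real_normK (num_real k)) sqrD_le.
  have s1 : `|h| + `|k| <= 2 * p by rewrite mulr_natl lerD.
  have s0 : 0 <= h ^+ 2 + k ^+ 2 by rewrite addr_ge0 ?sqr_ge0.
  apply: (@le_trans _ _ ((`|M| + 1) * (2 * p * (2 * (h ^+ 2 + k ^+ 2))))).
    have -> : (`|h| + `|k|) ^+ 3 = (`|h| + `|k|) * (`|h| + `|k|) ^+ 2 by ring.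
    apply: (@le_trans _ _ ((`|M| + 1) * ((`|h| + `|k|) * (`|h| + `|k|) ^+ 2))).
      by rewrite ler_wpM2r ?mulr_ge0 ?sqr_ge0 ?addr_ge0 // (le_trans (ler_norm M)) // lerDl.
    by rewrite ler_wpM2l ?(ltW M1) // ler_pM ?sqr_ge0 ?addr_ge0.
  have -> : (`|M| + 1) * (2 * p * (2 * (h ^+ 2 + k ^+ 2))) =
     p * (8 * (`|M| + 1)) / 2 * (h ^+ 2 + k ^+ 2) by field.
  by rewrite ler_wpM2r // ler_pM2r // invr_gt0.
move: h2; rewrite ler_norml => /andP[_ h2]; nra.
Qed.

End HalfDisc.

(** * Approximation on the arc and analyticity of the normal slope *)

Section HalfDisc2.
Variable R : realType.
Local Notation pt := (pt R).
Implicit Types (P Q : {poly R}) (r : R) (f : R -> R -> R).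

Lemma contS_inv (S : set pt) (g : pt -> R) : contS S g -> (forall z, S z -> g z != 0) ->
  contS S (fun z => (g z)^-1).
Proof.
move=> /contSP /subspace_continuousP hg g0; apply/contSP/subspace_continuousP => z Sz.
by apply: cvgV; [exact: g0|exact: hg].
Qed.

Lemma contS_circle r (g : pt -> R) : 0 < r -> contS (halfdisc r) g ->
  cont1 (- r) r (fun c => g (c, Num.sqrt (r ^+ 2 - c ^+ 2))).
Proof.
move=> r0 cg.
have D c : - r <= c <= r -> halfdisc r (c, Num.sqrt (r ^+ 2 - c ^+ 2)).
  move=> /andP[c1 c2]; split; rewrite /= ?sqrtr_ge0 // sqr_sqrtr; first by lra.
  by nra.
move=> c hc e e0; have [d d0 hd] := cg _ (D c hc) e e0.
exists (Num.min d (d ^+ 2 / (2 * r))).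
  by rewrite lt_min d0 divr_gt0 ?exprn_gt0 // mulr_gt0.
move=> y hy; rewrite lt_min => /andP[y1 y2]; apply: hd; first exact: D.
split => //=; set a := Num.sqrt _; set b := Num.sqrt _.
have a0 : 0 <= a by exact: sqrtr_ge0.
have b0 : 0 <= b by exact: sqrtr_ge0.
have ea : a ^+ 2 = r ^+ 2 - y ^+ 2 by rewrite sqr_sqrtr //; move: hy => /andP[]; nra.
have eb : b ^+ 2 = r ^+ 2 - c ^+ 2 by rewrite sqr_sqrtr //; move: hc => /andP[]; nra.
have h : `|y - c| * (2 * r) < d ^+ 2 by rewrite -ltr_pdivlMr // mulr_gt0.
have k : `|a - b| * (a + b) = `|y - c| * `|y + c|.
  rewrite -[X in _ * X = _]ger0_norm ?addr_ge0 // -!normrM -!subr_sqr ea eb.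
  by rewrite -normrN; congr (`| _ |); ring.
have yc : `|y + c| <= 2 * r.
  by rewrite ler_norml; move: hy hc => /andP[? ?] /andP[? ?]; lra.
rewrite -ltr_sqr ?nnegrE ?(ltW d0) // (le_lt_trans _ h) //.
apply: (@le_trans _ _ (`|a - b| * (a + b))).
  rewrite expr2 ler_wpM2l // ler_norml; lra.
by rewrite k ler_wpM2l.
Qed.

(** [circle_poly] requires boundary values of the form [s B(c)], while [f / s] may be unbounded at
    the ends of the arc. Replacing it by [f s / (s^2 + t)] costs [f t / (s^2 + t)], which is small
    because [f] vanishes at the ends with a quadratic modulus. *)
Lemma halfdisc_approx r f e : 0 < r -> contS (halfdisc r) (fun z => f z.1 z.2) ->
  (forall h, `|h| <= r -> f h 0 = 0) -> 0 < e ->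
  exists P, P`_0 = 0 /\ forall c s, c ^+ 2 + s ^+ 2 = r ^+ 2 -> 0 <= s ->
    `|f c s - imP P c s| <= e.
Proof.
move=> r0 cf f0 e0.
pose sq c := Num.sqrt (r ^+ 2 - c ^+ 2).
pose G c := f c (sq c).
have cG : cont1 (- r) r G by exact: (contS_circle r0 cf).
have rr : - r <= r by lra.
have [K [K0 hK]] := cont1_quad_modulus rr cG (divr_gt0 e0 (ltr0Sn _ 3)).
have Gr : G r = 0 by rewrite /G /sq subrr sqrtr0 f0 // gtr0_norm.
have Gnr : G (- r) = 0 by rewrite /G /sq sqrrN subrr sqrtr0 f0 // normrN gtr0_norm.
have sqE c : - r <= c <= r -> sq c ^+ 2 = (r - c) * (r + c).
  by move=> /andP[? ?]; rewrite sqr_sqrtr; [ring|nra].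
(* The nearer end of the arc is used: for [c >= 0], [(r - c)^2 <= (r - c) (r + c) = s^2]. *)
have GK c : - r <= c <= r -> `|G c| <= e / 4 + K * sq c ^+ 2.
  move=> hc; have /andP[c1 c2] := hc; rewrite sqE //.
  have h1 := hK c r hc ltac:(lra); have h2 := hK c (- r) hc ltac:(lra).
  rewrite Gr subr0 in h1; rewrite Gnr subr0 opprK in h2.
  have [c0|c0] := leP 0 c.
    by apply: (le_trans h1); rewrite lerD2l ler_wpM2l //; nra.
  by apply: (le_trans h2); rewrite lerD2l ler_wpM2l //; nra.
pose t := e / (4 * (K + 1)).
have K1 : 0 < K + 1 by lra.
have t0 : 0 < t by rewrite divr_gt0 // mulr_gt0.
have Kt : K * t <= e / 4.
  have -> : e / 4 = (K + 1) * t by rewrite /t; field; lra.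
  by rewrite ler_wpM2r ?(ltW t0) //; lra.
pose g (z : pt) := f z.1 z.2 * (z.2 * (z.2 * z.2 + t)^-1).
have cg : contS (halfdisc r) g.
  apply: contSM => //; apply: contSM; first exact: contS_snd.
  apply: contS_inv; first exact: (contSD (contSM (@contS_snd _ _) (@contS_snd _ _)) (@contS_cst _ _ _)).
  by move=> z _; rewrite gt_eqF // ltr_wpDl // -expr2 sqr_ge0.
have ck := contS_circle r0 cg.
have er : 0 < e / (2 * r) by rewrite divr_gt0 // mulr_gt0.
have rr' : - r < r by lra.
have [B hB] := weierstrass rr' ck er.
have [P hP] := circle_poly r B.
(* The constant coefficient is invisible in [Im P]; removing it prepares for [pnorm_half]. *)
exists (P - P`_0 *: 'X^0); split; first by rewrite coefB coefZ coefXn eqxx mulr1 subrr.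
move=> c s cs s0; rewrite imPB imPZ imPXn mulr0 subr0 -hP //.
have hc : - r <= c <= r by rewrite -ler_norml -ler_sqr ?nnegrE ?(ltW r0) // real_normK ?num_real // -cs lerDl sqr_ge0.
have sE : s = sq c by rewrite /sq -cs [c ^+ 2 + _]addrC addrK sqrtr_sqr ger0_norm.
have sr : s <= r by rewrite -ler_sqr ?nnegrE ?(ltW r0) // -cs lerDr sqr_ge0.
have := hB c hc; rewrite -/(sq c) -sE => h1.
have h2 : `|s * g (c, s) - s * B.[c]| <= e / 2.
  rewrite -mulrBr normrM (ger0_norm s0).
  have -> : e / 2 = r * (e / (2 * r)) by field; rewrite gt_eqF.
  by rewrite ler_pM.
have h3 : `|f c s - s * g (c, s)| <= e / 2.
  have q0 : 0 < s * s + t by rewrite ltr_wpDl // -expr2 sqr_ge0.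
  have -> : f c s - s * g (c, s) = f c s * (t / (s * s + t)).
    by rewrite /g /=; field; rewrite gt_eqF.
  rewrite normrM (ger0_norm (_ : 0 <= t / _)); last by rewrite divr_ge0 // ltW.
  have := GK c hc; rewrite /G -sE => h4.
  rewrite mulrA ler_pdivrMr //.
  apply: (@le_trans _ _ ((e / 4 + K * s ^+ 2) * t)); first by rewrite ler_wpM2r // ltW.
  have : K * t * s ^+ 2 <= e / 4 * s ^+ 2 by rewrite ler_wpM2r // sqr_ge0.
  have := sqr_ge0 s; have := mulr_gt0 e0 t0; nra.
rewrite -(subrKA (s * g (c, s))) (le_trans (ler_normD _ _)) //; lra.
Qed.

(** Two approximants are close on the arc, hence by [pnorm_half] close in coefficients; the limit of
    their derivatives on the axis is analytic and is the slope of [f] at [y = 0]. *)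
Theorem halfdisc_analytic r f : 0 < r -> contS (halfdisc r) (fun z => f z.1 z.2) ->
  (forall h, `|h| <= r -> f h 0 = 0) ->
  (forall h y, h ^+ 2 + y ^+ 2 < r ^+ 2 -> 0 < y -> ~ touch_above f h y) ->
  (forall h y, h ^+ 2 + y ^+ 2 < r ^+ 2 -> 0 < y -> ~ touch_above (fun h y => - f h y) h y) ->
  exists H, [/\ wan H 0 & exists2 d, 0 < d & forall h, `|h| <= d -> forall e, 0 < e ->
    exists2 eta, 0 < eta & forall y, 0 < y < eta -> `|f h y - y * H h| <= e * y].
Proof.
move=> r0 cf f0 nta ntb.
have [d [d0 small]] : exists d : nat -> R, (forall n, 0 < d n) /\
    forall e, 0 < e -> exists n0, forall n, (n0 <= n)%N -> d n <= e.
  exists (fun n => n.+1%:R^-1); split=> [n|e e0]; first by rewrite invr_gt0.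
  exists (Num.bound e^-1) => n hn.
  rewrite -[e]invrK lef_pV2 ?posrE ?invr_gt0 ?ltr0n //.
  rewrite (le_trans (ltW (archi_boundP _))) ?invr_ge0 ?(ltW e0) // ler_nat.
  exact: leq_trans hn _.
have hP0 n : exists P, P`_0 = 0 /\ forall c s, c ^+ 2 + s ^+ 2 = r ^+ 2 -> 0 <= s ->
    `|f c s - imP P c s| <= d n.
  exact: halfdisc_approx.
have [P hP] := choice hP0.
(* Comparison from both sides carries the approximation from the arc to the whole half-disc. *)
have inner n z : halfdisc r z -> `|f z.1 z.2 - imP (P n) z.1 z.2| <= d n.
  move=> Dz; have n0 : 0 <= d n by exact: ltW.
  have [_ hn] := hP n.
  have up : f z.1 z.2 - imP (P n) z.1 z.2 <= d n.
    apply: (halfdisc_compare r0 n0 cf f0 nta) => // c s cs s0.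
    exact: le_trans (ler_norm _) (hn c s cs s0).
  have lo : - f z.1 z.2 - imP (0 - P n) z.1 z.2 <= d n.
    apply: (halfdisc_compare (f := fun h y => - f h y) r0 n0 (contSN cf)) => // [h hr|c s cs s0].
      by rewrite f0 ?oppr0.
    rewrite imPB imP0 sub0r opprK.
    by apply: (le_trans (ler_norm _)); rewrite -normrN opprD !opprK hn.
  have key (x a E : R) : x - a <= E -> - x - (0 - a) <= E -> `|x - a| <= E.
    by move=> ? ?; rewrite ler_norml; lra.
  by apply: key; rewrite // -[0](imP0 z.1 z.2) -imPB.
have cP m n : pnorm (r / 2) (P m - P n) <= 4 * (d m + d n).
  apply: pnorm_half => //; first by rewrite coefB (hP m).1 (hP n).1 subr0.
  move=> c s cs s0; rewrite imPB -(subrKA (f c s)) (le_trans (ler_normD _ _)) // lerD //.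
    by rewrite distrC; apply: (hP m).2.
  exact: (hP n).2.
have r4 : 0 < r / 4 by lra.
have r42 : r / 4 < r / 2 by lra.
have ncP : ncauchy (r / 2) P.
  move=> e e0; have [n0 hn] := small (e / 8) ltac:(lra); exists n0 => m n hm hn'.
  by apply: (le_trans (cP m n)); have := hn m hm; have := hn n hn'; lra.
have ncP' := ncauchy_deriv (ltW r4) r42 ncP.
have [H hH] : exists H : R -> R, forall t, `|t| <= r / 4 -> (fun n => (P n)^`().[t]) @ \oo --> H t.
  pose H t := lim ((fun n => (P n)^`().[t]) @ \oo); exists H => t tr.
  have [l hl] : exists l : R, (fun n => (P n)^`().[t]) @ \oo --> l.
    apply: (cauchy_eps (u := fun n => (P n)^`().[t])) => e e0.
    have [n0 hn] := ncP' e e0; exists n0 => m n hm hnn.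
    by rewrite -hornerN -hornerD (le_trans (horner_le_pnorm _ tr)) // hn.
  by apply/cvg_ex; exists l.
exists H; split.
  by exists (r / 4), (fun n => (P n)^`()); split => // t tr; rewrite add0r; exact: hH.
exists (r / 8); first lra.
move=> h hr e e0.
have hr4 : `|h| <= r / 4 by lra.
have Hn n : `|H h - (P n)^`().[h]| * (r / 4) <= 4 * d n.
  rewrite -ler_pdivlMr //; apply/ler_addgt0Pr => b b0.
  have [n0 hn0] := small (b * (r / 16)) ltac:(apply: mulr_gt0; lra).
  apply: (cvg_dist_le (hH h hr4)); exists n0 => m hm.
  rewrite -hornerN -hornerD -derivB (le_trans (horner_le_pnorm _ hr4)) //.
  have := pnorm_deriv (P m - P n) (ltW r4) r42.
  have -> : r / 2 - r / 4 = r / 4 by field.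
  have E : (4 * d n / (r / 4) + b) * (r / 4) = 4 * d n + b * (r / 4).
    by field; rewrite gt_eqF.
  move=> h1; rewrite -(ler_pM2r r4) E (le_trans h1) // (le_trans (cP m n)) //.
  by have := hn0 m hm; lra.
have Dh y : 0 < y < r / 8 -> halfdisc r (h, y) /\ h ^+ 2 + y ^+ 2 <= (r / 4) ^+ 2.
  move=> /andP[y0 y8]; move: hr; rewrite ler_norml => /andP[h1 h2].
  by split; [split => /=; [nra|lra]|nra].
(* Uniform closeness alone would be lost on division by [y]. A better approximant [P n0], with
   [d n0] small against [y], is inserted; the difference [Im (P n0 - P n)] carries the factor
   [y]. *)
have fn n y : 0 < y < r / 8 -> `|f h y - imP (P n) h y| * (r / 4) <= y * (4 * d n).
  move=> hy; have [D1 D2] := Dh y hy; have /andP[y0 y8] := hy.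
  apply/ler_addgt0Pr => b b0.
  have [n0 hn0] := small (b / (r / 4 + y * 4)) ltac:(by rewrite divr_gt0 //; lra).
  have s0 := hn0 n0 (leqnn _).
  have q0 : 0 < r / 4 + y * 4 by lra.
  rewrite ler_pdivlMr // in s0.
  have h1 := inner n0 (h, y) D1; rewrite /= in h1.
  have h2 := imP_le_pnorm (P n0 - P n) (ltW r4) r42 D2.
  have r4E : r / 2 - r / 4 = r / 4 by field.
  rewrite r4E imPB (gtr0_norm y0) in h2.
  have h3 := le_trans h2 (ler_wpM2l (ltW y0) (cP n0 n)).
  have h4 : `|f h y - imP (P n) h y| <= `|f h y - imP (P n0) h y| + `|imP (P n0) h y - imP (P n) h y|.
    by rewrite -(subrKA (imP (P n0) h y)) ler_normD.
  have h5 := ler_wpM2r (ltW r4) h4.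
  have h6 := ler_wpM2r (ltW r4) h1.
  rewrite mulrDl in h5; clear h1 h2 h4 D1 D2 hn0 Dh Hn; nra.
have [n0 hn0] := small (e * (r / 4) / 16) ltac:(apply: divr_gt0 => //; apply: mulr_gt0 => //; lra).
have s0 : 4 * d n0 <= e / 4 * (r / 4) by have := hn0 n0 (leqnn _); lra.
have [M hM] := imP_deriv (P n0) hr4.
have M1 : 0 < `|M| + 1 by rewrite ltr_wpDl.
exists (Num.min (r / 8) (e / (2 * (`|M| + 1)))).
  by rewrite lt_min divr_gt0 //= divr_gt0 // mulr_gt0.
move=> y; rewrite lt_min => /andP[y0 /andP[y8 yM]].
have hy : 0 < y < r / 8 by rewrite y0 y8.
have yr : `|y| <= r / 4 by rewrite gtr0_norm //; lra.
have h1 := fn n0 y hy; have h2 := Hn n0; have h3 := hM y yr.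
rewrite (gtr0_norm y0) in h3.
have h1' : `|f h y - imP (P n0) h y| <= y * (e / 4).
  by rewrite -(ler_pM2r r4) (le_trans h1) // -mulrA ler_wpM2l // ltW.
have h2' : `|H h - (P n0)^`().[h]| <= e / 4.
  by rewrite -(ler_pM2r r4) (le_trans h2).
have h3' : M * y ^+ 2 <= y * (e / 2).
  rewrite ltr_pdivlMr ?mulr_gt0 // in yM.
  have : M * y <= e / 2.
    have : M * y <= (`|M| + 1) * y by rewrite ler_wpM2r ?(ltW y0) // (le_trans (ler_norm M)) // lerDl.
    lra.
  move=> My; have := ler_wpM2r (ltW y0) My; have -> : M * y ^+ 2 = M * y * y by ring.
  by have -> : y * (e / 2) = e / 2 * y by ring.
have -> : f h y - y * H h = (f h y - imP (P n0) h y) + (imP (P n0) h y - y * (P n0)^`().[h])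
   - y * (H h - (P n0)^`().[h]) by ring.
rewrite (le_trans (ler_normB _ _)) // normrM (gtr0_norm y0).
have h4 := ler_wpM2l (ltW y0) h2'.
have -> : e * y = y * (e / 4) + y * (e / 2) + y * (e / 4) by field.
by rewrite lerD // (le_trans (ler_normD _ _)) // lerD // (le_trans h3).
Qed.

End HalfDisc2.

(** * The partial Legendre transform *)

Section PartialLegendre.
Variable R : realType.
Local Notation pt := (pt R).
Variables (N : set pt) (s : pt -> R) (K : R).
Hypothesis (cN : closed N) (bN : forall z, N z -> `|z.1| <= K /\ `|z.2| <= K).
Hypothesis (vN : Defs.convex_set N) (vs : convex_on N s) (cs : contS N s).

Lemma N_mix x y x' y' t : N (x, y) -> N (x', y') -> 0 <= t <= 1 ->
  N ((1 - t) * x + t * x', (1 - t) * y + t * y').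
Proof. by move=> h h' ht; have := vN h h' ht. Qed.

Lemma s_mix x y x' y' t : N (x, y) -> N (x', y') -> 0 <= t <= 1 ->
  s ((1 - t) * x + t * x', (1 - t) * y + t * y') <= (1 - t) * s (x, y) + t * s (x', y').
Proof. by move=> h h' ht; have := vs h h' ht. Qed.

Definition slice (y : R) := exists x, N (x, y).

Lemma slice_mix y y' t : slice y -> slice y' -> 0 <= t <= 1 -> slice ((1 - t) * y + t * y').
Proof. by move=> [x h] [x' h'] ht; exists ((1 - t) * x + t * x'); exact: N_mix. Qed.

Definition argmin (p y x : R) :=
  N (x, y) /\ forall x', N (x', y) -> s (x, y) - p * x <= s (x', y) - p * x'.

Lemma argmin_ex p y : slice y -> exists x, argmin p y x.
Proof.
move=> [x0 h0]; pose S := N `&` [set z | z.2 = y].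
have cS : closed S.
  apply/closed_near2 => z hz; split.
    by apply: ((closed_near2 N).1 cN) => d d0; have [w [Nw _] wz] := hz d d0; exists w.
  apply/eqP; rewrite -subr_eq0 -normr_le0 leNgt; apply/negP => h.
  by have [w [_ /= wy] [_ h2]] := hz _ h; move: h2; rewrite wy distrC ltxx.
have cf : contS S (fun z => s z - p * z.1).
  apply: contS_sub (contSB cs (contSM (@contS_cst _ _ p) (@contS_fst _ _))) => z [] //.
have [[x y'] [Nz /= yE] hz] := contS_min cS (fun z Sz => bN Sz.1) (ex_intro S (x0, y) (conj h0 erefl)) cf.
exists x; rewrite -yE; split => // x' Nx'.
by apply: (hz (x', y')); split => //=.
Qed.

(** The value at a chosen minimiser, hence the minimum ([psi_argmin]). The default [0] of [xget] is
    taken only when no minimiser exists, which by [argmin_ex] means an empty slice. *)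
Definition psi (p y : R) : R := let x := xget 0 [set x | argmin p y x] in s (x, y) - p * x.

Lemma psi_argmin p y x : argmin p y x -> psi p y = s (x, y) - p * x.
Proof.
move=> h; have h' : argmin p y (xget 0 [set x | argmin p y x]).
  exact: (xgetPex 0 (ex_intro _ x h)).
apply/eqP; rewrite eq_le; apply/andP; split; first by apply: h'.2; exact: h.1.
by apply: h.2; exact: h'.1.
Qed.

Lemma psi_le p y x : N (x, y) -> psi p y <= s (x, y) - p * x.
Proof.
by move=> h; have [x0 h0] := argmin_ex p (ex_intro _ x h); rewrite (psi_argmin h0) h0.2.
Qed.

Lemma psi_concave p p' y t : slice y -> 0 <= t <= 1 ->
  (1 - t) * psi p y + t * psi p' y <= psi ((1 - t) * p + t * p') y.
Proof.
move=> Yy /andP[t0 t1]; have [x h] := argmin_ex ((1 - t) * p + t * p') Yy.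
rewrite (psi_argmin h); have [Nx _] := h.
have h1 : (1 - t) * psi p y <= (1 - t) * (s (x, y) - p * x) by rewrite ler_wpM2l ?subr_ge0 // psi_le.
have h2 : t * psi p' y <= t * (s (x, y) - p' * x) by rewrite ler_wpM2l // psi_le.
nra.
Qed.

(** Partial minimisation of a jointly convex function is convex, whereas in [p] a minimum of affine
    functions is concave. Both touching lemmas exploit this saddle structure. *)
Lemma psi_convex p y y' t : slice y -> slice y' -> 0 <= t <= 1 ->
  psi p ((1 - t) * y + t * y') <= (1 - t) * psi p y + t * psi p y'.
Proof.
move=> Yy Yy' ht; have [x h] := argmin_ex p Yy; have [x' h'] := argmin_ex p Yy'.
rewrite (psi_argmin h) (psi_argmin h').
apply: (le_trans (psi_le p (N_mix h.1 h'.1 ht))).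
have := s_mix h.1 h'.1 ht; lra.
Qed.

Lemma psi_lip p p' y : slice y -> `|psi p y - psi p' y| <= K * `|p - p'|.
Proof.
move=> Yy.
have key a b : psi a y - psi b y <= K * `|a - b|.
  have [x h] := argmin_ex b Yy; have := psi_le a h.1; rewrite (psi_argmin h).
  have [xK _] := bN h.1; rewrite /= in xK.
  have : (b - a) * x <= K * `|a - b|.
    by rewrite (le_trans (ler_norm _)) // normrM mulrC distrC ler_wpM2r.
  lra.
by rewrite ler_norml; apply/andP; split; [have := key p' p; rewrite distrC; lra|exact: key].
Qed.

(** A convex function lies below its chords; the chord from [y] to [y + b] and the one from
    [y + t b] to [y - b] bound the increment from both sides. *)
Lemma psi_cont_y p y a : 0 < a -> slice (y - a) -> slice (y + a) -> slice y ->
  exists C, 0 <= C /\ forall y', `|y' - y| <= a -> `|psi p y' - psi p y| <= C * `|y' - y|.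
Proof.
move=> a0 Ym Yp Yy.
set D := `|psi p (y - a) - psi p y| + `|psi p (y + a) - psi p y|.
have D0 : 0 <= D by rewrite addr_ge0.
exists (D / a); split; first by rewrite divr_ge0 // ltW.
have key b t : b = a \/ b = - a -> 0 <= t <= 1 ->
    `|psi p (y + t * b) - psi p y| <= D * t.
  move=> hb /andP[t0 t1].
  have Yb : slice (y + b) by case: hb => ->.
  have Ynb : slice (y - b) by case: hb => ->; rewrite ?opprK.
  have Db : `|psi p (y + b) - psi p y| <= D.
    by case: hb => ->; rewrite /D ?lerDl ?lerDr.
  have Dnb : `|psi p (y - b) - psi p y| <= D.
    by case: hb => ->; rewrite /D ?opprK ?lerDl ?lerDr.
  have Yt : slice (y + t * b).
    have -> : y + t * b = (1 - t) * y + t * (y + b) by ring.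
    by apply: slice_mix => //; apply/andP.
  have up : psi p (y + t * b) <= (1 - t) * psi p y + t * psi p (y + b).
    have -> : y + t * b = (1 - t) * y + t * (y + b) by ring.
    by apply: psi_convex => //; apply/andP.
  (* [y] is the mean of [y + t b] and [y - b] with weights [1 / (1 + t)] and [t / (1 + t)]. *)
  pose u := t / (1 + t).
  have t10 : 0 < 1 + t by lra.
  have u0 : 0 <= u by rewrite divr_ge0 // ltW.
  have u1 : u <= 1 by rewrite ler_pdivrMr //; lra.
  have ut : u * (1 + t) = t by rewrite mulfVK // gt_eqF.
  have lo : psi p y <= (1 - u) * psi p (y + t * b) + u * psi p (y - b).
    have E : y = (1 - u) * (y + t * b) + u * (y - b).
      have -> : (1 - u) * (y + t * b) + u * (y - b) = y + b * (t - u * (1 + t)) by ring.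
      by rewrite ut; ring.
    by rewrite {1}E; apply: psi_convex => //; rewrite u0 u1.
  move: Db Dnb; rewrite !ler_norml => /andP[_ d1] /andP[_ d2].
  set A := psi p (y + t * b) in up lo *; set B := psi p y in up lo d1 d2 *.
  set E := psi p (y + b) in up d1; set F := psi p (y - b) in lo d2.
  have up' : A - B <= t * D.
    by have := ler_wpM2l t0 d1; lra.
  have lo' : B - A <= t * D.
    have h1 : (1 + t) * B <= A + t * F.
      have h2 := ler_wpM2l (ltW t10) lo.
      have E2 : (1 + t) * ((1 - u) * A + u * F) = A + t * F + (t - u * (1 + t)) * (A - F) by ring.
      by rewrite E2 ut subrr mul0r addr0 in h2.
    by have := ler_wpM2l t0 d2; lra.
  by rewrite mulrC; lra.
move=> y' hy'; set t := `|y' - y| / a.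
have ht : 0 <= t <= 1 by rewrite divr_ge0 ?(ltW a0) //= ler_pdivrMr // mul1r.
rewrite mulrAC -mulrA -/t.
have [h|h] := leP 0 (y' - y).
  have -> : y' = y + t * a by rewrite /t ger0_norm // mulfVK ?gt_eqF //; ring.
  by apply: key => //; left.
have -> : y' = y + t * - a by rewrite /t ltr0_norm //; field; rewrite gt_eqF.
by apply: key => //; right.
Qed.

Lemma psi_cont p y a e : 0 < a -> slice (y - a) -> slice (y + a) -> 0 < e ->
  exists2 d, 0 < d & forall p' y', `|p' - p| < d -> `|y' - y| < d -> `|psi p' y' - psi p y| <= e.
Proof.
move=> a0 Ym Yp e0.
have Yb t : `|t - y| <= a -> slice t.
  rewrite ler_norml => /andP[h1 h2].
  have -> : t = (1 - (t - (y - a)) / (2 * a)) * (y - a) + (t - (y - a)) / (2 * a) * (y + a).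
    by field; rewrite gt_eqF.
  apply: slice_mix => //; apply/andP; split; first by rewrite divr_ge0 //; lra.
  by rewrite ler_pdivrMr; lra.
have Yy : slice y by apply: Yb; rewrite subrr normr0 ltW.
have [C [C0 hC]] := psi_cont_y p a0 Ym Yp Yy.
have K0 : 0 <= K by have [x h] := Yy; rewrite (le_trans _ (bN h).1).
have KC : 0 < K + C + 1 by lra.
exists (Num.min a (e / (K + C + 1))); first by rewrite lt_min a0 divr_gt0.
move=> p' y'; rewrite !lt_min => /andP[_ p2] /andP[y1 y2].
have Yy' : slice y' by apply: Yb; exact: ltW.
rewrite -(subrKA (psi p y')) (le_trans (ler_normD _ _)) //.
have h1 := psi_lip p' p Yy'; have h2 := hC y' (ltW y1).
rewrite ltr_pdivlMr // in p2; rewrite ltr_pdivlMr // in y2.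
have := normr_ge0 (p' - p); have := normr_ge0 (y' - y); nra.
Qed.

Lemma subdiff_argmin x y p q : N (x, y) -> subdiff N s (x, y) (p, q) ->
  argmin p y x /\ forall y', slice y' -> psi p y + q * (y' - y) <= psi p y'.
Proof.
move=> Nxy h; have am : argmin p y x.
  split => // x' Nx'; have := h (x', y) Nx'; rewrite /dotp /= subrr mulr0 addr0; lra.
split => // y' Yy'; have [x' h'] := argmin_ex p Yy'.
rewrite (psi_argmin am) (psi_argmin h'); have := h (x', y') h'.1; rewrite /dotp /=; lra.
Qed.

(** With [subdiff_argmin], a subgradient splits into two one-variable conditions: [x] minimises for
    the slope [p], and [q] is a supporting slope of [psi p] at [y]. *)
Lemma argmin_subdiff x y p q : argmin p y x ->
  (forall y', slice y' -> psi p y + q * (y' - y) <= psi p y') -> subdiff N s (x, y) (p, q).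
Proof.
move=> am h [x' y'] Nz; rewrite /dotp /=.
have := h y' (ex_intro _ x' Nz); have := psi_le p Nz; rewrite (psi_argmin am); lra.
Qed.

(* If [-x] is a supergradient at an interior local maximum of [psi + x p], then
   [x] is a minimiser there: minimisers at [p - h] and [p + h] lie on both sides of [x]. *)
Lemma argmin_of_localmax p y x d : 0 < d -> slice y ->
  (forall p', `|p' - p| <= d -> psi p' y + x * p' <= psi p y + x * p) -> argmin p y x.
Proof.
move=> d0 Yy hm.
have side h : `|h| <= d -> exists2 xh, argmin (p + h) y xh & h * x <= h * xh.
  move=> hd; have [xh ah] := argmin_ex (p + h) Yy; exists xh => //.
  have := hm (p + h); rewrite addrAC subrr add0r => /(_ hd).
  rewrite (psi_argmin ah); have := psi_le p ah.1; lra.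
have right h : 0 < h <= d -> exists2 xh, argmin (p + h) y xh & x <= xh.
  move=> /andP[h0 hd]; have [|xh a1 a2] := side h; first by rewrite gtr0_norm.
  by exists xh => //; rewrite -(ler_pM2l h0).
have left h : 0 < h <= d -> exists2 xh, argmin (p - h) y xh & xh <= x.
  move=> /andP[h0 hd]; have [|xh a1 a2] := side (- h); first by rewrite normrN gtr0_norm.
  by exists xh => //; rewrite -(ler_pM2l h0); lra.
have dd : 0 < d <= d by rewrite d0 lexx.
have mix (u v x0 : R) : u <= x0 -> x0 <= v -> u < v ->
    exists2 t, 0 <= t <= 1 & x0 = (1 - t) * u + t * v.
  move=> h1 h2 h3; exists ((x0 - u) / (v - u)).
    by rewrite divr_ge0 ?subr_ge0 //= ?(ltW h3) // ler_pdivrMr ?subr_gt0 // mul1r lerD2r.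
  by field; rewrite subr_eq0 gt_eqF.
have yy t : (1 - t) * y + t * y = y by ring.
have Nx : N (x, y).
  have [u au ux] := left _ dd; have [v av xv] := right _ dd.
  have [uv|uv] := ltP u v; last first.
    have -> : x = u by apply/eqP; rewrite eq_le ux andbT (le_trans xv).
    exact: au.1.
  have [t ht ->] := mix _ _ _ ux xv uv.
  by have := N_mix au.1 av.1 ht; rewrite yy.
split => // x' Nx'.
apply/ler_addgt0Pr => e e0.
have [xx'|xx'|<-] := ltgtP x x'; last by rewrite lerDl ltW.
  (* The slope [p - h] has a minimiser to the left of [x]; convexity between it and [x'] gives the
     inequality up to [h (x' - x) <= e]. *)
  pose h := Num.min d (e / (x' - x)).
  have hh : 0 < h <= d by rewrite lt_min d0 ge_min lexx /= divr_gt0 // subr_gt0.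
  have he : h * (x' - x) <= e by rewrite -ler_pdivlMr ?subr_gt0 // ge_min lexx orbT.
  have [u au ux] := left _ hh.
  have [t ht tE] := mix _ _ _ ux (ltW xx') (le_lt_trans ux xx').
  have h1 := s_mix au.1 Nx' ht; rewrite yy -tE in h1.
  have h2 := au.2 x' Nx'.
  have /andP[t0 t1] := ht.
  have h3 : (1 - t) * (s (u, y) - (p - h) * u) <= (1 - t) * (s (x', y) - (p - h) * x').
    by rewrite ler_wpM2l ?subr_ge0.
  have E : (1 - t) * ((p - h) * (u - x')) = (p - h) * (x - x') by rewrite tE; ring.
  lra.
pose h := Num.min d (e / (x - x')).
have hh : 0 < h <= d by rewrite lt_min d0 ge_min lexx /= divr_gt0 // subr_gt0.
have he : h * (x - x') <= e by rewrite -ler_pdivlMr ?subr_gt0 // ge_min lexx orbT.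
have [v av xv] := right _ hh.
have [t ht tE] := mix _ _ _ (ltW xx') xv (lt_le_trans xx' xv).
have h1 := s_mix Nx' av.1 ht; rewrite yy -tE in h1.
have h2 := av.2 x' Nx'.
have /andP[t0 t1] := ht.
have h3 : t * (s (v, y) - (p + h) * v) <= t * (s (x', y) - (p + h) * x').
  by rewrite ler_wpM2l.
have E : t * ((p + h) * (v - x')) = (p + h) * (x - x') by rewrite tE; ring.
lra.
Qed.

End PartialLegendre.

(** * Touching quadratics and preservation of area *)

Section Touch.
Variable R : realType.
Local Notation pt := (pt R).

Lemma emul_inv (a L : R) (m : \bar R) : 0 < a -> ((a^-1)%:E * m = L%:E)%E -> m = (a * L)%:E.
Proof.
move=> a0; have ai : 0 < a^-1 by rewrite invr_gt0.
case: m => [m| |].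
- by rewrite -EFinM => -[<-]; congr (_%:E); field; rewrite gt_eqF.
- by rewrite gt0_muley ?lte_fin.
- by rewrite gt0_muleNy ?lte_fin.
Qed.

Lemma eq_lexx (x y : R) : x = y -> x <= y. Proof. by move=> ->. Qed.

Lemma ball_norm (c u r : R) : c - r <= u <= c + r -> `|u| <= `|c| + r.
Proof.
by rewrite -ler_distl => h; rewrite -[u](subrK c) addrC (le_trans (ler_normD _ _)) // lerD2l.
Qed.

Lemma sqr_mix_le (p p' t : R) : 0 <= t <= 1 -> ((1 - t) * p + t * p' - p') ^+ 2 <= (p - p') ^+ 2.
Proof.
move=> ht; have -> : (1 - t) * p + t * p' - p' = (1 - t) * (p - p') by ring.
by rewrite exprMn ler_piMl ?sqr_ge0 // expr_le1 //; lra.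
Qed.

Lemma mix_in_ball (c u w r : R) : `|u - c| < r -> exists t, [/\ 0 < t, t <= 1 &
  `|(1 - t) * u + t * w - c| <= r].
Proof.
move=> ur; pose d := r - `|u - c|; have d0 : 0 < d by rewrite subr_gt0.
have q0 : 0 < d + `|w - u| by rewrite ltr_pwDl.
have n0 : 0 <= `|w - u| by [].
exists (d / (d + `|w - u|)); split; first by rewrite divr_gt0.
  by rewrite ler_pdivrMr // mul1r lerDl.
set t := _ / _; have t0 : 0 < t by rewrite divr_gt0.
have -> : (1 - t) * u + t * w - c = (u - c) + t * (w - u) by ring.
rewrite (le_trans (ler_normD _ _)) // normrM (gtr0_norm t0) -lerBrDl -/d /t mulrAC.
by rewrite ler_pdivrMr // ler_wpM2l ?(ltW d0) // lerDr ltW.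
Qed.

(** [F] lies above its line of slope [k] through [F0], whereas [Q] relative to that slope is a
    parabola with vertex [us]. Moving towards the vertex therefore keeps [Q] strictly below [F]. *)
Lemma below_mix (Q0 Qt Qs F0 Ft k u ut us C : R) : 0 < C -> F0 + k * (ut - u) <= Ft ->
  Qt - k * ut = Qs - k * us + C / 2 * (ut - us) ^+ 2 ->
  Q0 - k * u = Qs - k * us + C / 2 * (u - us) ^+ 2 ->
  (ut - us) ^+ 2 <= (u - us) ^+ 2 -> Q0 < F0 -> Qt < Ft.
Proof.
move=> C0 h1 h2 h3 h4 h5; have : C / 2 * (ut - us) ^+ 2 <= C / 2 * (u - us) ^+ 2.
  by rewrite ler_wpM2l // divr_ge0 // ltW.
move: (C / 2 * _) (C / 2 * _) h2 h3 => S T h2 h3 ST; lra.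
Qed.

Lemma chord_support (F0 F1 Fm k u w t : R) : 0 < t -> Fm <= (1 - t) * F0 + t * F1 ->
  F0 - k * u <= Fm - k * ((1 - t) * u + t * w) -> F0 + k * (w - u) <= F1.
Proof. by move=> t0 h1 h2; rewrite -(ler_pM2l t0); lra. Qed.

Lemma chord_contra (F0 F1 Fm Q0 Qm k u w t : R) : 0 <= t -> (1 - t) * F0 + t * F1 <= Fm ->
  Fm < Qm -> Qm + k * ((1 - t) * u + t * w) <= Q0 + k * u -> F0 + k * u <= F1 + k * w ->
  Q0 < F0 -> False.
Proof. by move=> t0 h1 h2 h3 h4 h5; have := ler_wpM2l t0 h4; lra. Qed.

Lemma crossing (p1 r p p' : R) : `|p - p1| < r -> ~~ (`|p' - p1| < r) ->
  exists2 t, 0 <= t <= 1 & `|(1 - t) * p + t * p' - p1| = r.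
Proof.
move=> h; rewrite -leNgt => h'; have r0 : 0 < r by exact: le_lt_trans h.
move: h; rewrite ltr_norml => /andP[h1 h2].
have [h0|h0] := leP 0 (p' - p1).
  rewrite ger0_norm // in h'.
  have q : 0 < p' - p by lra.
  exists ((p1 + r - p) / (p' - p)).
    by rewrite divr_ge0 ?(ltW q) //=; [rewrite ler_pdivrMr //; lra|lra].
  rewrite [X in `|X|](_ : _ = r) ?gtr0_norm //; field; lra.
rewrite ltr0_norm // in h'.
have q : 0 < p - p' by lra.
exists ((p - p1 + r) / (p - p')).
  by rewrite divr_ge0 ?(ltW q) //=; [rewrite ler_pdivrMr //; lra|lra].
rewrite [X in `|X|](_ : _ = - r) ?normrN ?gtr0_norm //; field; lra.
Qed.

Lemma open_preim_affine (T : pt -> pt) (C : R) (D : set pt) : 0 < C ->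
  (forall z w, `|(T w).1 - (T z).1| <= C * (`|w.1 - z.1| + `|w.2 - z.2|) /\
               `|(T w).2 - (T z).2| <= C * (`|w.1 - z.1| + `|w.2 - z.2|)) ->
  open D -> open (T @^-1` D).
Proof.
move=> C0 hT; rewrite openE => oD; apply: open_near2 => z Dz.
have [d d0 hd] := (interior_near2 _ _).1 (oD _ Dz).
exists (d / (2 * C)); first by rewrite divr_gt0 // mulr_gt0.
move=> w [w1 w2]; apply: hd; have [h1 h2] := hT z w.
rewrite ltr_pdivlMr ?mulr_gt0 // in w1; rewrite ltr_pdivlMr ?mulr_gt0 // in w2.
by split; [apply: le_lt_trans h1 _|apply: le_lt_trans h2 _]; lra.
Qed.

Lemma open_xmap (a b c : R) (D : set pt) : open D -> open (xmap a b c @^-1` D).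
Proof.
apply: (@open_preim_affine _ (`|a| + `|b| + 1)); first by rewrite ltr_wpDl // addr_ge0.
move=> z w /=; have := normr_ge0 (w.1 - z.1); have := normr_ge0 (w.2 - z.2).
have := normr_ge0 a; have := normr_ge0 b => b0 a0 q2 q1; split; last by nra.
have -> : a * w.1 + b * w.2 + c - (a * z.1 + b * z.2 + c) = a * (w.1 - z.1) + b * (w.2 - z.2) by ring.
by rewrite (le_trans (ler_normD _ _)) // !normrM; nra.
Qed.

Lemma open_ymap (a b c : R) (D : set pt) : open D -> open (ymap a b c @^-1` D).
Proof.
apply: (@open_preim_affine _ (`|a| + `|b| + 1)); first by rewrite ltr_wpDl // addr_ge0.
move=> z w /=; have := normr_ge0 (w.1 - z.1); have := normr_ge0 (w.2 - z.2).
have := normr_ge0 a; have := normr_ge0 b => b0 a0 q2 q1; split; first by nra.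
have -> : b * w.1 + a * w.2 + c - (b * z.1 + a * z.2 + c) = b * (w.1 - z.1) + a * (w.2 - z.2) by ring.
by rewrite (le_trans (ler_normD _ _)) // !normrM; nra.
Qed.

Lemma lebesgue_box_fin (D : set pt) (p1 y1 r : R) : 0 < r -> open D -> D !=set0 ->
  (forall z, D z -> `|z.1 - p1| < r /\ `|z.2 - y1| < r) ->
  exists2 m : R, 0 < m & leb2 D = m%:E.
Proof.
move=> r0 oD [z Dz] hD.
have pos := leb2_open_gt0 oD Dz.
have fin : (leb2 D < +oo)%E.
  apply: (@le_lt_trans _ _ (leb2 ([set` `]p1 - r, p1 + r[] `*` [set` `]y1 - r, y1 + r[]))).
    apply: (@le_measure _ _ _ (leb2m R)); rewrite ?inE.
    - exact: open_measurable2.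
    - by apply: measurableX; exact: measurable_itv.
    - move=> w /hD []; rewrite !ltr_norml => /andP[? ?] /andP[? ?].
      by split; rewrite /= in_itv /=; lra.
  by rewrite leb2_rect !lebesgue_measure_itv /= !lte_fin; do 2!case: ifP => _;
    rewrite ?mule0 ?mul0e // -?EFinB -?EFinM ltry.
case: (leb2 D) pos fin => [m| |] //; rewrite lte_fin => m0 _; by exists m.
Qed.

Variables (N : set pt) (s : pt -> R) (K : R).
Hypothesis (cN : closed N) (bN : forall z, N z -> `|z.1| <= K /\ `|z.2| <= K).
Hypothesis (vN : Defs.convex_set N) (vs : convex_on N s) (cs : contS N s).
Variable W : set pt.
Hypothesis (oW : open W) (WN : W `<=` N).
Hypothesis MA : forall E, open E -> E `<=` W ->
  mu_ext (@leb2 R) (subdiff_img N s E) = leb2 E.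
Variables (p1 y1 r0 : R).
Hypothesis r00 : 0 < r0.
Hypothesis Yb : forall y, `|y - y1| <= r0 -> slice N y.
Hypothesis HW : forall p y x, `|p - p1| <= r0 -> `|y - y1| <= r0 -> argmin N s p y x -> W (x, y).

Local Notation psi := (psi N s).

Lemma psi_cont_loc p y e : `|y - y1| < r0 -> 0 < e ->
  exists2 d, 0 < d & forall p' y', `|p' - p| < d -> `|y' - y| < d -> `|psi p' y' - psi p y| < e.
Proof.
move=> hy e0; have a0 : 0 < r0 - `|y - y1| by rewrite subr_gt0.
have e2 : 0 < e / 2 by lra.
have s1 : slice N (y - (r0 - `|y - y1|)).
  by apply: Yb; rewrite addrAC (le_trans (ler_normB _ _)) // (gtr0_norm a0); lra.
have s2 : slice N (y + (r0 - `|y - y1|)).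
  by apply: Yb; rewrite addrAC (le_trans (ler_normD _ _)) // (gtr0_norm a0); lra.
have [d d0 hd] := psi_cont cN bN vN vs cs p a0 s1 s2 e2.
by exists d => // p' y' h1 h2; rewrite (le_lt_trans (hd _ _ h1 h2)) //; lra.
Qed.

(** One statement for both signs: [sg = 1] when a quadratic touches [psi] from above, [sg = -1] when
    it touches [- psi]. *)
Lemma open_region (sg a b A B C e r : R) : r <= r0 -> open [set z : pt | [/\ `|z.1 - p1| < r,
   `|z.2 - y1| < r & a + b * (z.1 - p1) + e * (z.2 - y1) + A * (z.1 - p1) ^+ 2
     + B * ((z.1 - p1) * (z.2 - y1)) + C * (z.2 - y1) ^+ 2 < sg * psi z.1 z.2]].
Proof.
move=> rr; apply: open_near2 => z [z1 z2 z3].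
pose q (w : pt) := a + b * (w.1 - p1) + e * (w.2 - y1) + A * (w.1 - p1) ^+ 2
     + B * ((w.1 - p1) * (w.2 - y1)) + C * (w.2 - y1) ^+ 2.
have cq : contS setT q.
  have c1 : contS setT (fun w : pt => w.1 - p1) by exact: contSB (@contS_fst _ _) (@contS_cst _ _ _).
  have c2 : contS setT (fun w : pt => w.2 - y1) by exact: contSB (@contS_snd _ _) (@contS_cst _ _ _).
  have cc (c : R) : contS setT (fun w : pt => c) by exact: contS_cst.
  have c11 := contSM c1 c1; have c12 := contSM c1 c2; have c22 := contSM c2 c2.
  exact: (contSD (contSD (contSD (contSD (contSD (cc a) (contSM (cc b) c1)) (contSM (cc e) c2))
    (contSM (cc A) c11)) (contSM (cc B) c12)) (contSM (cc C) c22)).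
set g := sg * psi z.1 z.2 - q z; have g0 : 0 < g by rewrite subr_gt0.
have g20 : 0 < g / 2 by rewrite divr_gt0.
have [d1 d10 h1] := contS_near cq (I : setT z) g20.
have sg1 : 0 < `|sg| + 1 by rewrite ltr_wpDl.
have g2 : 0 < g / (2 * (`|sg| + 1)) by rewrite divr_gt0 // mulr_gt0.
have [d2 d20 h2] := psi_cont_loc z.1 (lt_le_trans z2 rr) g2.
pose d := Num.min (Num.min d1 d2) (Num.min (r - `|z.1 - p1|) (r - `|z.2 - y1|)).
exists d; first by rewrite !lt_min d10 d20 !subr_gt0 z1 z2.
move=> w wz.
have w1 : near2 d1 z w by apply: near2_le wz; rewrite !ge_min lexx.
have [w2 w3] : near2 d2 z w by apply: near2_le wz; rewrite !ge_min lexx orbT.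
have [w4 _] : near2 (r - `|z.1 - p1|) z w by apply: near2_le wz; rewrite !ge_min lexx !orbT.
have [_ w5] : near2 (r - `|z.2 - y1|) z w by apply: near2_le wz; rewrite !ge_min lexx !orbT.
split.
- by rewrite -(subrKA z.1) (le_lt_trans (ler_normD _ _)) // -ltrBrDr.
- by rewrite -(subrKA z.2) (le_lt_trans (ler_normD _ _)) // -ltrBrDr.
have a1 := h1 w I w1; have a2 := h2 _ _ w2 w3.
have a3 : `|sg * (psi w.1 w.2 - psi z.1 z.2)| < g / 2.
  rewrite normrM; apply: (@le_lt_trans _ _ ((`|sg| + 1) * `|psi w.1 w.2 - psi z.1 z.2|)).
    by rewrite ler_wpM2r // lerDl.
  have -> : g / 2 = (`|sg| + 1) * (g / (2 * (`|sg| + 1))) by field; rewrite gt_eqF.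
  by rewrite ltr_pM2l.
move: a1 a3; rewrite !ltr_norml mulrBr => /andP[_ a1] /andP[a3 _].
rewrite -/(q w); rewrite /g in a1 a3 *; lra.
Qed.

(** Lower the quadratic by [e] and let [D] be the region of the box where [psi] exceeds it. The
    points whose critical [p] lies in [D] form a set of area [- A |D|], and all their subgradients
    have their critical [y] in [D], a set of area [C |D|]. The Monge-Ampere equation then gives
    [- A <= C]. *)
Lemma no_touch_above : ~ touch_above psi p1 y1.
Proof.
move=> [a [b [A [B [C [d [r1 [d0 r10 AC H1]]]]]]]].
pose r := Num.min r1 r0.
have r_gt0 : 0 < r by rewrite lt_min r10.
have rr1 : r <= r1 by rewrite ge_min lexx.
have rr0 : r <= r0 by rewrite ge_min lexx orbT.
have Hr p y : `|p - p1| <= r -> `|y - y1| <= r -> psi p y <= psi p1 y1 + a * (p - p1) + b * (y - y1)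
   + (A / 2 * (p - p1) ^+ 2 + B * ((p - p1) * (y - y1)) + C / 2 * (y - y1) ^+ 2)
   - d * ((p - p1) ^+ 2 + (y - y1) ^+ 2).
  move=> hp hy; have := H1 (p - p1) (y - y1) (le_trans hp rr1) (le_trans hy rr1).
  by rewrite ![_ + (_ - _)]addrC !subrK.
have rn : `|r| = r by rewrite gtr0_norm.
(* Convexity of [psi] in [y], at the midpoint [y1], forces the touching quadratic to be convex in
   [y]. *)
have C0 : 0 < C.
  have h1 : psi p1 ((1 - 2^-1) * (y1 - r) + 2^-1 * (y1 + r)) <=
     (1 - 2^-1) * psi p1 (y1 - r) + 2^-1 * psi p1 (y1 + r).
    have s1 : slice N (y1 - r) by apply: Yb; rewrite addrAC subrr add0r normrN rn.
    have s2 : slice N (y1 + r) by apply: Yb; rewrite addrAC subrr add0r rn.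
    by apply: (psi_convex cN bN vN vs cs p1 s1 s2); lra.
  have E : (1 - 2^-1) * (y1 - r) + 2^-1 * (y1 + r) = y1 by field.
  rewrite E in h1.
  have h2 := Hr p1 (y1 - r); have h3 := Hr p1 (y1 + r).
  rewrite !subrr normr0 (addrAC y1 (- r)) subrr !add0r normrN rn (ltW r_gt0) in h2.
  rewrite !subrr normr0 (addrAC y1 r) subrr !add0r rn (ltW r_gt0) in h3.
  have {}h2 := h2 isT (lexx _); have {}h3 := h3 isT (lexx _).
  have r2 : 0 < r ^+ 2 by rewrite exprn_gt0.
  have : 0 <= (C - 2 * d) * r ^+ 2 by lra.
  rewrite pmulr_lge0 //; lra.
have A0 : 0 < - A by lra.
(* Half of the strict gap [d r^2]: the lowered quadratic is below [psi] at the centre and still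
   above it on the boundary of the box. *)
pose e := d * r ^+ 2 / 2.
have e0 : 0 < e by rewrite divr_gt0 // mulr_gt0 // exprn_gt0.
pose q (p y : R) := (psi p1 y1 - e) + a * (p - p1) + b * (y - y1) + A / 2 * (p - p1) ^+ 2
   + B * ((p - p1) * (y - y1)) + C / 2 * (y - y1) ^+ 2.
pose D : set pt := [set z | [/\ `|z.1 - p1| < r, `|z.2 - y1| < r & q z.1 z.2 < 1 * psi z.1 z.2]].
have oD : open D by exact: open_region.
have edge p y : `|p - p1| <= r -> `|y - y1| <= r -> `|p - p1| = r \/ `|y - y1| = r ->
   psi p y < q p y.
  move=> hp hy hr; have h1 := Hr p y hp hy; rewrite /q.
  have h2 : r ^+ 2 <= (p - p1) ^+ 2 + (y - y1) ^+ 2.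
    have s1 := sqr_ge0 (p - p1); have s2 := sqr_ge0 (y - y1).
    by case: hr => <-; rewrite real_normK ?num_real //; [rewrite lerDl|rewrite lerDr].
  have h3 := ler_wpM2l (ltW d0) h2.
  have : 0 < d * r ^+ 2 by rewrite mulr_gt0 // exprn_gt0.
  rewrite /e; lra.
have D1 : D (p1, y1).
  split; rewrite /= ?subrr ?normr0 // /q /= !subrr mul1r; lra.
have bD z : D z -> `|z.1 - p1| < r /\ `|z.2 - y1| < r by case.
have [L L0 LE] := lebesgue_box_fin r_gt0 oD (ex_intro _ _ D1) bD.
clear Hr H1 rn D1 bD rr1 d0; clearbody r e.
(* [X] replaces [x] by the critical point of [q p y + x p] in [p], and [Y] replaces the slope [q']
   by the critical point of [q p y - q' y] in [y]. *)
pose X := xmap ((- A)^-1) (B / - A) (p1 + (a - B * y1) / - A).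
pose Y := ymap (C^-1) (- B / C) (y1 + (- b + B * p1) / C).
have XE x y : X (x, y) = (p1 - (x + a + B * (y - y1)) / A, y).
  by rewrite /X /xmap /=; congr (_, _); field; lra.
have YE p y : Y (p, y) = (p, y1 + (y - b - B * (p - p1)) / C).
  by rewrite /Y /ymap /=; congr (_, _); field; lra.
pose E := X @^-1` D.
have oE : open E by exact: open_xmap.
have slope (x y p p' : R) : p = p1 - (x + a + B * (y - y1)) / A ->
    q p' y + x * p' = q p y + x * p + A / 2 * (p' - p) ^+ 2.
  by move=> ->; rewrite /q; field; lra.
(* Increasing [psi + x p] cannot lead out of [D]: the segment would meet the boundary of the box,
   where [psi < q], against the concavity of [psi] in [p] and the maximality of [p] for
   [q + x p]. *)
have inD x y p p' : D (p, y) -> p = p1 - (x + a + B * (y - y1)) / A ->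
    psi p y + x * p <= psi p' y + x * p' -> D (p', y).
  move=> [/= dp dy dq] pE hp'; rewrite mul1r in dq.
  have sq p'' := slope x y p p'' pE.
  have qle p'' : q p'' y + x * p'' <= q p y + x * p.
    by rewrite sq gerDl nmulr_rle0 ?sqr_ge0 //; lra.
  have lt' : `|p' - p1| < r.
    apply/negPn/negP => hn; have [t ht tr] := crossing dp hn.
    have Yy : slice N y by apply: Yb; rewrite (le_trans (ltW dy)).
    have h1 := psi_concave cN bN cs p p' Yy ht.
    have h2 := edge _ y (eq_lexx tr) (ltW dy) (or_introl tr).
    have h3 := qle ((1 - t) * p + t * p').
    have /andP[t0 t1] := ht.
    exact: chord_contra t0 h1 h2 h3 hp' dq.
  split => //=; rewrite mul1r; have := qle p'; lra.
(* A maximiser of [psi + x p] over the box stays in [D], hence off the boundary;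
   [argmin_of_localmax] makes [x] a minimiser there, and [HW] places the point in [W]. *)
have EW : E `<=` W.
  move=> [x y]; rewrite /E /= XE => Dz; set p := p1 - _ in Dz.
  have [/= dp dy _] := Dz.
  have Yy : slice N y by apply: Yb; rewrite (le_trans (ltW dy)).
  have cF : contS [set z : pt | p1 - r <= z.1 <= p1 + r /\ p1 - r <= z.2 <= p1 + r]
     (fun z => psi z.1 y + x * z.1).
    apply: contSD; last exact: contSM (@contS_cst _ _ _) (@contS_fst _ _).
    move=> z _ e1 e10; have [d1 d10 hd1] := psi_cont_loc z.1 (lt_le_trans dy rr0) e10.
    exists d1 => // w _ [w1 _]; apply: ltW; apply: hd1 => //.
    by rewrite subrr normr0.
  have bb (z : pt) : p1 - r <= z.1 <= p1 + r /\ p1 - r <= z.2 <= p1 + r ->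
      `|z.1| <= `|p1| + r /\ `|z.2| <= `|p1| + r.
    by move=> [? ?]; split; exact: ball_norm.
  have n0 : [set z : pt | p1 - r <= z.1 <= p1 + r /\ p1 - r <= z.2 <= p1 + r] (p, p1).
    by split; rewrite /= -ler_distl ?subrr ?normr0 ltW.
  have [[p' p0] [/= hp' _] hm] := contS_max (@square_closed R (p1 - r) (p1 + r)) bb (ex_intro _ _ n0) cF.
  have hm' p'' : `|p'' - p1| <= r -> psi p'' y + x * p'' <= psi p' y + x * p'.
    by move=> h; apply: (hm (p'', p1)); split; rewrite /= -ler_distl ?subrr ?normr0 // ltW.
  have [/= dp' _ _] := inD x y p p' Dz erefl (hm' p (ltW dp)).
  apply: (HW (p := p')); [exact: le_trans (ltW dp') rr0|exact: le_trans (ltW dy) rr0|].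
  apply: (argmin_of_localmax cN bN vN vs cs (d := r - `|p' - p1|)) => //; first by rewrite subr_gt0.
  move=> p'' hp''; apply: hm'.
  by rewrite -(subrKA p') (le_trans (ler_normD _ _)) // -lerBrDr.
have sub : subdiff_img N s E `<=` Y @^-1` D.
  move=> [p' q'] [[x y] Ez]; have Nz := WN (EW _ Ez).
  move: Ez; rewrite /E /= XE => Dz; set p := p1 - _ in Dz.
  move=> /(subdiff_argmin cN bN cs Nz)[am hq].
  have Dp' : D (p', y).
    apply: inD Dz erefl _; rewrite (psi_argmin am).
    by have := psi_le cN bN cs p Nz; lra.
  rewrite YE; set ys := y1 + _.
  have [/= dp dy dq] := Dp'; rewrite mul1r in dq; clear am inD slope EW Dp' Dz.
  have sq y' : q p' y' - q' * y' = q p' ys - q' * ys + C / 2 * (y' - ys) ^+ 2.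
    by rewrite /q /ys; field; lra.
  have lower t : 0 <= t <= 1 -> `|(1 - t) * y + t * ys - y1| <= r ->
      q p' ((1 - t) * y + t * ys) < psi p' ((1 - t) * y + t * ys).
    move=> /andP[t0 t1] hyt; set yt := (1 - t) * y + t * ys in hyt *.
    have h1 := hq yt (Yb (le_trans hyt rr0)).
    have h2 := sq yt; have h3 := sq y.
    have h4 : (yt - ys) ^+ 2 <= (y - ys) ^+ 2 by apply: sqr_mix_le; rewrite t0.
    exact: below_mix C0 h1 h2 h3 h4 dq.
  have lt' : `|ys - y1| < r.
    apply/negPn/negP => hn; have [t ht tr] := crossing dy hn.
    have h2 := edge _ _ (ltW dp) (eq_lexx tr) (or_intror tr).
    by have := lt_trans h2 (lower t ht (eq_lexx tr)); rewrite ltxx.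
  split => //=; rewrite mul1r.
  have := lower 1; rewrite subrr mul0r mul1r add0r; apply; first by rewrite ler01 lexx.
  exact: ltW.
have mE := open_measurable2 oE.
have oB : open (Y @^-1` D) by exact: open_ymap.
have mB := open_measurable2 oB.
have h1 := le_mu_ext_leb2 sub.
rewrite (MA oE EW) (mu_ext_leb2 mB) in h1.
have Ai : 0 < (- A)^-1 by rewrite invr_gt0.
have Ci : 0 < C^-1 by rewrite invr_gt0.
have mD := open_measurable2 oD.
have e1 := leb2_xmap (B / - A) (p1 + (a - B * y1) / - A) Ai mD.
have e2 := leb2_ymap (- B / C) (y1 + (- b + B * p1) / C) Ci mD.
rewrite LE in e1 e2.
rewrite (emul_inv A0 e1) (emul_inv C0 e2) lee_fin ler_pM2r // in h1; lra.
Qed.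

(** The mirror image with the inclusion reversed: each [(p, q')] whose critical [y] lies in [D] is a
    subgradient at some point of [E]. Hence [- C |D| <= A |D|]. *)
Lemma no_touch_below : ~ touch_above (fun p y => - psi p y) p1 y1.
Proof.
move=> [a [b [A [B [C [d [r1 [d0 r10 AC H1]]]]]]]].
(* Half of [r0], so that [psi] is known to be continuous on the closed box over which a minimum is
   taken. *)
pose r := Num.min r1 (r0 / 2).
have r_gt0 : 0 < r by rewrite lt_min r10 divr_gt0.
have rr1 : r <= r1 by rewrite ge_min lexx.
have rr0' : r < r0.
  by apply: (@le_lt_trans _ _ (r0 / 2)); [rewrite ge_min lexx orbT|have := r00; lra].
have rr0 : r <= r0 by exact: ltW.
have Hr p y : `|p - p1| <= r -> `|y - y1| <= r -> - psi p y <= - psi p1 y1 + a * (p - p1) + b * (y - y1)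
   + (A / 2 * (p - p1) ^+ 2 + B * ((p - p1) * (y - y1)) + C / 2 * (y - y1) ^+ 2)
   - d * ((p - p1) ^+ 2 + (y - y1) ^+ 2).
  move=> hp hy; have := H1 (p - p1) (y - y1) (le_trans hp rr1) (le_trans hy rr1).
  by rewrite ![_ + (_ - _)]addrC !subrK.
have rn : `|r| = r by rewrite gtr0_norm.
have A0 : 0 < A.
  have Y1 : slice N y1 by apply: Yb; rewrite subrr normr0 ltW.
  have h1 : (1 - 2^-1) * psi (p1 - r) y1 + 2^-1 * psi (p1 + r) y1 <=
     psi ((1 - 2^-1) * (p1 - r) + 2^-1 * (p1 + r)) y1.
    by apply: (psi_concave cN bN cs _ _ Y1); lra.
  have E : (1 - 2^-1) * (p1 - r) + 2^-1 * (p1 + r) = p1 by field.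
  rewrite E in h1.
  have h2 := Hr (p1 - r) y1; have h3 := Hr (p1 + r) y1.
  rewrite !subrr normr0 (addrAC p1 (- r)) subrr !add0r normrN rn (ltW r_gt0) in h2.
  rewrite !subrr normr0 (addrAC p1 r) subrr !add0r rn (ltW r_gt0) in h3.
  have {}h2 := h2 (lexx _) isT; have {}h3 := h3 (lexx _) isT.
  have r2 : 0 < r ^+ 2 by rewrite exprn_gt0.
  have : 0 <= (A - 2 * d) * r ^+ 2 by lra.
  rewrite pmulr_lge0 //; lra.
have C0 : 0 < - C by lra.
pose e := d * r ^+ 2 / 2.
have e0 : 0 < e by rewrite divr_gt0 // mulr_gt0 // exprn_gt0.
pose q (p y : R) := (- psi p1 y1 - e) + a * (p - p1) + b * (y - y1) + A / 2 * (p - p1) ^+ 2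
   + B * ((p - p1) * (y - y1)) + C / 2 * (y - y1) ^+ 2.
pose D : set pt := [set z | [/\ `|z.1 - p1| < r, `|z.2 - y1| < r & q z.1 z.2 < -1 * psi z.1 z.2]].
have oD : open D by exact: open_region.
have edge p y : `|p - p1| <= r -> `|y - y1| <= r -> `|p - p1| = r \/ `|y - y1| = r ->
   - psi p y < q p y.
  move=> hp hy hr; have h1 := Hr p y hp hy; rewrite /q.
  have h2 : r ^+ 2 <= (p - p1) ^+ 2 + (y - y1) ^+ 2.
    have s1 := sqr_ge0 (p - p1); have s2 := sqr_ge0 (y - y1).
    by case: hr => <-; rewrite real_normK ?num_real //; [rewrite lerDl|rewrite lerDr].
  have h3 := ler_wpM2l (ltW d0) h2.
  have : 0 < d * r ^+ 2 by rewrite mulr_gt0 // exprn_gt0.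
  rewrite /e; lra.
have D1 : D (p1, y1).
  split; rewrite /= ?subrr ?normr0 // /q /= !subrr mulN1r; lra.
have bD z : D z -> `|z.1 - p1| < r /\ `|z.2 - y1| < r by case.
have [L L0 LE] := lebesgue_box_fin r_gt0 oD (ex_intro _ _ D1) bD.
clear Hr H1 rn D1 bD rr1 d0; clearbody r e.
pose X := xmap (A^-1) (- B / A) (p1 + (B * y1 - a) / A).
pose Y := ymap ((- C)^-1) (B / - C) (y1 + (b - B * p1) / - C).
have XE x y : X (x, y) = (p1 + (x - a - B * (y - y1)) / A, y).
  by rewrite /X /xmap /=; congr (_, _); field; lra.
have YE p y : Y (p, y) = (p, y1 - (y + b + B * (p - p1)) / C).
  by rewrite /Y /ymap /=; congr (_, _); field; lra.
pose E := X @^-1` D `&` W.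
have oX : open (X @^-1` D) by exact: open_xmap.
have oE : open E by exact: openI.
have EW : E `<=` W by move=> z [].
have sub : Y @^-1` D `<=` subdiff_img N s E.
  move=> [p q'] /=; rewrite YE; set y := y1 - _ => Dz.
  have [/= dp dy dq] := Dz; rewrite mulN1r in dq.
  have sq y' : q p y' + q' * y' = q p y + q' * y + C / 2 * (y' - y) ^+ 2.
    by rewrite /q /y; field; lra.
  have qle y' : q p y' + q' * y' <= q p y + q' * y.
    by rewrite sq gerDl nmulr_rle0 ?sqr_ge0 //; lra.
  have cG : contS [set z : pt | y1 - r <= z.1 <= y1 + r /\ y1 - r <= z.2 <= y1 + r]
     (fun z => psi p z.1 - q' * z.1).
    apply: contSB; last exact: contSM (@contS_cst _ _ _) (@contS_fst _ _).
    move=> z [z1 _] e1 e10.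
    have z1' : `|z.1 - y1| <= r by rewrite ler_distl.
    have [d1 d10 hd1] := psi_cont_loc p (le_lt_trans z1' rr0') e10.
    exists d1 => // w _ [w1 _]; apply: ltW; apply: hd1 => //.
    by rewrite subrr normr0.
  have bb (z : pt) : y1 - r <= z.1 <= y1 + r /\ y1 - r <= z.2 <= y1 + r ->
      `|z.1| <= `|y1| + r /\ `|z.2| <= `|y1| + r.
    by move=> [? ?]; split; exact: ball_norm.
  have n0 : [set z : pt | y1 - r <= z.1 <= y1 + r /\ y1 - r <= z.2 <= y1 + r] (y, y1).
    by split; rewrite /= -ler_distl ?subrr ?normr0 ltW.
  have [[ys y0] [/= hys _] hm] := contS_min (@square_closed R (y1 - r) (y1 + r)) bb (ex_intro _ _ n0) cG.
  have hm' y'' : `|y'' - y1| <= r -> psi p ys - q' * ys <= psi p y'' - q' * y''.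
    by move=> h; apply: (hm (y'', y1)); split; rewrite /= -ler_distl ?subrr ?normr0 // ltW.
  have ys1 : `|ys - y1| <= r by rewrite ler_distl.
  have hy0 := hm' y (ltW dy); clear cG bb n0 hm hys.
  have qys : q p ys < - psi p ys by have := qle ys; lra.
  have ys2 : `|ys - y1| < r.
    rewrite lt_neqAle ys1 andbT; apply/eqP => E1.
    have h1 := edge p ys (ltW dp) ys1 (or_intror E1).
    by have := lt_trans h1 qys; rewrite ltxx.
  have Yys : slice N ys by apply: Yb; rewrite (le_trans ys1).
  (* The minimum over the box is not on its boundary, so convexity of [psi] in [y] makes it global
     and [q'] a subgradient of [psi p]. *)
  have glob y' : slice N y' -> psi p ys + q' * (y' - ys) <= psi p y'.
    move=> Yy'.
    have [t [t0 t1 near]] := mix_in_ball y' ys2.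
    have ht : 0 <= t <= 1 by rewrite (ltW t0) t1.
    have h1 := psi_convex cN bN vN vs cs p Yys Yy' ht.
    have h2 := hm' _ near.
    exact: chord_support t0 h1 h2.
  have [xs am] := argmin_ex cN bN cs p Yys.
  have Wxs : W (xs, ys).
    by apply: (HW (p := p)) => //; [exact: le_trans (ltW dp) rr0|exact: le_trans ys1 rr0].
  exists (xs, ys); last exact: (argmin_subdiff cN bN cs am glob).
  split => //=; rewrite XE; set p' := p1 + _; clear glob hm' qle sq Wxs hy0.
  have sqp p'' : q p'' ys - xs * p'' = q p' ys - xs * p' + A / 2 * (p'' - p') ^+ 2.
    by rewrite /q /p'; field; lra.
  have Fle p'' : psi p'' ys + xs * p'' <= psi p ys + xs * p.
    by rewrite (psi_argmin am); have := psi_le cN bN cs p'' am.1; lra.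
  have lower t : 0 <= t <= 1 ->
      q ((1 - t) * p + t * p') ys < - psi ((1 - t) * p + t * p') ys.
    move=> /andP[t0 t1]; set pt := (1 - t) * p + t * p'.
    have h1 : - psi p ys + xs * (pt - p) <= - psi pt ys by have := Fle pt; lra.
    have h2 := sqp pt; have h3 := sqp p.
    have h4 : (pt - p') ^+ 2 <= (p - p') ^+ 2 by apply: sqr_mix_le; rewrite t0.
    exact: below_mix A0 h1 h2 h3 h4 qys.
  have lt' : `|p' - p1| < r.
    apply/negPn/negP => hn; have [t ht tr] := crossing dp hn.
    have h2 := edge _ _ (eq_lexx tr) ys1 (or_introl tr).
    by have := lt_trans h2 (lower t ht); rewrite ltxx.
  split => //=; rewrite mulN1r.
  by have := lower 1; rewrite subrr mul0r mul1r add0r; apply; rewrite ler01 lexx.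
have mE := open_measurable2 oE.
have mX := open_measurable2 oX.
have oB : open (Y @^-1` D) by exact: open_ymap.
have mB := open_measurable2 oB.
have h1 := le_mu_ext_leb2 sub.
rewrite (MA oE EW) (mu_ext_leb2 mB) in h1.
have h2 : (leb2 E <= leb2 (X @^-1` D))%E.
  by apply: (@le_measure _ _ _ (leb2m R)); rewrite ?inE // => z [].
have {h1 h2} h3 := le_trans h1 h2.
have Ai : 0 < A^-1 by rewrite invr_gt0.
have Ci : 0 < (- C)^-1 by rewrite invr_gt0.
have mD := open_measurable2 oD.
have e1 := leb2_xmap (- B / A) (p1 + (B * y1 - a) / A) Ai mD.
have e2 := leb2_ymap (B / - C) (y1 + (b - B * p1) / - C) Ci mD.
rewrite LE in e1 e2.
rewrite (emul_inv A0 e1) (emul_inv C0 e2) lee_fin ler_pM2r // in h3; lra.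
Qed.

End Touch.

(** * Harmonicity up to the line [y = 0] and the slope function *)

Section Local.
Variable R : realType.
Local Notation pt := (pt R).

Lemma touch_above_ext (f g : R -> R -> R) h0 y0 h1 y1 c d : 0 < d ->
  (forall h k, `|h| <= d -> `|k| <= d -> f (h0 + h) (y0 + k) = g (h1 + h) (y1 + k) + c) ->
  touch_above f h0 y0 -> touch_above g h1 y1.
Proof.
move=> d0 hfg [a [b [A [B [C [e [p [e0 p0 AC H]]]]]]]].
exists a, b, A, B, C, e, (Num.min p d); split => //; first by rewrite lt_min p0.
move=> h k; rewrite !le_min => /andP[h2 h3] /andP[k2 k3].
have := H h k h2 k2; rewrite (hfg h k h3 k3).
have := hfg 0 0; rewrite normr0 !addr0 (ltW d0) => /(_ isT isT) ->; lra.
Qed.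

Variables (N : set pt) (s : pt -> R) (K : R).
Hypothesis (cN : closed N) (bN : forall z, N z -> `|z.1| <= K /\ `|z.2| <= K).
Hypothesis (vN : Defs.convex_set N) (vs : convex_on N s) (cs : contS N s).
Variable W : set pt.
Hypothesis (oW : open W) (WN : W `<=` N).
Hypothesis MA : forall E, open E -> E `<=` W ->
  mu_ext (@leb2 R) (subdiff_img N s E) = leb2 E.
Hypothesis N0 : N (0, 0).
Variables (p1 dl : R) (z1 : pt).
Hypothesis (dl0 : 0 < dl) (Nz1 : N z1) (z10 : 0 < z1.2).
(* Along the line [y = 0] the point [0] is the only minimiser, with room for varying slopes. *)
Hypothesis Cond : forall p, `|p - p1| < dl -> forall x, N (x, 0) -> x != 0 ->
  s (0, 0) < s (x, 0) - p * x.

Local Notation psi := (psi N s).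

Lemma scaled_point y : 0 < y <= z1.2 -> N (y / z1.2 * z1.1, y) /\
  s (y / z1.2 * z1.1, y) <= (1 - y / z1.2) * s (0, 0) + y / z1.2 * s z1.
Proof.
move=> /andP[y0 y1].
have ht : 0 <= y / z1.2 <= 1.
  by rewrite divr_ge0 ?(ltW y0) ?(ltW z10) //= ler_pdivrMr // mul1r.
have E : y = (1 - y / z1.2) * 0 + y / z1.2 * z1.2 by rewrite mulr0 add0r mulfVK // gt_eqF.
have E1 : y / z1.2 * z1.1 = (1 - y / z1.2) * 0 + y / z1.2 * z1.1 by rewrite mulr0 add0r.
have Nz1' : N (z1.1, z1.2) by case: (z1) Nz1.
split.
  by rewrite {2}E E1; exact: (N_mix vN N0 Nz1' ht).
have := s_mix vs N0 Nz1' ht; rewrite -E -E1; by case: (z1).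
Qed.

Lemma slice_small y : 0 <= y <= z1.2 -> slice N y.
Proof.
rewrite le_eqVlt => /andP[/orP[/eqP<-|y0] y1]; first by exists 0.
by exists (y / z1.2 * z1.1); apply: (scaled_point _).1; rewrite y0.
Qed.

(** The competitor at height [y] is taken on the segment from the origin to [z1]. *)
Lemma psi_upper : exists2 C, 0 < C & forall p y, `|p - p1| < dl -> 0 < y <= z1.2 ->
  psi p y <= s (0, 0) + C * y.
Proof.
pose D := `|s z1 - s (0, 0)| + (`|p1| + dl) * `|z1.1|.
have D0 : 0 <= D by rewrite addr_ge0 // mulr_ge0 // addr_ge0 // ltW.
exists ((D + 1) / z1.2); first by rewrite divr_gt0 // ltr_wpDl.
move=> p y hp hy; have [h1 h2] := scaled_point hy.
apply: (le_trans (psi_le cN bN cs p h1)); have /andP[y0 y1] := hy.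
set t := y / z1.2 in h1 h2 *.
have t0 : 0 < t by rewrite divr_gt0.
have -> : (D + 1) / z1.2 * y = (D + 1) * t by rewrite /t; ring.
have h3 : - p * z1.1 <= (`|p1| + dl) * `|z1.1|.
  rewrite (le_trans (ler_norm _)) // normrM normrN ler_wpM2r //.
  by rewrite -[p](subrK p1) addrC (le_trans (ler_normD _ _)) // lerD2l ltW.
have h4 : s z1 - s (0, 0) <= `|s z1 - s (0, 0)| by exact: ler_norm.
have h5 : t * (s z1 - s (0, 0) - p * z1.1) <= t * D.
  by rewrite ler_wpM2l ?(ltW t0) // /D; lra.
nra.
Qed.

(** Compactness: on the axis, away from the origin, the penalised function [g] is bounded below by
    some [m > 0], so its points with [g <= m / 2] stay at positive height, whereas [psi] exceeds the
    value at the origin by at most [C y]. Low minimisers are thus close to the origin, uniformly in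
    the slope. *)
Lemma argmin_near r : 0 < r -> exists2 eta, 0 < eta & forall p y x, `|p - p1| <= dl / 2 ->
  0 < y < eta -> argmin N s p y x -> near2 r (0, 0) (x, y).
Proof.
move=> r0; have dlp := dl0; have z1p := z10.
(* The term [dl / 2 * |z.1|] covers all slopes within [dl / 2] of [p1] at once; [Cond] at
   [p1 + dl / 2] and at [p1 - dl / 2] makes [g] positive on the axis off the origin. *)
pose g (z : pt) := s z - p1 * z.1 - dl / 2 * `|z.1| - s (0, 0).
have cg (S : set pt) : S `<=` N -> contS S g.
  move=> SN; have cc c : contS S (fun=> c) by exact: contS_cst.
  have c1 := @contS_fst _ S.
  have ca : contS S (fun z => `|z.1|).
    move=> z _ e e0; exists e => // w _ [h _].
    by rewrite (le_trans (ler_dist_dist _ _)) // ltW.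
  exact: (contSB (contSB (contSB (contS_sub SN cs) (contSM (cc p1) c1)) (contSM (cc (dl / 2)) ca)) (cc _)).
have clos (P : set pt) : closed P -> closed (N `&` P) by move=> h; exact: closedI.
have far : closed [set z : pt | r <= `|z.1|].
  have -> : [set z : pt | r <= `|z.1|] = [set z : pt | - `|z.1| <= - r].
    by apply/seteqP; split => z /=; rewrite lerN2.
  apply: closed_le => z _ e e0; exists e => // w _ [h _].
  rewrite -opprD normrN (le_trans (ler_dist_dist _ _)) // ltW //.
have ypos : closed [set z : pt | 0 <= z.2].
  have -> : [set z : pt | 0 <= z.2] = [set z : pt | - z.2 <= 0].
    by apply/seteqP; split => z /=; rewrite oppr_le0.
  by apply: closed_le; apply: contSN; exact: contS_snd.
have yneg : closed [set z : pt | z.2 <= 0] by apply: closed_le; exact: contS_snd.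
pose S0 := N `&` ([set z : pt | r <= `|z.1|] `&` ([set z : pt | 0 <= z.2] `&` [set z : pt | z.2 <= 0])).
have cS0 : closed S0 by apply: clos; apply: closedI => //; exact: closedI.
have [m m0 hm] : exists2 m, 0 < m & forall z, S0 z -> m <= g z.
  have [S0n|S0e] := pselect (S0 !=set0); last first.
    by exists 1 => // z Sz; exfalso; apply: S0e; exists z.
  have [z Sz hz] := contS_min cS0 (fun z (Sz : S0 z) => bN Sz.1) S0n (cg S0 (fun z (Sz : S0 z) => Sz.1)).
  exists (g z) => //; case: Sz => Nz [/= rz [y1 y2]].
  have yz : z.2 = 0 by apply/eqP; rewrite eq_le y1 y2.
  have zE : z = (z.1, 0) by rewrite -yz; case: (z).
  have z0 : z.1 != 0 by rewrite -normr_gt0 (lt_le_trans r0).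
  rewrite zE in Nz; rewrite /g {1}zE.
  have [h|h] := leP 0 z.1.
    have := Cond (p := p1 + dl / 2) _ Nz z0; rewrite addrAC subrr add0r gtr0_norm ?divr_gt0 //.
    by move=> /(_ ltac:(lra)); rewrite ger0_norm //; lra.
  have := Cond (p := p1 - dl / 2) _ Nz z0; rewrite addrAC subrr add0r normrN gtr0_norm ?divr_gt0 //.
  by move=> /(_ ltac:(lra)); rewrite ltr0_norm //; lra.
pose S1 := N `&` ([set z : pt | r <= `|z.1|] `&` ([set z : pt | 0 <= z.2] `&` [set z : pt | g z <= m / 2])).
have cS1 : closed S1.
  apply/closed_near2 => z hz.
  have NN : (N `&` ([set z : pt | r <= `|z.1|] `&` [set z : pt | 0 <= z.2])) z.
    apply: ((closed_near2 _).1 (clos _ (closedI far ypos))) => d d0.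
    by have [w [Nw [rw [yw _]]] wz] := hz d d0; exists w.
  case: NN => Nz [rz yz]; split => //; split => //; split => //=.
  rewrite leNgt; apply/negP => h.
  have gp : 0 < g z - m / 2 by rewrite subr_gt0.
  have [d d0 hd] := contS_near (cg N (fun z h => h)) Nz gp.
  have [w [Nw [_ [_ /= gw]]] wz] := hz d d0; have := hd w Nw wz.
  by rewrite ltr_norml => /andP[]; lra.
have [e1 e10 he1] : exists2 e1, 0 < e1 & forall z, S1 z -> e1 <= z.2.
  have [S1n|S1e] := pselect (S1 !=set0); last first.
    by exists 1 => // z Sz; exfalso; apply: S1e; exists z.
  have [z Sz hz] := contS_min cS1 (fun z (Sz : S1 z) => bN Sz.1) S1n (@contS_snd _ _).
  exists z.2 => //; case: Sz => Nz [/= rz [/= y1 gz]].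
  rewrite lt_neqAle y1 andbT; apply/eqP => yE.
  have : m <= g z by apply: hm; split => //; split => //; split => //=; rewrite -yE.
  by have := m0; lra.
have [C C0 hC] := psi_upper.
exists (Num.min (Num.min e1 (m / (2 * C))) (Num.min r z1.2)).
  by rewrite !lt_min e10 r0 z10 divr_gt0 // mulr_gt0.
move=> p y x hp /andP[y0]; rewrite !lt_min => /andP[/andP[ye1 yC] /andP[yr yz1]] am.
split => /=; rewrite subr0; last by rewrite gtr0_norm.
rewrite ltNge; apply/negP => rx.
have pdl : `|p - p1| < dl by rewrite (le_lt_trans hp) //; lra.
have y1 : 0 < y <= z1.2 by rewrite y0 ltW.
have h1 := hC p y pdl y1; rewrite (psi_argmin am) in h1.
rewrite ltr_pdivlMr ?mulr_gt0 // in yC.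
have S1z : S1 (x, y).
  split; [exact: am.1|split => //; split => /=; first exact: ltW].
  rewrite /g /=.
  have h2 : (p - p1) * x <= dl / 2 * `|x|.
    by rewrite (le_trans (ler_norm _)) // normrM ler_wpM2r.
  lra.
by have := he1 _ S1z; rewrite /= leNgt ye1.
Qed.

Lemma psi_lower e : 0 < e -> exists2 eta, 0 < eta & forall p y, `|p - p1| <= dl / 2 ->
  0 < y < eta -> s (0, 0) - e <= psi p y.
Proof.
move=> e0; have dlp := dl0; have z1p := z10; have e2 : 0 < e / 2 by lra.
have [d d0 hd] := contS_near cs N0 e2.
have P0 : 0 < `|p1| + dl by rewrite ltr_wpDl.
pose r := Num.min d (e / (2 * (`|p1| + dl))).
have r0 : 0 < r by rewrite lt_min d0 divr_gt0 // mulr_gt0.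
have [eta eta0 h] := argmin_near r0.
exists (Num.min eta z1.2); first by rewrite lt_min eta0.
move=> p y hp /andP[y0]; rewrite lt_min => /andP[ye yz].
have Yy : slice N y by apply: slice_small; rewrite (ltW y0) (ltW yz).
have [x am] := argmin_ex cN bN cs p Yy; rewrite (psi_argmin am).
have hy : 0 < y < eta by rewrite y0 ye.
have nr := h p y x hp hy am.
have nd : near2 d (0, 0) (x, y) by apply: near2_le nr; rewrite ge_min lexx.
have := hd _ am.1 nd; rewrite ltr_norml => /andP[h1 _].
have [/= xr _] := nr; rewrite subr0 lt_min in xr; have /andP[_ xr2] := xr.
rewrite ltr_pdivlMr ?mulr_gt0 // in xr2.
have : p * x <= (`|p1| + dl) * `|x|.
  rewrite (le_trans (ler_norm _)) // normrM ler_wpM2r //.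
  rewrite -[p](subrK p1) addrC (le_trans (ler_normD _ _)) // lerD2l; lra.
lra.
Qed.

Variable rho : R.
Hypothesis rho0 : 0 < rho.
Hypothesis HW : forall p y x, `|p - p1| < dl -> 0 < y -> near2 rho (0, 0) (x, y) ->
  argmin N s p y x -> W (x, y).

(** The slope at [y = 0] decides about subgradients because [s] is convex along segments from the
    origin: a plane through the value at the origin lies below [s] for [y > 0] as soon as it does so
    near the axis. *)
Theorem local_analytic : exists H, wan H p1 /\ exists2 d, 0 < d & forall p, `|p - p1| < d ->
  forall q, q <= H p <-> forall x y, N (x, y) -> 0 < y -> s (0, 0) + p * x + q * y <= s (x, y).
Proof.
have dlp := dl0; have z1p := z10; have rhop := rho0.
have [eta eta0 heta] := argmin_near rho0.
pose r := Num.min (dl / 4) (Num.min (eta / 2) (z1.2 / 2)).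
have r0 : 0 < r by rewrite !lt_min !divr_gt0.
have rdl : r <= dl / 4 by rewrite ge_min lexx.
have reta : r <= eta / 2 by rewrite !ge_min lexx orbT.
have rz : r <= z1.2 / 2 by rewrite !ge_min lexx !orbT.
have rd2 : r <= dl / 2 by lra.
have rz1 : r <= z1.2 by lra.
have dl2 : dl / 2 < dl by lra.
clearbody r.
(* The slope is shifted so that [p1] becomes [0]. The value [0] on the axis is the limit of
   [psi - s (0, 0)], by [psi_upper] and [psi_lower]. *)
pose f (h y : R) := if y <= 0 then 0 else psi (p1 + h) y - s (0, 0).
have fE h y : 0 < y -> f h y = psi (p1 + h) y - s (0, 0).
  by move=> y0; rewrite /f leNgt y0.
have f0 h : `|h| <= r -> f h 0 = 0 by rewrite /f lexx.
have small (h y : R) : h ^+ 2 + y ^+ 2 <= r ^+ 2 -> `|h| <= r /\ `|y| <= r.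
  move=> hy; split; rewrite -ler_sqr ?nnegrE ?(ltW r0) // real_normK ?num_real //.
    by rewrite (le_trans _ hy) // lerDl sqr_ge0.
  by rewrite (le_trans _ hy) // lerDr sqr_ge0.
have cf : contS (halfdisc r) (fun z => f z.1 z.2).
  move=> [h y] [/= hy y0] e e0.
  have [hr yr] := small _ _ hy.
  move: y0; rewrite le_eqVlt => /orP[/eqP yE|y0].
    have [C C0 hC] := psi_upper; have [e1 e10 he1] := psi_lower e0.
    exists (Num.min e1 (e / C)); first by rewrite lt_min e10 divr_gt0.
    move=> [h' y'] [/= hy' y0'] [_ /=]; rewrite -yE subr0 => yd.
    rewrite /f /= lexx subr0; case: (leP y' 0) => [_|y'0]; first by rewrite normr0 ltW.
    have [hr' yr'] := small _ _ hy'.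
    rewrite gtr0_norm // in yd yr'; move: yd; rewrite lt_min => /andP[yd1 yd2].
    have ph : `|p1 + h' - p1| <= dl / 2 by rewrite addrAC subrr add0r (le_trans hr').
    rewrite ltr_pdivlMr // in yd2.
    have hd : `|p1 + h' - p1| < dl by rewrite (le_lt_trans ph) // gtr_pMr // invf_lt1 // ltr1n.
    have h1 := hC (p1 + h') y' hd ltac:(by rewrite y'0 (le_trans yr')).
    have h2 := he1 (p1 + h') y' ph ltac:(by rewrite y'0 yd1).
    by rewrite ler_norml; lra.
  rewrite gtr0_norm // in yr.
  have a0 : 0 < y / 2 by lra.
  have s1 : slice N (y - y / 2) by apply: slice_small; lra.
  have s2 : slice N (y + y / 2) by apply: slice_small; lra.
  have [d d0 hd] := psi_cont cN bN vN vs cs (p1 + h) a0 s1 s2 e0.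
  exists (Num.min d (y / 2)); first by rewrite lt_min d0.
  move=> [h' y'] _ [/=]; rewrite !lt_min => /andP[h1 _] /andP[h2 h3].
  have y'0 : 0 < y' by move: h3; rewrite ltr_norml => /andP[]; lra.
  rewrite !fE //.
  have -> : psi (p1 + h') y' - s (0, 0) - (psi (p1 + h) y - s (0, 0)) = psi (p1 + h') y' - psi (p1 + h) y by ring.
  apply: hd => //.
  by have -> : p1 + h' - (p1 + h) = h' - h by ring.
have touch (h y : R) : h ^+ 2 + y ^+ 2 < r ^+ 2 -> 0 < y ->
    ~ touch_above f h y /\ ~ touch_above (fun h y => - f h y) h y.
  clear cf f0; move=> hy y0; have [hr yr] := small _ _ (ltW hy); clear small; rewrite gtr0_norm // in yr.
  pose r1 := Num.min (dl / 4) (y / 2).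
  have r10 : 0 < r1 by rewrite lt_min !divr_gt0.
  have r1d : r1 <= dl / 4 by rewrite ge_min lexx.
  have r1y : r1 <= y / 2 by rewrite ge_min lexx orbT.
  have Yb y' : `|y' - y| <= r1 -> slice N y'.
    by rewrite ler_norml => /andP[? ?]; apply: slice_small; lra.
  have HW' p y' x : `|p - (p1 + h)| <= r1 -> `|y' - y| <= r1 -> argmin N s p y' x -> W (x, y').
    move=> hp; rewrite ler_norml => /andP[g1 g2] am.
    have pp : `|p - p1| <= dl / 2.
      have -> : p - p1 = (p - (p1 + h)) + h by ring.
      by rewrite (le_trans (ler_normD _ _)) //; lra.
    apply: (HW (p := p)) => //; [exact: le_lt_trans dl2|lra|].
    by apply: (heta p y' x pp _ am); lra.
  have ext h' k : `|h'| <= y / 2 -> `|k| <= y / 2 -> f (h + h') (y + k) = psi (p1 + h + h') (y + k) + - s (0, 0).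
    by move=> _; rewrite ler_norml => /andP[? ?]; rewrite fE ?addrA //; lra.
  have y2 : 0 < y / 2 by lra.
  split.
    move=> /(touch_above_ext y2 ext).
    exact: (no_touch_above cN bN vN vs cs WN MA r10 Yb HW').
  have ext' h' k : `|h'| <= y / 2 -> `|k| <= y / 2 -> - f (h + h') (y + k) = - psi (p1 + h + h') (y + k) + s (0, 0).
    by move=> ? ?; rewrite ext //; ring.
  move=> /(touch_above_ext (f := fun h y => - f h y) (g := fun h y => - psi h y) y2 ext').
  exact: (no_touch_below cN bN vN vs cs oW MA r10 Yb HW').
have [H [wH [d d0 hd]]] := halfdisc_analytic r0 cf f0 (fun h y a b => (touch h y a b).1) (fun h y a b => (touch h y a b).2).
clear touch cf f0 heta small.
exists (fun p => H (p - p1)); split.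
  apply: (wan_comp (f := fun p => p - p1) (g := H)); last by rewrite subrr.
  by apply: wanB; [exact: wan_id|exact: wan_cst].
exists (Num.min d r); first by rewrite lt_min d0.
move=> p; rewrite lt_min => /andP[pd pr] q.
have pE : p1 + (p - p1) = p by ring.
split=> [qH x y Nxy y0|hq].
  apply/ler_addgt0Pr => e e0.
  have [eta1 eta10 he] := hd _ (ltW pd) (e / y) (divr_gt0 e0 y0).
  (* The point [(x, y)] is pulled towards the origin to the height [t y < eta1], where the slope
     estimate holds. *)
  pose t := Num.min 1 (eta1 / (2 * y)).
  have t0 : 0 < t by rewrite lt_min ltr01 divr_gt0 // mulr_gt0.
  have t1 : t <= 1 by rewrite ge_min lexx.
  have te : t * (2 * y) <= eta1 by rewrite -ler_pdivlMr ?mulr_gt0 // ge_min lexx orbT.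
  have ty0 : 0 < t * y by rewrite mulr_gt0.
  have ty : 0 < t * y < eta1 by rewrite ty0 /= (lt_le_trans _ te) // mulrCA ltr_pMl // ltr1n.
  have := he _ ty; rewrite fE // pE ler_norml => /andP[h1 _].
  have ht : 0 <= t <= 1 by rewrite (ltW t0) t1.
  have Nt := N_mix vN N0 Nxy ht; have st := s_mix vs N0 Nxy ht.
  rewrite !mulr0 !add0r in Nt st.
  have h2 := psi_le cN bN cs p Nt.
  have h3 : e / y * (t * y) = t * e by field; rewrite gt_eqF.
  rewrite h3 in h1.
  have h4 : t * y * q <= t * y * H (p - p1) by rewrite ler_wpM2l // ltW.
  clear ht Nt te ty0 ty t1 qH he; rewrite -(ler_pM2l t0); lra.
apply/ler_addgt0Pr => e e0.
have [eta1 eta10 he] := hd _ (ltW pd) e e0.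
pose y := Num.min (eta1 / 2) z1.2.
have y0 : 0 < y by rewrite lt_min z10 divr_gt0.
have ye : 0 < y < eta1 by rewrite y0 /= (le_lt_trans (y := eta1 / 2)) ?ge_min ?lexx // ltr_pdivrMr // ltr_pMr // ltr1n.
have yz : y <= z1.2 by rewrite ge_min lexx orbT.
have := he _ ye; rewrite fE // pE ler_norml => /andP[_ h1].
have Yy : slice N y by apply: slice_small; rewrite (ltW y0) yz.
have [x am] := argmin_ex cN bN cs p Yy.
have h2 := hq x y am.1 y0; rewrite (psi_argmin am) in h1.
rewrite -(ler_pM2l y0); lra.
Qed.

End Local.

(** * Absence of subgradients inside affine edges *)

Section Edge.
Variable R : realType.
Local Notation pt := (pt R).
Lemma open_rect (a b c d : R) : open ([set` `]a, b[] `*` [set` `]c, d[] : set pt).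
Proof.
apply: open_near2 => z [/=]; rewrite !in_itv /= => /andP[h1 h2] /andP[h3 h4].
exists (Num.min (Num.min (z.1 - a) (b - z.1)) (Num.min (z.2 - c) (d - z.2))).
  by rewrite !lt_min !subr_gt0 h1 h2 h3 h4.
move=> w []; rewrite !lt_min !ltr_norml => /andP[/andP[/andP[? ?] /andP[? ?]] _].
move=> /andP[_ /andP[/andP[? ?] /andP[? ?]]].
by split; rewrite /= in_itv /=; lra.
Qed.

Variables (N : set pt) (s : pt -> R).
Hypothesis (vs : convex_on N s).
Variable W : set pt.
Hypothesis (WN : W `<=` N).
Hypothesis MA : forall E, open E -> E `<=` W ->
  mu_ext (@leb2 R) (subdiff_img N s E) = leb2 E.
Variables (l eta m : R).
Hypothesis (l0 : 0 < l) (eta0 : 0 < eta).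
Hypothesis edge : forall x, `|x| <= l -> N (x, 0) /\ s (x, 0) = s (0, 0) + m * x.
Hypothesis boxW : forall x y, `|x| < l -> 0 < y < eta -> W (x, y).

(* A supporting plane at [0] would make the normal slope of [s] constant along the edge,
   so thin strips near the edge would have gradient images of too small area. *)
Lemma edge_empty (xi : pt) : ~ subdiff N s (0, 0) xi.
Proof.
case: xi => p q hxi; have lp := l0; have etap := eta0.
have lhalf : l / 2 < l by lra.
have l00 : `|0 : R| <= l by rewrite normr0 ltW.
have sup x y : N (x, y) -> s (0, 0) + p * x + q * y <= s (x, y).
  by move=> Nz; have := hxi _ Nz; rewrite /dotp /= !subr0 addrA.
have mp : m = p.
  have l1 : `|l| <= l by rewrite gtr0_norm.
  have l2 : `|- l| <= l by rewrite normrN gtr0_norm.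
  have [N1 e1] := edge l1; have [N2 e2] := edge l2.
  have h1 := sup _ _ N1; have h2 := sup _ _ N2; rewrite e1 in h1; rewrite e2 in h2.
  by apply: (mulIf (lt0r_neq0 l0)); lra.
pose f x y := s (x, y) - s (0, 0) - p * x - q * y.
have f0 x y : N (x, y) -> 0 <= f x y by move=> /sup; rewrite /f; lra.
have fe x : `|x| <= l -> f x 0 = 0 by move=> /edge[_ E]; rewrite /f E mp; ring.
have Nb x y : `|x| < l -> 0 < y < eta -> N (x, y) by move=> h1 h2; apply: WN; exact: boxW.
have fmix x y x' y' t : N (x, y) -> N (x', y') -> 0 <= t <= 1 ->
    f ((1 - t) * x + t * x') ((1 - t) * y + t * y') <= (1 - t) * f x y + t * f x' y'.
  by move=> h h' ht; have := s_mix vs h h' ht; rewrite /f; lra.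
have cone x y x' t : N (x, y) -> `|x'| <= l -> 0 <= t <= 1 ->
    f ((1 - t) * x + t * x') ((1 - t) * y) <= (1 - t) * f x y.
  move=> h h' ht; have := fmix _ _ _ _ _ h (edge h').1 ht.
  by rewrite mulr0 addr0 (fe _ h') mulr0 addr0.
have l0' : `|0 : R| < l by rewrite normr0.
pose S := [set f 0 y / y | y in [set y | 0 < y < eta]].
have S0 : S !=set0 by exists (f 0 (eta / 2) / (eta / 2)), (eta / 2) => //=; lra.
have Slb : lbound S 0.
  move=> _ [y /= hy <-]; have /andP[y0 _] := hy.
  by rewrite divr_ge0 ?(ltW y0) // f0 //; exact: Nb.
have Sinf : has_inf S by split => //; exists 0.
(* [d] is the normal slope at the edge. With tolerance [k] the subgradients over the strip lie in a
   rectangle of area [32 k^2 e / l], against the area [l e / 2] of the strip; [k = l / 16] makes the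
   former [l e / 8]. *)
pose d := inf S; pose k := l / 16.
have k0 : 0 < k by rewrite divr_gt0.
have [_ [y1 /= hy1 <-] dk] := inf_adherent k0 Sinf.
have /andP[y10 y1e] := hy1.
have dle y : 0 < y < eta -> d * y <= f 0 y.
  move=> hy; have /andP[y0 _] := hy; rewrite -ler_pdivlMr //.
  by apply: ge_inf; [exists 0|exists y].
have f0y y : 0 < y <= y1 -> f 0 y <= (d + k) * y.
  move=> /andP[y0 yy].
  have ht : 0 <= 1 - y / y1 <= 1.
    by rewrite subr_ge0 ler_pdivrMr // mul1r yy /= gerBl divr_ge0 // ltW.
  have := cone 0 y1 0 _ (Nb _ _ l0' hy1) l00 ht.
  rewrite !mulr0 addr0 subKr mulfVK ?gt_eqF // => h; apply: (le_trans h).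
  rewrite ltr_pdivrMr // in dk.
  have -> : (d + k) * y = y / y1 * ((d + k) * y1) by field; rewrite gt_eqF.
  by rewrite ler_wpM2l ?divr_ge0 ?(ltW y0) ?(ltW y10) // ltW.
clear hxi sup mp l00 fmix S0 Slb Sinf dk; clearbody d; clear S.
have sgn (u : R) : exists e : R, (e = 1 \/ e = -1) /\ u = e * `|u|.
  have [h|h] := leP 0 u; [exists 1|exists (-1)]; split; rewrite ?mul1r ?mulN1r; auto.
  by rewrite ger0_norm.
  by rewrite ltr0_norm // opprK.
have nl (e : R) : e = 1 \/ e = -1 -> `|e * l| <= l.
  by move=> [->|->]; rewrite ?mul1r ?mulN1r ?normrN gtr0_norm.
(* The bounds on the line [x = 0] spread sideways by convexity: [(u, y)] lies between a higher point
   of that line and an end of the edge. For [lo], a lower point of the line lies between [(u, y)]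
   and the opposite end. *)
have up u y : `|u| <= l / 2 -> 0 < y <= y1 / 2 -> f u y <= (d + k) * y.
  move=> hu /andP[y0 yy]; have [e [he uE]] := sgn u.
  pose t := `|u| / l.
  have t0 : 0 <= t by rewrite divr_ge0 // ltW.
  have t2 : t <= 1 / 2 by rewrite ler_pdivrMr //; lra.
  have t1 : 0 < 1 - t by lra.
  have Y1 : 0 < y / (1 - t) <= y1.
    rewrite divr_gt0 //= ler_pdivrMr //; nra.
  have Y2 : 0 < y / (1 - t) < eta by case/andP: Y1 => -> h /=; exact: le_lt_trans h y1e.
  have ht : 0 <= t <= 1 by lra.
  have := cone 0 _ (e * l) t (Nb _ _ l0' Y2) (nl _ he) ht.
  have -> : (1 - t) * 0 + t * (e * l) = u.
    by rewrite mulr0 add0r uE /t; field; rewrite gt_eqF.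
  have -> : (1 - t) * (y / (1 - t)) = y by field; rewrite gt_eqF.
  move=> h; apply: (le_trans h).
  have h2 := f0y _ Y1.
  have := ler_wpM2l (ltW t1) h2.
  by have -> : (1 - t) * ((d + k) * (y / (1 - t))) = (d + k) * y by field; rewrite gt_eqF.
have lo u y : `|u| <= l / 2 -> 0 < y < eta -> d * y <= f u y.
  move=> hu hy; have /andP[y0 yy] := hy; have [e [he uE]] := sgn u.
  have u0 := normr_ge0 u.
  pose t := `|u| / (`|u| + l).
  have q0 : 0 < `|u| + l by lra.
  have t0 : 0 <= t by rewrite divr_ge0 // ltW.
  have t1 : t < 1 by rewrite ltr_pdivrMr // mul1r ltrDl.
  have he' : - e = 1 \/ - e = -1 by case: he => ->; [right|left]; rewrite ?opprK.
  have ht : 0 <= t <= 1 by rewrite t0 ltW.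
  have ul : `|u| < l by exact: le_lt_trans hu lhalf.
  have := cone u y (- e * l) t (Nb _ _ ul hy) (nl _ he') ht.
  have -> : (1 - t) * u + t * (- e * l) = 0.
    by rewrite [in X in (1 - t) * X]uE /t; field; rewrite gt_eqF.
  have t10 : 0 < 1 - t by rewrite subr_gt0.
  have hy' : 0 < (1 - t) * y < eta by rewrite mulr_gt0 //=; nra.
  have h2 := dle _ hy'.
  by move=> h; rewrite -(ler_pM2l t10); lra.
clear cone sgn nl f0y dle f0 l0' hy1.
(* Heights in the strip are below [2 e], so that even [2 y] stays within the range [y1 / 2] of the
   upper bound. *)
pose e := Num.min (y1 / 8) (eta / 8).
have e0 : 0 < e by rewrite lt_min !divr_gt0.
have ey : e <= y1 / 8 by rewrite ge_min lexx.
have ee : e <= eta / 8 by rewrite ge_min lexx orbT.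
pose E : set pt := [set` `]- (l / 4), l / 4[] `*` [set` `]e, 2 * e[].
have oE : open E by exact: open_rect.
have EW : E `<=` W.
  move=> [x y] [/=]; rewrite !in_itv /= => /andP[x1 x2] /andP[h1 h2].
  by apply: boxW; [rewrite ltr_norml|]; lra.
pose B : set pt := [set` `[p - 8 * k * e / l, p + 8 * k * e / l]] `*` [set` `[q + d, q + (d + 2 * k)]].
have sub : subdiff_img N s E `<=` B.
  move=> [P Q] [[x y] [/=]]; rewrite !in_itv /= => /andP[x1 x2] /andP[h1 h2] hs.
  have sg x' y' : N (x', y') -> f x y + (P - p) * (x' - x) + (Q - q) * (y' - y) <= f x' y'.
    by move=> h; have := hs _ h; rewrite /dotp /f /=; lra.
  have hx : `|x| <= l / 2 by rewrite ler_norml; lra.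
  have xl : `|x| < l := le_lt_trans hx lhalf.
  have hy : 0 < y < eta by lra.
  have y2 : 0 < y <= y1 / 2 by lra.
  have L1 := lo _ _ hx hy; clear lo hs; clearbody k f.
  have side x' : `|x'| <= l / 2 -> (P - p) * (x' - x) <= 2 * k * e.
    move=> hx'; have Nx' : N (x', y) by apply: Nb => //; exact: le_lt_trans lhalf.
    have := sg _ _ Nx'; have := up _ _ hx' y2; nra.
  have s1 := side (x + l / 4) ltac:(by rewrite ler_norml; lra).
  have s2 := side (x - l / 4) ltac:(by rewrite ler_norml; lra).
  have E1 : 8 * k * e / l * l = 8 * k * e by rewrite mulfVK // gt_eqF.
  have r1 : P - p <= 8 * k * e / l by rewrite -(ler_pM2r l0); lra.
  have r2 : - (8 * k * e / l) <= P - p by rewrite -(ler_pM2r l0); lra.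
  clear s1 s2 side E1.
  have N2 : N (x, 2 * y) by apply: Nb => //; lra.
  have y22 : 0 < 2 * y <= y1 / 2 by lra.
  have r3 : (Q - q) * y <= (d + 2 * k) * y by have := sg _ _ N2; have := up _ _ hx y22; lra.
  have [Ne _] := edge (ltW xl).
  have r4 : d * y <= (Q - q) * y by have := sg _ _ Ne; rewrite fe ?(ltW xl) //; lra.
  have y0 : 0 < y by case/andP: hy.
  rewrite ler_pM2r // in r3; rewrite ler_pM2r // in r4.
  clear - r1 r2 r3 r4 vs MA WN edge boxW l0 eta0.
  by split; rewrite /= in_itv /=; lra.
clear up lo fe Nb.
have h1 := le_mu_ext_leb2 sub.
have mB : measurable B by apply: measurableX; exact: measurable_itv.
have ke : 0 < 8 * k * e / l by rewrite divr_gt0 // !mulr_gt0.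
rewrite (MA oE EW) (mu_ext_leb2 mB) !leb2_rect !lebesgue_measure_itv /= !lte_fin in h1.
rewrite !ifT in h1; try lra.
rewrite -!EFinB -!EFinM lee_fin in h1.
have k2 : 8 * k * e / l = e / 2 by rewrite /k; field; rewrite gt_eqF.
rewrite k2 in h1; have := mulr_gt0 l0 e0; rewrite /k in h1; nra.
Qed.

End Edge.

(** * Rotated frames *)

Section Frames.
Variable R : realType.
Local Notation pt := (pt R).
Implicit Types (N W : set pt) (s : pt -> R) (c d : R) (p z w xi : pt).

(** The data that the local analysis consumes, bundled for transport to other frames; [W] is the
    region where the Monge-Ampere measure has density one. *)
Definition good N s W := exists K,
  [/\ closed N, forall z, N z -> `|z.1| <= K /\ `|z.2| <= K, Defs.convex_set N, convex_on N s &
   [/\ contS N s, open W, W `<=` N & forall E, open E -> E `<=` W ->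
     mu_ext (@leb2 R) (subdiff_img N s E) = leb2 E]].

(* Passage from a rotated frame with origin [p0] to the original coordinates. *)
Definition fr c d p0 z := addp (rot c (- d) z) p0.
Definition gr c d p0 z := rot c d (subp z p0).

Lemma rotK c d z : c ^+ 2 + d ^+ 2 = 1 -> rot c d (rot c (- d) z) = z.
Proof.
case: z => x y h; rewrite /rot /=; congr (_, _).
  by rewrite -[RHS]mul1r -h; ring.
by rewrite -[RHS]mul1r -h; ring.
Qed.

Lemma rotVK c d z : c ^+ 2 + d ^+ 2 = 1 -> rot c (- d) (rot c d z) = z.
Proof. by move=> h; have := @rotK c (- d) z; rewrite opprK sqrrN; apply. Qed.

Lemma frK c d p0 z : c ^+ 2 + d ^+ 2 = 1 -> gr c d p0 (fr c d p0 z) = z.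
Proof.
move=> h; rewrite /gr /fr -[RHS](rotK _ h); congr (rot c d _).
by rewrite /subp /addp !addrK -surjective_pairing.
Qed.

Lemma grK c d p0 z : c ^+ 2 + d ^+ 2 = 1 -> fr c d p0 (gr c d p0 z) = z.
Proof.
by move=> h; rewrite /gr /fr rotVK //; case: z => a b; rewrite /subp /addp /= !subrK.
Qed.

Lemma fr0 c d p0 : fr c d p0 (0, 0) = p0.
Proof. by case: p0 => a b; rewrite /fr /addp /rot /=; congr (_, _); ring. Qed.

Lemma dotp_fr c d p0 xi z w : dotp xi (subp (fr c d p0 z) (fr c d p0 w)) =
  dotp (rot c d xi) (subp z w).
Proof. by rewrite /dotp /subp /fr /addp /rot /=; ring. Qed.

Lemma subdiff_fr N s c d p0 z xi : c ^+ 2 + d ^+ 2 = 1 ->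
  subdiff (fr c d p0 @^-1` N) (s \o fr c d p0) z (rot c d xi) <-> subdiff N s (fr c d p0 z) xi.
Proof.
move=> h; split=> H w Nw.
  have := H (gr c d p0 w); rewrite /= grK // => /(_ Nw).
  by rewrite -(dotp_fr c d p0) grK.
by rewrite /= -(dotp_fr c d p0); exact: H.
Qed.

Lemma subdiff_fr' N s c d p0 z xi : c ^+ 2 + d ^+ 2 = 1 ->
  subdiff (fr c d p0 @^-1` N) (s \o fr c d p0) z xi <-> subdiff N s (fr c d p0 z) (rot c (- d) xi).
Proof. by move=> h; rewrite -(subdiff_fr _ _ _ _ _ h) rotK. Qed.

Lemma unit_le1 c d : c ^+ 2 + d ^+ 2 = 1 -> `|c| <= 1 /\ `|d| <= 1.
Proof.
move=> h; split; rewrite -(ler_sqr) ?nnegrE // real_normK ?num_real // expr1n -h.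
  by rewrite lerDl sqr_ge0.
by rewrite lerDr sqr_ge0.
Qed.

Lemma rot_lip c d z w : c ^+ 2 + d ^+ 2 = 1 ->
  `|(rot c d w).1 - (rot c d z).1| <= 1 * (`|w.1 - z.1| + `|w.2 - z.2|) /\
  `|(rot c d w).2 - (rot c d z).2| <= 1 * (`|w.1 - z.1| + `|w.2 - z.2|).
Proof.
move=> /unit_le1[c1 d1]; rewrite /rot /= mul1r; split.
  have -> : c * w.1 - d * w.2 - (c * z.1 - d * z.2) = c * (w.1 - z.1) - d * (w.2 - z.2) by ring.
  by rewrite (le_trans (ler_normB _ _)) // !normrM lerD // ler_piMl.
have -> : d * w.1 + c * w.2 - (d * z.1 + c * z.2) = d * (w.1 - z.1) + c * (w.2 - z.2) by ring.
by rewrite (le_trans (ler_normD _ _)) // !normrM lerD // ler_piMl.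
Qed.

Lemma sqrN_unit c d : c ^+ 2 + d ^+ 2 = 1 -> c ^+ 2 + (- d) ^+ 2 = 1.
Proof. by rewrite sqrrN. Qed.

Lemma fr_lip c d p0 z w : c ^+ 2 + d ^+ 2 = 1 ->
  `|(fr c d p0 w).1 - (fr c d p0 z).1| <= 1 * (`|w.1 - z.1| + `|w.2 - z.2|) /\
  `|(fr c d p0 w).2 - (fr c d p0 z).2| <= 1 * (`|w.1 - z.1| + `|w.2 - z.2|).
Proof.
move=> /sqrN_unit h; have sb (a b e : R) : a + e - (b + e) = a - b by ring.
by rewrite /fr /addp /= !sb; exact: rot_lip.
Qed.

Lemma near2_fr c d p0 z w e : c ^+ 2 + d ^+ 2 = 1 -> near2 (e / 2) z w ->
  near2 e (fr c d p0 z) (fr c d p0 w).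
Proof.
move=> h [h1 h2]; have [l1 l2] := fr_lip p0 z w h.
by split; [apply: le_lt_trans l1 _|apply: le_lt_trans l2 _]; lra.
Qed.

Lemma near2_rot c d z w e : c ^+ 2 + d ^+ 2 = 1 -> near2 (e / 2) z w ->
  near2 e (rot c d z) (rot c d w).
Proof.
move=> h [h1 h2]; have [l1 l2] := rot_lip z w h.
by split; [apply: le_lt_trans l1 _|apply: le_lt_trans l2 _]; lra.
Qed.

Lemma segpt_fr c d p0 z w t : fr c d p0 (segpt z w t) = segpt (fr c d p0 z) (fr c d p0 w) t.
Proof. by rewrite /fr /segpt /addp /scalep /rot /=; congr (_, _); ring. Qed.

Lemma leb_pres_gr c d p0 : c ^+ 2 + d ^+ 2 = 1 -> leb_pres (gr c d p0).
Proof.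
move=> h; have -> : gr c d p0 = rot c d \o (fun z => addp z (- p0.1, - p0.2)).
  by apply/funext => z; rewrite /gr /subp /addp.
by apply: leb_pres_comp; [exact: leb_pres_rot|exact: leb_pres_translate].
Qed.

(** Subgradients rotate with the frame ([subdiff_fr]) and rotations preserve area, so the equation
    keeps its form. Equality of outer measures takes [mu_ext_preim] for the rotation and for its
    inverse. *)
Lemma good_fr N s W c d p0 : c ^+ 2 + d ^+ 2 = 1 -> good N s W ->
  good (fr c d p0 @^-1` N) (s \o fr c d p0) (fr c d p0 @^-1` W).
Proof.
move=> h [K [cN bN vN vs [cs oW WN MA]]].
have [c1 d1] := unit_le1 h.
exists (2 * (`|K| + `|p0.1| + `|p0.2|)); split.
- apply/closed_near2 => z hz /=; apply: ((closed_near2 N).1 cN) => e e0.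
  have [w Nw wz] := hz (e / 2) ltac:(lra); exists (fr c d p0 w) => //; exact: near2_fr.
- move=> z Nz; rewrite -(frK p0 z h).
  have [b1 b2] := bN _ Nz; set v := fr c d p0 z in b1 b2 *.
  have K1 : `|v.1| <= `|K| by rewrite (le_trans b1) // ler_norm.
  have K2 : `|v.2| <= `|K| by rewrite (le_trans b2) // ler_norm.
  have q1 : `|v.1 - p0.1| <= `|K| + `|p0.1| by rewrite (le_trans (ler_normB _ _)) // lerD2r.
  have q2 : `|v.2 - p0.2| <= `|K| + `|p0.2| by rewrite (le_trans (ler_normB _ _)) // lerD2r.
  have key (a b : R) : `|a| <= 1 -> `|b| <= 1 ->
     `|a * (v.1 - p0.1)| + `|b * (v.2 - p0.2)| <= 2 * (`|K| + `|p0.1| + `|p0.2|).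
    move=> a1 b1'; rewrite !normrM.
    have := ler_piMl (normr_ge0 (v.1 - p0.1)) a1; have := ler_piMl (normr_ge0 (v.2 - p0.2)) b1'.
    have := normr_ge0 p0.1; have := normr_ge0 p0.2; lra.
  by rewrite /gr /rot /subp /=; split; [rewrite (le_trans (ler_normB _ _))|rewrite (le_trans (ler_normD _ _))]; rewrite ?key.
- by move=> z w t Nz Nw ht; rewrite /= segpt_fr; exact: vN.
- by move=> z w t Nz Nw ht; rewrite /= segpt_fr; exact: vs.
split.
- move=> z Nz e e0; have [e1 e10 he] := cs _ Nz e e0; exists (e1 / 2); first lra.
  by move=> w Nw wz; apply: he => //; exact: near2_fr.
- by apply: open_preim_affine oW; [exact: ltr01|move=> z w; exact: fr_lip].
- by move=> z Wz; exact: WN.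
move=> E oE EW.
have oE' : open (gr c d p0 @^-1` E).
  apply: open_preim_affine oE; [exact: ltr01|move=> z w].
  have := rot_lip (subp z p0) (subp w p0) h; rewrite /subp /= -/(subp z p0) -/(subp w p0).
  have -> (a b e : R) : a - e - (b - e) = a - b by ring.
  by have -> (a b e : R) : a - e - (b - e) = a - b by ring.
have E'W : gr c d p0 @^-1` E `<=` W.
  by move=> z Ez; have := EW _ Ez; rewrite /= grK.
have -> : subdiff_img (fr c d p0 @^-1` N) (s \o fr c d p0) E =
    rot c (- d) @^-1` (subdiff_img N s (gr c d p0 @^-1` E)).
  apply/seteqP; split => xi [z Ez hz].
    exists (fr c d p0 z); first by rewrite /= frK.
    exact/subdiff_fr'.
  exists (gr c d p0 z) => //; apply/(subdiff_fr' _ _ _ _ _ h).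
  by rewrite grK.
have eqE : leb2 (gr c d p0 @^-1` E) = leb2 E by have [] := leb_pres_gr p0 h (open_measurable2 oE).
rewrite -eqE -(MA _ oE' E'W); apply/eqP; rewrite eq_le; apply/andP; split.
  by apply: mu_ext_preim; apply: leb_pres_rot; exact: sqrN_unit.
set X := subdiff_img _ _ _.
have -> : mu_ext (@leb2 R) X = mu_ext (@leb2 R) (rot c d @^-1` (rot c (- d) @^-1` X)).
  by congr (mu_ext _ _); apply/seteqP; split => z /=; rewrite rotVK.
by apply: mu_ext_preim; exact: leb_pres_rot.
Qed.

Lemma subdiff_closed N s z : closed (subdiff N s z).
Proof.
apply/closed_near2 => xi hxi w Nw.
apply/ler_addgt0Pr => e e0; set u := subp w z.
have P : 0 < `|u.1| + `|u.2| + 1 by rewrite ltr_wpDl // addr_ge0.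
have [eta h [n1 n2]] := hxi (e / (`|u.1| + `|u.2| + 1)) (divr_gt0 e0 P).
rewrite ltr_pdivlMr // in n1; rewrite ltr_pdivlMr // in n2.
have := h w Nw; rewrite -/u /dotp => h1.
have h2 : (xi.1 - eta.1) * u.1 + (xi.2 - eta.2) * u.2 <= e.
  apply: (@le_trans _ _ (`|eta.1 - xi.1| * `|u.1| + `|eta.2 - xi.2| * `|u.2|)).
    by rewrite lerD // (le_trans (ler_norm _)) // normrM distrC.
  have := normr_ge0 (eta.1 - xi.1); have := normr_ge0 (eta.2 - xi.2).
  have := normr_ge0 u.1; have := normr_ge0 u.2; nra.
lra.
Qed.

Lemma subdiff_convex N s z : Defs.convex_set (subdiff N s z).
Proof.
move=> xi eta t h1 h2 /andP[t0 t1] w Nw.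
have := h1 w Nw; have := h2 w Nw; set u := subp w z => a2 a1.
have -> : s z + dotp (segpt xi eta t) u = (1 - t) * (s z + dotp xi u) + t * (s z + dotp eta u).
  by rewrite /segpt /dotp /addp /scalep /=; ring.
have t1' : 0 <= 1 - t by lra.
have := ler_wpM2l t1' a1; have := ler_wpM2l t0 a2; lra.
Qed.

(** The homothety of centre [v] and ratio [1 - t] maps the box around [u] onto the box around the
    point of the segment. *)
Lemma interior_seg (S : set pt) u v e t : Defs.convex_set S ->
  (forall w, near2 e u w -> S w) -> S v -> 0 <= t < 1 ->
  forall w, near2 ((1 - t) * e) (segpt u v t) w -> S w.
Proof.
move=> vS hu Sv /andP[t0 t1] w [w1 w2]; have t1' : 0 < 1 - t by lra.
pose u' := addp u (scalep (1 - t)^-1 (subp w (segpt u v t))).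
have -> : w = segpt u' v t.
  case: w {w1 w2} @u' => a b /=; rewrite /segpt /addp /scalep /subp /=.
  by congr (_, _); field; lra.
apply: vS => //; last by lra.
apply: hu; split; rewrite /u' /addp /scalep /subp /=.
  rewrite addrAC subrr add0r normrM gtr0_norm ?invr_gt0 //.
  by rewrite mulrC ltr_pdivrMr // [e * _]mulrC.
rewrite addrAC subrr add0r normrM gtr0_norm ?invr_gt0 //.
by rewrite mulrC ltr_pdivrMr // [e * _]mulrC.
Qed.

Lemma frontier_closed (S : set pt) : closed S -> frontier S = S `\` interior S.
Proof. by move=> h; rewrite /frontier -(closure_id S).1. Qed.

End Frames.

(** * Gas points *)

Section Gas.
Variable R : realType.
Local Notation pt := (pt R).

Lemma polar_unit (c d : R) : c ^+ 2 + d ^+ 2 = 1 -> exists th, cos th = c /\ sin th = d.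
Proof.
move=> h; have [c1 _] := unit_le1 h; move: c1; rewrite ler_norml => c1.
have s1 : sin (acos c) = `|d|.
  rewrite sin_acos //; have -> : 1 - c ^+ 2 = d ^+ 2 by rewrite -h; ring.
  by rewrite sqrtr_sqr.
have [d0|d0] := leP 0 d.
  by exists (acos c); rewrite acosK ?in_itv // s1 ger0_norm.
by exists (- acos c); rewrite cosN sinN acosK ?in_itv // s1 ltr0_norm // opprK.
Qed.

Lemma wan_cont (f : R -> R) t0 e : wan f t0 -> 0 < e ->
  exists2 d, 0 < d & forall t, `|t - t0| < d -> `|f t - f t0| < e.
Proof.
move=> /wan_derivable/derivable1_diffP/differentiable_continuous/cvgrPdist_lt /(_ e) h e0.
have [d /= d0 hd] := h e0; exists d => // t td.
by rewrite distrC; apply: hd; rewrite /ball /= distrC.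
Qed.

Variables (N W : set pt) (s : pt -> R) (p0 : pt) (rho : R).
Hypothesis (gd : good N s W) (Np0 : N p0) (rho0 : 0 < rho).
Hypothesis Wnear : forall z, near2 rho p0 z -> z <> p0 -> W z.
Let K := subdiff N s p0.
Variables (xs : pt) (dl : R).
Hypothesis (dl0 : 0 < dl) (Kball : forall xi, near2 dl xs xi -> K xi).

(** A subgradient is tested at the four points at distance [rho / 2] from [p0] along the axes. *)
Lemma gas_bounded : exists2 B, 0 < B & forall xi, K xi -> `|xi.1| <= B /\ `|xi.2| <= B.
Proof.
have [_ [_ _ _ _ [_ _ WN _]]] := gd.
have rp := rho0; have r20 : 0 < rho / 2 by lra.
have Np a b : (a, b) <> (0, 0) -> `|a| < rho -> `|b| < rho -> N (p0.1 + a, p0.2 + b).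
  move=> ab a1 b1; apply: WN; apply: Wnear; first by split; rewrite /= addrAC subrr add0r.
  move=> E; apply: ab; have := congr1 fst E; have := congr1 snd E => /= e2 e1.
  by congr (_, _); lra.
pose v a b := `|s (p0.1 + a, p0.2 + b) - s p0|.
pose B := (v (rho / 2) 0 + v (- (rho / 2)) 0 + v 0 (rho / 2) + v 0 (- (rho / 2))) / (rho / 2) + 1.
have v0 a b : 0 <= v a b by exact: normr_ge0.
have B0 : 0 < B by rewrite ltr_wpDl // divr_ge0 ?(ltW r20) // !addr_ge0.
exists B => // xi Kxi.
have key a b : N (p0.1 + a, p0.2 + b) -> xi.1 * a + xi.2 * b <= v a b.
  move=> /Kxi; rewrite /dotp /subp /= ![_ + _ - p0.1]addrAC ![_ + _ - p0.2]addrAC !subrr !add0r => h.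
  rewrite (le_trans _ (ler_norm _)) //; lra.
have rr : `|rho / 2| < rho by rewrite gtr0_norm //; lra.
have rn : `|- (rho / 2)| < rho by rewrite normrN.
have z0 : `|0 : R| < rho by rewrite normr0.
have ne (x : R) : x != 0 -> (x, 0 : R) <> (0, 0) by move=> /eqP h E; apply: h; have := congr1 fst E.
have ne' (x : R) : x != 0 -> (0 : R, x) <> (0, 0) by move=> /eqP h E; apply: h; have := congr1 snd E.
have n1 : rho / 2 != 0 by rewrite gt_eqF.
have n2 : - (rho / 2) != 0 by rewrite oppr_eq0.
have k1 := key _ _ (Np _ _ (ne _ n1) rr z0); have k2 := key _ _ (Np _ _ (ne _ n2) rn z0).
have k3 := key _ _ (Np _ _ (ne' _ n1) z0 rr); have k4 := key _ _ (Np _ _ (ne' _ n2) z0 rn).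
have BE : B * (rho / 2) = v (rho / 2) 0 + v (- (rho / 2)) 0 + v 0 (rho / 2) + v 0 (- (rho / 2)) + rho / 2.
  by rewrite /B; field; lra.
have w1 := v0 (rho / 2) 0; have w2 := v0 (- (rho / 2)) 0.
have w3 := v0 0 (rho / 2); have w4 := v0 0 (- (rho / 2)).
clear rr rn z0 ne ne' n1 n2 key.
split; rewrite -(ler_pM2r r20) BE -{1}(gtr0_norm r20) -normrM ler_norml; lra.
Qed.

Definition ray (th r : R) : pt := (xs.1 + r * cos th, xs.2 + r * sin th).
(** Distance from the interior point [xs] to the boundary of [K] in direction [th]; polar
    coordinates are used since a closed curve is no global graph. *)
Definition radial (th : R) : R := sup [set r | 0 <= r /\ K (ray th r)].

Lemma ray_near (th r r' e : R) : `|r' - r| < e -> near2 e (ray th r) (ray th r').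
Proof.
move=> h; have c1 : `|cos th| <= 1 by rewrite ler_norml cos_geN1 cos_le1.
have s1 : `|sin th| <= 1 by rewrite ler_norml sin_geN1 sin_le1.
split; rewrite /ray /= opprD addrACA subrr add0r -mulrBl normrM (le_lt_trans _ h) //;
  by rewrite ler_piMr.
Qed.

Lemma ray0 th : ray th 0 = xs.
Proof. by rewrite /ray !mul0r !addr0 -surjective_pairing. Qed.

Lemma ray_bound : exists2 B, 0 < B & forall th r, 0 <= r -> K (ray th r) -> r <= B.
Proof.
have [B B0 hB] := gas_bounded.
exists (2 * (B + `|xs.1| + `|xs.2|)); first by rewrite mulr_gt0 // -addrA ltr_pwDl // addr_ge0.
move=> th r r0 /hB; rewrite /ray /= => -[h1 h2].
have k1 : `|r * cos th| <= B + `|xs.1|.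
  by rewrite -[r * cos th](addKr xs.1) addrC (le_trans (ler_normB _ _)) // lerD2r.
have k2 : `|r * sin th| <= B + `|xs.2|.
  by rewrite -[r * sin th](addKr xs.2) addrC (le_trans (ler_normB _ _)) // lerD2r.
have E : r ^+ 2 = `|r * cos th| ^+ 2 + `|r * sin th| ^+ 2.
  by rewrite !real_normK ?num_real // !exprMn -mulrDr cos2Dsin2 mulr1.
have := normr_ge0 (r * cos th); have := normr_ge0 (r * sin th).
have := normr_ge0 xs.1; have := normr_ge0 xs.2 => x2 x1 a2 a1.
by rewrite -ler_sqr ?nnegrE //; [nra|lra].
Qed.

Lemma radialP th : [/\ dl / 2 <= radial th, K (ray th (radial th)) &
  forall r, 0 <= r -> K (ray th r) -> r <= radial th].
Proof.
have dp := dl0; have [B B0 hB] := ray_bound.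
set S := [set r | 0 <= r /\ K (ray th r)].
have Sd : S (dl / 2).
  split; first lra; apply: Kball; rewrite -(ray0 th); apply: ray_near.
  by rewrite subr0 gtr0_norm; lra.
have Ss : has_sup S.
  by split; [exists (dl / 2)|exists B => r [r0 Kr]; exact: hB Kr].
have ub r : 0 <= r -> K (ray th r) -> r <= radial th.
  by move=> r0 Kr; apply: (sup_upper_bound Ss).
split => //; first by apply: (sup_upper_bound Ss).
have cK : closed K by exact: subdiff_closed.
apply: ((closed_near2 K).1 cK) => e e0.
have [r [r0 Kr] hr] := sup_adherent e0 Ss.
exists (ray th r) => //; apply: ray_near.
have := ub r r0 Kr; rewrite -/(radial th) in hr.
by move=> h; rewrite ler0_norm; lra.
Qed.

Lemma radial_gt0 th : 0 < radial th.
Proof. by have [h _ _] := radialP th; have := dl0; lra. Qed.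

(** In the frame whose second axis points in direction [th0], the boundary is the graph of [H], and
    [r = radial (th0 + tau)] solves [q1 + r cos tau = H (p1 - r sin tau)]. With [x = - r sin tau]
    this reads [- x / (H (p1 + x) - q1) = tan tau], which [wan_inverse] solves for [x]; then
    [r = (H (p1 + x) - q1) / cos tau]. *)
Lemma radial_analytic th0 : wan radial th0.
Proof.
have dp := dl0; have rp := rho0.
pose c := sin th0; pose d := cos th0.
have cd : c ^+ 2 + d ^+ 2 = 1 by rewrite addrC cos2Dsin2.
pose N' := fr c d p0 @^-1` N; pose s' := s \o fr c d p0; pose W' := fr c d p0 @^-1` W.
have [K' [cN bN vN vs [cs oW WN MA]]] : good N' s' W' by exact: good_fr.
pose Kf := subdiff N' s' (0, 0).
have KfE xi : Kf (rot c d xi) <-> K xi by rewrite /Kf subdiff_fr // fr0.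
pose p1 := (rot c d xs).1; pose q1 := (rot c d xs).2.
have rayE th r : rot c d (ray th r) = (p1 - r * sin (th - th0), q1 + r * cos (th - th0)).
  by rewrite /p1 /q1 /ray /rot sinB cosB /= -/c -/d; congr (_, _); ring.
have Kfball eta : near2 (dl / 2) (p1, q1) eta -> Kf eta.
  rewrite -[eta](rotK _ cd) => h; apply/KfE; apply: Kball.
  rewrite -[xs](rotVK _ cd); apply: near2_rot; first by rewrite sqrrN.
  by rewrite rotK // in h; rewrite rotK // [rot c d xs]surjective_pairing.
have Wn z : near2 (rho / 2) (0, 0) z -> z <> (0, 0) -> W' z.
  move=> h z0; apply: Wnear; first by have := near2_fr p0 cd h; rewrite fr0.
  move=> E; apply: z0; transitivity (gr c d p0 (fr c d p0 (0, 0))); last by rewrite frK.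
  by rewrite -[LHS](frK p0 z cd) E fr0.
have N'0 : N' (0, 0) by rewrite /N' /= fr0.
pose z1 : pt := (0, rho / 4).
have z10 : 0 < z1.2 by rewrite /=; lra.
have Nz1 : N' z1.
  apply: WN; apply: Wn; last by move=> E; have := congr1 snd E => /= h; lra.
  by split; rewrite /= !subr0 ?normr0 ?gtr0_norm //; lra.
have dl4 : 0 < dl / 4 by lra.
have dl42 : dl / 4 < dl / 2 by lra.
(* A whole box of subgradients surrounds [(p1, q1)]; tilting the slope by [dl / 8] in the direction
   of [x] makes the inequality on the axis strict. *)
have Cond p : `|p - p1| < dl / 4 -> forall x, N' (x, 0) -> x != 0 ->
    s' (0, 0) < s' (x, 0) - p * x.
  rewrite ltr_norml => /andP[h1 h2] x Nx x0.
  have [x1|x1] := ltP 0 x.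
    have : Kf (p + dl / 8, q1).
      by apply: Kfball; split; rewrite /= ?subrr ?normr0 ?ltr_norml; lra.
    by move=> /(_ _ Nx); rewrite /dotp /subp /=; nra.
  have x2 : x < 0 by rewrite lt_neqAle x0.
  have : Kf (p - dl / 8, q1).
    by apply: Kfball; split; rewrite /= ?subrr ?normr0 ?ltr_norml; lra.
  by move=> /(_ _ Nx); rewrite /dotp /subp /=; nra.
have HW p y x : `|p - p1| < dl / 4 -> 0 < y -> near2 (rho / 2) (0, 0) (x, y) ->
    argmin N' s' p y x -> W' (x, y).
  move=> _ y0 h _; apply: Wn => // E; have := congr1 snd E => /= h2; lra.
have r20 : 0 < rho / 2 by lra.
have [H [wH [e e0 hH]]] := local_analytic cN bN vN vs cs oW WN MA N'0 dl4 Nz1 z10 Cond r20 HW.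
have KfH p q : `|p - p1| < e -> `|p - p1| < dl / 4 -> q1 <= q -> Kf (p, q) <-> q <= H p.
  move=> pe pd qq; split=> [h|/(hH p pe) h].
    by apply/(hH p pe) => x y Nxy y0; have := h _ Nxy; rewrite /dotp /subp /= !subr0 addrA.
  move=> [x y] Nxy; rewrite /dotp /subp /= !subr0 addrA.
  have [y0|y0] := ltP 0 y; first exact: h.
  have : Kf (p, q1).
    by apply: Kfball; split; [exact: lt_trans dl42|rewrite /= subrr normr0 (lt_trans dl4)].
  by move=> /(_ _ Nxy); rewrite /dotp /subp /= !subr0; nra.
have Hq p : `|p - p1| < e -> `|p - p1| < dl / 4 -> q1 + dl / 4 <= H p.
  move=> pe pd; apply/KfH => //; first by rewrite lerDl ltW.
  by apply: Kfball; split; [exact: lt_trans dl42|rewrite /= addrAC subrr add0r gtr0_norm].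
(* If the end of the ray were strictly below the graph, [interior_seg] would make it an interior
   point and the ray could be prolonged inside the subdifferential. *)
have onH tau : 0 < cos tau -> `|radial (th0 + tau) * sin tau| < Num.min e (dl / 4) ->
    q1 + radial (th0 + tau) * cos tau = H (p1 - radial (th0 + tau) * sin tau).
  move=> ct; rewrite lt_min; set r := radial _; set p := p1 - _ => /andP[h1 h2].
  have [r1 Kr hr] := radialP (th0 + tau); rewrite -/r in r1 Kr hr.
  have rp0 : 0 < r by exact: radial_gt0.
  have tE : th0 + tau - th0 = tau by ring.
  have pp : p - p1 = - (r * sin tau) by rewrite /p; ring.
  have pe : `|p - p1| < e by rewrite pp normrN.
  have pd : `|p - p1| < dl / 4 by rewrite pp normrN.
  have qq : q1 <= q1 + r * cos tau by rewrite lerDl mulr_ge0 // ltW.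
  have Kfr : Kf (p, q1 + r * cos tau).
    by have := (KfE _).2 Kr; rewrite rayE tE.
  apply/eqP; rewrite eq_le (KfH p _ pe pd qq).1 //= leNgt; apply/negP => lt.
  have KH : Kf (p, H p) by apply/KfH => //; rewrite (le_trans _ (Hq p pe pd)) // lerDl ltW.
  have ball w : near2 (dl / 4) (p, q1) w -> Kf w.
    move=> hw; apply: Kfball; have -> : dl / 2 = dl / 4 + dl / 4 by field.
    by apply: near2_trans hw; split; rewrite //= subrr normr0.
  have Hq1 : 0 < H p - q1 by rewrite subr_gt0 (lt_le_trans _ (Hq p pe pd)) // ltrDl.
  pose t := r * cos tau / (H p - q1).
  have ht : 0 <= t < 1.
    rewrite divr_ge0 ?(ltW Hq1) //=; first by rewrite ltr_pdivrMr // mul1r ltrBrDl.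
    by rewrite mulr_ge0 // ltW.
  have t1 : 0 < (1 - t) * (dl / 4) by rewrite mulr_gt0 // subr_gt0; case/andP: ht.
  have E : (p, q1 + r * cos tau) = segpt (p, q1) (p, H p) t.
    by rewrite /segpt /addp /scalep /=; congr (_, _); [ring|rewrite /t; field; exact: lt0r_neq0].
  have vKf : Defs.convex_set Kf by exact: subdiff_convex.
  have far := interior_seg vKf ball KH ht.
  set m := (1 - t) * (dl / 4) in t1 far.
  have : Kf (rot c d (ray (th0 + tau) (r + m / 4))).
    apply: far; rewrite -E -[p]/(p1 - _).
    have -> : (p1 - r * sin tau, q1 + r * cos tau) = rot c d (ray (th0 + tau) r) by rewrite rayE tE.
    apply: near2_rot => //; apply: ray_near.
    by rewrite addrAC subrr add0r gtr0_norm ?divr_gt0 // ltr_pM2l // ltf_pV2 ?posrE // ltr_nat.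
  move=> /(KfE _).1 Kr'; have rm : 0 <= r + m / 4 by rewrite addr_ge0 // ltW // divr_gt0.
  by have := hr _ rm Kr'; rewrite gerDl leNgt divr_gt0.
pose G x := (H (p1 + x) - q1)^-1.
have p10 : `|p1 - p1| < e by rewrite subrr normr0.
have p10' : `|p1 - p1| < dl / 4 by rewrite subrr normr0.
have Hp1 : H (p1 + 0) - q1 != 0 by rewrite addr0 subr_eq0 gt_eqF // (lt_le_trans _ (Hq p1 p10 p10')) // ltrDl.
have wH0 : wan (fun x => H (p1 + x)) 0.
  by apply: (wan_comp (f := fun x => p1 + x) (g := H)); [apply: wanD; [exact: wan_cst|exact: wan_id]|rewrite addr0].
have wG : wan G 0.
  apply: (wan_comp (f := fun x => H (p1 + x) - q1) (g := fun x => x^-1)).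
    by apply: wanB => //; exact: wan_cst.
  exact: wan_inv.
pose F x := - x * G x.
have wF : wan F 0 by apply: wanM => //; apply: wanN; exact: wan_id.
have F0 : F 0 = 0 by rewrite /F oppr0 mul0r.
have dF : is_derive (0 : R) 1 F (- G 0).
  have dG : is_derive (0 : R) 1 G ('D_1 G 0) by apply: derivableP; exact: wan_derivable.
  have dI : is_derive (0 : R) 1 (fun x : R => - x) (- 1) by exact: is_deriveN.
  have := is_deriveM dI dG.
  have -> : - (0 : R) *: 'D_1 G 0 + G 0 *: - 1 = - G 0.
    by rewrite oppr0 scale0r add0r /GRing.scale /= mulrN1.
  exact.
have G0 : - G 0 != 0 by rewrite oppr_eq0 invr_eq0.
have [k [d0 [d00 wk hk]]] := wan_inverse wF F0 dF G0.
have [B B0 hB] := ray_bound.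
(* [B] bounds the radii, so [|sin tau| < m] keeps [r sin tau] within the ranges where [k] inverts
   [F] and where the boundary is the graph of [H]. *)
pose m := Num.min d0 (Num.min e (dl / 4)) / B.
have m0 : 0 < m by rewrite divr_gt0 // !lt_min d00 e0 dl4.
have [ws wc] := wan_sincos (0 : R).
have [e1 e10 he1] := wan_cont ws m0.
have [e2 e20 he2] := wan_cont wc (ltr01 : 0 < 1 :> R).
pose T (tau : R) := sin tau / cos tau.
have wT : wan T 0.
  apply: wanM; first exact: ws.
  apply: (wan_comp (f := cos) (g := fun x => x^-1)); first exact: wc.
  by rewrite cos0; apply: wan_inv; exact: oner_neq0.
have T0 : T 0 = 0 by rewrite /T sin0 mul0r.
apply: wan_shift.
apply: (wan_near (g := fun tau => (H (p1 + k (T tau)) - q1) * (cos tau)^-1) (d := Num.min e1 e2)).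
- by rewrite lt_min e10.
- move=> tau; rewrite subr0 lt_min => /andP[t1 t2].
  have := he1 tau; rewrite subr0 sin0 subr0 => /(_ t1) h1.
  have := he2 tau; rewrite subr0 cos0 => /(_ t2); rewrite ltr_norml => /andP[h2 _].
  have ct : 0 < cos tau by move: h2; rewrite ltrBrDl subrr.
  have [r1 Kr _] := radialP (th0 + tau); have rp0 := radial_gt0 (th0 + tau).
  have rB := hB _ _ (ltW rp0) Kr.
  have hx : `|radial (th0 + tau) * sin tau| < Num.min d0 (Num.min e (dl / 4)).
    rewrite normrM gtr0_norm //; apply: (@le_lt_trans _ _ (B * `|sin tau|)); first by rewrite ler_wpM2r.
    by rewrite mulrC -ltr_pdivlMr.
  rewrite lt_min in hx; have /andP[hx1 hx2] := hx.
  have E := onH tau ct hx2.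
  pose x := - (radial (th0 + tau) * sin tau).
  have Fx : F x = T tau.
    rewrite /F /G /x -E /T [X in (X - q1)]addrC addrK opprK.
    by field; rewrite !gt_eqF.
  have kx : k (T tau) = x by rewrite -Fx hk // /x normrN.
  by rewrite kx /x -E [X in (X - q1)]addrC addrK mulfK // gt_eqF.
have k0 : k 0 = 0 by rewrite -F0 hk // normr0.
apply: wanM; last first.
  apply: (wan_comp (f := cos) (g := fun x => x^-1)); first exact: wc.
  by rewrite cos0; apply: wan_inv; exact: oner_neq0.
apply: wanB; last exact: wan_cst.
apply: (wan_comp (f := fun tau => k (T tau)) (g := fun x => H (p1 + x))).
  by apply: (wan_comp (f := T) (g := k)) => //; rewrite T0.
by rewrite T0 k0.
Qed.

End Gas.

(** * Closed analytic curves given by a radial function *)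

Section Jordan.
Variable R : realType.
Local Notation pt := (pt R).
Variables (K : set pt) (xs : pt) (dl : R) (rad : R -> R).
Hypothesis (cK : closed K) (vK : Defs.convex_set K).
Hypothesis (dl0 : 0 < dl) (Kball : forall xi, near2 dl xs xi -> K xi).
Hypothesis (rad0 : forall th, 0 < rad th) (Krad : forall th, K (ray xs th (rad th))).
Hypothesis radmax : forall th r, 0 <= r -> K (ray xs th r) -> r <= rad th.
Hypothesis wrad : forall th, wan rad th.

Lemma polar_exists (v : pt) : v <> xs -> exists th r, 0 < r /\ v = ray xs th r.
Proof.
move=> vx; pose a := v.1 - xs.1; pose b := v.2 - xs.2.
have ab : 0 < a ^+ 2 + b ^+ 2.
  rewrite lt_neqAle addr_ge0 ?sqr_ge0 // andbT eq_sym paddr_eq0 ?sqr_ge0 // !sqrf_eq0.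
  apply/negP => /andP[/eqP a0 /eqP b0]; apply: vx.
  case: v @a @b a0 b0 => v1 v2 /=; case: xs => x1 x2 /= /eqP; rewrite subr_eq0 => /eqP -> /eqP.
  by rewrite subr_eq0 => /eqP ->.
pose r := Num.sqrt (a ^+ 2 + b ^+ 2).
have r0 : 0 < r by rewrite sqrtr_gt0.
have rE : r ^+ 2 = a ^+ 2 + b ^+ 2 by rewrite sqr_sqrtr // ltW.
have [|th [c s]] := @polar_unit R (a / r) (b / r).
  by rewrite !expr_div_n -mulrDl rE divff // gt_eqF.
exists th, r; split => //; rewrite [LHS]surjective_pairing /ray c s.
by congr (_, _); rewrite mulrC divfK ?gt_eqF // /a /b; ring.
Qed.

(** Points short of the end of their ray are interior by [interior_seg]; the end is not, since the
    ray cannot be prolonged. *)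
Lemma radial_frontier : frontier K = [set ray xs th (rad th) | th in setT].
Proof.
rewrite frontier_closed //; apply/seteqP; split => [v [Kv nv]|_ [th _ <-]].
  have vx : v <> xs.
    by move=> E; apply: nv; apply/interior_near2; exists dl => //; rewrite E.
  have [th [r [r0 E]]] := polar_exists vx; exists th => //.
  rewrite E in Kv nv *; have rm := radmax (ltW r0) Kv.
  suff -> : r = rad th by [].
  apply/eqP; rewrite eq_le rm /= leNgt; apply/negP => lt.
  apply: nv; apply/interior_near2.
  have Rp := rad0 th; pose t := r / rad th.
  have ht : 0 <= t < 1 by rewrite divr_ge0 //= ?(ltW Rp) ?(ltW r0) // ltr_pdivrMr // mul1r.
  exists ((1 - t) * dl); first by rewrite mulr_gt0 // subr_gt0; case/andP: ht.
  have -> : ray xs th r = segpt xs (ray xs th (rad th)) t.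
    rewrite /ray /segpt /addp /scalep /=; congr (_, _); rewrite /t; field; exact: lt0r_neq0.
  exact: (interior_seg vK Kball (Krad th) ht).
split; first exact: Krad.
move=> /interior_near2[e e0 he].
have Kr : K (ray xs th (rad th + e / 2)).
  by apply: he; apply: ray_near; rewrite addrAC subrr add0r gtr0_norm; lra.
have Rp := rad0 th.
have := radmax (_ : 0 <= rad th + e / 2) Kr; lra.
Qed.

Lemma cos_eq1 (x : R) : 0 <= x < 2 * pi -> cos x = 1 -> x = 0.
Proof.
move=> /andP[x0 x1] cx; apply/eqP; rewrite eq_le x0 andbT leNgt; apply/negP => xp.
have s0 : 0 < sin (x / 2) by apply: sin_gt0_pi; apply/andP; split; [lra|rewrite ltr_pdivrMr // mulrC].
have : cos (x / 2 + x / 2) = 1 by rewrite -[RHS]cx; congr cos; field.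
rewrite cosD; have := cos2Dsin2 (x / 2); nra.
Qed.

Lemma radial_jordan : analytic_jordan_curve (frontier K).
Proof.
pose w : R := 2 * pi; have w0 : 0 < w by rewrite mulr_gt0 // pi_gt0.
pose g (t : R) : pt := ray xs (w * t) (rad (w * t)).
have per th : cos (th + w) = cos th /\ sin (th + w) = sin th.
  have -> : w = pi *+ 2 by rewrite /w mulr_natl.
  by split; [exact: cosD2pi|exact: sinD2pi].
have radw th : rad (th + w) = rad th.
  have [c s] := per th.
  have rE r : ray xs (th + w) r = ray xs th r by rewrite /ray c s.
  by apply/eqP; rewrite eq_le; apply/andP; split;
    [apply: radmax; rewrite ?ltW // -rE|apply: radmax; rewrite ?ltW // rE].
have wg t : wan (fun t => rad (w * t)) t /\ wan (fun t => cos (w * t)) t /\ wan (fun t => sin (w * t)) t.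
  have wl : wan (fun t => w * t) t by apply: wanM; [exact: wan_cst|exact: wan_id].
  have [ws wc] := wan_sincos (w * t).
  split; first exact: (wan_comp wl (wrad _)).
  by split; [exact: (wan_comp wl wc)|exact: (wan_comp wl ws)].
have wg1 t : wan (fun t => (g t).1) t.
  by have [a [b _]] := wg t; apply: wanD; [exact: wan_cst|exact: wanM].
have wg2 t : wan (fun t => (g t).2) t.
  by have [a [_ b]] := wg t; apply: wanD; [exact: wan_cst|exact: wanM].
exists g; split; first last.
  split.
    move=> s t hs ht E.
    wlog st : s t hs ht E / s <= t.
      by move=> Hw; have [h|h] := leP s t; [exact: Hw|apply/esym; apply: Hw => //; exact: ltW].
    have e1 : rad (w * s) * cos (w * s) = rad (w * t) * cos (w * t).
      by have := congr1 fst E; rewrite /g /ray /= => /addrI.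
    have e2 : rad (w * s) * sin (w * s) = rad (w * t) * sin (w * t).
      by have := congr1 snd E; rewrite /g /ray /= => /addrI.
    have re : rad (w * s) = rad (w * t).
      have sq th : (rad th * cos th) ^+ 2 + (rad th * sin th) ^+ 2 = rad th ^+ 2.
        by rewrite !exprMn -mulrDr cos2Dsin2 mulr1.
      have h := sq (w * s); rewrite e1 e2 sq in h.
      by apply/eqP; rewrite -(eqrXn2 (ltn0Sn 1)) ?ltW // h.
    rewrite re in e1 e2.
    have rn : rad (w * t) != 0 by rewrite gt_eqF.
    have {}e1 := mulfI rn e1; have {}e2 := mulfI rn e2.
    have : cos (w * t - w * s) = 1.
      by rewrite cosB e1 e2; have := cos2Dsin2 (w * t); rewrite !expr2.
    move=> /cos_eq1; rewrite -mulrBr => H.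
    have : w * (t - s) = 0.
      apply: H; move: hs ht => /andP[s0 s1] /andP[t0 t1]; rewrite mulr_ge0 ?(ltW w0) ?subr_ge0 //=.
      by rewrite -/w gtr_pMr //; lra.
    move=> /eqP; rewrite mulf_eq0 (gt_eqF w0) /= subr_eq0 => /eqP ->; done.
  split.
    split; first exact: wan_analytic.
    split; first exact: wan_analytic.
    move=> t [d1 d2].
    (* The component of [g u - xs] across the ray at [t]. It equals [rad (w u) sin (w (u - t))],
       whose derivative at [t] is [w rad (w t) > 0], so the velocity cannot vanish. *)
    pose h u := - ((g u).1 - xs.1) * sin (w * t) + ((g u).2 - xs.2) * cos (w * t).
    have D1 : is_derive t 1 (fun u => (g u).1) 0.
      by rewrite -d1 derive1E; apply: derivableP; exact: wan_derivable.
    have D2 : is_derive t 1 (fun u => (g u).2) 0.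
      by rewrite -d2 derive1E; apply: derivableP; exact: wan_derivable.
    have dh0 : is_derive t 1 h 0.
      have E : h = (fun u => (- sin (w * t)) * (g u).1 + cos (w * t) * (g u).2 + (xs.1 * sin (w * t) - xs.2 * cos (w * t))).
        by apply/funext => u; rewrite /h; ring.
      rewrite E.
      have := is_deriveD (is_deriveD (is_deriveZ (- sin (w * t)) D1) (is_deriveZ (cos (w * t)) D2))
         (is_derive_cst (xs.1 * sin (w * t) - xs.2 * cos (w * t)) t 1).
      by rewrite !scaler0 !addr0.
    pose rw u := rad (w * u).
    have hE : h = rw * (fun u => sin (w * (u - t))).
      apply/funext => u; rewrite -[RHS]/(rad (w * u) * sin (w * (u - t))) mulrBr sinB.
      by rewrite /h /g /ray /=; ring.
    have drw : is_derive t 1 rw ('D_1 rw t) by apply: derivableP; apply: wan_derivable; have [] := wg t.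
    have dS : is_derive t 1 (fun u => sin (w * (u - t))) w.
      have da : is_derive t 1 (fun u : R => w * (u - t)) w.
        have := is_deriveZ w (is_deriveB (is_derive_id t 1) (is_derive_cst t t 1)).
        by rewrite subr0 /GRing.scale /= mulr1.
      have := @is_derive1_comp R sin (fun u => w * (u - t)) t (cos (w * (t - t))) w (is_derive_sin _) da.
      by rewrite subrr mulr0 cos0 mul1r.
    have := is_deriveM drw dS; rewrite -hE subrr mulr0 sin0 scale0r addr0 => dh.
    have := @derive_val _ _ _ _ _ _ _ dh; rewrite (@derive_val _ _ _ _ _ _ _ dh0) => /esym /eqP.
    by rewrite mulf_eq0 /rw (gt_eqF (rad0 _)) (gt_eqF w0).
  rewrite radial_frontier; apply/seteqP; split => [_ [th _ <-]|_ [t _ <-]].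
    by exists (th / w) => //; rewrite /g mulrC divfK // gt_eqF.
  by exists (w * t).
move=> t; rewrite /g mulrDr mulr1 radw; have [c s] := per (w * t).
by rewrite /ray c s.
Qed.

End Jordan.

Theorem gas_curve (R : realType) (N W : set (pt R)) (s : pt R -> R) (p0 : pt R) (rho : R)
    (xs : pt R) (dl : R) : good N s W -> 0 < rho ->
  (forall z, near2 rho p0 z -> z <> p0 -> W z) -> N p0 -> 0 < dl ->
  (forall xi, near2 dl xs xi -> subdiff N s p0 xi) ->
  let C := frontier (subdiff N s p0) in
  box_bounded C /\ convex_curve C /\ analytic_jordan_curve C.
Proof.
move=> gd rho0 Wn Np0 dl0 Kb C.
have cK : closed (subdiff N s p0) by exact: subdiff_closed.
split.
  have [B B0 hB] := gas_bounded gd rho0 Wn.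
  by exists B => xi; rewrite /C frontier_closed // => -[/hB].
split; first by exists (subdiff N s p0); split => //; exact: subdiff_convex.
have rP th := radialP gd rho0 Wn dl0 Kb th.
apply: (@radial_jordan R _ xs dl (radial N s p0 xs)) => //.
- exact: subdiff_convex.
- by move=> th; exact: (radial_gt0 gd rho0 Wn dl0 Kb).
- by move=> th; have [] := rP th.
- by move=> th r r0 Kr; have [_ _] := rP th; exact.
- by move=> th; exact: (radial_analytic gd Np0 rho0 Wn dl0 Kb).
Qed.

(** * Vertices *)

Section Subgradient.
Variable R : realType.
Local Notation pt := (pt R).
Variables (N : set pt) (s : pt -> R) (K : R).
Hypothesis (cN : closed N) (bN : forall z, N z -> `|z.1| <= K /\ `|z.2| <= K).
Hypothesis (vN : Defs.convex_set N) (vs : convex_on N s) (cs : contS N s).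

(** The supremum of the left difference quotients is a supporting slope. It turns a minimiser at an
    intermediate height into a point that carries a subgradient. *)
Lemma psi_subgrad p y u v : slice N u -> slice N y -> slice N v -> u < y < v ->
  exists q, forall y', slice N y' -> psi N s p y + q * (y' - y) <= psi N s p y'.
Proof.
move=> Yu Yy Yv /andP[uy yv].
have slopes y1 y2 : slice N y1 -> slice N y2 -> y1 < y -> y < y2 ->
   (psi N s p y - psi N s p y1) / (y - y1) <= (psi N s p y2 - psi N s p y) / (y2 - y).
  move=> Y1 Y2 h1 h2; pose t := (y - y1) / (y2 - y1).
  have q0 : 0 < y2 - y1 by lra.
  have ht : 0 <= t <= 1 by rewrite divr_ge0 /= ?ler_pdivrMr //; lra.
  have := psi_convex cN bN vN vs cs p Y1 Y2 ht.
  have -> : (1 - t) * y1 + t * y2 = y by rewrite /t; field; lra.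
  have tE : t * (y2 - y1) = y - y1 by rewrite /t; field; lra.
  move=> h; rewrite ler_pdivrMr ?subr_gt0 // mulrAC ler_pdivlMr ?subr_gt0 //.
  have := ler_wpM2r (ltW q0) h.
  have -> : ((1 - t) * psi N s p y1 + t * psi N s p y2) * (y2 - y1) =
    (y2 - y1) * psi N s p y1 + (t * (y2 - y1)) * (psi N s p y2 - psi N s p y1) by ring.
  rewrite tE; nra.
pose S := [set (psi N s p y - psi N s p y1) / (y - y1) | y1 in [set y1 | slice N y1 /\ y1 < y]].
have Ss : has_sup S.
  split; first by exists ((psi N s p y - psi N s p u) / (y - u)), u.
  exists ((psi N s p v - psi N s p y) / (v - y)) => _ [y1 [Y1 h1] <-]; exact: slopes.
exists (sup S) => y' Yy'.
have [h|h|->] := ltgtP y' y; last by rewrite subrr mulr0 addr0.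
  have : (psi N s p y - psi N s p y') / (y - y') <= sup S.
    by apply: (sup_upper_bound Ss); exists y'.
  by rewrite ler_pdivrMr ?subr_gt0 //; lra.
have : sup S <= (psi N s p y' - psi N s p y) / (y' - y).
  by apply: ge_sup; [case: Ss|move=> _ [y1 [Y1 h1] <-]; exact: slopes].
by rewrite ler_pdivlMr ?subr_gt0 //; lra.
Qed.

End Subgradient.

(** * Subdifferentials at vertices as analytic hypographs *)

Section Graph.
Variable R : realType.
Local Notation pt := (pt R).

Lemma sup_halfline (S : set R) (h : R) : (forall q, S q <-> q <= h) -> sup S = h.
Proof.
move=> hS; have -> : S = [set q | q <= h] by apply/seteqP; split => q /hS.
apply/eqP; rewrite eq_le; apply/andP; split.
  by apply: ge_sup; [exists h => /=|].
by apply: sup_upper_bound => //=; split; [exists h => /=|exists h].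
Qed.

(** Each local function is the supremum of the vertical section of [K], so all of them are
    restrictions of one function. *)
Lemma glue_graph (K : set pt) (I : set R) :
  (forall p1, I p1 -> exists H, wan H p1 /\ exists2 d, 0 < d & forall p, `|p - p1| < d ->
     forall q, K (p, q) <-> q <= H p) ->
  exists H, forall p, I p -> wan H p /\ forall q, K (p, q) <-> q <= H p.
Proof.
move=> h; pose H p := sup [set q | K (p, q)].
exists H => p Ip; have [H1 [w1 [d d0 hd]]] := h p Ip.
have E p' : `|p' - p| < d -> H p' = H1 p' by move=> hp; apply: sup_halfline; exact: hd.
split; first exact: (wan_near d0 E w1).
have pd : `|p - p| < d by rewrite subrr normr0.
by move=> q; rewrite E //; exact: hd.
Qed.

Section Corner.
Variables (N W : set pt) (s : pt -> R) (x1 x2 h0 : R).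
Hypothesis (gd : good N s W) (N0 : N (0, 0)) (x12 : x1 < x2) (h00 : 0 < h0).
Hypothesis wedge : forall x y, N (x, y) -> x1 * y <= x <= x2 * y.
Hypothesis N1 : forall h, 0 <= h <= h0 -> N (x1 * h, h).
Hypothesis N2 : forall h, 0 <= h <= h0 -> N (x2 * h, h).
Hypothesis Win : forall x y, 0 < y < h0 -> x1 * y < x < x2 * y -> W (x, y).
Hypothesis E1 : forall h xi, 0 < h < h0 -> ~ subdiff N s (x1 * h, h) xi.
Hypothesis E2 : forall h xi, 0 < h < h0 -> ~ subdiff N s (x2 * h, h) xi.

Lemma wedge_ge0 x y : N (x, y) -> 0 <= y.
Proof. by move=> /wedge /andP[a b]; have := le_trans a b; have := x12; nra. Qed.

(** The slice at height [0] is the corner alone, so every slope [p] is admissible and [H] is defined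
    on the whole line. The bounds by lines of slopes [- x1] and [- x2] are kept for the tangents at
    infinity. *)
Lemma corner_graph : exists H, [/\ forall p, wan H p,
  forall p q, subdiff N s (0, 0) (p, q) <-> q <= H p &
  exists C, forall p, [/\ H p <= C - p * x2, H p <= C - p * x1,
    0 <= p -> H 0 - p * x2 <= H p & p <= 0 -> H 0 - p * x1 <= H p]].
Proof.
have [K [cN bN vN vs [cs oW WN MA]]] := gd; have hp := h00.
have z10 : 0 < (x1 * h0, h0).2 by [].
have Nz1 : N (x1 * h0, h0) by apply: N1; rewrite ltW // lexx.
have Nz2 : N (x2 * h0, h0) by apply: N2; rewrite ltW // lexx.
have SY y : 0 <= y <= h0 -> slice N y by move=> hy; exists (x1 * y); exact: N1.
have loc p1 : exists H, wan H p1 /\ exists2 d, 0 < d & forall p, `|p - p1| < d ->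
     forall q, subdiff N s (0, 0) (p, q) <-> q <= H p.
  have Cond p : `|p - p1| < 1 -> forall x, N (x, 0) -> x != 0 -> s (0, 0) < s (x, 0) - p * x.
    by move=> _ x /wedge; rewrite !mulr0 -eq_le => /eqP <-; rewrite eqxx.
  (* A minimiser at an intermediate height carries a subgradient; [E1] and [E2] forbid this on the
     two sides, so the minimiser lies strictly inside the wedge. *)
  have HW p y x : `|p - p1| < 1 -> 0 < y -> near2 h0 (0, 0) (x, y) -> argmin N s p y x -> W (x, y).
    move=> _ y0 [_ /=]; rewrite subr0 gtr0_norm // => yh am.
    have hy : 0 < y < h0 by rewrite y0.
    have hy2 : 0 < y < h0 by [].
    have y00 : slice N 0 by exists 0.
    have [q hq] := psi_subgrad cN bN vN vs cs p y00
       (SY y ltac:(by rewrite (ltW y0) (ltW yh))) (SY h0 ltac:(by rewrite lexx (ltW hp))) hy2.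
    have sd := argmin_subdiff cN bN cs am hq.
    have /andP[a b] := wedge am.1.
    apply: Win => //; rewrite !lt_neqAle a b !andbT; apply/andP; split; apply/eqP => E.
      by apply: (E1 (xi := (p, q)) hy); rewrite E.
    by apply: (E2 (xi := (p, q)) hy); rewrite -E.
  have [H [wH [d d0 hd]]] := local_analytic cN bN vN vs cs oW WN MA N0 ltr01 Nz1 z10 Cond h00 HW.
  exists H; split => //; exists d => // p pd q; split=> [h|/(hd p pd) h].
    by apply/(hd p pd) => x y Nxy _; have := h _ Nxy; rewrite /dotp /subp /= !subr0 addrA.
  move=> [x y] Nxy; rewrite /dotp /subp /= !subr0 addrA.
  have := wedge_ge0 Nxy; rewrite le_eqVlt => /orP[/eqP y0|]; last exact: h.
  rewrite -y0 in Nxy *; have := wedge Nxy; rewrite !mulr0 -eq_le => /eqP <-.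
  by rewrite mulr0 !addr0.
have [H hH] := glue_graph (I := setT) (fun p1 _ => loc p1).
exists H; split.
- by move=> p; have [] := hH p I.
- by move=> p q; have [_ h] := hH p I; exact: h.
have hh0 : 0 <= h0^-1 by rewrite invr_ge0 ltW.
pose A z := `|s z - s (0, 0)| / h0.
exists (A (x1 * h0, h0) + A (x2 * h0, h0)) => p.
have [_ hK] := hH p I; have KH := (hK (H p)).2 (lexx _).
have up x : N (x * h0, h0) -> H p <= A (x * h0, h0) - p * x.
  move=> Nx; have := KH _ Nx; rewrite /dotp /subp /= !subr0 => h.
  have : s (x * h0, h0) - s (0, 0) <= A (x * h0, h0) * h0.
    by rewrite /A mulfVK ?gt_eqF // ler_norm.
  by move=> h2; rewrite -(ler_pM2r hp); lra.
have A0 z : 0 <= A z by rewrite mulr_ge0.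
have a1 := A0 (x1 * h0, h0); have a2 := A0 (x2 * h0, h0).
have up1 := up _ Nz1; have up2 := up _ Nz2.
have [_ hK0] := hH 0 I; have KH0 := (hK0 (H 0)).2 (lexx _).
(* [(0, H 0)] is a subgradient; tilting it to the slope [p] and lowering it by [p x] keeps it below
   [s] wherever [p u <= p x y]. *)
have low x : (forall u y, N (u, y) -> p * u <= p * (x * y)) -> H 0 - p * x <= H p.
  move=> hx; apply/hK => -[u y] Nz; have := KH0 _ Nz; rewrite /dotp /subp /= !subr0.
  by have := hx u y Nz; lra.
split; [lra|lra| |] => p0; apply: low => u y /wedge /andP[b1 b2].
  by rewrite ler_wpM2l.
by rewrite ler_wnM2l.
Qed.

End Corner.

Section Side.
Variables (N W : set pt) (s : pt -> R) (a b l : R).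
Hypothesis (gd : good N s W) (ab : a < b) (l0 : 0 < l).
Hypothesis pos : forall x y, N (x, y) -> 0 <= y.
Hypothesis side : forall x, `|x| <= l -> N (x, 0).
Hypothesis sL : forall x, - l <= x <= 0 -> s (x, 0) = s (0, 0) + a * x.
Hypothesis sR : forall x, 0 <= x <= l -> s (x, 0) = s (0, 0) + b * x.
Hypothesis Win : forall x y, `|x| < l -> 0 < y < l -> W (x, y).

Lemma fr10 (p0 z : pt) : fr 1 0 p0 z = (z.1 + p0.1, z.2 + p0.2).
Proof. by rewrite /fr /addp /rot /=; congr (_, _); ring. Qed.

Lemma side_empty x0 m xi : `|x0| = l / 2 ->
  (forall x, `|x| <= l / 4 -> s (x0 + x, 0) = s (x0, 0) + m * x) -> ~ subdiff N s (x0, 0) xi.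
Proof.
move=> hx0 hm; have lp := l0; have u : 1 ^+ 2 + 0 ^+ 2 = 1 :> R by ring.
have [K [cN bN vN vs [cs oW WN MA]]] := good_fr (x0, 0) u gd.
have E : (x0, 0) = fr 1 0 (x0, 0) (0, 0) :> pt by rewrite fr0.
rewrite E => /(subdiff_fr _ _ _ _ _ u).
have xl x : `|x| <= l / 4 -> `|x + x0| < l.
  by move=> h; rewrite (le_lt_trans (ler_normD _ _)) // hx0; lra.
have l4 : 0 < l / 4 by lra.
apply: (edge_empty vs WN MA (l := l / 4) (eta := l) (m := m)) => // [x hx|x y hx hy].
  rewrite /= !fr10 /= !add0r; split; first by apply: side; rewrite ltW // xl.
  by rewrite addrC hm.
by rewrite /= fr10 /= addr0; apply: Win => //; apply: xl; exact: ltW.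
Qed.

(** Slopes strictly between [a] and [b] make the vertex the only minimiser on the side. At slope [a]
    or [b] the supporting plane would touch along half of the side and give a subgradient at a
    midpoint, against [side_empty]; so the interval of slopes is open. *)
Lemma side_graph : exists H, (forall p, a < p < b -> wan H p) /\
  forall p q, subdiff N s (0, 0) (p, q) <-> a < p < b /\ q <= H p.
Proof.
have [K [cN bN vN vs [cs oW WN MA]]] := gd; have lp := l0; have abp := ab.
have N0 : N (0, 0) by apply: side; rewrite normr0 ltW.
have l2 : 0 < l / 2 by lra.
have Nz1 : N (0, l / 2) by apply: WN; apply: Win; rewrite ?normr0 //; lra.
have strict p x : a < p < b -> N (x, 0) -> x != 0 -> s (0, 0) < s (x, 0) - p * x.
  move=> /andP[ap pb] Nx x0; have nx : 0 < `|x| by rewrite normr_gt0.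
  pose t := Num.min 1 (l / `|x|).
  have t0 : 0 < t by rewrite lt_min ltr01 divr_gt0.
  have t1 : t <= 1 by rewrite ge_min lexx.
  have tx : t * `|x| <= l by rewrite -ler_pdivlMr // ge_min lexx orbT.
  have ht : 0 <= t <= 1 by rewrite (ltW t0).
  have := s_mix vs N0 Nx ht; rewrite !mulr0 !add0r => h.
  have h2 : s (0, 0) < s (t * x, 0) - p * (t * x).
    have [xp|xn] := ltP 0 x.
      have tx0 : 0 < t * x by rewrite mulr_gt0.
      rewrite gtr0_norm // in tx; rewrite (@sR (t * x)) ?tx ?(ltW tx0) //.
      have : 0 < (b - p) * (t * x) by rewrite mulr_gt0 // subr_gt0.
      lra.
    have xn' : x < 0 by rewrite lt_neqAle x0.
    have tx0 : t * x < 0 by rewrite pmulr_rlt0.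
    rewrite ltr0_norm // in tx; rewrite (@sL (t * x)); last by lra.
    have : 0 < (a - p) * (t * x) by rewrite nmulr_rgt0 // subr_lt0.
    lra.
  rewrite -(ltr_pM2l t0); lra.
have loc p1 : a < p1 < b -> exists H, wan H p1 /\ exists2 d, 0 < d & forall p, `|p - p1| < d ->
     forall q, subdiff N s (0, 0) (p, q) <-> q <= H p.
  move=> /andP[ap pb]; pose dl := Num.min (p1 - a) (b - p1).
  have dl0 : 0 < dl by rewrite lt_min !subr_gt0 ap.
  have inI p : `|p - p1| < dl -> a < p < b.
    by rewrite lt_min !ltr_norml => /andP[/andP[? ?] /andP[? ?]]; lra.
  have Cond p : `|p - p1| < dl -> forall x, N (x, 0) -> x != 0 -> s (0, 0) < s (x, 0) - p * x.
    by move=> /inI pI x; exact: strict.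
  have HW p y x : `|p - p1| < dl -> 0 < y -> near2 l (0, 0) (x, y) -> argmin N s p y x -> W (x, y).
    move=> _ y0 [/=]; rewrite !subr0 => h1 h2 _; apply: Win => //.
    by rewrite y0 -(gtr0_norm y0).
  have [H [wH [d d0 hd]]] := local_analytic cN bN vN vs cs oW WN MA N0 dl0 Nz1 l2 Cond l0 HW.
  exists H; split => //; exists (Num.min d dl); first by rewrite lt_min d0.
  move=> p; rewrite lt_min => /andP[pd pdl] q; split=> [h|/(hd p pd) h].
    by apply/(hd p pd) => x y Nxy _; have := h _ Nxy; rewrite /dotp /subp /= !subr0 addrA.
  move=> [x y] Nxy; rewrite /dotp /subp /= !subr0 addrA.
  have := pos Nxy; rewrite le_eqVlt => /orP[/eqP y0|]; last exact: h.
  rewrite -y0 in Nxy *; have [->|x0] := eqVneq x 0; first by rewrite !mulr0 !addr0.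
  by have := Cond p pdl x Nxy x0; lra.
have [H hH] := glue_graph (I := [set p | a < p < b]) loc.
exists H; split; first by move=> p /hH[].
move=> p q; split=> [Kpq|[/hH[_ h] hq]]; last by apply/h.
suff Ip : a < p < b by split => //; have [_ h] := hH p Ip; apply/h.
have at_ x : `|x| <= l -> s (0, 0) + p * x <= s (x, 0).
  by move=> /side Nx; have := Kpq _ Nx; rewrite /dotp /subp /= !subr0 mulr0 addr0.
have pb : p <= b.
  have hl : `|l| <= l by rewrite gtr0_norm.
  have hl' : 0 <= l <= l by rewrite ltW // lexx.
  by have := at_ l hl; rewrite (sR hl') lerD2l ler_pM2r.
have ap : a <= p.
  have hl : `|- l| <= l by rewrite normrN gtr0_norm.
  have hl' : - l <= - l <= 0 by rewrite lexx oppr_le0 ltW.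
  by have := at_ (- l) hl; rewrite (sL hl') lerD2l !mulrN lerN2 ler_pM2r.
have move_ x0 : s (x0, 0) = s (0, 0) + p * x0 -> subdiff N s (x0, 0) (p, q).
  move=> E [x y] Nxy; have := Kpq _ Nxy; rewrite /dotp /subp /= !subr0 E; lra.
rewrite !lt_neqAle ap pb !andbT; apply/andP; split; apply/eqP => E.
  apply: (@side_empty (- (l / 2)) a (p, q)).
  - by rewrite normrN gtr0_norm.
  - by move=> x; rewrite ler_norml => /andP[? ?]; rewrite (@sL (- (l / 2) + x)) ?(@sL (- (l / 2))); try lra; ring.
  - by apply: move_; rewrite (@sL (- (l / 2))) ?E //; lra.
apply: (@side_empty (l / 2) b (p, q)).
- by rewrite gtr0_norm.
- by move=> x; rewrite ler_norml => /andP[? ?]; rewrite (@sR (l / 2 + x)) ?(@sR (l / 2)); try lra; ring.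
- by apply: move_; rewrite (@sR (l / 2)) ?E //; lra.
Qed.

End Side.
End Graph.

(** * Limits of unit tangents at the ends of an arc *)

Section Ends.
Variable R : realType.
Local Notation pt := (pt R).
Implicit Types (f mu : R -> R) (e : R).

(* Limit at [+oo] for [e = 1] and at [-oo] for [e = -1]. *)
Definition endlim e f (l : R) := forall eps, 0 < eps ->
  exists T, forall t, T < e * t -> `|f t - l| <= eps.

Lemma endlim_pinfty f l : endlim 1 f l -> f @ +oo --> l.
Proof.
move=> h; apply/cvgrPdist_le => e e0; have [T hT] := h e e0.
exists T; split; first exact: num_real.
by move=> t Tt; rewrite distrC; apply: hT; rewrite mul1r.
Qed.

Lemma endlim_ninfty f l : endlim (- 1) f l -> f @ -oo --> l.
Proof.
move=> h; apply/cvgrPdist_le => e e0; have [T hT] := h e e0.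
exists (- T); split; first exact: num_real.
by move=> t Tt; rewrite distrC; apply: hT; rewrite mulN1r ltrNr.
Qed.

Lemma endlimD e f g l k : endlim e f l -> endlim e g k -> endlim e (fun t => f t + g t) (l + k).
Proof.
move=> hf hg eps e0; have e2 : 0 < eps / 2 by lra.
have [T1 h1] := hf _ e2; have [T2 h2] := hg _ e2.
exists (Num.max T1 T2) => t; rewrite gt_max => /andP[/h1 a1 /h2 a2].
by rewrite opprD addrACA (le_trans (ler_normD _ _)) //; lra.
Qed.

Lemma endlimZ e k f l : endlim e f l -> endlim e (fun t => k * f t) (k * l).
Proof.
move=> hf eps e0; have k0 : 0 < `|k| + 1 by rewrite ltr_wpDl.
have [T h] := hf _ (divr_gt0 e0 k0); exists T => t /h.
rewrite ler_pdivlMr // -mulrBr normrM => h1; rewrite (le_trans _ h1) //.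
by rewrite mulrC ler_wpM2l // lerDl.
Qed.

(** [tg1] and [tg2] are the components of the unit tangent [(1, m) / sqrt (1 + m^2)] to a graph of
    slope [m]. *)
Definition tg1 (m : R) := (Num.sqrt (1 + m ^+ 2))^-1.
Definition tg2 (m : R) := m * tg1 m.

Lemma sqrt1_bounds (m : R) : [/\ 1 <= Num.sqrt (1 + m ^+ 2), `|m| <= Num.sqrt (1 + m ^+ 2) &
  Num.sqrt (1 + m ^+ 2) ^+ 2 = 1 + m ^+ 2].
Proof.
have p : 0 <= 1 + m ^+ 2 by rewrite addr_ge0 ?sqr_ge0.
split; last by rewrite sqr_sqrtr.
- by rewrite -[X in X <= _]sqrtr1 ler_wsqrtr // lerDl sqr_ge0.
- by rewrite -sqrtr_sqr ler_wsqrtr // lerDr.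
Qed.

Lemma tg_lip m m0 : `|tg1 m - tg1 m0| <= `|m - m0| /\
  `|tg2 m - tg2 m0| <= (1 + `|m0|) * `|m - m0|.
Proof.
rewrite /tg2 /tg1; have [a1 am a2] := sqrt1_bounds m; have [b1 bm b2] := sqrt1_bounds m0.
move: a1 am a2 b1 bm b2; set a := Num.sqrt _; set b := Num.sqrt _ => a1 am a2 b1 bm b2.
have a0 : 0 < a by lra. have b0 : 0 < b by lra.
have ab : `|a - b| <= `|m - m0|.
  have s0 : 0 < a + b by lra.
  rewrite -(ler_pM2r s0) -{1}(gtr0_norm s0) -normrM.
  have -> : (a - b) * (a + b) = (m - m0) * (m + m0) by transitivity (a ^+ 2 - b ^+ 2); [ring|rewrite a2 b2; ring].
  by rewrite normrM ler_wpM2l // (le_trans (ler_normD _ _)) // lerD.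
have L1 : `|a^-1 - b^-1| <= `|m - m0|.
  have -> : a^-1 - b^-1 = (b - a) / (a * b) by field; rewrite !gt_eqF.
  rewrite normrM normfV (gtr0_norm (mulr_gt0 a0 b0)) ler_pdivrMr ?mulr_gt0 // distrC.
  by rewrite (le_trans ab) // ler_peMr //; nra.
split => //.
have -> : m * a^-1 - m0 * b^-1 = (m - m0) * a^-1 + m0 * (a^-1 - b^-1) by ring.
rewrite (le_trans (ler_normD _ _)) // !normrM mulrDl mul1r lerD //; last exact: ler_wpM2l.
by rewrite ler_piMr // gtr0_norm ?invr_gt0 // invf_le1.
Qed.

Lemma endlim_tg e mu m0 : endlim e mu m0 ->
  endlim e (tg1 \o mu) (tg1 m0) /\ endlim e (tg2 \o mu) (tg2 m0).
Proof.
move=> h; split=> eps e0.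
  by have [T hT] := h _ e0; exists T => t /hT; apply: le_trans; have [] := tg_lip (mu t) m0.
have k0 : 0 < 1 + `|m0| by rewrite ltr_pwDl.
have [T hT] := h _ (divr_gt0 e0 k0); exists T => t /hT.
rewrite ler_pdivlMr // mulrC; apply: le_trans; by have [] := tg_lip (mu t) m0.
Qed.

Lemma endlim_tg_infty e mu : (forall M, exists T, forall t, T < e * t -> M < mu t) ->
  endlim e (tg1 \o mu) 0 /\ endlim e (tg2 \o mu) 1.
Proof.
move=> h; have key eps : 0 < eps -> exists T, forall t, T < e * t ->
   `|tg1 (mu t)| <= eps /\ `|tg2 (mu t) - 1| <= eps.
  move=> e0; have [T hT] := h eps^-1; exists T => t /hT; set m := mu t => mM.
  have ie : 0 < eps^-1 by rewrite invr_gt0.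
  have m0 : 0 < m by lra.
  have [a1 am a2] := sqrt1_bounds m; rewrite /tg2 /tg1; move: a1 am a2; set a := Num.sqrt _ => a1 am a2.
  rewrite gtr0_norm // in am; have a0 : 0 < a by lra.
  have ae : a^-1 <= eps by rewrite -[eps]invrK lef_pV2 ?posrE //; lra.
  split; first by rewrite gtr0_norm ?invr_gt0.
  have -> : m / a - 1 = - ((a - m) / a) by field; rewrite gt_eqF.
  rewrite normrN ger0_norm; last by rewrite divr_ge0 ?subr_ge0 // ltW.
  rewrite (le_trans _ ae) // -[leRHS]mul1r ler_wpM2r ?invr_ge0 ?(ltW a0) //.
  have : (a - m) * (a + m) = 1 by transitivity (a ^+ 2 - m ^+ 2); [ring|rewrite a2; ring].
  nra.
split=> eps e0; have [T hT] := key eps e0; exists T => t /hT[] //.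
by rewrite subr0.
Qed.

Lemma tgN m : tg1 (- m) = tg1 m /\ tg2 (- m) = - tg2 m.
Proof. by rewrite /tg2 /tg1 sqrrN mulNr. Qed.

Lemma endlim_tg_ninfty e mu : (forall M, exists T, forall t, T < e * t -> mu t < M) ->
  endlim e (tg1 \o mu) 0 /\ endlim e (tg2 \o mu) (- 1).
Proof.
move=> h; have [|l1 l2] := @endlim_tg_infty e (fun t => - mu t).
  by move=> M; have [T hT] := h (- M); exists T => t /hT; rewrite ltrNr.
split.
  move=> eps e0; have [T hT] := l1 _ e0; exists T => t /hT /=.
  by have [-> _] := tgN (mu t).
have := endlimZ (- 1) l2; rewrite mulr1 => l2' eps e0.
have [T hT] := l2' _ e0; exists T => t /hT /=.
by have [_ ->] := tgN (mu t); rewrite mulrNN mul1r.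
Qed.

End Ends.
Arguments tg1 {R} m.
Arguments tg2 {R} m.

(** * Rotated analytic graphs as unbounded arcs *)

Section GraphArc.
Variable R : realType.
Local Notation pt := (pt R).
Implicit Types (c d : R) (u w z : pt).

Lemma enorm_rot c d z : c ^+ 2 + d ^+ 2 = 1 -> enorm (rot c d z) = enorm z.
Proof.
move=> h; rewrite /enorm; congr Num.sqrt; rewrite /dotp /rot /=.
by rewrite -[RHS]mul1r -h; ring.
Qed.

Lemma crossp_rot c d z w : c ^+ 2 + d ^+ 2 = 1 -> crossp (rot c d z) (rot c d w) = crossp z w.
Proof. by move=> h; rewrite /crossp /rot /= -[RHS]mul1r -h; ring. Qed.

Lemma enorm_ge z : `|z.1| <= enorm z /\ `|z.2| <= enorm z.
Proof.
rewrite /enorm /dotp -!expr2; split; rewrite -sqrtr_sqr ler_wsqrtr //.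
  by rewrite lerDl sqr_ge0.
by rewrite lerDr sqr_ge0.
Qed.

Lemma rot_neq0 c d z : c ^+ 2 + d ^+ 2 = 1 -> z <> (0, 0) -> rot c d z <> (0, 0).
Proof.
move=> h z0 E; apply: z0; rewrite -(rotVK z h) E /rot /=; congr (_, _); ring.
Qed.

(** [P] parametrises by the line the interval over which the graph is defined. Since [Dp > 0], the
    unit tangent depends on the slope [mu] alone, so its limits at both ends are those of [tg1] and
    [tg2] along [mu]. *)
Theorem graph_arc c d (P Dp H : R -> R) (C : set pt) (um up dm dp : pt) :
  c ^+ 2 + d ^+ 2 = 1 ->
  (forall t, wan P t) -> (forall t : R, is_derive t 1 P (Dp t)) -> (forall t, 0 < Dp t) ->
  injective P -> (forall t, wan H (P t)) ->
  (forall M : R, exists T, forall t, T < `|t| -> M < `|P t| \/ M < `|H (P t)|) ->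
  C = [set rot c (- d) (P t, H (P t)) | t in setT] ->
  let mu (t : R) : R := derive1 H (P t) in
  endlim (- 1) (tg1 \o mu) dm.1 -> endlim (- 1) (tg2 \o mu) dm.2 ->
  endlim 1 (tg1 \o mu) dp.1 -> endlim 1 (tg2 \o mu) dp.2 ->
  dm <> (0, 0) -> dp <> (0, 0) ->
  crossp (rot c (- d) dm) um = 0 -> crossp (rot c (- d) dp) up = 0 ->
  ~ box_bounded C /\ unbounded_arc_with_end_tangents C um up.
Proof.
move=> h wP dP P0 Pinj wH coer CE mu m1 m2 p1 p2 dm0 dp0 cm cp.
have h' : c ^+ 2 + (- d) ^+ 2 = 1 by rewrite sqrrN.
pose g (t : R) : pt := rot c (- d) (P t, H (P t)).
have wHP t : wan (fun t => H (P t)) t by exact: (wan_comp (wP t) (wH t)).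
have dHP (t : R) : is_derive t 1 (fun t => H (P t)) (mu t * Dp t).
  have dH : is_derive (P t) 1 H (mu t) by rewrite /mu derive1E; apply: derivableP; exact: wan_derivable.
  exact: (@is_derive1_comp R H P t (mu t) (Dp t) dH (dP t)).
have w1 t : wan (fun t => (g t).1) t.
  by apply: wanB; apply: wanZ; [exact: wP|exact: wHP].
have w2 t : wan (fun t => (g t).2) t.
  by apply: wanD; apply: wanZ; [exact: wP|exact: wHP].
have d1 t : derive1 (fun u : R => (g u).1) t = c * Dp t - - d * (mu t * Dp t).
  by rewrite derive1E; have [_ ->] := is_deriveB (is_deriveZ c (dP t)) (is_deriveZ (- d) (dHP t)).
have d2 t : derive1 (fun u : R => (g u).2) t = - d * Dp t + c * (mu t * Dp t).
  by rewrite derive1E; have [_ ->] := is_deriveD (is_deriveZ (- d) (dP t)) (is_deriveZ c (dHP t)).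
have dg t : (derive1 (fun u : R => (g u).1) t, derive1 (fun u : R => (g u).2) t) =
    rot c (- d) (Dp t, mu t * Dp t) by rewrite d1 d2.
have ut t : unit_tangent g t = rot c (- d) (tg1 (mu t), tg2 (mu t)).
  rewrite /unit_tangent dg enorm_rot // /enorm /dotp /=.
  have [a1 am a2] := sqrt1_bounds (mu t).
  have -> : Dp t * Dp t + mu t * Dp t * (mu t * Dp t) = Dp t ^+ 2 * (1 + mu t ^+ 2) by ring.
  rewrite sqrtrM ?sqr_ge0 // sqrtr_sqr gtr0_norm // /tg2 /tg1 /scalep /rot /=.
  move: a1; set a := Num.sqrt _ => a1; have Dt := P0 t.
  by congr (_, _); field; apply/andP; split; apply/eqP; lra.
have gcoer M : exists T, forall t, T < `|t| -> M < enorm (g t).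
  have [T hT] := coer M; exists T => t /hT tM; rewrite /g enorm_rot //.
  have [e1 e2] := enorm_ge (P t, H (P t)).
  by case: tM => ?; [apply: lt_le_trans e1|apply: lt_le_trans e2].
have lm e x y : endlim e (tg1 \o mu) x -> endlim e (tg2 \o mu) y ->
   endlim e (fun t => (unit_tangent g t).1) (rot c (- d) (x, y)).1 /\
   endlim e (fun t => (unit_tangent g t).2) (rot c (- d) (x, y)).2.
  move=> hx hy; split.
    have E : (fun t => (unit_tangent g t).1) = (fun t => c * (tg1 \o mu) t + d * (tg2 \o mu) t).
      by apply/funext => t; rewrite ut /rot /=; ring.
    have -> : (rot c (- d) (x, y)).1 = c * x + d * y by rewrite /rot /=; ring.
    by rewrite E; apply: endlimD; exact: endlimZ.
  have E : (fun t => (unit_tangent g t).2) = (fun t => (- d) * (tg1 \o mu) t + c * (tg2 \o mu) t).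
    by apply/funext => t; rewrite ut /rot /=; ring.
  by rewrite E; apply: endlimD; exact: endlimZ.
split.
  move=> [M hM]; have [T hT] := gcoer (2 * M).
  have tT : T < `|T| + 1 by rewrite (le_lt_trans (ler_norm _)) // ltrDl.
  have := hT (`|T| + 1); rewrite ger0_norm ?addr_ge0 // => /(_ tT).
  have : C (g (`|T| + 1)) by rewrite CE; exists (`|T| + 1).
  move=> /hM; set z := g _ => -[z1 z2].
  have M0 : 0 <= M by rewrite (le_trans _ z1).
  rewrite ltNge => /negP; apply.
  rewrite /enorm -(ger0_norm (_ : 0 <= 2 * M)); last lra.
  rewrite -sqrtr_sqr ler_wsqrtr // /dotp.
  move: z1 z2; rewrite !ler_norml => /andP[? ?] /andP[? ?]; nra.
exists g; split.
  move=> t t' E; apply: Pinj; have := congr1 (rot c d) E.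
  by rewrite /g !rotK // => -[].
split.
  split; first exact: wan_analytic.
  split; first exact: wan_analytic.
  move=> t; rewrite dg; apply: rot_neq0 => // -[E _]; have := P0 t; rewrite E; lra.
split; first by rewrite CE.
split => //.
have [lm1 lm2] := lm _ _ _ m1 m2; have [lp1 lp2] := lm _ _ _ p1 p2.
exists (rot c (- d) (dm.1, dm.2)), (rot c (- d) (dp.1, dp.2)).
split; first exact: endlim_ninfty.
split; first exact: endlim_ninfty.
split; first exact: endlim_pinfty.
split; first exact: endlim_pinfty.
by rewrite -!surjective_pairing; split; split => //; exact: rot_neq0.
Qed.

Lemma frontier_rot c d (S : set pt) : c ^+ 2 + d ^+ 2 = 1 -> closed S ->
  frontier (rot c d @^-1` S) = rot c d @^-1` (frontier S).
Proof.
move=> h cS; have h' : c ^+ 2 + (- d) ^+ 2 = 1 by rewrite sqrrN.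
have cS' : closed (rot c d @^-1` S).
  apply/closed_near2 => z hz /=; apply: ((closed_near2 S).1 cS) => e e0.
  have [w Sw wz] := hz (e / 2) ltac:(lra); exists (rot c d w) => //; exact: near2_rot.
rewrite !frontier_closed //; apply/seteqP; split => z [Sz nz]; split => //= /interior_near2 [e e0 he];
  apply: nz; apply/interior_near2; exists (e / 2); try lra; move=> w wz.
  by apply: he; exact: near2_rot.
by have := near2_rot h' wz; rewrite rotVK // => /he; rewrite /= rotK.
Qed.

Lemma graph_frontier (K : set pt) (I : set R) (H : R -> R) : closed K -> open I ->
  (forall p, I p -> wan H p) -> (forall p q, K (p, q) <-> I p /\ q <= H p) ->
  frontier K = [set (p, H p) | p in I].
Proof.
move=> cK oI wH hK; rewrite frontier_closed //; apply/seteqP; split => [[p q] [Kz nz]|_ [p Ip <-]].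
  have [Ip qH] := (hK _ _).1 Kz; exists p => //; congr (_, _).
  apply/eqP; rewrite eq_le qH andbT leNgt; apply/negP => lt; apply: nz.
  have e0 : 0 < (H p - q) / 2 by lra.
  have [d d0 hd] := wan_cont (wH p Ip) e0.
  have : nbhs p I by exact: open_nbhs_nbhs.
  move=> /nbhs_ballP[d' /= d0' hd'].
  apply/interior_near2; exists (Num.min (Num.min d d') ((H p - q) / 2)).
    by rewrite !lt_min d0 d0'.
  move=> [p' q'] [/=]; rewrite !lt_min => /andP[/andP[a1 a2] _] /andP[_ a3].
  apply/hK; split; first by apply: hd'; rewrite /ball /= distrC.
  by move: a3 (hd p' a1); rewrite !ltr_norml => /andP[? ?] /andP[? ?]; lra.
split; first exact/hK.
move=> /interior_near2[e e0 he].
have /hK[_ /=] : K (p, H p + e / 2).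
  by apply: he; split; rewrite /= ?subrr ?normr0 // addrAC subrr add0r gtr0_norm; lra.
lra.
Qed.

Lemma derive_le_eps (H : R -> R) (p e : R) : derivable H p 1 -> 0 < e -> exists2 dl, 0 < dl &
  forall k, `|k| < dl -> `|H (p + k) - H p - derive1 H p * k| <= e * `|k|.
Proof.
move=> dH e0; have : is_derive p 1 H (derive1 H p).
  by rewrite derive1E; exact: derivableP.
move=> [_ hv]; have := dH => /cvgrPdist_le /(_ e e0).
rewrite -[lim _]/('D_1 H p) hv => -[dl /= dl0 hdl]; exists dl => // k kd.
have [->|k0] := eqVneq k 0; first by rewrite addr0 subrr mulr0 subr0 normr0 mulr0.
have := hdl k; rewrite /ball_ /= sub0r normrN => /(_ kd k0).
rewrite /GRing.scale /= mulr1 [k + p]addrC => hk.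
have -> : H (p + k) - H p - derive1 H p * k = - ((derive1 H p - k^-1 * (H (p + k) - H p)) * k).
  by rewrite mulrBl mulrAC mulVf // mul1r; ring.
by rewrite normrN normrM ler_wpM2r.
Qed.

(** The concavity inequality along the segment, divided by [t] for small [t], up to an error [e]. *)
Lemma tangent_above (H : R -> R) p v : wan H p ->
  (forall t, 0 < t <= 1 -> (1 - t) * H p + t * H v <= H (p + t * (v - p))) ->
  H v - H p <= derive1 H p * (v - p).
Proof.
move=> wH hc; apply/ler_addgt0Pr => e e0.
have n0 : 0 < `|v - p| + 1 by rewrite ltr_wpDl.
have [dl dl0 hd] := derive_le_eps (wan_derivable wH) (divr_gt0 e0 n0).
pose t := Num.min 1 (dl / (2 * (`|v - p| + 1))).
have q0 : 0 < dl / (2 * (`|v - p| + 1)) by rewrite divr_gt0 // mulr_gt0.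
have t0 : 0 < t by rewrite lt_min ltr01.
have ht : 0 < t <= 1 by rewrite t0 ge_min lexx.
have td : `|t * (v - p)| < dl.
  have : t <= dl / (2 * (`|v - p| + 1)) by rewrite ge_min lexx orbT.
  rewrite ler_pdivlMr ?mulr_gt0 // normrM gtr0_norm // => h1.
  have : 0 < t * (`|v - p| + 2) by rewrite mulr_gt0 // ltr_wpDl.
  lra.
have := hd _ td; rewrite normrM (gtr0_norm t0) ler_norml => /andP[_ h1].
have := hc t ht => h2.
have h3 : e / (`|v - p| + 1) * `|v - p| <= e.
  by rewrite mulrAC ler_pdivrMr // ler_wpM2l // ?(ltW e0) // lerDl.
rewrite -(ler_pM2l t0); have := ler_wpM2l (ltW t0) h3; lra.
Qed.

End GraphArc.

(** * Boundary arcs at corners and at flat points *)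

Section Arcs.
Variable R : realType.
Local Notation pt := (pt R).
Implicit Types (c d : R) (u w z : pt).

Lemma multi_rot c d z : multi (rot c d z) = rot c d (multi z).
Proof. by rewrite /multi /rot /=; congr (_, _); ring. Qed.

Lemma subdiff_frE (N : set pt) s c d p0 : c ^+ 2 + d ^+ 2 = 1 ->
  subdiff N s p0 = rot c d @^-1` subdiff (fr c d p0 @^-1` N) (s \o fr c d p0) (0, 0).
Proof.
move=> h; apply/seteqP; split => xi /=.
  by move=> hx; apply/subdiff_fr => //; rewrite fr0.
by move=> /(subdiff_fr _ _ _ _ _ h); rewrite fr0.
Qed.

Lemma graph_concave (K : set pt) (H : R -> R) p v t : Defs.convex_set K ->
  K (p, H p) -> K (v, H v) ->
  (forall q, K (p + t * (v - p), q) -> q <= H (p + t * (v - p))) -> 0 <= t <= 1 ->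
  (1 - t) * H p + t * H v <= H (p + t * (v - p)).
Proof.
move=> vK kp kv hq ht; apply: hq; have := vK _ _ _ kp kv ht.
by rewrite /segpt /addp /scalep /= (_ : (1 - t) * p + t * v = p + t * (v - p)) //; ring.
Qed.

Theorem corner_arc (N W : set pt) (s : pt -> R) p0 pm pp c d x1 x2 h0 l1 l2 :
  good N s W -> c ^+ 2 + d ^+ 2 = 1 -> N p0 -> x1 < x2 -> 0 < h0 ->
  (forall x y, N (fr c d p0 (x, y)) -> x1 * y <= x <= x2 * y) ->
  (forall h, 0 <= h <= h0 -> N (fr c d p0 (x1 * h, h))) ->
  (forall h, 0 <= h <= h0 -> N (fr c d p0 (x2 * h, h))) ->
  (forall x y, 0 < y < h0 -> x1 * y < x < x2 * y -> W (fr c d p0 (x, y))) ->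
  (forall h xi, 0 < h < h0 -> ~ subdiff N s (fr c d p0 (x1 * h, h)) xi) ->
  (forall h xi, 0 < h < h0 -> ~ subdiff N s (fr c d p0 (x2 * h, h)) xi) ->
  subp pm p0 = rot c (- d) (scalep l1 (x1, 1)) ->
  subp p0 pp = rot c (- d) (scalep l2 (x2, 1)) ->
  let C := frontier (subdiff N s p0) in
  ~ box_bounded C /\ convex_curve C /\
  unbounded_arc_with_end_tangents C (multi (subp pm p0)) (multi (subp p0 pp)).
Proof.
move=> gd h Np0 x12 h00 wedge N1 N2 Win E1 E2 hm hp C.
have gd' := good_fr p0 h gd.
have [|||H [wH hK [B hB]]] := @corner_graph R _ _ _ x1 x2 h0 gd' _ x12 h00 wedge N1 N2 Win.
- by rewrite /= fr0.
- by move=> k xi k0 /(subdiff_fr' _ _ _ _ _ h); exact: E1.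
- by move=> k xi k0 /(subdiff_fr' _ _ _ _ _ h); exact: E2.
set K := subdiff _ _ _ in hK.
have cK : closed K by exact: subdiff_closed.
have CE : C = [set rot c (- d) (t, H t) | t in setT].
  rewrite /C (subdiff_frE _ _ _ h) frontier_rot //.
  rewrite (@graph_frontier _ K setT H) //; last 2 first.
    exact: openT.
    by move=> p q; rewrite hK; split=> [|[]].
  apply/seteqP; split => [z [t _ E]|_ [t _ <-]].
    by exists t => //; rewrite E rotVK.
  by exists t => //; rewrite rotK.
have tan p v : H v - H p <= derive1 H p * (v - p).
  apply: tangent_above => // t /andP[t0 t1]; apply: (@graph_concave K).
  - exact: subdiff_convex.
  - exact/hK.
  - exact/hK.
  - by move=> q /hK.
  - by rewrite (ltW t0).
have CE0 : 0 <= B - H 0 by have [] := hB 0; rewrite mul0r subr0; lra.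
(* Concavity compares the derivative at [t] with the chords to [0] and to [2 t]; since [H] stays
   between two lines of slope [- x], the error is at most [(B - H 0) / |t|]. The limiting tangent
   [(1, - x)] is orthogonal to the side of direction [(x, 1)]. *)
have slope (e x : R) : (forall p, 0 < e * p -> H p <= B - p * x /\ H 0 - p * x <= H p) ->
    e ^+ 2 = 1 -> endlim e (fun t => derive1 H t) (- x).
  move=> hx e2 eps e0; exists ((B - H 0) / eps) => t te.
  have et : 0 < e * t by rewrite (le_lt_trans _ te) // divr_ge0 // ltW.
  rewrite ltr_pdivrMr // in te.
  have [a1 a2] := hx _ et.
  have [b1 b2] : H (t + t) <= B - (t + t) * x /\ H 0 - (t + t) * x <= H (t + t).
    by apply: hx; lra.
  have t1 := tan t 0; have t2 := tan t (t + t).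
  have k1 : `|derive1 H t - - x| * (e * t) <= B - H 0.
    rewrite -{1}(gtr0_norm et) -normrM mulrCA normrM.
    have -> : `|e| = 1 by apply/eqP; rewrite -sqrp_eq1 // real_normK ?num_real // e2.
    rewrite mul1r ler_norml; lra.
  rewrite -(ler_pM2r et); apply: (le_trans k1); lra.
have [|tp1 tp2] := endlim_tg (slope 1 x2 _ (expr1n _ _)).
  move=> p; rewrite mul1r => p0'; have [? _ k _] := hB p.
  by split => //; apply: k; exact: ltW.
have [||tm1 tm2] := endlim_tg (slope (- 1) x1 _ (_ : (- 1) ^+ 2 = 1)).
- move=> p; rewrite mulN1r oppr_gt0 => p0'; have [_ ? _ k] := hB p.
  by split => //; apply: k; exact: ltW.
- by rewrite sqrrN expr1n.
have tg0 (x : R) : tg1 x != 0.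
  by have [k _ _] := sqrt1_bounds x; rewrite /tg1 invr_eq0; apply/eqP; lra.
have [] := @graph_arc R c d id (fun=> 1) H C (multi (subp pm p0)) (multi (subp p0 pp))
   (tg1 (- x1), tg2 (- x1)) (tg1 (- x2), tg2 (- x2)) h.
- by move=> t; exact: wan_id.
- by move=> t; exact: ltr01.
- by [].
- by move=> t; exact: wH.
- by move=> M; exists M => t Mt; left.
- exact: CE.
- exact: tm1.
- exact: tm2.
- exact: tp1.
- exact: tp2.
- by case=> /eqP; rewrite (negbTE (tg0 _)).
- by case=> /eqP; rewrite (negbTE (tg0 _)).
- rewrite hm multi_rot crossp_rot ?sqrrN // /crossp /multi /scalep /tg2 /=; ring.
- rewrite hp multi_rot crossp_rot ?sqrrN // /crossp /multi /scalep /tg2 /=; ring.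
move=> nb arc; split => //; split => //.
by exists (subdiff N s p0); split => //; exact: subdiff_convex.
Qed.

(** An analytic parametrisation of the open interval by the whole line, as the definition of an arc
    demands. The symmetry [P (- t) - a = b - P t] reduces one end to the other. *)
Lemma logistic (a b : R) (P := fun t => a + (b - a) * (1 + expR (- t))^-1) : a < b ->
  [/\ forall t, wan P t, exists2 Dp, (forall t : R, is_derive t 1 P (Dp t)) & (forall t, 0 < Dp t),
   injective P & [/\ forall t, a < P t < b, forall p, a < p < b -> exists t, P t = p &
   forall e, 0 < e -> exists T, forall t, T < t -> b - e < P t /\ P (- t) < a + e]].
Proof.
move=> ab; have ba : 0 < b - a by lra.
have E0 t : 0 < expR t :> R by exact: expR_gt0.
have E1 t : 0 < 1 + expR (- t) :> R by rewrite addr_gt0.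
have wE t : wan (fun t : R => 1 + expR (- t)) t.
  apply: wanD; first exact: wan_cst.
  by apply: (wan_comp (wanN (wan_id t))); exact: wan_exp.
have sym t : P (- t) - a = b - P t.
  rewrite /P opprK expRN; have := E0 t; set x := expR t => x0; field.
  by apply/andP; split; apply/eqP; lra.
have inI t : a < P t < b.
  have : 0 < (1 + expR (- t))^-1 < 1 by rewrite invr_gt0 E1 invf_lt1 // ltrDl E0.
  move=> /andP[i0 i1]; rewrite /P; apply/andP; split; first by rewrite ltrDl mulr_gt0.
  have : (b - a) * (1 + expR (- t))^-1 < (b - a) * 1 by rewrite ltr_pM2l.
  lra.
split.
- move=> t; apply: wanD; first exact: wan_cst.
  apply: wanZ; apply: (wan_comp (f := fun t => 1 + expR (- t)) (wE t)).
  by apply: wan_inv; rewrite gt_eqF.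
- exists (fun t => (b - a) * ((1 + expR (- t)) ^- 2 * expR (- t))) => t; last first.
    by rewrite mulr_gt0 // mulr_gt0 // ?invr_gt0 ?exprn_gt0.
  have dN : is_derive t 1 (fun t : R => - t) (- 1) by exact: is_deriveN (is_derive_id t 1).
  have dE := @is_derive1_comp R expR (fun t => - t) t (expR (- t)) (- 1) (is_derive_expR _) dN.
  have dA := is_deriveD (is_derive_cst (1 : R) t 1) dE.
  have n0 : 1 + expR (- t) != 0 by rewrite gt_eqF.
  have dV := @is_deriveV R (fun t : R => 1 + expR (- t)) t _ _ n0 dA.
  have := is_deriveD (is_derive_cst a t 1) (is_deriveZ (b - a) dV).
  have -> : 0 + (b - a) *: (- (1 + expR (- t)) ^- 2 *: (0 + expR (- t) * - 1)) =
      (b - a) * ((1 + expR (- t)) ^- 2 * expR (- t)) by rewrite /GRing.scale /=; ring.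
  exact.
- move=> t t' /addrI /(mulfI (lt0r_neq0 ba)) /invr_inj /addrI /expR_inj /oppr_inj; exact.
split => //.
- move=> p /andP[ap pb]; exists (- ln ((b - p) / (p - a))).
  rewrite /P opprK lnK ?posrE ?divr_gt0 ?subr_gt0 //; field.
  by apply/andP; split; apply/eqP; lra.
move=> e e0; exists ((b - a) / e) => t; rewrite ltr_pdivrMr // => te.
suff : b - P t < e by move=> h; have := sym t; split; lra.
rewrite -sym /P opprK addrAC subrr add0r ltr_pdivrMr ?addr_gt0 //.
have : 1 + t <= expR t by exact: expR_ge1Dx.
nra.
Qed.

Theorem side_arc (N W : set pt) (s : pt -> R) p0 pm pp c d a b l l1 l2 :
  good N s W -> c ^+ 2 + d ^+ 2 = 1 -> a < b -> 0 < l ->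
  (forall x y, N (fr c d p0 (x, y)) -> 0 <= y) ->
  (forall x, `|x| <= l -> N (fr c d p0 (x, 0))) ->
  (forall x, - l <= x <= 0 -> s (fr c d p0 (x, 0)) = s p0 + a * x) ->
  (forall x, 0 <= x <= l -> s (fr c d p0 (x, 0)) = s p0 + b * x) ->
  (forall x y, `|x| < l -> 0 < y < l -> W (fr c d p0 (x, y))) ->
  subp pm p0 = rot c (- d) (l1, 0) -> subp p0 pp = rot c (- d) (l2, 0) ->
  let C := frontier (subdiff N s p0) in
  ~ box_bounded C /\ convex_curve C /\
  unbounded_arc_with_end_tangents C (multi (subp pm p0)) (multi (subp p0 pp)).
Proof.
move=> gd h ab l0 pos side sL sR Win hm hp C.
have gd' := good_fr p0 h gd.
have [||H [wH hK]] := @side_graph R _ _ _ a b l gd' ab l0 pos side _ _ Win.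
- by move=> x hx; rewrite /= fr0; exact: sL.
- by move=> x hx; rewrite /= fr0; exact: sR.
set K := subdiff _ _ _ in hK.
have cK : closed K by exact: subdiff_closed.
pose P t := a + (b - a) * (1 + expR (- t))^-1.
have [wP [Dp dP Dp0] Pinj [PI Psurj Pend]] := logistic ab.
have CE : C = [set rot c (- d) (P t, H (P t)) | t in setT].
  rewrite /C (subdiff_frE _ _ _ h) frontier_rot //.
  rewrite (@graph_frontier _ K `]a, b[ H) //.
  apply/seteqP; split => [z [p pI E]|_ [t _ <-]].
    rewrite /= in_itv /= in pI; have [t tp] := Psurj p pI.
    by exists t => //; rewrite /P tp E rotVK.
  by exists (P t); rewrite /= ?in_itv ?PI ?rotK.
have tan p v : a < p < b -> a < v < b -> H v - H p <= derive1 H p * (v - p).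
  move=> pI vI; apply: tangent_above => [|t /andP[t0 t1]]; first exact: wH.
  apply: (@graph_concave K).
  - exact: subdiff_convex.
  - exact/hK.
  - exact/hK.
  - by move=> q /hK[].
  - by rewrite (ltW t0).
pose c0 := (a + b) / 2; have c0I : a < c0 < b by rewrite /c0; lra.
(* [K] is closed and lies over the open interval, so no bounded part of the graph approaches a
   finite end: otherwise the limit point [(x0, - M)] would belong to [K]. *)
have blow x0 : ~ (a < x0 < b) -> forall M, exists2 dl, 0 < dl & forall p, a < p < b ->
    `|p - x0| < dl -> H p < - M.
  move=> nx M; apply: contrapT => hn; apply: nx.
  suff /hK[] : K (x0, - M) by [].
  apply: ((closed_near2 K).1 cK) => e e0; apply: contrapT => he; apply: hn.
  exists e => // p pI pe; rewrite ltNge; apply/negP => hM; apply: he.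
  exists (p, - M); first exact/hK.
  by split => //=; rewrite subrr normr0.
have blowT M : exists T, forall t, T < t -> H (P t) < - M /\ H (P (- t)) < - M.
  have [|d1 d10 h1] := blow b _ M; first by rewrite ltxx andbF.
  have [|d2 d20 h2] := blow a _ M; first by rewrite ltxx.
  have [|T hT] := Pend (Num.min d1 d2); first by rewrite lt_min d10.
  exists T => t /hT[]; rewrite -/(P _) -/(P _).
  have /andP[p1 p2] := PI t; have /andP[q1 q2] := PI (- t).
  rewrite -!/(P _) in p1 p2 q1 q2 *.
  have m1 : Num.min d1 d2 <= d1 by rewrite ge_min lexx.
  have m2 : Num.min d1 d2 <= d2 by rewrite ge_min lexx orbT.
  move=> r1 r2; split; [apply: h1|apply: h2]; try exact: PI; rewrite ltr_norml;
    clear -p1 p2 q1 q2 r1 r2 m1 m2 d10 d20; lra.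
have slope M : exists T, forall t, T < t -> derive1 H (P t) < M /\ - M < derive1 H (P (- t)).
  (* At this depth the chord from the midpoint [c0], of width less than [b - a], is steeper than
     [|M|]; by concavity the tangent is steeper still. *)
  have [T hT] := blowT ((`|M| + 1) * (b - a) - H c0).
  have [|T' hT'] := Pend ((b - a) / 4); first by rewrite divr_gt0 // subr_gt0.
  exists (Num.max T T') => t; rewrite gt_max => /andP[/hT[k1 k2] /hT'[]]; rewrite -!/(P _) => r1 r2.
  have /andP[p1 p2] := PI t; have /andP[q1 q2] := PI (- t); rewrite -!/(P _) in p1 p2 q1 q2.
  have t1 := tan _ _ (PI t) c0I; have t2 := tan _ _ (PI (- t)) c0I; rewrite -!/(P _) in t1 t2.
  have nM : - `|M| <= M by rewrite lerNl -normrN ler_norm.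
  have nM' : M <= `|M| by rewrite ler_norm.
  have n0 : 0 <= `|M| by [].
  move: k1 k2 r1 r2 p1 p2 q1 q2 t1 t2 nM nM' n0; rewrite /c0.
  move: (P t) (P (- t)) (derive1 H (P t)) (derive1 H (P (- t))) (`|M|) => p q m n A.
  move=> k1 k2 r1 r2 p1 p2 q1 q2 t1 t2 nM nM' n0.
  clear -k1 k2 r1 r2 p1 p2 q1 q2 t1 t2 nM nM' n0; split.
    rewrite ltNge; apply/negP => Mm.
    have u0 : 0 < p - (a + b) / 2 by lra.
    have : - A * (p - (a + b) / 2) <= m * (p - (a + b) / 2) by rewrite ler_pM2r //; lra.
    have : A * (p - (a + b) / 2) <= A * (b - a) by rewrite ler_wpM2l //; lra.
    lra.
  rewrite ltNge; apply/negP => Mm.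
  have u0 : 0 < (a + b) / 2 - q by lra.
  have : n * ((a + b) / 2 - q) <= A * ((a + b) / 2 - q) by rewrite ler_pM2r //; lra.
  have : A * ((a + b) / 2 - q) <= A * (b - a) by rewrite ler_wpM2l //; lra.
  lra.
have [|tp1 tp2] := @endlim_tg_ninfty R 1 (fun t => derive1 H (P t)).
  by move=> M; have [T hT] := slope M; exists T => t; rewrite mul1r => /hT[].
have [|tm1 tm2] := @endlim_tg_infty R (- 1) (fun t => derive1 H (P t)).
  move=> M; have [T hT] := slope (- M); exists T => t; rewrite mulN1r => /hT[_].
  by rewrite !opprK.
(* In the rotated frame the arc comes up vertically at the left end and goes down vertically at the
   right end. *)
have [] := @graph_arc R c d P Dp H C (multi (subp pm p0)) (multi (subp p0 pp)) (0, 1) (0, - 1) h.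
- exact: wP.
- exact: Dp0.
- exact: Pinj.
- by move=> t; apply: wH; exact: PI.
- move=> M; have [T hT] := blowT `|M|; exists T => t Tt; right.
  have : H (P t) < - `|M|.
    by move: Tt; have [t0|t0] := ger0P t; move=> /hT[]; rewrite ?opprK.
  rewrite ltrNr => hM; rewrite (le_lt_trans (ler_norm M)) // (lt_le_trans hM) //.
  by rewrite -normrN ler_norm.
- exact: CE.
- exact: tm1.
- exact: tm2.
- exact: tp1.
- exact: tp2.
- by case=> /eqP; rewrite oner_eq0.
- by case=> /eqP; rewrite oppr_eq0 oner_eq0.
- rewrite hm multi_rot crossp_rot ?sqrrN // /crossp /multi /=; ring.
- rewrite hp multi_rot crossp_rot ?sqrrN // /crossp /multi /=; ring.
move=> nb arc; split => //; split => //.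
by exists (subdiff N s p0); split => //; exact: subdiff_convex.
Qed.

End Arcs.

(** * Polygons and their edges *)

Section Hull.
Variable R : realType.
Local Notation pt := (pt R).
Implicit Types (P S : set pt) (z w v : pt).

Lemma conv_hull_convex P : Defs.convex_set (conv_hull P).
Proof.
move=> _ _ t [n [w [v [w0 [w1 [Pv ->]]]]]] [m [w' [v' [w0' [w1' [Pv' ->]]]]]] /andP[t0 t1].
exists (n + m)%N.
exists (fun k : 'I_(n + m) => match fintype.split k with inl i => (1 - t) * w i | inr j => t * w' j end).
exists (fun k : 'I_(n + m) => match fintype.split k with inl i => v i | inr j => v' j end).
have E (F : 'I_n -> R) (G : 'I_m -> R) :
    \sum_(k < n + m) match fintype.split k with inl i => F i | inr j => G j end = \sum_i F i + \sum_j G j.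
  rewrite big_split_ord /=; congr (_ + _); apply: eq_bigr => i _.
    by rewrite (unsplitK (inl i : 'I_n + 'I_m)).
  by rewrite (unsplitK (inr i : 'I_n + 'I_m)).
have E2 (k : 'I_(n + m)) (p : pt -> R) :
    (match fintype.split k with inl i => (1 - t) * w i | inr j => t * w' j end) *
    p (match fintype.split k with inl i => v i | inr j => v' j end) =
    match fintype.split k with inl i => (1 - t) * (w i * p (v i)) | inr j => t * (w' j * p (v' j)) end.
  by case: (fintype.split k) => i; rewrite mulrA.
split; first by move=> k; case: (fintype.split k) => i; rewrite mulr_ge0 // subr_ge0.
split; first by rewrite E -!mulr_sumr w1 w1'; ring.
split; first by move=> k; case: (fintype.split k) => i.
rewrite /segpt /addp /scalep /=; congr (_, _).
  by rewrite (eq_bigr _ (fun k _ => E2 k fst)) E -!mulr_sumr.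
by rewrite (eq_bigr _ (fun k _ => E2 k snd)) E -!mulr_sumr.
Qed.

Lemma conv_hull_bounded P M : (forall z, P z -> `|z.1| <= M /\ `|z.2| <= M) ->
  forall z, conv_hull P z -> `|z.1| <= M /\ `|z.2| <= M.
Proof.
move=> hP _ [n [w [v [w0 [w1 [Pv ->]]]]]] /=.
have key (p : pt -> R) : (forall i, `|p (v i)| <= M) -> `|\sum_(i < n) w i * p (v i)| <= M.
  move=> hp; rewrite (le_trans (ler_norm_sum _ _ _)) //.
  rewrite -[leRHS]mul1r -w1 mulr_suml; apply: ler_sum => i _.
  by rewrite normrM ger0_norm // ler_wpM2l.
by split; apply: key => i; have [] := hP _ (Pv i).
Qed.

Lemma conv_hull_sub P S : P `<=` S -> conv_hull P `<=` conv_hull S.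
Proof. by move=> PS _ [n [w [v [w0 [w1 [Pv ->]]]]]]; exists n, w, v; split => //; split => //; split => // i; exact: PS. Qed.

Lemma conv_hull_mem P v : P v -> conv_hull P v.
Proof.
move=> Pv; exists 1%N, (fun=> 1), (fun=> v); split=> //; split; first by rewrite big_ord1.
by split => //; rewrite !big_ord1 !mul1r -surjective_pairing.
Qed.

(** Collecting the weights that fall on [P] writes a convex combination as a point of a segment from
    [v]. Adding one point at a time then gives compactness of the hull of a finite set. *)
Lemma conv_hull_add P v : P !=set0 ->
  conv_hull (v |` P) = [set segpt v x t | x in conv_hull P & t in `[(0 : R), 1]].
Proof.
move=> [v0 Pv0]; apply/seteqP; split; last first.
  move=> _ [x hx [t ht] <-]; apply: conv_hull_convex.
  - by apply: conv_hull_mem; left.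
  - by apply: conv_hull_sub hx; exact: subsetUr.
  - by move: ht; rewrite /= in_itv.
move=> _ [n [w [u [w0 [w1 [Pu ->]]]]]].
pose b i := `[< P (u i) >].
pose A := \sum_(i | b i) w i.
have A0 : 0 <= A by exact: sumr_ge0.
have split_ (F : 'I_n -> R) : \sum_i F i = \sum_(i | b i) F i + \sum_(i | ~~ b i) F i.
  by rewrite (bigID b).
have AC : \sum_(i | ~~ b i) w i = 1 - A by rewrite -w1 split_ /A; ring.
have A1 : A <= 1 by rewrite -subr_ge0 -AC; exact: sumr_ge0.
have uv i : ~~ b i -> u i = v.
  by move=> /asboolPn nb; case: (Pu i) => // /nb.
have S (p : pt -> R) : \sum_i w i * p (u i) = \sum_(i | b i) w i * p (u i) + (1 - A) * p v.
  rewrite split_; congr (_ + _); rewrite -AC mulr_suml; apply: eq_bigr => i /uv -> //.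
rewrite (S fst) (S snd).
have [A00|An] := eqVneq A 0.
  exists v0; first exact: conv_hull_mem.
  exists 0; first by rewrite /= in_itv /= lexx ler01.
  have Z i : b i -> w i = 0.
    move: A00; rewrite /A => /eqP; rewrite psumr_eq0 // => /allP h bi.
    by have := h i (mem_index_enum i); rewrite bi => /eqP.
  rewrite A00 !big1 /segpt /addp /scalep /=; first by congr (_, _); ring.
    by move=> i /Z ->; rewrite mul0r.
  by move=> i /Z ->; rewrite mul0r.
have Ap : 0 < A by rewrite lt_neqAle eq_sym An.
pose x : pt := (A^-1 * \sum_(i | b i) w i * (u i).1, A^-1 * \sum_(i | b i) w i * (u i).2).
exists x.
  exists n, (fun i => if b i then A^-1 * w i else 0), (fun i => if b i then u i else v0).
  split; first by move=> i; case: (b i) => //; rewrite mulr_ge0 // invr_ge0.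
  split; first by rewrite -big_mkcond -mulr_sumr mulVf.
  split; first by move=> i; case: (boolP (b i)) => // /asboolP.
  rewrite /x; congr (_, _); rewrite mulr_sumr big_mkcond; apply: eq_bigr => i _;
    by case: (b i); rewrite ?mul0r ?mulrA.
exists A; first by rewrite /= in_itv /= A0.
by rewrite /x /segpt /addp /scalep /= !mulrA divff // !mul1r; congr (_, _); rewrite addrC.
Qed.

Lemma conv_hull1 v : conv_hull [set v] = [set v].
Proof.
apply/seteqP; split; last by move=> _ ->; exact: conv_hull_mem.
move=> _ [n [w [u [w0 [w1 [Pu ->]]]]]] /=; rewrite [v]surjective_pairing.
have E i : u i = v by exact: Pu.
by congr (_, _); under eq_bigr do rewrite E; rewrite -mulr_suml w1 mul1r.
Qed.

Lemma conv_hull_compact (s : seq pt) : compact (conv_hull [set` s]).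
Proof.
elim: s => [|v s IH].
  have -> : conv_hull [set` [::]] = set0 :> set pt.
    apply/seteqP; split => // x [[|n] [w [u [w0 [w1 [Pu _]]]]]].
      by move: w1 => /eqP; rewrite big_ord0 eq_sym oner_eq0.
    by have := Pu ord0.
  exact: compact0.
have -> : [set` v :: s] = v |` [set` s].
  apply/seteqP; split => x /=; rewrite inE.
    by case/orP => [/eqP ->|]; [left|right].
  by case=> [->|->]; rewrite ?eqxx ?orbT.
have [E|/set0P S0] := eqVneq [set` s] set0.
  by rewrite E setU0 conv_hull1; exact: compact_set1.
rewrite conv_hull_add //.
have -> : [set segpt v x t | x in conv_hull [set` s] & t in `[(0 : R), 1]] =
    (fun z : pt * R => segpt v z.1 z.2) @` (conv_hull [set` s] `*` `[0, 1]).
  apply/seteqP; split => [_ [x hx [t ht] <-]|_ [[x t] [hx ht] <-]].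
    by exists (x, t).
  by exists x => //; exists t.
apply: continuous_compact; last by apply: compact_setX => //; exact: segment_compact.
apply: continuous_subspaceT => z; rewrite /segpt /addp /scalep /=.
have c2 : (fun z : pt * R => z.2) @ z --> z.2 by exact: cvg_snd.
have c1 : (fun z : pt * R => z.1) @ z --> z.1 by exact: cvg_fst.
have c11 : (fun z : pt * R => z.1.1) @ z --> z.1.1 by apply: cvg_comp c1 _; exact: cvg_fst.
have c12 : (fun z : pt * R => z.1.2) @ z --> z.1.2 by apply: cvg_comp c1 _; exact: cvg_snd.
have cA (a : R) (f : pt * R -> R) (l : R) : f @ z --> l ->
    (fun z : pt * R => (1 - z.2) * a + z.2 * f z) @ z --> (1 - z.2) * a + z.2 * l.
  move=> hf; apply: cvgD; apply: cvgM => //; try exact: cvg_cst.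
  by apply: cvgB => //; exact: cvg_cst.
exact: (cvg_pair (cA v.1 _ _ c11) (cA v.2 _ _ c12)).
Qed.

Lemma polygon_closed P : finite_set P -> closed (conv_hull P).
Proof.
move=> /finite_seqP[s ->]; apply: compact_closed; last exact: conv_hull_compact.
exact: norm_hausdorff.
Qed.

Lemma finite_bounded P : finite_set P -> exists M, forall z, P z -> `|z.1| <= M /\ `|z.2| <= M.
Proof.
move=> /finite_seqP[s ->]; exists (\sum_(z <- s) (`|z.1| + `|z.2|)) => z /= zs.
rewrite (big_rem z) //=.
have : 0 <= \sum_(y <- rem z s) (`|y.1| + `|y.2|) by apply: sumr_ge0 => i _; rewrite addr_ge0.
have := normr_ge0 z.1; have := normr_ge0 z.2; lra.
Qed.

End Hull.

(** * Triangles, null lines and isolation of finitely many points *)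

Section Geometry.
Variable R : realType.
Local Notation pt := (pt R).
Implicit Types (N S K : set pt) (z w v a b : pt).

(** Barycentric coordinates in the triangle [a b c], with weight [1 - be - ga] at [a]; [baryE]
    recovers them by Cramer's rule. *)
Definition bary a b c (be ga : R) : pt :=
  (a.1 + be * (b.1 - a.1) + ga * (c.1 - a.1), a.2 + be * (b.2 - a.2) + ga * (c.2 - a.2)).

Lemma bary_mem S a b c be ga : Defs.convex_set S -> S a -> S b -> S c ->
  0 <= be -> 0 <= ga -> be + ga <= 1 -> S (bary a b c be ga).
Proof.
move=> vS Sa Sb Sc be0 ga0 bg.
have [E|n] := eqVneq (be + ga) 0.
  have [-> ->] : be = 0 /\ ga = 0 by split; lra.
  by rewrite /bary !mul0r !addr0 -surjective_pairing.
have p : 0 < be + ga by rewrite lt_neqAle eq_sym n addr_ge0.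
have -> : bary a b c be ga = segpt a (segpt b c (ga / (be + ga))) (be + ga).
  rewrite /bary /segpt /addp /scalep /=; congr (_, _); field; exact: lt0r_neq0.
apply: (vS) => //; last by rewrite bg ltW.
by apply: vS => //; rewrite divr_ge0 ?(ltW p) //= ler_pdivrMr // mul1r lerDr.
Qed.

Lemma baryE a b c z : crossp (subp b a) (subp c a) != 0 ->
  z = bary a b c (crossp (subp z a) (subp c a) / crossp (subp b a) (subp c a))
     (crossp (subp b a) (subp z a) / crossp (subp b a) (subp c a)).
Proof.
case: z => z1 z2; rewrite /bary /crossp /subp /= => D0.
by congr (_, _); field.
Qed.

Lemma bary_near S a b c be ga : Defs.convex_set S -> S a -> S b -> S c ->
  crossp (subp b a) (subp c a) != 0 -> 0 < be -> 0 < ga -> be + ga < 1 ->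
  exists2 dl, 0 < dl & forall z, near2 dl (bary a b c be ga) z -> S z.
Proof.
move=> vS Sa Sb Sc D0 be0 ga0 bg; set D := crossp _ _ in D0.
pose m := Num.min (Num.min be ga) ((1 - be - ga) / 2).
have m0 : 0 < m by rewrite !lt_min be0 ga0 divr_gt0 // -addrA -opprD subr_gt0.
pose k := `|b.1 - a.1| + `|b.2 - a.2| + (`|c.1 - a.1| + `|c.2 - a.2|) + 1.
have n1 := normr_ge0 (b.1 - a.1); have n2 := normr_ge0 (b.2 - a.2).
have n3 := normr_ge0 (c.1 - a.1); have n4 := normr_ge0 (c.2 - a.2).
have k0 : 0 < k by rewrite /k; lra.
have D1 : 0 < `|D| by rewrite normr_gt0.
pose dl := m * `|D| / k; have dl0 : 0 < dl by rewrite divr_gt0 // mulr_gt0.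
exists dl => // z; set z0 := bary _ _ _ _ _ => -[h1 h2].
pose be' := crossp (subp z a) (subp c a) / D; pose ga' := crossp (subp b a) (subp z a) / D.
have key (p q x y : R) : `|x| < dl -> `|y| < dl -> `|p| + `|q| + 1 <= k -> `|(p * x + q * y) / D| < m.
  move=> hx hy pq; rewrite normrM normfV ltr_pdivrMr //.
  have p0 := normr_ge0 p; have q0 := normr_ge0 q.
  have E : m * `|D| = dl * k by rewrite /dl divfK // gt_eqF.
  rewrite E (le_lt_trans (ler_normD _ _)) // !normrM.
  have : `|p| * `|x| <= `|p| * dl by rewrite ler_wpM2l // ltW.
  have : `|q| * `|y| <= `|q| * dl by rewrite ler_wpM2l // ltW.
  have : (`|p| + `|q| + 1) * dl <= k * dl by rewrite ler_pM2r.
  clear h1 h2 n1 n2 n3 n4 be0 ga0 bg m0; lra.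
have B1 : `|be' - be| < m.
  have -> : be' - be = ((c.2 - a.2) * (z.1 - z0.1) + (- (c.1 - a.1)) * (z.2 - z0.2)) / D.
    by rewrite /be' /z0 /bary /D /crossp /subp /=; field; exact: D0.
  by apply: key => //; rewrite normrN /k; lra.
have G1 : `|ga' - ga| < m.
  have -> : ga' - ga = ((- (b.2 - a.2)) * (z.1 - z0.1) + (b.1 - a.1) * (z.2 - z0.2)) / D.
    by rewrite /ga' /z0 /bary /D /crossp /subp /=; field; exact: D0.
  by apply: key => //; rewrite normrN /k; lra.
have m1 : m <= be by rewrite !ge_min lexx.
have m2 : m <= ga by rewrite !ge_min lexx orbT.
have m3 : m <= (1 - be - ga) / 2 by rewrite !ge_min lexx orbT.
rewrite (baryE z D0); apply: bary_mem => //; move: B1 G1; rewrite -/D -/be' -/ga' !ltr_norml;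
  move: be' ga' m1 m2 m3; clearbody m; clear => be' ga' ? ? ? /andP[? ?] /andP[? ?]; lra.
Qed.

Lemma leb2_axis : leb2 [set z : pt | z.2 = 0] = 0%E.
Proof.
have -> : [set z : pt | z.2 = 0] = [set: R] `*` [set 0] by apply/seteqP; split => z /= => [|[]].
by rewrite /leb2 product_measure1E //= lebesgue_measure_set1 mule0.
Qed.

Lemma line_null (p : pt) c d S : c ^+ 2 + d ^+ 2 = 1 -> (forall z, S z -> (gr c d p z).2 = 0) ->
  mu_ext (@leb2 R) S = 0%E.
Proof.
move=> h hS; have mA : measurable [set z : pt | z.2 = 0].
  have -> : [set z : pt | z.2 = 0] = [set: R] `*` [set 0] by apply/seteqP; split => z /= => [|[]].
  exact: measurableX.
have [mL eL] := leb_pres_gr p h mA.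
apply/eqP; rewrite eq_le; apply/andP; split; last exact: mu_ext_ge0.
rewrite -leb2_axis -eL -mu_ext_leb2 //; exact: le_mu_ext_leb2.
Qed.

(** The rotation that takes [v] to the positive first axis, written so that heights in the new frame
    are cross products with [v]. *)
Lemma unit_dir v : v <> (0, 0) -> exists c d, [/\ c ^+ 2 + d ^+ 2 = 1, 0 < enorm v &
  forall z, rot c d z = (dotp v z / enorm v, crossp v z / enorm v)].
Proof.
move=> v0; have q0 : 0 < v.1 ^+ 2 + v.2 ^+ 2.
  rewrite lt_neqAle addr_ge0 ?sqr_ge0 // andbT eq_sym paddr_eq0 ?sqr_ge0 // !sqrf_eq0.
  by apply/negP => /andP[/eqP a0 /eqP b0]; apply: v0; rewrite [v]surjective_pairing a0 b0.
have E : enorm v ^+ 2 = v.1 ^+ 2 + v.2 ^+ 2 by rewrite /enorm /dotp -!expr2 sqr_sqrtr // ltW.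
have e0 : 0 < enorm v by rewrite /enorm sqrtr_gt0 /dotp -!expr2.
exists (v.1 / enorm v), (- v.2 / enorm v); split => //.
  by rewrite !expr_div_n -mulrDl sqrrN -E divff // gt_eqF // exprn_gt0.
by move=> z; rewrite /rot /dotp /crossp; congr (_, _) => /=; ring.
Qed.

(** Three non-collinear points span a triangle with interior; without such points the set lies on a
    line, which is null. *)
Lemma convex_thick K : Defs.convex_set K -> mu_ext (@leb2 R) K != 0%E ->
  exists xs dl, 0 < dl /\ forall z, near2 dl xs z -> K z.
Proof.
move=> vK mK; apply: contrapT => hn; move/negP: mK; apply; apply/eqP.
have col a b c : K a -> K b -> K c -> crossp (subp b a) (subp c a) = 0.
  move=> Ka Kb Kc; apply/eqP/negPn/negP => D0; apply: hn.
  have t3 : (0 : R) < 1 / 3 by lra.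
  have [|dl dl0 h] := @bary_near K a b c (1 / 3) (1 / 3) vK Ka Kb Kc D0 t3 t3; first lra.
  by exists (bary a b c (1 / 3) (1 / 3)), dl.
have [[a Ka]|/set0P/negP/negPn/eqP K0] := pselect (K !=set0); last first.
  by apply: (@line_null (0, 0) 1 0); [ring|rewrite K0].
have [[b [Kb ba]]|nb] := pselect (exists b, K b /\ b <> a).
  have [|c [d [h e0 hr]]] := @unit_dir (subp b a).
    move=> [E1 E2]; apply: ba; rewrite [a]surjective_pairing [b]surjective_pairing.
    by congr (_, _); apply/eqP; rewrite -subr_eq0 ?E1 ?E2.
  apply: (line_null (p := a) h) => z Kz; rewrite /gr hr /= col //; exact: mul0r.
apply: (@line_null a 1 0); first ring.
move=> z Kz; have -> : z = a by apply: contrapT => za; apply: nb; exists z.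
by rewrite /gr /rot /subp /=; ring.
Qed.

Lemma fin_min l (Q : 'I_l -> R -> Prop) : (forall j, exists2 d, 0 < d & Q j d) ->
  (forall j d d', 0 < d' <= d -> Q j d -> Q j d') -> exists2 d, 0 < d & forall j, Q j d.
Proof.
move=> h mono; have [f hf] := choice (fun j => let: ex_intro2 d d0 q := h j in ex_intro _ d (conj d0 q)).
exists (\big[Num.min/1]_j f j).
  by apply: lt_bigmin => // j _; have [] := hf j.
move=> j; apply: mono (hf j).2; rewrite bigmin_le_cond // andbT.
by apply: lt_bigmin => // i _; have [] := hf i.
Qed.

Lemma finite_avoid l (q : 'I_l -> pt) z :
  exists2 d, 0 < d & forall j, q j <> z -> ~ near2 d z (q j).
Proof.
apply: (@fin_min l (fun j d => q j <> z -> ~ near2 d z (q j))) => [j|j d d' /andP[d0 dd] h /h n /(near2_le dd)//].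
have [->|qz] := pselect (q j = z); first by exists 1.
apply: contrapT => hn; apply: qz.
have H d : 0 < d -> near2 d z (q j).
  by move=> d0; apply: contrapT => nn; apply: hn; exists d.
rewrite [z]surjective_pairing [q j]surjective_pairing; congr (_, _); apply/eqP;
  rewrite -subr_eq0 -normr_le0 leNgt; apply/negP => n0; have [n1 n2] := H _ n0; move: n1 n2; rewrite ?ltxx //.
Qed.

End Geometry.

(** * Affinity of the boundary values between neighbouring vertices *)

Section Edges.
Variable R : realType.
Local Notation pt := (pt R).
Implicit Types (N P : set pt) (v a b : pt) (L s : pt -> R).

(** [D] is the derivative of [f] at [t]. *)
Definition slope_at (f : R -> R) (t D : R) := forall e, 0 < e -> exists2 dl, 0 < dl &
  forall x, `|x| < dl -> `|f (t + x) - f t - D * x| <= e * `|x|.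

Lemma slope_ray f t D w k : slope_at f t D -> w != 0 ->
  (forall th, 0 <= th <= 1 -> f (t + th * w) - f t = th * k) -> D * w = k.
Proof.
move=> hD w0 hk; have nw : 0 < `|w| by rewrite normr_gt0.
apply/eqP; rewrite -subr_eq0 -normr_le0; apply/ler_addgt0Pr => e e0; rewrite add0r.
have [dl dl0 h] := hD _ (divr_gt0 e0 nw).
pose th := Num.min 1 (dl / (2 * `|w|)).
have th0 : 0 < th by rewrite lt_min ltr01 divr_gt0 // mulr_gt0.
have th1 : 0 <= th <= 1 by rewrite (ltW th0) ge_min lexx.
have tw : `|th * w| < dl.
  have : th <= dl / (2 * `|w|) by rewrite ge_min lexx orbT.
  rewrite ler_pdivlMr ?mulr_gt0 // normrM gtr0_norm //; nra.
have := h _ tw; rewrite hk // normrM (gtr0_norm th0).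
have -> : th * k - D * (th * w) = - (th * (D * w - k)) by ring.
rewrite normrN normrM (gtr0_norm th0) mulrCA ler_pM2l //.
by rewrite divfK // gt_eqF.
Qed.

Lemma slope_support f t D m r : slope_at f t D -> 0 < r ->
  (forall x, `|x| < r -> f t + m * x <= f (t + x)) -> D = m.
Proof.
move=> hD r0 hm; apply/eqP; rewrite -subr_eq0 -normr_le0; apply/ler_addgt0Pr => e e0.
have [dl dl0 h] := hD e e0; rewrite add0r.
pose x := Num.min dl r / 2.
have mx : 0 < Num.min dl r by rewrite lt_min dl0.
have x0 : 0 < x by rewrite divr_gt0.
have m1 : Num.min dl r <= dl by rewrite ge_min lexx.
have m2 : Num.min dl r <= r by rewrite ge_min lexx orbT.
have x1 : `|x| < dl by rewrite gtr0_norm // /x; lra.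
have x2 : `|x| < r by rewrite gtr0_norm // /x; lra.
have y1 : `|- x| < dl by rewrite normrN.
have y2 : `|- x| < r by rewrite normrN.
have := h _ x1; have := h _ y1; have := hm _ x2; have := hm _ y2.
rewrite normrN (gtr0_norm x0) !ler_norml => a1 a2 /andP[b1 b2] /andP[b3 b4].
by clear -x0 a1 a2 b1 b2 b3 b4; apply/andP; split; rewrite -(ler_pM2r x0); lra.
Qed.

Lemma segptB a b (t x : R) : segpt a b (t + x) = addp (segpt a b t) (scalep x (subp b a)).
Proof. by rewrite /segpt /addp /scalep /subp /=; congr (_, _); ring. Qed.

Lemma parallelE v e : v <> (0, 0) -> crossp v e = 0 -> exists k, e = scalep k v.
Proof.
move=> v0 h; have [c [d [u e0 hr]]] := unit_dir v0.
have q0 : v.1 ^+ 2 + v.2 ^+ 2 != 0.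
  apply: contra_not_neq v0 => /eqP; rewrite paddr_eq0 ?sqr_ge0 // !sqrf_eq0 => /andP[/eqP a0 /eqP b0].
  by rewrite [v]surjective_pairing a0 b0.
exists (dotp v e / (v.1 ^+ 2 + v.2 ^+ 2)); rewrite /scalep [e in LHS]surjective_pairing.
have h1 : v.1 * e.2 = v.2 * e.1 by apply/eqP; rewrite -subr_eq0; apply/eqP.
congr (_, _); apply: (mulIf q0); rewrite mulrAC divfK // /dotp.
  have -> : (v.1 * e.1 + v.2 * e.2) * v.1 = v.1 ^+ 2 * e.1 + v.2 * (v.1 * e.2) by ring.
  by rewrite h1; ring.
have -> : (v.1 * e.1 + v.2 * e.2) * v.2 = v.1 * (v.2 * e.1) + v.2 ^+ 2 * e.2 by ring.
by rewrite -h1; ring.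
Qed.

Lemma contS_segpt N s a b (t e : R) : Defs.convex_set N -> contS N s -> N a -> N b -> 0 <= t <= 1 ->
  0 < e -> exists2 d, 0 < d & forall x, 0 <= x <= 1 -> `|x - t| < d ->
    `|s (segpt a b x) - s (segpt a b t)| <= e.
Proof.
move=> vN cs Na Nb ht e0; have [d d0 hd] := cs _ (vN _ _ _ Na Nb ht) e e0.
pose k := `|b.1 - a.1| + `|b.2 - a.2| + 1; have k0 : 0 < k by rewrite ltr_wpDl ?addr_ge0.
exists (d / k) => [|x hx]; first by rewrite divr_gt0.
rewrite ltr_pdivlMr // => xt; apply: hd; first exact: vN.
have n1 := normr_ge0 (b.1 - a.1); have n2 := normr_ge0 (b.2 - a.2); have n3 := normr_ge0 (x - t).
rewrite (_ : x = t + (x - t)) ?segptB ?subrKC; last by ring.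
split; rewrite /addp /scalep /subp /= addrAC subrr add0r normrM (le_lt_trans _ xt) // ler_wpM2l // /k; lra.
Qed.

Lemma mix_itv (x y t : R) : 0 <= x <= 1 -> 0 <= y <= 1 -> 0 <= t <= 1 ->
  0 <= (1 - t) * x + t * y <= 1.
Proof. by move=> /andP[? ?] /andP[? ?] /andP[? ?]; apply/andP; split; nra. Qed.

(** Between neighbouring vertices [L] is differentiable at every point and has finitely many affine
    pieces. Were the convex function [s] not affine there, every slope between those of two chords
    would be a derivative somewhere; one slope more than there are pieces puts two of them on the
    same piece. *)
Lemma edge_affine N P L s a b : closed N -> Defs.convex_set N -> convex_on N s -> contS N s ->
  (forall p, frontier N p -> s p = L p) -> piecewise_affine_on_boundary N L ->
  ccw_next N (P `|` Qset N P L) a b ->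
  forall t, 0 <= t <= 1 -> s (segpt a b t) = (1 - t) * s a + t * s b.
Proof.
move=> cN vN vs cs sL [n [aa [bb [fr_ aff]]]] [Vb [ba [edge [noV left]]]].
have FN p : frontier N p -> N p by rewrite frontier_closed // => -[].
have seg0 : segpt a b 0 = a by rewrite /segpt /addp /scalep /= [RHS]surjective_pairing; congr (_, _); ring.
have seg1 : segpt a b 1 = b by rewrite /segpt /addp /scalep /= [RHS]surjective_pairing; congr (_, _); ring.
have Na : N a by apply: FN; rewrite -seg0; apply: edge; rewrite lexx ler01.
have Nb : N b by apply: FN; rewrite -seg1; apply: edge; rewrite lexx ler01.
pose f t := s (segpt a b t).
have v0 : subp b a <> (0, 0).
  move=> [E1 E2]; apply: ba; rewrite [a]surjective_pairing [b]surjective_pairing.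
  by congr (_, _); apply/eqP; rewrite -subr_eq0 ?E1 ?E2.
have slp t : 0 < t < 1 -> exists D, slope_at f t D.
  move=> ht; have htw : 0 <= t <= 1 by case/andP: ht => ? ?; rewrite !ltW.
  have nP : ~ P (segpt a b t) by move=> h; apply: (noV t ht); left.
  have nQ : ~ Qset N P L (segpt a b t) by move=> h; apply: (noV t ht); right.
  have [e [r [e0 [r0 [fre dL]]]]] : exists (e : pt) (r : R), e <> (0, 0) /\ 0 < r /\
         (forall x, `|x| < r -> frontier N (addp (segpt a b t) (scalep x e))) /\
         derivable (fun x : R => L (addp (segpt a b t) (scalep x e))) 0 1.
    by apply: contrapT => h; apply: nQ; split; [exact: edge|split].
  (* Frontier points on both sides along [e] lie in the half-plane of the edge, so [e] is parallel
     to the edge. *)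
  have ce : crossp (subp b a) e = 0.
    have r2 : `|r / 2| < r by rewrite gtr0_norm; lra.
    have r2' : `|- (r / 2)| < r by rewrite normrN.
    have h1 := left _ (FN _ (fre _ r2)); have h2 := left _ (FN _ (fre _ r2')).
    have E x : crossp (subp b a) (subp (addp (segpt a b t) (scalep x e)) a) = x * crossp (subp b a) e.
      by rewrite /crossp /subp /addp /scalep /segpt /addp /scalep /=; ring.
    rewrite !E in h1 h2; apply/eqP; rewrite eq_le; apply/andP; split; nra.
  have [k ek] := parallelE v0 ce.
  have k0 : k != 0 by apply: contra_not_neq e0 => k0; rewrite ek k0 /scalep !mul0r.
  have nk : 0 < `|k| by rewrite normr_gt0.
  pose h (x : R) := L (addp (segpt a b t) (scalep x e)).
  have fh x : `|x / k| < r -> f (t + x) = h (x / k).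
    move=> xr; rewrite /f /h segptB.
    have -> : scalep x (subp b a) = scalep (x / k) e.
      by rewrite ek /scalep /= !mulrA divfK.
    by apply: sL; exact: fre.
  exists (derive1 h 0 / k) => eps eps0.
  have [dl dl0 hd'] := derive_le_eps dL (mulr_gt0 eps0 nk).
  have hd y : `|y| < dl -> `|h (0 + y) - h 0 - derive1 h 0 * y| <= eps * `|k| * `|y| by exact: hd'.
  exists (Num.min dl r * `|k|); first by rewrite mulr_gt0 // lt_min dl0.
  move=> x; rewrite -ltr_pdivrMr // -normfV -normrM lt_min => /andP[xd xr].
  have := hd _ xd; rewrite add0r -fh //.
  have -> : h 0 = f t by rewrite -[t in RHS]addr0 fh ?mul0r ?normr0.
  have -> : eps * `|k| * `|x / k| = eps * `|x|.
    by rewrite -mulrA normrM normfV [`|k| * _]mulrC divfK // gt_eqF.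
  by rewrite mulrA mulrAC.
move=> t ht; apply/eqP; rewrite eq_le vs //= leNgt; apply/negP => lt.
have [E0|t0] := eqVneq t 0; first by move: lt; rewrite E0 seg0; lra.
have [E1|t1] := eqVneq t 1; first by move: lt; rewrite E1 seg1; lra.
have /andP[tp tl] : 0 < t < 1 by case/andP: ht => h1 h2; rewrite !lt_neqAle eq_sym t0 t1 h1.
rewrite -/(f t) in lt.
pose s1 := (f t - s a) / t; pose s2 := (s b - f t) / (1 - t).
have t1' : 0 < 1 - t by lra.
have s1E : s1 * t = f t - s a by rewrite /s1 divfK // gt_eqF.
have s2E : s2 * (1 - t) = s b - f t by rewrite /s2 divfK // gt_eqF.
have s12 : s1 < s2 by rewrite -(ltr_pM2r tp) -(ltr_pM2r t1'); nra.
(* [f x - m x] attains its minimum inside, since the chord slopes [s1 < m < s2] exclude both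
   ends. *)
have minm m : s1 < m < s2 -> exists ta, 0 < ta < 1 /\
    forall x, 0 <= x <= 1 -> f ta + m * (x - ta) <= f x.
  move=> /andP[m1 m2]; pose S := [set z : pt | 0 <= z.1 <= 1 /\ 0 <= z.2 <= 1].
  have cS : contS S (fun z => f z.1 - m * z.1).
    apply: contSB; last by apply: contSM; [exact: contS_cst|exact: contS_fst].
    move=> z [z1 _] e e0; have [d d0 hd] := contS_segpt vN cs Na Nb z1 e0.
    by exists d => // w [w1 _] [wz _]; exact: hd.
  have bS z : S z -> `|z.1| <= 1 /\ `|z.2| <= 1.
    by move=> [/andP[? ?] /andP[? ?]]; rewrite !ger0_norm.
  have S0 : S !=set0 by exists (0, 0); split; rewrite /= lexx ler01.
  have [z [z1 _] hz] := contS_min (@square_closed R 0 1) bS S0 cS.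
  have hz' x : 0 <= x <= 1 -> f z.1 - m * z.1 <= f x - m * x.
    by move=> hx; apply: (hz (x, x)).
  have f0 : f 0 = s a by rewrite /f seg0.
  have f1 : f 1 = s b by rewrite /f seg1.
  exists z.1; split; last by move=> x /hz' hx; clear -hx; lra.
  have := hz' t ht; case/andP: z1 => z10 z11; rewrite !lt_neqAle z10 z11 !andbT => ht'.
  apply/andP; split; apply/eqP => E.
    move: ht'; rewrite -E f0 => ht'; have : m * t <= s1 * t by clear -ht' s1E; lra.
    by rewrite ler_pM2r // leNgt m1.
  move: ht'; rewrite E f1 => ht'; have : s2 * (1 - t) <= m * (1 - t) by clear -ht' s2E; lra.
  by rewrite ler_pM2r // leNgt m2.
pose N2 : R := n.+2%:R; have N20 : 0 < N2 by rewrite ltr0n.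
(* These are [n + 1] distinct slopes strictly between [s1] and [s2], one more than the [n] affine
   pieces. *)
pose m (i : 'I_n.+1) := s1 + i.+1%:R / N2 * (s2 - s1).
have hm i : s1 < m i < s2.
  have i0 : 0 < i.+1%:R / N2 by rewrite divr_gt0 // ltr0n.
  have i1 : i.+1%:R / N2 < 1 by rewrite ltr_pdivrMr // mul1r ltr_nat ltnS.
  have d0 : 0 < s2 - s1 by lra.
  have := mulr_gt0 i0 d0; have : 0 < (1 - i.+1%:R / N2) * (s2 - s1) by rewrite mulr_gt0 // subr_gt0.
  rewrite /m; move: (i.+1%:R / N2) => y y1 y2; clear -y1 y2; lra.
have minj i j : m i = m j -> i = j.
  have d0 : s2 - s1 != 0 by rewrite subr_eq0 gt_eqF.
  have n0 : N2^-1 != 0 by rewrite invr_eq0 gt_eqF.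
  move=> /addrI /(mulIf d0) /(mulIf n0) /eqP; rewrite eqr_nat eqSS => /eqP h.
  exact: val_inj.
have [T hT] := choice (fun i => minm _ (hm i)).
have hJ i : exists k : 'I_n, exists2 x, 0 <= x <= 1 & segpt (aa k) (bb k) x = segpt a b (T i).
  have : frontier N (segpt a b (T i)).
    by apply: edge; have [/andP[? ?] _] := hT i; rewrite !ltW.
  by rewrite fr_ => -[k _ [x hx <-]]; exists k, x; move: hx; rewrite /= ?in_itv.
have [J hJJ] := choice hJ.
have : ~ injective J.
  by move=> /leq_card; rewrite !card_ord ltnn.
apply=> i j Jij; apply: minj.
have [/andP[i0 i1] iS] := hT i; have [/andP[j0 j1] jS] := hT j.
have sup k : slope_at f (T k) (m k).
  have [/andP[k0 k1] kS] := hT k; have [|D hD] := slp (T k); first by rewrite k0.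
  suff <- : D = m k by [].
  apply: (slope_support (r := Num.min (T k) (1 - T k)) hD); first by rewrite lt_min k0 subr_gt0.
  move=> x; rewrite lt_min !ltr_norml => /andP[/andP[u1 u2] /andP[u3 u4]].
  have := kS (T k + x); rewrite [T k + x - T k]addrAC subrr add0r; apply.
  by clear -u1 u4; lra.
have [x hx Ex] := hJJ i; have [y hy Ey] := hJJ j; rewrite -Jij in Ey.
have lin th : 0 <= th <= 1 -> f (T i + th * (T j - T i)) = (1 - th) * f (T i) + th * f (T j).
  move=> hth; have inI' := mix_itv hx hy hth.
  have inI : 0 <= T i + th * (T j - T i) <= 1.
    have -> : T i + th * (T j - T i) = (1 - th) * T i + th * T j by ring.
    by apply: mix_itv hth; rewrite ltW //= ltW.
  have E : segpt a b (T i + th * (T j - T i)) = segpt (aa (J i)) (bb (J i)) ((1 - th) * x + th * y).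
    have mixE (a' b' : pt) x' y' : segpt a' b' ((1 - th) * x' + th * y') =
        segpt (segpt a' b' x') (segpt a' b' y') th.
      by rewrite /segpt /addp /scalep /=; congr (_, _); ring.
    rewrite mixE Ex Ey -mixE; congr segpt; ring.
  have fE k z : 0 <= z <= 1 -> segpt (aa (J i)) (bb (J i)) z = segpt a b k -> 0 <= k <= 1 ->
      f k = (1 - z) * L (aa (J i)) + z * L (bb (J i)).
    by move=> hz Ez hk; rewrite -aff // Ez; apply: sL; exact: edge.
  rewrite (fE _ _ inI' (esym E) inI) (fE _ _ hx Ex) ?(fE _ _ hy Ey) ?ltW //; ring.
(* At a common point both slopes are the derivative there. Between distinct points [f] is affine, so
   both derivatives are the slope of the chord. *)
have [Tij|Tij] := eqVneq (T i) (T j).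
  have [/andP[k0 k1] kS] := hT j.
  apply: (slope_support (r := Num.min (T j) (1 - T j)) (f := f) (t := T j)).
  - by rewrite -Tij.
  - by rewrite lt_min k0 subr_gt0.
  move=> z; rewrite lt_min !ltr_norml => /andP[/andP[u1 u2] /andP[u3 u4]].
  have := kS (T j + z); rewrite [T j + z - T j]addrAC subrr add0r; apply.
  by clear -u1 u4; lra.
have w0 : T j - T i != 0 by rewrite subr_eq0 eq_sym.
have w0' : T i - T j != 0 by rewrite subr_eq0.
apply: (mulIf w0); rewrite (slope_ray (sup i) w0 (k := f (T j) - f (T i))); last first.
  by move=> th hth; rewrite lin //; ring.
rewrite -[T j - T i]opprB mulrN (slope_ray (sup j) w0' (k := f (T i) - f (T j))) ?opprB //.
move=> th hth; have -> : T j + th * (T i - T j) = T i + (1 - th) * (T j - T i) by ring.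
by rewrite lin; [ring|case/andP: hth => v1 v2; clear -v1 v2; lra].
Qed.

End Edges.

Lemma wedge_norm (R : realType) (x1 x2 x y d : R) : 0 < y -> x1 * y < x < x2 * y ->
  y * (`|x1| + `|x2| + 1) < d -> `|x| < d /\ `|y| < d.
Proof.
move=> y0 /andP[xl xr] yd; have n1 := normr_ge0 x1; have n2 := normr_ge0 x2.
have g1 := ler_norm x2; have g2 : - `|x1| <= x1 by rewrite lerNl -normrN ler_norm.
have q1 : x2 * y <= `|x2| * y by rewrite ler_pM2r.
have q2 : - `|x1| * y <= x1 * y by rewrite ler_pM2r.
have q3 : 0 <= `|x1| * y by rewrite mulr_ge0 // ltW.
have q4 : 0 <= `|x2| * y by rewrite mulr_ge0 // ltW.
by rewrite (gtr0_norm y0) ltr_norml; split; lra.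
Qed.

(** * The polygon near gas points, corners and flat points *)

Section Assembly.
Variable R : realType.
Local Notation pt := (pt R).
Variables (N P : set pt) (L : pt -> R) (l : nat) (q : 'I_l -> pt) (c : 'I_l -> R) (sigma : pt -> R).
Hypotheses (poly : is_polygon N P) (datum : boundary_datum N L).
Hypotheses (qint : forall j, interior N (q j)) (c0 : forall j, 0 < c j).
Hypothesis (tension : surface_tension N P L q c sigma).

Let V := P `|` Qset N P L.
Let W := interior N `\` range q.

Lemma N_closed : closed N.
Proof. by have [fP [-> _]] := poly; exact: polygon_closed. Qed.

Lemma N_convex : Defs.convex_set N.
Proof. by have [_ [-> _]] := poly; exact: conv_hull_convex. Qed.

Lemma sigma_cont : contS N sigma.
Proof. by have [_ [/contSP h _]] := tension. Qed.

Lemma sigma_convex : convex_on N sigma.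
Proof. by have [h _] := tension. Qed.

Lemma frontier_sub p : frontier N p -> N p.
Proof. by rewrite (frontier_closed N_closed) => -[]. Qed.

Lemma frontier_not_gas p : frontier N p -> forall j, q j <> p.
Proof. by move=> [_ np] j E; apply: np; rewrite -E; exact: qint. Qed.

(** On [W] all Dirac terms vanish, which leaves the equation with density one. *)
Lemma good_sigma : good N sigma W.
Proof.
have [fP [NE _]] := poly; have [K hK] := finite_bounded fP.
have oW : open W.
  apply: open_near2 => z [/interior_near2[d d0 hd] nz].
  have [d' d0' hd'] := finite_avoid q z.
  exists (Num.min (d / 2) d') => [|w [w1 w2]]; first by rewrite lt_min divr_gt0.
  have m1 : Num.min (d / 2) d' <= d / 2 by rewrite ge_min lexx.
  have m2 : Num.min (d / 2) d' <= d' by rewrite ge_min lexx orbT.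
  split; last first.
    move=> [j _ E]; apply: (hd' j); first by move=> jz; apply: nz; exists j.
    by rewrite E; split; exact: lt_le_trans m2.
  apply/interior_near2; exists (d / 2); first by rewrite divr_gt0.
  move=> v wv; apply: hd; rewrite (splitr d); apply: near2_trans wv.
  by split; exact: lt_le_trans m1.
exists K; split; [exact: N_closed|by rewrite NE; exact: conv_hull_bounded|exact: N_convex|exact: sigma_convex|].
split; [exact: sigma_cont|exact: oW|by move=> z [/interior_subset]|].
move=> E oE EW; have [_ [_ [_ MA]]] := tension.
rewrite MA; [|exact: open_measurable2|by move=> z /EW[]].
rewrite big1 ?adde0 // => j _; rewrite diracE memNset ?mule0 //.
by move=> /EW[_]; apply; exists j.
Qed.

(** The gradient image of the single point [q j] has measure at least [c j > 0], so [convex_thick]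
    finds interior points. *)
Lemma gas_thick j : exists xs dl, 0 < dl /\ forall z, near2 dl xs z -> subdiff N sigma (q j) z.
Proof.
apply: convex_thick; first exact: subdiff_convex.
have [_ [_ [_ MA]]] := tension.
have m1 : measurable [set q j] by rewrite (_ : [set q j] = [set (q j).1] `*` [set (q j).2]);
  [exact: measurableX|apply/seteqP; split => [z -> //|[z1 z2] [/= -> ->]]; rewrite -surjective_pairing].
have := MA [set q j] m1; rewrite /subdiff_img bigcup_set1 => ->; last by move=> z ->; exact: qint.
rewrite gt_eqF //; apply: (@lt_le_trans _ _ (c j)%:E); first by rewrite lte_fin.
rewrite (bigD1 j) //= diracE mem_set // mule1.
rewrite addeCA leeDl // adde_ge0 //.
by apply: sume_ge0 => i _; rewrite diracE mule_ge0 // lee_fin ltW.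
Qed.

Lemma gas_case j : let C := frontier (subdiff N sigma (q j)) in
  box_bounded C /\ convex_curve C /\ analytic_jordan_curve C.
Proof.
have [xs [dl [dl0 hdl]]] := gas_thick j.
have /interior_near2[d d0 hd] := qint j.
have [d' d0' hd'] := finite_avoid q (q j).
have m1 : Num.min (d / 2) d' <= d / 2 by rewrite ge_min lexx.
have m2 : Num.min (d / 2) d' <= d' by rewrite ge_min lexx orbT.
apply: (gas_curve good_sigma (rho := Num.min (d / 2) d') _ _ _ dl0 hdl).
- by rewrite lt_min divr_gt0.
- move=> z [z1 z2] zq; split.
    apply/interior_near2; exists (d / 2); first by rewrite divr_gt0.
    move=> v wv; apply: hd; rewrite (splitr d); apply: near2_trans wv.
    by split; exact: lt_le_trans m1.
  move=> [i _ E]; apply: (hd' i); first by rewrite E.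
  by rewrite E; split; exact: lt_le_trans m2.
- exact: interior_subset.
Qed.

Lemma interior_pos v (a z0 : pt) : v <> (0, 0) ->
  (forall z, N z -> 0 <= crossp v (subp z a)) -> interior N z0 -> 0 < crossp v (subp z0 a).
Proof.
move=> v0 h /interior_near2[d d0 hd].
have [_ [_ [_ e0 _]]] := unit_dir v0.
have q0 : 0 < v.1 * v.1 + v.2 * v.2 by move: e0; rewrite /enorm sqrtr_gt0.
pose k := `|v.1| + `|v.2| + 1; have k0 : 0 < k by rewrite ltr_wpDl ?addr_ge0.
pose r := d / k; have r0 : 0 < r by rewrite divr_gt0.
have E : r * k = d by rewrite /r divfK // gt_eqF.
have n1 := normr_ge0 v.1; have n2 := normr_ge0 v.2.
have small x : `|x| < k -> `|r * x| < d by move=> xk; rewrite normrM gtr0_norm // -E ltr_pM2l.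
(* Moving [z0] perpendicularly to [v] stays in [N] and lowers the cross product by [r |v|^2 > 0]. *)
have /h : N (z0.1 + r * v.2, z0.2 + r * (- v.1)).
  by apply: hd; split; rewrite /= addrAC subrr add0r; apply: small; rewrite ?normrN /k; lra.
have := mulr_gt0 r0 q0; rewrite /crossp /subp /=; lra.
Qed.

(** Near an inner point of the edge [a b], the half-box above it lies in the triangle with apex
    [z0]; barycentric coordinates in that triangle determine its size, and [finite_avoid] keeps it
    off the gas points. *)
Lemma inner_box (a b z0 : pt) t cc d lam : N a -> N b -> N z0 -> cc ^+ 2 + d ^+ 2 = 1 ->
  subp b a = rot cc (- d) (lam, 0) -> 0 < lam -> 0 < (gr cc d (segpt a b t) z0).2 ->
  0 < t < 1 -> (forall j, q j <> segpt a b t) ->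
  exists2 eta, 0 < eta & forall x y, `|x| < eta -> 0 < y < eta -> W (fr cc d (segpt a b t) (x, y)).
Proof.
move=> Na Nb Nz h vE l0 Y0 /andP[t0 t1] av; set m := segpt a b t in Y0 av *.
have z0E := grK m z0 h; set X := (gr cc d m z0).1; set Y := (gr cc d m z0).2 in Y0.
have z0E' : z0 = fr cc d m (X, Y) by rewrite -[LHS]z0E /X /Y -surjective_pairing.
have aE : a = fr cc d m (- (t * lam), 0).
  have e1 := congr1 fst vE; have e2 := congr1 snd vE; rewrite /subp /rot /= in e1 e2.
  rewrite /fr /rot /addp /m /segpt /addp /scalep /= [a in LHS]surjective_pairing.
  have b1 : b.1 = a.1 + (cc * lam - - d * 0) by rewrite -e1; ring.
  have b2 : b.2 = a.2 + (- d * lam + cc * 0) by rewrite -e2; ring.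
  by rewrite b1 b2; congr (_, _); ring.
have bE : b = fr cc d m ((1 - t) * lam, 0).
  have e1 := congr1 fst vE; have e2 := congr1 snd vE; rewrite /subp /rot /= in e1 e2.
  rewrite /fr /rot /addp /m /segpt /addp /scalep /= [b in LHS]surjective_pairing.
  have b1 : b.1 = a.1 + (cc * lam - - d * 0) by rewrite -e1; ring.
  have b2 : b.2 = a.2 + (- d * lam + cc * 0) by rewrite -e2; ring.
  by rewrite b1 b2; congr (_, _); ring.
have D0 : crossp (subp b a) (subp z0 a) != 0.
  have -> : crossp (subp b a) (subp z0 a) = (cc ^+ 2 + d ^+ 2) * (lam * Y).
    by rewrite {1}bE z0E' aE /crossp /subp /fr /rot /addp /=; ring.
  by rewrite h mul1r gt_eqF // mulr_gt0.
have [d' d0' hd'] := finite_avoid q m.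
pose mu := Num.min t (1 - t); have mu0 : 0 < mu by rewrite lt_min t0 subr_gt0.
have mu1 : mu <= t by rewrite ge_min lexx.
have mu2 : mu <= 1 - t by rewrite ge_min lexx orbT.
(* [k1], [k2] and [k3] bound the variation of the barycentric coordinates per unit of [x] and [y];
   [mu] is the distance of [t] from the ends of the edge. *)
pose k1 := lam^-1; have k10 : 0 < k1 by rewrite invr_gt0.
pose k2 := (t * lam + `|X|) / (lam * Y).
have k20 : 0 <= k2 by rewrite divr_ge0 ?addr_ge0 ?mulr_ge0 // ltW.
pose k3 := Y^-1; have k30 : 0 < k3 by rewrite invr_gt0.
have k0 : 0 < k1 + k2 + k3 by lra.
pose eta := Num.min (mu / (k1 + k2 + k3)) (d' / 2).
have eta0 : 0 < eta by rewrite lt_min !divr_gt0.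
have eta1 : eta * (k1 + k2 + k3) <= mu by rewrite -ler_pdivlMr // ge_min lexx.
have eta2 : eta <= d' / 2 by rewrite ge_min lexx orbT.
exists eta => // x y xe /andP[y0 ye].
pose ga := y * k3; pose be := t + (x * k1 - ga * (t * lam + X) * k1).
have E : fr cc d m (x, y) = bary a b z0 be ga.
  rewrite {1}aE {1}bE z0E' /bary /fr /rot /addp /= /be /ga /k1 /k3.
  by congr (_, _); field; rewrite ?gt_eqF.
have ga0 : 0 < ga by rewrite mulr_gt0.
have xk : `|x * k1| <= eta * k1 by rewrite normrM (gtr0_norm k10) ler_pM2r // ltW.
have gk : ga < eta * k3 by rewrite ltr_pM2r.
have wk : `|ga * (t * lam + X) * k1| <= eta * k2.
  have -> : ga * (t * lam + X) * k1 = y * ((t * lam + X) / (lam * Y)).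
    by rewrite /ga /k1 /k3; field; rewrite ?gt_eqF.
  have tl : 0 <= t * lam by rewrite mulr_ge0 // ltW.
  rewrite normrM (gtr0_norm y0) ler_pM // ?(ltW ye) ?(ltW y0) //.
  rewrite normrM normfV (gtr0_norm (mulr_gt0 l0 Y0)) /k2 ler_pM2r ?invr_gt0 ?mulr_gt0 //.
  by rewrite (le_trans (ler_normD _ _)) // (ger0_norm tl).
move: xk wk; rewrite !ler_norml => /andP[x1 x2] /andP[w1 w2].
have be0 : 0 < be by clear aE bE z0E z0E' D0 E xe eta0 eta2 Y0; rewrite /be; lra.
have bg : be + ga < 1 by clear aE bE z0E z0E' D0 E xe eta0 eta2 Y0; rewrite /be; lra.
have [dl dl0 hdl] := bary_near N_convex Na Nb Nz D0 be0 ga0 bg.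
split; first by apply/interior_near2; exists dl => //; rewrite E.
move=> [j _ jE]; apply: (hd' j); first exact: av.
rewrite jE; have := @near2_fr R cc d m (0, 0) (x, y) d' h; rewrite fr0; apply.
by split; rewrite /= subr0 ?(gtr0_norm y0) (lt_le_trans _ eta2).
Qed.

Lemma ccw_facts a b : ccw_next N V a b -> [/\ N a, N b, subp b a <> (0, 0),
  forall t, 0 <= t <= 1 -> frontier N (segpt a b t) & forall t, 0 <= t <= 1 -> N (segpt a b t)].
Proof.
move=> [_ [ba [edge _]]].
have FN t : 0 <= t <= 1 -> N (segpt a b t) by move=> /edge/frontier_sub.
have seg0 : segpt a b 0 = a by rewrite /segpt /addp /scalep /= [RHS]surjective_pairing; congr (_, _); ring.
have seg1 : segpt a b 1 = b by rewrite /segpt /addp /scalep /= [RHS]surjective_pairing; congr (_, _); ring.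
split => //; [by rewrite -seg0; apply: FN; rewrite lexx ler01|by rewrite -seg1; apply: FN; rewrite lexx ler01|].
move=> [E1 E2]; apply: ba; rewrite [a]surjective_pairing [b]surjective_pairing.
by congr (_, _); apply/eqP; rewrite -subr_eq0 ?E1 ?E2.
Qed.

Lemma sigma_edge a b t : ccw_next N V a b -> 0 <= t <= 1 ->
  sigma (segpt a b t) = (1 - t) * sigma a + t * sigma b.
Proof.
have [_ [pa _]] := datum; have [_ [_ [sL _]]] := tension.
by move=> ab; apply: (edge_affine N_closed N_convex sigma_convex sigma_cont sL pa ab).
Qed.

Lemma rot_self (v : pt) (cc d : R) : 0 < enorm v ->
  (forall z, rot cc d z = (dotp v z / enorm v, crossp v z / enorm v)) -> rot cc d v = (enorm v, 0).
Proof.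
move=> e0 ->; have e2 : enorm v ^+ 2 = dotp v v.
  by rewrite /enorm sqr_sqrtr // /dotp addr_ge0 // -expr2 sqr_ge0.
congr (_, _); first by rewrite -e2 expr2 mulfK // gt_eqF.
by rewrite /crossp [v.2 * _]mulrC subrr mul0r.
Qed.

Lemma fr_ray (a b : pt) cc d t : cc ^+ 2 + d ^+ 2 = 1 ->
  fr cc d a (scalep t (rot cc d (subp b a))) = segpt a b t.
Proof.
move=> h; have -> : scalep t (rot cc d (subp b a)) = rot cc d (scalep t (subp b a)).
  by rewrite /scalep /rot /=; congr (_, _); ring.
by rewrite /fr rotVK // /segpt /addp /scalep /subp /=; congr (_, _); ring.
Qed.

Lemma segptC (a b : pt) t : segpt a b t = segpt b a (1 - t).
Proof. by rewrite /segpt /addp /scalep /=; congr (_, _); ring. Qed.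

Lemma edge_no_subdiff a b t xi : ccw_next N V a b -> 0 < t < 1 -> ~ subdiff N sigma (segpt a b t) xi.
Proof.
move=> ab ht; have [Na Nb v0 Fe Ne] := ccw_facts ab.
have /andP[t0 t1] := ht; have htw : 0 <= t <= 1 by rewrite !ltW.
have [_ [_ [_ [z0 iz0]]]] := poly.
have left : forall z, N z -> 0 <= crossp (subp b a) (subp z a) by case: ab => _ [_ [_ [_]]].
have z0pos := interior_pos v0 left iz0.
set m := segpt a b t; set v := subp b a in v0 left z0pos.
have [cc [d [h e0 hr]]] := unit_dir v0; have rv := rot_self e0 hr.
have vE : v = rot cc (- d) (enorm v, 0) by rewrite -rv rotVK.
have Y0 : 0 < (gr cc d m z0).2.
  rewrite /gr hr /= divr_gt0 //; suff -> : crossp v (subp z0 m) = crossp v (subp z0 a) by [].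
  by rewrite /crossp /v /m /subp /segpt /addp /scalep /=; ring.
have [eta eta0 box] := inner_box Na Nb (interior_subset iz0) h vE e0 Y0 ht (frontier_not_gas (Fe t htw)).
pose mu := Num.min t (1 - t); have mu0 : 0 < mu by rewrite lt_min t0 subr_gt0.
have mu1 : mu <= t by rewrite ge_min lexx.
have mu2 : mu <= 1 - t by rewrite ge_min lexx orbT.
pose k := Num.min eta (mu * enorm v); have k0 : 0 < k by rewrite lt_min eta0 mulr_gt0.
have frx x : fr cc d m (x, 0) = segpt a b (t + x / enorm v).
  rewrite segptB -/v; move: vE e0; move: (enorm v) => e -> e0; rewrite /fr /addp /rot /scalep /=.
  by congr (_, _); field; rewrite gt_eqF.
have [K [_ _ _ vs [_ _ WN MA]]] := good_fr m h good_sigma.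
rewrite -/m -[m](fr0 cc d) => /(subdiff_fr _ _ _ _ _ h).
apply: (edge_empty vs WN MA (l := k) (eta := eta) (m := (sigma b - sigma a) / enorm v)) => //.
  move=> x xk; have xe : `|x| <= mu * enorm v by rewrite (le_trans xk) // ge_min lexx orbT.
  have : `|x / enorm v| <= mu by rewrite normrM normfV (gtr0_norm e0) ler_pdivrMr.
  rewrite ler_norml => /andP[x1 x2].
  have hx : 0 <= t + x / enorm v <= 1 by lra.
  rewrite /= fr0 frx; split; first exact: Ne.
  by rewrite (sigma_edge ab hx) (sigma_edge ab htw) -/m; field; rewrite gt_eqF.
by move=> x y xk hy; apply: box => //; rewrite (lt_le_trans xk) // ge_min lexx.
Qed.

(** The second axis of the frame is the bisector [n = |v| u + |u| v], so both sides have positive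
    height and the polygon lies in a wedge [x1 y <= x <= x2 y]. *)
Lemma corner_case p0 pm pp : ccw_next N V pm p0 -> ccw_next N V p0 pp ->
  0 < crossp (subp pp p0) (subp pm p0) ->
  let C := frontier (subdiff N sigma p0) in
  ~ box_bounded C /\ convex_curve C /\
  unbounded_arc_with_end_tangents C (multi (subp pm p0)) (multi (subp p0 pp)).
Proof.
move=> cm cp D0; have [Nm Np0 _ _ _] := ccw_facts cm; have [_ Npp _ Fp _] := ccw_facts cp.
set u := subp pp p0 in D0 *; set v := subp pm p0 in D0 *.
have n_pos (w : pt) : 0 <= dotp w w by rewrite /dotp addr_ge0 // -expr2 sqr_ge0.
have eu2 : enorm u ^+ 2 = dotp u u by rewrite /enorm sqr_sqrtr.
have ev2 : enorm v ^+ 2 = dotp v v by rewrite /enorm sqr_sqrtr.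
(* Lagrange's identity: with [crossp u v > 0] it excludes opposite directions, so [n] has a positive
   product with both sides. *)
have lag : dotp u v ^+ 2 + crossp u v ^+ 2 = (enorm u * enorm v) ^+ 2.
  by rewrite exprMn eu2 ev2 /dotp /crossp; ring.
have eu : 0 < enorm u.
  rewrite lt_neqAle sqrtr_ge0 andbT eq_sym; apply/eqP => E.
  by move: lag; rewrite E mul0r expr0n /= mulr0n; have := sqr_ge0 (dotp u v); have := exprn_gt0 2 D0; lra.
have ev : 0 < enorm v.
  rewrite lt_neqAle sqrtr_ge0 andbT eq_sym; apply/eqP => E.
  by move: lag; rewrite E mulr0 expr0n /= mulr0n; have := sqr_ge0 (dotp u v); have := exprn_gt0 2 D0; lra.
have uv : 0 < dotp u v + enorm u * enorm v.
  rewrite ltNge; apply/negP => le; have m0 := mulr_gt0 eu ev; have := exprn_gt0 2 D0; nra.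
pose n : pt := (enorm v * u.1 + enorm u * v.1, enorm v * u.2 + enorm u * v.2).
have un : dotp u n = enorm u * (dotp u v + enorm u * enorm v).
  have -> : dotp u n = enorm v * dotp u u + enorm u * dotp u v by rewrite /dotp /n /=; ring.
  by rewrite -eu2; ring.
have vn : dotp v n = enorm v * (dotp u v + enorm u * enorm v).
  have -> : dotp v n = enorm u * dotp v v + enorm v * dotp u v by rewrite /dotp /n /=; ring.
  by rewrite -ev2; ring.
have nn0 : (n.2, - n.1) <> (0, 0).
  move=> E; have E1 : n.2 = 0 := congr1 fst E.
  have E2 : n.1 = 0 by apply/eqP; rewrite -oppr_eq0; apply/eqP; exact: (congr1 snd E).
  have := mulr_gt0 eu uv.
  by rewrite -un /dotp -/n E1 E2 !mulr0 addr0 ltxx.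
have [cc [d [h e0 hr]]] := unit_dir nn0.
pose a1 := (rot cc d u).1; pose b1 := (rot cc d u).2.
pose a2 := (rot cc d v).1; pose b2 := (rot cc d v).2.
have cE (w : pt) : crossp (n.2, - n.1) w = dotp w n by rewrite /crossp /dotp /=; ring.
have b10 : 0 < b1 by rewrite /b1 hr /= cE un divr_gt0 // mulr_gt0.
have b20 : 0 < b2 by rewrite /b2 hr /= cE vn divr_gt0 // mulr_gt0.
have DE : crossp u v = a1 * b2 - b1 * a2 by rewrite -(crossp_rot _ _ h).
have uE : u = rot cc (- d) (a1, b1) by rewrite /a1 /b1 -surjective_pairing rotVK.
have vE : v = rot cc (- d) (a2, b2) by rewrite /a2 /b2 -surjective_pairing rotVK.
pose x1 := a2 / b2; pose x2 := a1 / b1.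
have x1E : x1 * b2 = a2 by rewrite /x1 divfK // gt_eqF.
have x2E : x2 * b1 = a1 by rewrite /x2 divfK // gt_eqF.
have x12 : x1 < x2.
  by rewrite -(ltr_pM2r (mulr_gt0 b10 b20)); move: D0; rewrite DE -x1E -x2E; lra.
have p0E : p0 = segpt p0 pp 0 by rewrite /segpt /addp /scalep /= [LHS]surjective_pairing; congr (_, _); ring.
have Fp0 : frontier N p0 by rewrite p0E; apply: Fp; rewrite lexx ler01.
have [d' d0' hd'] := finite_avoid q p0.
pose M := `|x1| + `|x2| + 1; have M0 : 0 < M by rewrite ltr_wpDl ?addr_ge0.
have M1 : 1 <= M by rewrite /M lerDr addr_ge0.
(* Up to the heights [b1] and [b2] the wedge is bounded by the two edges themselves; the last bound
   keeps the truncated wedge away from the gas points. *)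
pose h0 := Num.min (Num.min b1 b2) (d' / 2 / M).
have h00 : 0 < h0 by rewrite !lt_min b10 b20 !divr_gt0.
have h01 : h0 <= b1 by rewrite !ge_min lexx.
have h02 : h0 <= b2 by rewrite !ge_min lexx orbT.
have h03 : h0 * M <= d' / 2 by rewrite -ler_pdivlMr // ge_min lexx orbT.
have hu' : cc ^+ 2 + (- d) ^+ 2 = 1 by rewrite sqrrN.
have subfr w : subp (fr cc d p0 w) p0 = rot cc (- d) w.
  by rewrite /fr /subp /addp /= !addrK.
have fr1 k : fr cc d p0 (x1 * k, k) = segpt p0 pm (k / b2).
  by rewrite -(fr_ray _ _ _ h) -/v [rot cc d v]surjective_pairing -/a2 -/b2 /scalep /= -x1E;
    congr fr; congr (_, _); field; rewrite gt_eqF.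
have fr2 k : fr cc d p0 (x2 * k, k) = segpt p0 pp (k / b1).
  by rewrite -(fr_ray _ _ _ h) -/u [rot cc d u]surjective_pairing -/a1 -/b1 /scalep /= -x2E;
    congr fr; congr (_, _); field; rewrite gt_eqF.
apply: (corner_arc good_sigma h Np0 x12 h00 (l1 := b2) (l2 := - b1)).
- move=> x y Nz.
  have lp : 0 <= crossp u (subp (fr cc d p0 (x, y)) p0) by case: cp => _ [_ [_ [_]]]; exact.
  have lm : 0 <= crossp (subp p0 pm) (subp (fr cc d p0 (x, y)) pm) by case: cm => _ [_ [_ [_]]]; exact.
  rewrite subfr uE crossp_rot // /crossp /= in lp.
  have E w : crossp (subp p0 pm) (subp w pm) = - crossp v (subp w p0).
    by rewrite /v /crossp /subp /=; ring.
  rewrite E oppr_ge0 subfr vE crossp_rot // /crossp /= in lm.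
  rewrite -x1E subr_le0 mulrAC [b2 * x]mulrC ler_pM2r // in lm.
  by rewrite -x2E subr_ge0 mulrAC [b1 * x]mulrC ler_pM2r // in lp; rewrite lm.
- move=> k /andP[k0 k1]; rewrite fr1; apply: N_convex => //.
  by rewrite divr_ge0 ?(ltW b20) //= ler_pdivrMr // mul1r (le_trans k1).
- move=> k /andP[k0 k1]; rewrite fr2; apply: N_convex => //.
  by rewrite divr_ge0 ?(ltW b10) //= ler_pdivrMr // mul1r (le_trans k1).
- move=> x y /andP[y0 yh] /andP[xl xr].
  have Dn : crossp u v != 0 by rewrite gt_eqF.
  have zE := baryE (fr cc d p0 (x, y)) Dn; rewrite -/u -/v in zE.
  rewrite subfr in zE; set be := _ / _ in zE; set ga := _ / _ in zE.
  have beE : be * crossp u v = x * b2 - y * a2.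
    by rewrite /be divfK // vE crossp_rot.
  have gaE : ga * crossp u v = a1 * y - b1 * x.
    by rewrite /ga divfK // uE crossp_rot.
  have be0 : 0 < be.
    have B : x1 * y * b2 < x * b2 by rewrite ltr_pM2r.
    have : 0 < be * crossp u v by rewrite beE -x1E subr_gt0 mulrCA mulrA.
    by rewrite pmulr_lgt0.
  have ga0 : 0 < ga.
    have B : x * b1 < x2 * y * b1 by rewrite ltr_pM2r.
    have : 0 < ga * crossp u v by rewrite gaE -x2E subr_gt0 [b1 * x]mulrC mulrAC.
    by rewrite pmulr_lgt0.
  have yE : be * b1 + ga * b2 = y.
    apply: (mulIf Dn); have -> : (be * b1 + ga * b2) * crossp u v =
      (be * crossp u v) * b1 + (ga * crossp u v) * b2 by ring.
    by rewrite beE gaE DE; ring.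
  have bg : be + ga < 1.
    rewrite -(ltr_pM2r h00) mul1r (le_lt_trans _ yh) // -yE mulrDl.
    by rewrite lerD // ler_pM2l.
  have [dl dl0 hdl] := bary_near N_convex Np0 Npp Nm Dn be0 ga0 bg.
  split; first by apply/interior_near2; exists dl => //; rewrite zE.
  move=> [j _ jE]; apply: (hd' j); first exact: frontier_not_gas.
  rewrite jE; have := @near2_fr R cc d p0 (0, 0) (x, y) d' h; rewrite fr0; apply.
  have yM : y * M < d' / 2 by rewrite (lt_le_trans _ h03) // ltr_pM2r.
  have xlr : x1 * y < x < x2 * y by rewrite xl.
  have [nx ny] := wedge_norm y0 xlr yM.
  by split; rewrite /= subr0.
- move=> k xi /andP[k0 k1]; rewrite fr1 segptC; apply: edge_no_subdiff => //.
  have kb : 0 < k / b2 < 1 by rewrite divr_gt0 //= ltr_pdivrMr // mul1r (lt_le_trans k1).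
  by case/andP: kb => k3 k4; rewrite subr_gt0 k4 gtrBl k3.
- move=> k xi /andP[k0 k1]; rewrite fr2; apply: edge_no_subdiff => //.
  by rewrite divr_gt0 //= ltr_pdivrMr // mul1r (lt_le_trans k1).
- by rewrite -/v vE /scalep /= mulr1 mulrC x1E.
- have -> : subp p0 pp = (- u.1, - u.2) by rewrite /u /subp /= !opprB.
  by rewrite uE /scalep /rot /= mulr1 -x2E; congr (_, _); ring.
Qed.

(** Here [pm], [p0] and [pp] are collinear; the half-plane conditions of both edges, tested at an
    interior point of [N], put [p0] between its neighbours ([k < 0]). *)
Lemma side_case p0 pm pp : V p0 -> ccw_next N V pm p0 -> ccw_next N V p0 pp ->
  crossp (subp pp p0) (subp pm p0) = 0 ->
  let C := frontier (subdiff N sigma p0) in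
  ~ box_bounded C /\ convex_curve C /\
  unbounded_arc_with_end_tangents C (multi (subp pm p0)) (multi (subp p0 pp)).
Proof.
move=> Vp0 cm cp D0; have [Nm Np0 vm0 Fm _] := ccw_facts cm; have [_ Npp u0 Fp _] := ccw_facts cp.
have [_ [_ [PE [z0 iz0]]]] := poly.
move: D0 u0; have [u uD] : exists u, u = subp pp p0 by exists (subp pp p0).
rewrite -uD => D0 u0.
have [k vE] := parallelE u0 D0.
have leftp : forall z, N z -> 0 <= crossp u (subp z p0) by rewrite uD; case: cp => _ [_ [_ [_]]].
have leftm : forall z, N z -> 0 <= crossp (subp p0 pm) (subp z pm) by case: cm => _ [_ [_ [_]]].
have zp := interior_pos u0 leftp iz0; have zm := interior_pos vm0 leftm iz0.
have pmE : pm = (p0.1 + k * u.1, p0.2 + k * u.2).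
  have := congr1 fst vE; have := congr1 snd vE; rewrite /subp /scalep /= => <- <-.
  by rewrite !subrKC -surjective_pairing.
have ppE : pp = (p0.1 + u.1, p0.2 + u.2) by rewrite uD /subp /= !subrKC -surjective_pairing.
have k0 : k < 0.
  have E : crossp (subp p0 pm) (subp z0 pm) = - k * crossp u (subp z0 p0).
    by rewrite pmE /crossp /subp /=; ring.
  by move: zm; rewrite E pmulr_lgt0 // oppr_gt0.
have [cc [d [h e0 hr]]] := unit_dir u0; have ru := rot_self e0 hr.
set e := enorm u in e0 ru.
have uE : u = rot cc (- d) (e, 0) by rewrite -ru rotVK.
(* [p0] divides the segment from [pm] to [pp] at this parameter, so [inner_box] can treat the two
   edges as one. *)
pose t := - k / (1 - k).
have ht : 0 < t < 1 by rewrite /t divr_gt0 ?ltr_pdivrMr /=; lra.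
have p0E : p0 = segpt pm pp t.
  rewrite pmE ppE /segpt /addp /scalep /t /= [LHS]surjective_pairing.
  by congr (_, _); field; apply/eqP; lra.
have ppm : subp pp pm = rot cc (- d) ((1 - k) * e, 0).
  have e1 : u.1 = cc * e - - d * 0 := congr1 fst uE.
  have e2 : u.2 = - d * e + cc * 0 := congr1 snd uE.
  by rewrite pmE ppE /rot /subp; congr (_, _); rewrite /= ?e1 ?e2; ring.
have Fp0 : frontier N p0.
  have -> : p0 = segpt p0 pp 0 by rewrite /segpt /addp /scalep /= [LHS]surjective_pairing; congr (_, _); ring.
  by apply: Fp; rewrite lexx ler01.
have lam0 : 0 < (1 - k) * e by rewrite mulr_gt0 //; lra.
have Y0 : 0 < (gr cc d (segpt pm pp t) z0).2 by rewrite -p0E /gr hr /= divr_gt0.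
have av j : q j <> segpt pm pp t by rewrite -p0E; exact: frontier_not_gas.
have [eta eta0] := inner_box Nm Npp (interior_subset iz0) h ppm lam0 Y0 ht av.
rewrite -p0E => box.
have frp x : fr cc d p0 (x, 0) = segpt p0 pp (x / e).
  rewrite -(fr_ray _ _ _ h) -uD ru /scalep /=; congr fr; congr (_, _); last by rewrite mulr0.
  by rewrite divfK // gt_eqF.
have ke0 : k * e < 0 by rewrite nmulr_rlt0.
have frm x : fr cc d p0 (x, 0) = segpt pm p0 (1 - x / (k * e)).
  rewrite frp -segptC pmE ppE /segpt /addp /scalep /=.
  by congr (_, _); field; rewrite gt_eqF //= lt_eqF.
pose a := (sigma pm - sigma p0) / (k * e); pose b := (sigma pp - sigma p0) / e.
have aE : a * (k * e) = sigma pm - sigma p0 by rewrite /a divfK // lt_eqF.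
have bE : b * e = sigma pp - sigma p0 by rewrite /b divfK // gt_eqF.
pose len := Num.min eta (Num.min e (- (k * e))).
have len0 : 0 < len by rewrite !lt_min eta0 e0 oppr_gt0.
have len1 : len <= eta by rewrite ge_min lexx.
have len2 : len <= e by rewrite !ge_min lexx orbT.
have len3 : len <= - (k * e) by rewrite !ge_min lexx !orbT.
have inp x : 0 <= x <= e -> 0 <= x / e <= 1.
  by move=> /andP[? ?]; rewrite divr_ge0 ?(ltW e0) //= ler_pdivrMr // mul1r.
have inm x : k * e <= x <= 0 -> 0 <= 1 - x / (k * e) <= 1.
  move=> /andP[x1 x2].
  have : 0 <= x / (k * e) <= 1 by rewrite ler_ndivrMr // mul1r x1 andbT mulr_le0 // invr_le0 ltW.
  by move=> /andP[w0 w1]; rewrite subr_ge0 w1 gerBl w0.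
have sR x : 0 <= x <= e -> sigma (fr cc d p0 (x, 0)) = sigma p0 + b * x.
  move=> hx; rewrite frp (sigma_edge cp (inp x hx)) /b; field; by rewrite gt_eqF.
have sL x : k * e <= x <= 0 -> sigma (fr cc d p0 (x, 0)) = sigma p0 + a * x.
  move=> hx; rewrite frm (sigma_edge cm (inm x hx)) /a; field; by rewrite gt_eqF //= lt_eqF.
have FR x : k * e <= x <= e -> frontier N (fr cc d p0 (x, 0)).
  move=> /andP[x1 x2]; have [xp|xn] := leP 0 x; first by rewrite frp; apply: Fp; apply: inp; rewrite xp.
  by rewrite frm; apply: Fm; apply: inm; rewrite x1 ltW.
have ab : a <= b.
  have := sigma_convex Nm Npp (_ : 0 <= t <= 1); rewrite -p0E => /(_ _) H.
  have {}H : sigma p0 <= (1 - t) * sigma pm + t * sigma pp by apply: H; case/andP: ht => ? ?; rewrite !ltW.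
  have k1 : 0 < 1 - k by rewrite subr_gt0 (lt_trans k0).
  have tE : t * (1 - k) = - k by rewrite /t divfK // gt_eqF.
  have := ler_wpM2r (ltW k1) H.
  have -> : ((1 - t) * sigma pm + t * sigma pp) * (1 - k) =
    ((1 - k) - t * (1 - k)) * sigma pm + (t * (1 - k)) * sigma pp by ring.
  rewrite tE => H2.
  have : k * (b * e) <= a * (k * e) by rewrite aE bE; lra.
  by rewrite mulrCA ler_nM2r.
(* [p0] is inside a segment of [N], hence not extreme, and so belongs to [Qset]; equal slopes would
   make [L] affine through [p0] and derivable along [u]. *)
have ab' : a < b.
  rewrite lt_neqAle ab andbT; apply/eqP => abE.
  have nP : ~ P p0.
    rewrite PE => -[_]; apply; exists pm, pp, t; split => //; split => //; split => //.
    move=> E; move: ppm; rewrite E /subp !subrr => /(congr1 (rot cc d)).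
    by rewrite rotK // /rot /= !mulr0 subrr => -[E2 _]; move: lam0; rewrite -E2 ltxx.
  case: Vp0 => // -[_ [_]]; apply; exists u, (Num.min 1 (- k)).
  have mk : 0 < Num.min 1 (- k) by rewrite lt_min ltr01 oppr_gt0.
  have aux x : addp p0 (scalep x u) = fr cc d p0 (x * e, 0).
    by rewrite frp mulfK ?gt_eqF // ppE /segpt /addp /scalep /=; congr (_, _); ring.
  have rng x : `|x| < Num.min 1 (- k) -> k * e <= x * e <= e.
    rewrite lt_min !ltr_norml opprK => /andP[/andP[_ u1] /andP[u2 _]].
    by rewrite ler_pM2r // -[X in _ && (_ <= X)]mul1r ler_pM2r // !ltW.
  split => //; split => //; split.
    by move=> x /rng hx; rewrite aux; exact: FR.
  have [_ [_ [sLf _]]] := tension.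
  have val x : `|x| < Num.min 1 (- k) -> L (addp p0 (scalep x u)) = sigma p0 + a * e * x.
    move=> /rng hx; rewrite aux -sLf; last exact: FR.
    have [xp|xn] := leP 0 (x * e); first by rewrite sR -?abE; [ring|rewrite xp; case/andP: hx].
    by rewrite sL; [ring|rewrite (ltW xn) andbT; case/andP: hx].
  have [] := @quad_is_derive R (fun x => L (addp p0 (scalep x u))) 0 (a * e) 0 (Num.min 1 (- k) / 2).
  - by rewrite divr_gt0.
  - move=> x hx; rewrite add0r !val ?normr0 //; last by rewrite (le_lt_trans hx) // ltr_pdivrMr // ltr_pMr // ltr1n.
    rewrite (_ : sigma p0 + a * e * x - (sigma p0 + a * e * 0) - a * e * x = 0); last by ring.
    by rewrite normr0 mul0r.
  - by [].
apply: (side_arc good_sigma h ab' len0 (l1 := k * e) (l2 := - e)).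
- move=> x y /leftp; rewrite /fr uE.
  have -> : subp (addp (rot cc (- d) (x, y)) p0) p0 = rot cc (- d) (x, y).
    by rewrite /subp /addp /= !addrK.
  by rewrite crossp_rot ?sqrrN // /crossp /= mul0r subr0 pmulr_rge0.
- move=> x; rewrite ler_norml => /andP[h1 h2]; apply: frontier_sub; apply: FR.
  by rewrite (le_trans h2) // (le_trans _ h1) // lerNr.
- by move=> x /andP[h1 h2]; apply: sL; rewrite h2 (le_trans _ h1) // lerNr.
- by move=> x /andP[h1 h2]; apply: sR; rewrite h1 (le_trans h2).
- move=> x y hx /andP[y0 y1]; apply: box; first exact: lt_le_trans len1.
  by rewrite y0 (lt_le_trans y1).
- by rewrite vE uE /scalep /rot /=; congr (_, _); ring.
- have -> : subp p0 pp = (- u.1, - u.2) by rewrite uD /subp /= !opprB.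
  by rewrite uE /rot /=; congr (_, _); ring.
Qed.

Lemma vertex_case p0 pm pp : V p0 -> ccw_next N V pm p0 -> ccw_next N V p0 pp ->
  let C := frontier (subdiff N sigma p0) in
  ~ box_bounded C /\ convex_curve C /\
  unbounded_arc_with_end_tangents C (multi (subp pm p0)) (multi (subp p0 pp)).
Proof.
move=> Vp0 cm cp; have [Nm _ _ _ _] := ccw_facts cm.
have : 0 <= crossp (subp pp p0) (subp pm p0) by case: cp => _ [_ [_ [_]]]; exact.
rewrite le_eqVlt => /orP[/eqP D0|D0]; first exact: side_case.
exact: corner_case.
Qed.

End Assembly.

Theorem theorem2p2 (R : realType) (N P : set (pt R)) (L : pt R -> R)
    (l : nat) (q : 'I_l -> pt R) (c : 'I_l -> R) (sigma : pt R -> R) :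
  is_polygon N P ->
  boundary_datum N L ->
  injective q ->
  (forall j : 'I_l, interior N (q j)) ->
  (forall j : 'I_l, 0 < c j) ->
  surface_tension N P L q c sigma ->
  (forall j : 'I_l,
     let C := frontier (subdiff N sigma (q j)) in
     box_bounded C /\ convex_curve C /\ analytic_jordan_curve C) /\
  (forall p0 pm pp : pt R,
     let V := P `|` Qset N P L in
     V p0 -> ccw_next N V pm p0 -> ccw_next N V p0 pp ->
     let C := frontier (subdiff N sigma p0) in
     ~ box_bounded C /\ convex_curve C /\
     unbounded_arc_with_end_tangents C
       (multi (subp pm p0)) (multi (subp p0 pp))).
Proof.
move=> poly datum qinj qint c0 tension; split.
  by move=> j; exact: gas_case poly qint c0 tension j.
move=> p0 pm pp V Vp0 cm cp.
exact: (vertex_case poly datum qint tension Vp0 cm cp).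
Qed.
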